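(* Let $f$ be a Łojasiewicz function on $[a,b]$ and let $\psi$ be smooth and positive in $[a,b]$. Then there exists $\xi\in(a,b)$ such that $$(\mathfrak{dist})\int_a^bf(x)\psi(x)\,dx=f(\xi)\int_a^b\psi(x)\,dx .$$
   Context: ''Smooth'' means $C^\infty$ on $[a,b]$ (including endpoints), and ''positive'' means $\psi\ge0$. A Łojasiewicz function on $[a,b]$ is the restriction to $[a,b]$ of a Łojasiewicz function on $\mathbb R$ (defined below). The product $f\psi$ is then distributionally integrable over $[a,b]$. Distributions are real. Notation: $\overline{\mathbb R}=\mathbb R\cup\{-\infty,\infty\}$; $\mathcal E'[a,b]$ is the space of distributions on $\mathbb R$ with support contained in $[a,b]$; $\langle \mathsf g(x+ty),\phi(y)\rangle:=|t|^{-1}\langle \mathsf g(y),\phi((y-x)/t)\rangle$ for $t\ne0$. Point values. For $\mathsf g\in\mathcal D'(\mathbb R)$, the distributional (Łojasiewicz) point value $\mathsf g(x_0)$ exists and equals $\gamma\in\mathbb R$ if $\lim_{\varepsilon\to0}\langle \mathsf g(x_0+\varepsilon y),\phi(y)\rangle=\gamma\int_{-\infty}^\infty\phi(y)\,dy$ for every $\phi\in\mathcal D(\mathbb R)$. A Łojasiewicz distribution is one having a point value at every point of $\mathbb R$. A function $G:\mathbb R\to\mathbb R$ is a Łojasiewicz function if there is a (necessarily unique) Łojasiewicz distribution $\mathsf G$ with $\mathsf G(x)=G(x)$ for all $x\in\mathbb R$. Test classes. $\mathcal T_0$: functions $\phi\in C^\infty(\mathbb R)$, $\phi\ge0$, $\int\phi=1$,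 such that for some $\alpha<-1$, $\phi^{(m)}(x)=O(|x|^{\alpha-m})$ as $|x|\to\infty$ for all $m\ge0$. $\mathcal T_1$: those $\phi\in\mathcal T_0$ with $x\phi'(x)\le0$ for all $x$. For $\mathsf g\in\mathcal E'(\mathbb R)$, $\phi\in\mathcal T_0$: $\mathsf g^{+}_{\phi,0}(x)=\limsup_{t\to0^+}\langle \mathsf g(x+ty),\phi(y)\rangle$ and $\mathsf g^{-}_{\phi,0}(x)=\liminf_{t\to0^+}\langle \mathsf g(x+ty),\phi(y)\rangle$. Integral. Let $f:[a,b]\to\overline{\mathbb R}$. A major distributional pair $(\mathsf u,\mathsf U)$ for $f$ consists of $\mathsf u\in\mathcal E'[a,b]$ and a Łojasiewicz distribution $\mathsf U$ with $\mathsf U'=\mathsf u$, $\mathsf U(a)=0$, such that there exist a countable set $E$ and a Lebesgue null set $Z$ with $\mathsf u^-_{\phi,0}(x)\ge f(x)$ for all $x\in[a,b]\setminus Z$, $\phi\in\mathcal T_0$, and $\mathsf u^-_{\phi,0}(x)>-\infty$ for all $x\in[a,b]\setminus E$, $\phi\in\mathcal T_1$. A minor distributional pair $(\mathsf v,\mathsf V)$ for $f$ consists of $\mathsf v\in\mathcal E'[a,b]$ and a Łojasiewicz distribution $\mathsf V$ with $\mathsf V'=\mathsf v$, $\mathsf V(a)=0$, such that there exist a countable set $E$ and a null set $Z$ with $\mathsf v^+_{\phi,0}(x)\le f(x)$ for all $x\in[a,b]\setminus Z$, $\phi\in\mathcal T_0$, and $\mathsf v^+_{\phi,0}(x)<\infty$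 for all $x\in[a,b]\setminus E$, $\phi\in\mathcal T_1$. The function $f$ is distributionally integrable over $[a,b]$ if it has both major and minor pairs and $\sup\mathsf V(b)=\inf\mathsf U(b)$ (sup over minor pairs, inf over major pairs); the common value is $(\mathfrak{dist})\int_a^bf(x)\,dx$. *)

(* Defs.v *)
From HB Require Import structures.
From mathcomp Require Import all_boot all_order all_algebra.
From mathcomp Require Import all_classical all_reals all_analysis.

Set Implicit Arguments.
Unset Strict Implicit.
Unset Printing Implicit Defensive.

Import Order.TTheory GRing.Theory Num.Theory.
Import numFieldNormedType.Exports.

Local Open Scope classical_set_scope.
Local Open Scope ring_scope.

Section Distributions.
Variable R : realType.
Implicit Types (phi psi chi : R -> R) (x t a b c : R).

Definition smooth phi := forall n x, derivable (derive1n n phi) x 1.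

Definition fun_support phi : set R := closure [set x | phi x != 0].

(* The class D(R). *)
Definition test_fun phi := smooth phi /\ compact (fun_support phi).

(* Elements of D'(R).  A distribution is carried by a functional on all of
   [R -> R], but only its values on D(R) are constrained or ever used. *)
Record distrib := Distrib {
  distrib_fun :> (R -> R) -> R ;
  distrib_linear : forall c phi psi, test_fun phi -> test_fun psi ->
    distrib_fun (fun y => c * phi y + psi y)
      = c * distrib_fun phi + distrib_fun psi ;
  distrib_continuous : forall K : set R, compact K ->
    exists C : R, exists N : nat, forall phi,
      test_fun phi -> fun_support phi `<=` K ->
      `|distrib_fun phi|
        <= C * \sum_(k < N.+1) sup (range (fun y => `|derive1n k phi y|)) }.

Definition is_derivative (U u : distrib) :=
  forall phi, test_fun phi -> u phi = - U (derive1 phi).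

Definition vanishes_on (g : distrib) (O : set R) :=
  forall phi, test_fun phi -> fun_support phi `<=` O -> g phi = 0.

Definition distrib_support (g : distrib) : set R :=
  ~` \bigcup_(O in [set O | open O /\ vanishes_on g O]) O.

(* E'[a,b] *)
Definition supported_in a b (g : distrib) :=
  distrib_support g `<=` `[a, b]%classic.

Definition cutoff (g : distrib) chi :=
  test_fun chi /\
  exists O : set R,
    [/\ open O, distrib_support g `<=` O & forall y, O y -> chi y = 1].

(* The pairing of a compactly supported distribution with a smooth function
   of arbitrary support: the common value of g (chi * phi) over all cutoffs
   chi equal to 1 near the support of g. *)
Definition ext_pairing (g : distrib) phi : R :=
  get [set v | exists2 chi, cutoff g chi & v = g (fun y => chi y * phi y)].

(* < T(x + t y), phi(y) > *)
Definition affine_pairing (T : (R -> R) -> R) x t phi : R :=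
  `|t|^-1 * T (fun y => phi ((y - x) / t)).

Definition point_value (g : distrib) x c :=
  forall phi, test_fun phi ->
    affine_pairing g x eps phi @[eps --> 0^']
      --> c * \int[@lebesgue_measure R]_y phi y.

Definition Lojasiewicz_distrib (g : distrib) :=
  forall x, exists c, point_value g x c.

Definition Lojasiewicz_fun (G : R -> R) :=
  exists2 g : distrib, Lojasiewicz_distrib g &
    forall x, point_value g x (G x).

Definition Lojasiewicz_fun_on a b (f : R -> R) :=
  exists2 G, Lojasiewicz_fun G & {in `[a, b], f =1 G}.

(* C^infty on [a,b], with one-sided derivatives at the endpoints; D n is the
   n-th derivative. *)
Definition smooth_on a b psi :=
  exists D : nat -> R -> R,
    {in `[a, b], D 0%N =1 psi} /\
    forall n, {in `[a, b], forall x,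
      (D n y - D n x) / (y - x) @[y --> within `[a, b]%classic x^']
        --> D n.+1 x}.

Definition T0 phi :=
  [/\ smooth phi, forall x, 0 <= phi x,
      \int[@lebesgue_measure R]_y phi y = 1 &
      exists2 alpha : R, alpha < -1 &
        forall m : nat, exists C M : R, forall x, M <= `|x| ->
          `|derive1n m phi x| <= C * `|x| `^ (alpha - m%:R)].

Definition T1 phi := T0 phi /\ forall x, x * derive1 phi x <= 0.

Definition upper_value (g : distrib) phi x : \bar R :=
  limf_esup (fun t => (affine_pairing (ext_pairing g) x t phi)%:E) 0^'+.

Definition lower_value (g : distrib) phi x : \bar R :=
  limf_einf (fun t => (affine_pairing (ext_pairing g) x t phi)%:E) 0^'+.

Implicit Type f : R -> \bar R.

Definition major_pair a b f (u U : distrib) :=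
  [/\ supported_in a b u, Lojasiewicz_distrib U, is_derivative U u,
      point_value U a 0 &
      exists E Z : set R,
      [/\ countable E, (@lebesgue_measure R).-negligible Z,
          forall x phi, x \in `[a, b] -> ~ Z x -> T0 phi ->
            (f x <= lower_value u phi x)%E &
          forall x phi, x \in `[a, b] -> ~ E x -> T1 phi ->
            (-oo < lower_value u phi x)%E]].

Definition minor_pair a b f (v V : distrib) :=
  [/\ supported_in a b v, Lojasiewicz_distrib V, is_derivative V v,
      point_value V a 0 &
      exists E Z : set R,
      [/\ countable E, (@lebesgue_measure R).-negligible Z,
          forall x phi, x \in `[a, b] -> ~ Z x -> T0 phi ->
            (upper_value v phi x <= f x)%E &
          forall x phi, x \in `[a, b] -> ~ E x -> T1 phi ->
            (upper_value v phi x < +oo)%E]].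

Definition major_values a b f : set R :=
  [set c | exists u U, major_pair a b f u U /\ point_value U b c].

Definition minor_values a b f : set R :=
  [set c | exists v V, minor_pair a b f v V /\ point_value V b c].

Definition dist_integrable a b f :=
  [/\ major_values a b f !=set0, minor_values a b f !=set0 &
      ereal_sup (EFin @` minor_values a b f)
        = ereal_inf (EFin @` major_values a b f)].

(* Meaningful when [dist_integrable a b f] holds. *)
Definition dist_integral a b f : \bar R :=
  ereal_inf (EFin @` major_values a b f).

End Distributions.

(* Main.v *)
Require Import Defs.
From mathcomp Require Import all_boot all_order all_algebra.
From mathcomp Require Import all_classical all_reals all_analysis.
From mathcomp Require Import ring lra.
Set Implicit Arguments.
Unset Strict Implicit.
Unset Printing Implicit Defensive.
Import Order.TTheory GRing.Theory Num.Theory.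
Import numFieldNormedType.Exports.
Local Open Scope classical_set_scope.
Local Open Scope ring_scope.

(* The heat extension hk T of a compactly supported functional T tests T against
   Gaussians.  If T has no atoms, hk T is bounded below along vertical lines
   outside a countable set, and its lower limit is nonnegative almost everywhere,
   then T >= 0: by Baire's theorem hk T is bounded below on a portion of the set
   where positivity fails, the parabolic minimum principle carries the bound
   across the complementary gaps, and Fatou's lemma concludes.  Applied to u - v
   this shows that minor values do not exceed major ones.

   If f is the point value function of g, then g psi cut off to [a, b] converges,
   because g is O(r) on dilations by r about a and b.  The limit and its primitive
   form a pair that is both major and minor, so the integral is its total mass c.

   Put I = int psi and suppose f <> c / I on ]a, b[.  Baire's theorem and the
   positivity theorem show that g - c / I has a constant sign on ]a, b[.  As its
   pairing with the cut-offs of psi tends to 0, it vanishes where psi > 0, so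
   f = c / I there, a contradiction. *)

(** * Smooth functions *)

(** The pairs constrain lower and upper values for whole classes of test functions, but the
    normalized Gaussian lies in [T1], hence in [T0], and it is also a heat kernel: this one test
    function gives access to a parabolic minimum principle.

    Crossing a gap is the delicate step, because no bound on [hk] is known near the bottom corners
    of the gap. Absence of atoms, made uniform by a Banach-Steinhaus argument, limits the negative
    part at height r to (K / r) exp(- dist^2 / (4 r^2)). This has mass of order K, so a Gaussian
    barrier would survive the limit r -> 0. The barrier is instead r times a space derivative of a
    Gaussian: it vanishes in the limit, and it has to be positive only on one side of its centre,
    since the sides of the gap carry their own bound.

    Cutting into dyadic annuli is the common tool for slowly decaying functions and for end points.
    It extends point values from compactly supported test functions to those of [T0], and it makes
    the cut-off products converge although the derivatives of psi are known only on [a, b]. *)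

Section SmoothCalculus.
Context {R : realType}.
Implicit Types (f g : R -> R) (n : nat) (x c B : R).

(* Hiding [smooth] and [derive1] behind opaque constants keeps conversion
   checks from unfolding them into limits. *)
Fact sm_key : {P : (R -> R) -> Prop | forall f, P f <-> smooth f}.
Proof. by exists (@smooth R). Qed.

Definition sm := sval sm_key.

Lemma smP f : sm f <-> smooth f.
Proof. exact: (svalP sm_key). Qed.

Fact der_key : {d : (R -> R) -> R -> R | forall f, d f = derive1 f}.
Proof. by exists (fun f => derive1 f). Qed.

Definition der := sval der_key.

Definition dn n f : R -> R := iter n der f.

Lemma derE f : der f = derive1 f.
Proof. exact: (svalP der_key). Qed.

Lemma dnE n f : dn n f = derive1n n f.
Proof. by elim: n => // n IH; rewrite derive1nS -IH -derE. Qed.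

Lemma dnS n f : dn n.+1 f = der (dn n f). Proof. by []. Qed.

Lemma dSn n f : dn n.+1 f = dn n (der f). Proof. exact: iterSr. Qed.

Lemma dn_dn f m n : dn m (dn n f) = dn (m + n) f.
Proof. by rewrite /dn iterD. Qed.

Lemma derivable_der f x : derivable f x 1 -> is_derive x 1 f (der f x).
Proof. by rewrite derE derive1E => /derivableP. Qed.

Lemma smooth_is_derive f n x : sm f -> is_derive x 1 (dn n f) (dn n.+1 f x).
Proof. by move=> /smP /(_ n x); rewrite -dnE => /derivable_der. Qed.

Lemma is_derive_der f (df : R -> R) :
  (forall x, is_derive x 1 f (df x)) -> der f = df.
Proof. by move=> h; apply/funext => x; rewrite derE derive1E; exact: derive_val. Qed.

(** Exhibiting the whole tower of derivatives proves smoothness and computes the derivatives at the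
    same time. *)
Lemma smooth_family (F : nat -> R -> R) :
  (forall n x, is_derive x 1 (F n) (F n.+1 x)) ->
  sm (F 0%N) /\ forall n, dn n (F 0%N) = F n.
Proof.
move=> h; have e n : dn n (F 0%N) = F n.
  by elim: n => // n IH; rewrite dnS IH; exact: is_derive_der.
by split=> //; apply/smP => n x; rewrite -dnE e; exact: ex_derive.
Qed.

Lemma smooth_der f : sm f -> sm (der f).
Proof.
by move=> /smP sf; apply/smP => n x; rewrite -dnE -dSn dnE; exact: sf.
Qed.

Lemma smooth_dn f n : sm f -> sm (dn n f).
Proof. by move=> sf; elim: n => // n; exact: smooth_der. Qed.

Lemma smooth_is_derive1 f x : sm f -> is_derive x 1 f (der f x).
Proof. by move/(smooth_is_derive 0 x). Qed.

Lemma smooth_derivable f x : sm f -> derivable f x 1.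
Proof. by move=> /smP /(_ 0%N x). Qed.

Lemma smooth_continuous f : sm f -> continuous f.
Proof.
by move=> sf x; apply/differentiable_continuous/derivable1_diffP/smooth_derivable.
Qed.

(** Differentiability of finite order, by recursion: closure under products, composition and
    inverses becomes an induction on n over all functions at once. The derivative of a product or a
    composite again contains the functions themselves, whence [CnW]. *)
Fixpoint Cn n f : Prop :=
  if n is n'.+1 then (forall x, derivable f x 1) /\ Cn n' (der f) else True.

Lemma smoothCn f : sm f <-> forall n, Cn n f.
Proof.
split=> [sf n|].
  elim: n f sf => //= n IH f sf; split; first by move=> x; exact: smooth_derivable.
  exact/IH/smooth_der.
move=> h; apply/smP => n; elim: n f h => [|n IH] f h x; first by have [] := h 1%N.
by rewrite derive1Sn -derE; apply: IH => m; have [] := h m.+1.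
Qed.

Lemma CnW n f : Cn n.+1 f -> Cn n f.
Proof. by elim: n f => // n IH f [df /IH ?]; split. Qed.

Lemma Cn_smooth n f : sm f -> Cn n f.
Proof. by move/smoothCn. Qed.

Lemma is_derive_affine (a b x : R) : is_derive x 1 (fun y => a * y + b) a.
Proof.
by apply: is_derive_eq; rewrite /GRing.scale /=; ring.
Qed.

Lemma der_lin c f g : (forall x, derivable f x 1) ->
  (forall x, derivable g x 1) ->
  der (fun y => c * f y + g y) = (fun y => c * der f y + der g y).
Proof.
move=> df dg; apply: is_derive_der => x.
have hf := derivable_der (df x); have hg := derivable_der (dg x).
by apply: is_derive_eq; rewrite /GRing.scale /=; ring.
Qed.

Lemma der_mul f g : (forall x, derivable f x 1) ->
  (forall x, derivable g x 1) ->
  der (fun y => f y * g y) = (fun y => der f y * g y + f y * der g y).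
Proof.
move=> df dg; apply: is_derive_der => x.
have hf := derivable_der (df x); have hg := derivable_der (dg x).
by apply: is_derive_eq; rewrite /GRing.scale /=; ring.
Qed.

Lemma der_compose f g : (forall x, derivable f x 1) ->
  (forall x, derivable g x 1) ->
  der (fun y => f (g y)) = (fun y => der f (g y) * der g y).
Proof.
by move=> df dg; apply/funext => x; rewrite !derE (@derive1_comp _ g f x).
Qed.

Lemma derivable_lin c f g x : derivable f x 1 -> derivable g x 1 ->
  derivable (fun y => c * f y + g y) x 1.
Proof. by move=> /derivableP hf /derivableP hg; exact: ex_derive. Qed.

Lemma derivable_mul f g x : derivable f x 1 -> derivable g x 1 ->
  derivable (fun y => f y * g y) x 1.
Proof. by move=> /derivableP hf /derivableP hg; exact: ex_derive. Qed.

Lemma derivable_compose f g x : derivable f (g x) 1 -> derivable g x 1 ->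
  derivable (fun y => f (g y)) x 1.
Proof.
move=> /derivable1_diffP df /derivable1_diffP dg.
by apply/derivable1_diffP; exact: (@differentiable_comp _ _ _ _ g f).
Qed.

Lemma smooth_lin c f g : sm f -> sm g -> sm (fun y => c * f y + g y).
Proof.
move=> sf sg; apply/smoothCn => n.
elim: n f g sf sg => //= n IH f g sf sg; split.
  by move=> x; apply: derivable_lin; exact: smooth_derivable.
rewrite der_lin; [|by move=> x; exact: smooth_derivable..].
by apply: IH; exact: smooth_der.
Qed.

Lemma dn_lin c f g n : sm f -> sm g ->
  dn n (fun y => c * f y + g y)
  = (fun y => c * dn n f y + dn n g y).
Proof.
elim: n f g => // n IH f g sf sg.
rewrite !dSn der_lin; [|by move=> x; exact: smooth_derivable..].
by rewrite IH //; exact: smooth_der.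
Qed.

Lemma smooth_cst c : sm (fun=> c : R).
Proof.
have [|] // := @smooth_family (fun n => if n is 0%N then fun=> c else fun=> 0).
by move=> [|n] x; exact: is_derive_cst.
Qed.

Lemma dn_cst c n : dn n.+1 (fun=> c : R) = fun=> 0.
Proof.
have [|_ ->] // := @smooth_family (fun n => if n is 0%N then fun=> c else fun=> 0).
by move=> [|m] x; exact: is_derive_cst.
Qed.

Lemma smooth_add f g : sm f -> sm g -> sm (fun y => f y + g y).
Proof.
move=> sf sg; have -> : (fun y => f y + g y) = (fun y => 1 * f y + g y).
  by apply/funext => y; rewrite mul1r.
exact: smooth_lin.
Qed.

Lemma smooth_scale c f : sm f -> sm (fun y => c * f y).
Proof.
move=> sf; have -> : (fun y => c * f y) = (fun y => c * f y + 0).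
  by apply/funext => y; rewrite addr0.
by apply: smooth_lin => //; exact: smooth_cst.
Qed.

Lemma dn_scale c f n : sm f ->
  dn n (fun y => c * f y) = (fun y => c * dn n f y).
Proof.
move=> sf; have -> : (fun y => c * f y) = (fun y => c * f y + 0).
  by apply/funext => y; rewrite addr0.
rewrite dn_lin //; last exact: smooth_cst.
by case: n => [|n]; apply/funext => y; rewrite ?dn_cst addr0.
Qed.

Lemma smooth_opp f : sm f -> sm (fun y => - f y).
Proof.
move=> sf; have -> : (fun y => - f y) = (fun y => (-1) * f y).
  by apply/funext => y; rewrite mulN1r.
exact: smooth_scale.
Qed.

Lemma smooth_sub f g : sm f -> sm g -> sm (fun y => f y - g y).
Proof. by move=> sf sg; apply: smooth_add => //; exact: smooth_opp. Qed.

Lemma dn_sub f g n : sm f -> sm g ->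
  dn n (fun y => f y - g y) = (fun y => dn n f y - dn n g y).
Proof.
move=> sf sg; have -> : (fun y => f y - g y) = (fun y => (-1) * g y + f y).
  by apply/funext => y; rewrite mulN1r addrC.
rewrite dn_lin //; apply/funext => y; by rewrite mulN1r addrC.
Qed.

Lemma dn_add f g n : sm f -> sm g ->
  dn n (fun y => f y + g y) = (fun y => dn n f y + dn n g y).
Proof.
move=> sf sg; have -> : (fun y => f y + g y) = (fun y => 1 * f y + g y).
  by apply/funext => y; rewrite mul1r.
rewrite dn_lin //; apply/funext => y; by rewrite mul1r.
Qed.

Lemma smooth_id : sm (fun y : R => y).
Proof.
have [|] // := @smooth_family
  (fun n => if n is 0%N then id else if n is 1%N then fun=> 1 else fun=> 0).
move=> [|[|n]] x /=; [exact: is_derive_id|exact: is_derive_cst..].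
Qed.

Lemma Cn_add n f g : Cn n f -> Cn n g -> Cn n (fun y => f y + g y).
Proof.
elim: n f g => //= n IH f g [df cf] [dg cg]; split=> [x|].
  have -> : (fun y => f y + g y) = (fun y => 1 * f y + g y).
    by apply/funext => y; rewrite mul1r.
  exact: derivable_lin.
have -> : der (fun y => f y + g y) = (fun y => der f y + der g y).
  have -> : (fun y => f y + g y) = (fun y => 1 * f y + g y).
    by apply/funext => y; rewrite mul1r.
  by rewrite der_lin//; apply/funext => y; rewrite mul1r.
exact: IH.
Qed.

Lemma Cn_mul n f g : Cn n f -> Cn n g -> Cn n (fun y => f y * g y).
Proof.
elim: n f g => // n IH f g cf cg.
have [df cf'] := cf; have [dg cg'] := cg; split=> [x|].
  exact: derivable_mul.
by rewrite der_mul//; apply: Cn_add; apply: IH => //; exact: CnW.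
Qed.

Lemma smooth_mul f g : sm f -> sm g -> sm (fun y => f y * g y).
Proof. by move=> /smoothCn sf /smoothCn sg; apply/smoothCn => n; exact: Cn_mul. Qed.

Lemma Cn_comp n f g : Cn n f -> Cn n g -> Cn n (fun y => f (g y)).
Proof.
elim: n f g => // n IH f g cf cg.
have [df cf'] := cf; have [dg cg'] := cg; split=> [x|].
  exact: derivable_compose.
by rewrite der_compose//; apply: Cn_mul => //; apply: IH => //; exact: CnW.
Qed.

Lemma smooth_comp f g : sm f -> sm g -> sm (fun y => f (g y)).
Proof. by move=> /smoothCn sf /smoothCn sg; apply/smoothCn => n; exact: Cn_comp. Qed.

Lemma smooth_affine (a b : R) : sm (fun y => a * y + b).
Proof.
apply: smooth_add; last exact: smooth_cst.
by apply: smooth_scale; exact: smooth_id.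
Qed.

Lemma smooth_comp_affine f (a b : R) : sm f -> sm (fun y => f (a * y + b)).
Proof. by move=> sf; apply: smooth_comp => //; exact: smooth_affine. Qed.

Lemma dn_comp_affine f (a b : R) n : sm f ->
  dn n (fun y => f (a * y + b)) = (fun y => a ^+ n * dn n f (a * y + b)).
Proof.
elim: n f => [|n IH] f sf.
  by apply/funext => y; rewrite expr0 mul1r.
rewrite !dSn.
have -> : der (fun y => f (a * y + b)) = (fun y => a * der f (a * y + b)).
  apply: is_derive_der => x.
  have hf := smooth_is_derive1 (a * x + b) sf.
  have ha := is_derive_affine a b x.
  have := @is_derive1_comp _ f _ x _ _ hf ha.
  by rewrite /GRing.scale /= mulrC.
rewrite dn_scale; last exact/smooth_comp_affine/smooth_der.
rewrite IH; last exact: smooth_der.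
by apply/funext => y; rewrite exprS mulrA.
Qed.

Lemma smooth_expR : sm (@expR R).
Proof. by have [] // := @smooth_family (fun _ => @expR R). Qed.

Lemma Cn_inv n f : (forall x, f x != 0) -> Cn n f -> Cn n (fun y => (f y)^-1).
Proof.
move=> f0; elim: n f f0 => // n IH f f0 cf.
have [df cf'] := cf.
have hd x : is_derive x 1 (fun y => (f y)^-1) (- der f x * ((f x)^-1 * (f x)^-1)).
  have hf := derivableP (df x).
  have h : derivable (fun y => (f y)^-1) x 1 by apply: derivableV.
  apply: is_derive_eq (derivableP h) _; rewrite (deriveV (f0 x) (df x)).
  by rewrite /GRing.scale /= derE derive1E -exprVn expr2 mulNr mulNr mulrC.
split=> [x|]; first by have := hd x => ?; exact: ex_derive.
rewrite (is_derive_der hd).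
apply: Cn_mul; last by apply: Cn_mul; apply: IH => //; exact: CnW.
have -> : (fun x => - der f x) = (fun x => (-1) * der f x).
  by apply/funext => x; rewrite mulN1r.
by apply: Cn_mul => //; apply: Cn_smooth; exact: smooth_cst.
Qed.

Lemma smooth_inv f : (forall x, f x != 0) -> sm f -> sm (fun y => (f y)^-1).
Proof. by move=> f0 /smoothCn sf; apply/smoothCn => n; exact: Cn_inv. Qed.

(** The C^n norm on S is at most B. The recursive form serves the induction behind Leibniz's rule;
    [dboundP] unfolds it. The derivatives are those on the whole line, so S may be any set, even a
    point. *)
Fixpoint dbound n (S : set R) B f : Prop :=
  (forall y, S y -> `|f y| <= B) /\
  (if n is n'.+1 then dbound n' S B (der f) else True).

Lemma dboundP n S B f :
  dbound n S B f <-> forall k y, (k <= n)%N -> S y -> `|dn k f y| <= B.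
Proof.
elim: n f => [|n IH] f; split.
- by move=> [h _] [|k] // y _; exact: h.
- by move=> h; split=> // y; exact: (h 0%N).
- move=> [h /IH h'] [|k] y kn Sy; first exact: h.
  by rewrite dSn; exact: h'.
- move=> h; split; first by move=> y; exact: (h 0%N).
  by apply/IH => k y kn Sy; rewrite -dSn; exact: h.
Qed.

Lemma dboundW n S B f : dbound n.+1 S B f -> dbound n S B f.
Proof. by move=> /dboundP h; apply/dboundP => k y kn; apply: h; exact: leqW. Qed.

Lemma dbound_le n m S S' B B' f : (m <= n)%N -> S' `<=` S -> B <= B' ->
  dbound n S B f -> dbound m S' B' f.
Proof.
move=> mn SS' BB' /dboundP h; apply/dboundP => k y km S'y.
by apply: le_trans BB'; apply: h; [exact: leq_trans mn|exact: SS'].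
Qed.

Lemma dbound_add n S B B' f g : sm f -> sm g ->
  dbound n S B f -> dbound n S B' g -> dbound n S (B + B') (fun y => f y + g y).
Proof.
move=> sf sg /dboundP hf /dboundP hg; apply/dboundP => k y kn Sy.
by rewrite dn_add//; apply: le_trans (ler_normD _ _) _; rewrite lerD ?hf ?hg.
Qed.

Lemma dbound_sub n S B B' f g : sm f -> sm g ->
  dbound n S B f -> dbound n S B' g -> dbound n S (B + B') (fun y => f y - g y).
Proof.
move=> sf sg /dboundP hf /dboundP hg; apply/dboundP => k y kn Sy.
by rewrite dn_sub//; apply: le_trans (ler_normB _ _) _; rewrite lerD ?hf ?hg.
Qed.

Lemma dbound_scale n S c B f : sm f ->
  dbound n S B f -> dbound n S (`|c| * B) (fun y => c * f y).
Proof.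
move=> sf /dboundP hf; apply/dboundP => k y kn Sy.
by rewrite dn_scale// normrM ler_wpM2l ?hf.
Qed.

(* The factor 2 ^ n bounds the sum of the coefficients in Leibniz's rule. *)
Lemma dbound_mul n S B B' f g : sm f -> sm g ->
  dbound n S B f -> dbound n S B' g ->
  dbound n S (2 ^+ n * (B * B')) (fun y => f y * g y).
Proof.
elim: n f g => [|n IH] f g sf sg hf hg.
  split=> // y Sy; rewrite expr0 mul1r normrM; apply: ler_pM => //.
    by have [h _] := hf; exact: h.
  by have [h _] := hg; exact: h.
have [h1 h2] := hf; have [h3 h4] := hg; split.
  move=> y Sy; rewrite normrM; apply: (@le_trans _ _ (B * B')).
    by apply: ler_pM; rewrite ?h1 ?h3.
  have ? : 0 <= B * B' by apply: mulr_ge0; [apply: le_trans (h1 y Sy)|apply: le_trans (h3 y Sy)].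
  by rewrite ler_peMl// exprn_ege1// ler1n.
rewrite der_mul; [|by move=> x; exact: smooth_derivable..].
rewrite exprS mulr2n mulrDl mul1r mulrDl.
apply: dbound_add; try (by apply: smooth_mul => //; exact: smooth_der).
- by apply: IH => //; [exact: smooth_der|exact: dboundW].
- by apply: IH => //; [exact: smooth_der|exact: dboundW].
Qed.

Lemma dbound_ge0 n S B f y : S y -> dbound n S B f -> 0 <= B.
Proof. by move=> Sy; case: n => [|n] [/(_ y Sy) h _]; apply: le_trans h. Qed.

Lemma mvt_bound f (df : R -> R) (M x y : R) : (forall z : R, is_derive z 1 f (df z)) ->
  (forall z, Num.min x y <= z <= Num.max x y -> `|df z| <= M) ->
  `|f y - f x| <= M * `|y - x|.
Proof.
move=> hd; wlog xy : x y / x <= y.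
  move=> W hM; case: (leP x y) => [|/ltW] xy; first exact: W.
  by rewrite distrC [`|y - x|]distrC; apply: W => //; rewrite minC maxC.
rewrite min_l// max_r// => hM.
have hc : {within `[x, y], continuous f}.
  by apply: derivable_within_continuous => z _; exact: ex_derive.
have [c cxy ->] := @MVT_segment R f df x y xy (fun z _ => hd z) hc.
rewrite normrM ler_wpM2r ?normr_ge0//; apply: hM.
by move: cxy; rewrite in_itv.
Qed.

End SmoothCalculus.

(** * Supports, test functions and limits of smooth functions *)

Section TestFunctions.
Context {R : realType}.
Implicit Types (f g : R -> R) (n : nat) (x y z h e c B : R).

(** With the denominator cleared, h = 0 is no exception and remainder estimates can be used as they
    are. *)
Lemma is_derive_eps f x (l : R) :
  (forall e, 0 < e -> exists2 d, 0 < d & forall h, `|h| < d ->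
    `|f (x + h) - f x - h * l| <= e * `|h|) <-> is_derive x 1 f l.
Proof.
split=> [H|[df <-] e e0].
  have hl : h^-1 *: (f (h *: 1 + x) - f x) @[h --> 0^'] --> l.
    apply/cvgrPdist_le => e e0; have [d d0 hd] := H _ e0.
    exists d => // h /=; rewrite sub0r normrN => hd' h0.
    have := hd _ hd'; rewrite /GRing.scale /= mulr1 [h + x]addrC => hh.
    have -> : l - h^-1 * (f (x + h) - f x) = - (h^-1 * (f (x + h) - f x - h * l)).
      by field.
    rewrite normrN normrM normfV mulrC ler_pdivrMr ?normr_gt0//.
  split; first by apply/cvg_ex; exists l.
  exact: (cvg_lim _ hl).
have /cvgrPdist_le /(_ _ e0) [d d0 hd] := df.
exists d => // h hd'; have [->|h0] := eqVneq h 0.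
  by rewrite addr0 subrr mul0r subr0 normr0 mulr0.
have := hd h; rewrite /= sub0r normrN => /(_ hd' h0).
rewrite /GRing.scale /= mulr1 [h + x]addrC => hh.
rewrite -ler_pdivrMr ?normr_gt0// -normfV -normrM.
apply: le_trans hh; rewrite /derive -normrN /GRing.scale /=.
under [X in lim (X @ _)]eq_fun do rewrite mulr1.
rewrite le_eqVlt; apply/orP; left; apply/eqP; congr `| _ |.
set L := lim _; by field.
Qed.

Lemma dn_eq_near k f g x e : sm f -> sm g -> 0 < e ->
  (forall y, `|y - x| < e -> f y = g y) -> dn k f x = dn k g x.
Proof.
elim: k f g => [|k IH] f g sf sg e0 h; first by apply: h; rewrite subrr normr0.
rewrite !dSn; apply: IH => //; [exact: smooth_der..|].
move=> y yx.
have hf : is_derive y 1 f (der f y) by exact: smooth_is_derive1.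
suff hg : is_derive y 1 g (der f y).
  by have [_ <-] := hg; have [_ <-] := smooth_is_derive1 y sg.
have h0 : 0 < e - `|y - x| by rewrite subr_gt0.
apply/is_derive_eps => r r0; have /is_derive_eps /(_ r r0) [d d0 hd] := hf.
exists (Num.min d (e - `|y - x|)); first by rewrite lt_min d0 h0.
move=> z; rewrite lt_min => /andP[/hd zd ze].
rewrite -(h y yx) -(h (y + z))//.
have -> : y + z - x = (y - x) + z by ring.
by apply: le_lt_trans (ler_normD _ _) _; rewrite addrC -ltrBrDr.
Qed.

Lemma dn0 k : dn k (fun=> 0 : R) = fun=> 0.
Proof. by case: k => // k; rewrite dn_cst. Qed.

Definition supp_in (A B : R) f := forall y, f y != 0 -> A <= y <= B.

Lemma supp_in_eq0 A B f y : supp_in A B f -> ~ (A <= y <= B) -> f y = 0.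
Proof. by move=> h; apply: contra_notP => /eqP /h. Qed.

Lemma supp_in_le A B A' B' f : A' <= A -> B <= B' -> supp_in A B f -> supp_in A' B' f.
Proof.
move=> AA BB h y /h /andP[Ay yB].
by rewrite (le_trans AA Ay) (le_trans yB BB).
Qed.

Lemma supp_in_dn A B f k : sm f -> supp_in A B f -> supp_in A B (dn k f).
Proof.
move=> sf h y; apply: contraNT => /negP nAB.
apply/eqP; have [e e0 he] : exists2 e, 0 < e & forall z, `|z - y| < e -> ~ (A <= z <= B).
  move/negP: nAB; rewrite negb_and -!ltNge => /orP[] yAB.
    exists (A - y); first by rewrite subr_gt0.
    move=> z zy /andP[Az _]; have := ler_norm (z - y); move: zy Az; clear; lra.
  exists (y - B); first by rewrite subr_gt0.
  move=> z zy /andP[_ Az]; have := ler_norm (y - z); rewrite distrC.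
  move: zy Az; clear; lra.
rewrite (@dn_eq_near k f (fun=> 0) y e) ?dn0//; first exact: smooth_cst.
by move=> z zy; apply: supp_in_eq0 h _; exact: he.
Qed.

Lemma supp_in_closure A B f : supp_in A B f -> fun_support f `<=` `[A, B]%classic.
Proof.
have /closure_id -> : closed `[A, B]%classic by exact: interval_closed.
by move=> h; apply: closure_subset => y /= /h; rewrite in_itv.
Qed.

Lemma test_funP f : test_fun f <-> sm f /\ exists A, supp_in (- A) A f.
Proof.
rewrite smP; split=> -[sf].
  move=> /compact_bounded [M [_ hM]]; split=> //; exists (M + 1) => y fy.
  by rewrite -ler_norml; apply: (hM (M + 1)); [rewrite ltrDl|exact: subset_closure].
move=> [A hA]; split=> //.
apply: (subclosed_compact _ (@segment_compact _ (- A) A)); first exact: closed_closure.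
exact: supp_in_closure.
Qed.

Lemma test_fun_supp A B f : sm f -> supp_in A B f -> test_fun f.
Proof.
move=> sf h; apply/test_funP; split=> //; exists (Num.max `|A| `|B|) => y /h /andP[Ay yB].
rewrite -ler_norml ler_norml; apply/andP; split.
  apply: le_trans Ay; rewrite lerNl; apply: le_trans (ler_norm _) _.
  by rewrite normrN le_max lexx.
by apply: le_trans yB _; apply: le_trans (ler_norm _) _; rewrite le_max lexx orbT.
Qed.

Lemma dbound_segment f n (A B : R) : sm f ->
  exists2 M, 0 <= M & dbound n [set y | A <= y <= B] M f.
Proof.
elim: n f => [|n IH] f sf.
  have [AB|BA] := leP A B; last first.
    by exists 0 => //; split=> // y /= /andP[Ay yB]; move: (lt_le_trans BA (le_trans Ay yB)); rewrite ltxx.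
  have cf : {within `[A, B], continuous (fun y => `|f y|)}.
    apply: continuous_subspaceT => y; apply: continuous_comp; first exact: smooth_continuous.
    exact: norm_continuous.
  have [c _ hc] := EVT_max AB cf.
  exists `|f c| => //; split=> // y /= yAB; apply: hc; by rewrite in_itv.
have [M M0 hM] := IH _ (smooth_der sf).
have [M' M'0 [hM' _]] : exists2 M, 0 <= M & dbound 0 [set y | A <= y <= B] M f.
  have [AB|BA] := leP A B; last first.
    by exists 0 => //; split=> // y /= /andP[Ay yB]; move: (lt_le_trans BA (le_trans Ay yB)); rewrite ltxx.
  have cf : {within `[A, B], continuous (fun y => `|f y|)}.
    apply: continuous_subspaceT => y; apply: continuous_comp; first exact: smooth_continuous.
    exact: norm_continuous.
  have [c _ hc] := EVT_max AB cf.
  exists `|f c| => //; split=> // y /= yAB; apply: hc; by rewrite in_itv.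
exists (M + M'); first exact: addr_ge0.
split=> [y /hM' h|]; first by apply: le_trans h _; rewrite lerDr.
by apply: dbound_le hM => //; rewrite lerDl.
Qed.

Lemma dbound_supp f n (A B : R) : sm f -> supp_in A B f ->
  exists2 M, 0 <= M & dbound n setT M f.
Proof.
move=> sf h; have [M M0 /dboundP hM] := dbound_segment n A B sf.
exists M => //; apply/dboundP => k y kn _.
have [->|fy] := eqVneq (dn k f y) 0; first by rewrite normr0.
by apply: hM => //; apply: supp_in_dn h _ fy.
Qed.

(** The difference f - F k is Lipschitz with constant u k, being the limit of the F m - F k, to
    which the mean value theorem applies. So the quotients of f inherit those of F k up to an error
    of order u k. *)
Lemma deriv_limit (F G : nat -> R -> R) f g (u : nat -> R) :
  (forall k x, is_derive x 1 (F k) (G k x)) ->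
  (forall k m x, (k <= m)%N -> `|G m x - G k x| <= u k) ->
  (forall k x, `|f x - F k x| <= u k) -> (forall k x, `|g x - G k x| <= u k) ->
  (forall e, 0 < e -> exists k, forall m, (k <= m)%N -> u m <= e) ->
  forall x, is_derive x 1 f (g x).
Proof.
move=> hF hG hf hg hu x.
have key k h : `|(f (x + h) - F k (x + h)) - (f x - F k x)| <= u k * `|h|.
  apply/ler_addgt0Pr => e e0; have [m0 hm0] := hu (e / 2) ltac:(move: e0; clear; lra).
  pose m := maxn m0 k; have hm : u m <= e / 2 by apply: hm0; exact: leq_maxl.
  have h1 : `|(F m (x + h) - F k (x + h)) - (F m x - F k x)| <= u k * `|h|.
    have hd z : is_derive z 1 (fun y => F m y - F k y) (G m z - G k z).
      have h1 := hF m z; have h2 := hF k z; exact: is_deriveB.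
    have := mvt_bound hd (fun z _ => hG k m z (leq_maxr _ _)) => /(_ x (x + h)).
    by rewrite [x + h - x]addrC addKr.
  have := hf m (x + h); have := hf m x; move: h1 hm; clear.
  rewrite !ler_norml => /andP[? ?] ? /andP[? ?] /andP[? ?]; apply/andP; split; lra.
apply/is_derive_eps => e e0.
have [k hk] := hu (e / 4) ltac:(move: e0; clear; lra).
have uk := hk k (leqnn k).
have /is_derive_eps /(_ (e / 2) ltac:(move: e0; clear; lra)) [d d0 hd] := hF k x.
exists d => // h /hd {}hd.
have h1 := le_trans (key k h) (ler_wpM2r (normr_ge0 h) uk).
have h2 : `|h * (g x - G k x)| <= e / 4 * `|h|.
  by rewrite normrM mulrC ler_wpM2r// (le_trans (hg k x)).
move: h1 h2 hd; set A := _ * (_ - _).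
have -> : A = h * g x - h * G k x by rewrite /A mulrBr.
have : 0 <= `|h| by [].
move: (`|h|) (h * g x) (h * G k x) => H ? ? ?.
have -> : e / 4 * H = e * H / 4 by rewrite mulrAC.
have -> : e / 2 * H = e * H / 2 by rewrite mulrAC.
clear; rewrite !ler_norml => /andP[? ?] /andP[? ?] /andP[? ?]; apply/andP; split; lra.
Qed.

Lemma cauchy_limit (a : nat -> R) (u : nat -> R) :
  (forall k m, (k <= m)%N -> `|a m - a k| <= u k) ->
  (forall e, 0 < e -> exists k, forall m, (k <= m)%N -> u m <= e) ->
  exists l, forall k, `|l - a k| <= u k.
Proof.
move=> ha hu.
have ca : cvg (a @ \oo).
  apply/cauchy_cvgP/cauchy_exP => e e0.
  have [k hk] := hu (e / 2) ltac:(move: e0; clear; lra).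
  exists (a k); exists k => // m /= km; rewrite /ball /=.
  rewrite distrC; apply: le_lt_trans (ha _ _ km) _.
  by apply: le_lt_trans (hk _ (leqnn k)) _; move: e0; clear; lra.
exists (lim (a @ \oo)) => k; apply/ler_addgt0Pr => e e0.
have /cvgrPdist_le /(_ e e0) [m _ hm] := ca.
have h1 := hm (maxn m k) (leq_maxl _ _).
have h2 := ha k (maxn m k) (leq_maxr _ _).
have -> : lim (a @ \oo) - a k = (a (maxn m k) - a k) + (lim (a @ \oo) - a (maxn m k)).
  by ring.
by apply: le_trans (ler_normD _ _) _; exact: lerD.
Qed.

(* The sequence need not be Cauchy in each C^j norm from the start: the j-th
   derivatives are controlled only from the index j on. *)
Lemma smooth_limit (S : nat -> R -> R) (u : nat -> R) N :
  (forall k, sm (S k)) ->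
  (forall k m, (k <= m)%N -> dbound (N + k) setT (u k) (fun y => S m y - S k y)) ->
  (forall e, 0 < e -> exists k, forall m, (k <= m)%N -> u m <= e) ->
  exists2 F, sm F & forall k, dbound (N + k) setT (u k) (fun y => F y - S k y).
Proof.
move=> sS hS hu.
have hS' j k m y : (j <= N + k)%N -> (k <= m)%N ->
    `|dn j (S m) y - dn j (S k) y| <= u k.
  move=> jk km; have /dboundP := hS k m km; move/(_ j y jk I).
  by rewrite dn_sub.
have hu' j e : 0 < e -> exists k, forall m, (k <= m)%N -> u (j + m)%N <= e.
  move=> /hu[k hk]; exists k => m km; apply: hk; exact: (leq_trans km (leq_addl _ _)).
have lim_ex j y : exists l, forall k, `|l - dn j (S (j + k)%N) y| <= u (j + k)%N.
  apply: (@cauchy_limit (fun k => dn j (S (j + k)%N) y) (fun k => u (j + k)%N)).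
    move=> k m km; apply: hS'; first exact: leq_trans (leq_addr k j) (leq_addl _ _).
    by rewrite leq_add2l.
  exact: hu'.
pose L j y := sval (cid (lim_ex j y)).
have hL j y k : `|L j y - dn j (S (j + k)%N) y| <= u (j + k)%N.
  by rewrite /L; case: cid => l /=.
have hL' j y k : (j <= N + k)%N -> `|L j y - dn j (S k) y| <= u k.
  move=> jk; apply/ler_addgt0Pr => e e0.
  have [m0 hm0] := hu e e0; pose m := maxn m0 k.
  have h1 := hL j y m.
  have h2 := hS' j k (j + m)%N y jk (leq_trans (leq_maxr m0 k) (leq_addl j m)).
  have h3 : u (j + m)%N <= e by apply: hm0; exact: leq_trans (leq_maxl m0 k) (leq_addl _ _).
  have -> : L j y - dn j (S k) y
      = (dn j (S (j + m)%N) y - dn j (S k) y) + (L j y - dn j (S (j + m)%N) y) by ring.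
  by apply: le_trans (ler_normD _ _) _; apply: lerD => //; exact: le_trans h3.
have hd j y : is_derive y 1 (L j) (L j.+1 y).
  apply: (@deriv_limit (fun k => dn j (S (j.+1 + k)%N)) (fun k => dn j.+1 (S (j.+1 + k)%N))
    _ _ (fun k => u (j.+1 + k)%N)).
  - by move=> k x; exact: smooth_is_derive.
  - move=> k m x km; apply: hS'; first exact: leq_trans (leq_addr k _) (leq_addl _ _).
    by rewrite leq_add2l.
  - move=> k x; apply: hL'.
    exact: leq_trans (leqnSn j) (leq_trans (leq_addr k _) (leq_addl _ _)).
  - move=> k x; apply: hL'; exact: leq_trans (leq_addr k _) (leq_addl _ _).
  - exact: hu'.
have [sL eL] := smooth_family hd.
exists (L 0%N) => // k; apply/dboundP => j y jk _.
by rewrite dn_sub// eL; exact: hL'.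
Qed.

End TestFunctions.

(** * Smooth cut-off functions *)

Section SmoothStep.
Context {R : realType}.
Implicit Types (x y z h e : R) (m n k : nat).

Lemma expR_ge_pow k x : 0 <= x -> (x / k.+1%:R) ^+ k.+1 <= expR x.
Proof.
move=> x0; have k0 : 0 < k.+1%:R :> R by rewrite ltr0n.
have -> : expR x = expR (x / k.+1%:R) ^+ k.+1.
  by rewrite -expRM_natl; congr expR; field; rewrite lt0r_neq0.
apply: lerXn2r; rewrite ?nnegrE ?expR_ge0 ?divr_ge0//.
by apply: le_trans (expR_ge1Dx _); rewrite lerDr.
Qed.

(** The derivative of each member is a linear combination of later members, so smoothness is an
    induction over all m at once; only m = 0 is used afterwards. *)
Definition flat m x : R := if 0 < x then x ^- m * expR (- x^-1) else 0.

Lemma flat_ge0 m x : 0 <= flat m x.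
Proof.
rewrite /flat; case: ifP => // x0; apply: mulr_ge0; last exact: expR_ge0.
by rewrite invr_ge0 exprn_ge0// ltW.
Qed.

Lemma flat_le m x : 0 < x -> flat m x <= m.+2%:R ^+ m.+2 * x ^+ 2.
Proof.
move=> x0; rewrite /flat x0 expRN.
have xm : 0 < x ^+ m by rewrite exprn_gt0.
rewrite mulrC ler_pdivrMr// -mulrA -exprD addSn addSn add0n -exprMn.
rewrite -[leRHS]invrK lef_pV2 ?posrE ?expR_gt0 ?invr_gt0 ?exprn_gt0 ?mulr_gt0//.
apply: le_trans (expR_ge_pow m.+1 _); last by rewrite invr_ge0 ltW.
by rewrite -exprVn invfM mulrC.
Qed.

Lemma is_derive_exprVn m x : x != 0 ->
  is_derive x 1 (fun y => y ^- m) (- m%:R * x ^- m.+1).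
Proof.
move=> xn0; have hi : is_derive x 1 (fun y => y^-1) (- x ^- 2).
  have := @is_deriveV _ (fun y => y) x 1 1 xn0 (is_derive_id _ _).
  by rewrite /GRing.scale /= mulr1.
have -> : (fun y : R => y ^- m) = (fun y => (y^-1) ^+ m).
  by apply/funext => y; rewrite exprVn.
case: m => [|m].
  by rewrite oppr0 mul0r; under eq_fun do rewrite expr0; exact: is_derive_cst.
have := is_deriveX m.+1 hi; rewrite exprfctE /GRing.scale /= => h.
apply: is_derive_eq h _; rewrite /= -mulr_natl.
have xm : x ^+ m != 0 by rewrite expf_neq0.
by rewrite exprVn !exprS; field; rewrite xm.
Qed.

Lemma is_derive_flat m x :
  is_derive x 1 (flat m) (- m%:R * flat m.+1 x + flat m.+2 x).
Proof.
have [x0|x0|<-] := ltgtP 0 x.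
- have hx : is_derive x 1 (fun y => y ^- m * expR (- y^-1))
      (- m%:R * flat m.+1 x + flat m.+2 x).
    have xn0 : x != 0 by rewrite gt_eqF.
    have hi : is_derive x 1 (fun y => y^-1) (- x ^- 2).
      by have := is_derive_exprVn 1 xn0; rewrite mulN1r.
    have he : is_derive x 1 (fun y => expR (- y^-1)) (expR (- x^-1) * x ^- 2).
      have hN : is_derive x 1 (fun y => - y^-1) (x ^- 2).
        by have := is_deriveN hi; rewrite opprK.
      exact: (@is_derive1_comp _ expR (fun y => - y^-1) x _ _ (is_derive_expR _) hN).
    have hm := is_derive_exprVn m xn0.
    have := is_deriveM hm he; rewrite /GRing.scale /= => h.
    apply: is_derive_eq h _; rewrite /flat x0 !exprS.
    have xm : x ^+ m != 0 by rewrite expf_neq0// gt_eqF.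
    by field; rewrite xm gt_eqF.
  apply/is_derive_eps => r r0; have /is_derive_eps /(_ r r0) [d d0 hd] := hx.
  exists (Num.min d x); first by rewrite lt_min d0.
  move=> h; rewrite lt_min => /andP[/hd {}hd hhx].
  have xh : 0 < x + h by have := ler_norm (- h); rewrite normrN; move: hhx; clear; lra.
  by rewrite {1 2}/flat xh x0.
- have -> : - m%:R * flat m.+1 x + flat m.+2 x = 0.
    by rewrite /flat ltNge (ltW x0) /= mulr0 addr0.
  apply/is_derive_eps => r r0; exists (- x); first by rewrite oppr_gt0.
  move=> h hx; have xh : (0 < x + h) = false.
    by apply/negbTE; rewrite -leNgt; have := ler_norm h; move: hx; clear; lra.
  rewrite /flat xh ltNge (ltW x0) /= subrr mulr0 subrr normr0.
  by rewrite mulr_ge0// ltW.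
- have -> : - m%:R * flat m.+1 0 + flat m.+2 0 = 0 :> R.
    by rewrite /flat ltxx mulr0 addr0.
  (* At the origin the quadratic bound [flat_le] forces the derivative 0. *)
  apply/is_derive_eps => r r0; set K : R := m.+2%:R ^+ m.+2.
  have K0 : 0 < K by rewrite exprn_gt0// ltr0n.
  exists (r / K); first by rewrite divr_gt0.
  move=> h hr; rewrite add0r mulr0 subr0 [flat m 0]/flat ltxx subr0 ger0_norm ?flat_ge0//.
  have [h0|h0] := ltP 0 h; last first.
    by rewrite /flat ltNge h0 /= mulr_ge0// ltW.
  apply: le_trans (flat_le m h0) _; rewrite -/K expr2 mulrA gtr0_norm//.
  rewrite ler_wpM2r ?(ltW h0)//; move: hr; rewrite gtr0_norm// ltr_pdivlMr// mulrC.
  exact: ltW.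
Qed.

Lemma smooth_flat m : sm (flat m).
Proof.
apply/smoothCn => n; elim: n m => //= n IH m; split=> [x|].
  by have := is_derive_flat m x => ?; exact: ex_derive.
rewrite (is_derive_der (is_derive_flat m)); apply: Cn_add => //.
by apply: Cn_mul => //; apply: Cn_smooth; exact: smooth_cst.
Qed.

Lemma flat_gt0 x : 0 < x -> 0 < flat 0 x.
Proof. by move=> x0; rewrite /flat x0 expr0 invr1 mul1r expR_gt0. Qed.

Lemma flat_le0 m x : x <= 0 -> flat m x = 0.
Proof. by rewrite leNgt /flat => /negbTE ->. Qed.

Lemma flat_mono x y : x <= y -> flat 0 x <= flat 0 y.
Proof.
move=> xy; have [x0|/flat_le0 ->] := ltP 0 x; last exact: flat_ge0.
have y0 := lt_le_trans x0 xy.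
by rewrite /flat x0 y0 expr0 invr1 !mul1r ler_expR lerN2 lef_pV2.
Qed.

(** Smooth transition from 0 on the negative half line to 1 beyond x = 1: the two summands of the
    denominator never vanish together. *)
Definition step x : R := flat 0 x / (flat 0 x + flat 0 (1 - x)).

Lemma step_den x : 0 < flat 0 x + flat 0 (1 - x).
Proof.
have [x0|x0] := ltP 0 x; first by rewrite ltr_pwDl ?flat_gt0 ?flat_ge0.
by rewrite ltr_wpDl ?flat_ge0// flat_gt0//; move: x0; clear; lra.
Qed.

Lemma smooth_step : sm step.
Proof.
have s1 : sm (fun x => flat 0 (1 - x)).
  have -> : (fun x => flat 0 (1 - x)) = (fun x => flat 0 (-1 * x + 1)).
    by apply/funext => x; congr flat; ring.
  by apply: smooth_comp_affine; exact: smooth_flat.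
apply: smooth_mul; first exact: smooth_flat.
apply: smooth_inv; last by apply: smooth_add => //; exact: smooth_flat.
by move=> x; rewrite gt_eqF// step_den.
Qed.

Lemma step_ge0 x : 0 <= step x.
Proof. by rewrite divr_ge0 ?flat_ge0// ltW// step_den. Qed.

Lemma step_le1 x : step x <= 1.
Proof. by rewrite ler_pdivrMr ?step_den// mul1r lerDl flat_ge0. Qed.

Lemma step0 x : x <= 0 -> step x = 0.
Proof. by rewrite /step => /flat_le0 ->; rewrite mul0r. Qed.

Lemma step1 x : 1 <= x -> step x = 1.
Proof.
move=> x1; rewrite /step [flat 0 (1 - x)]flat_le0 ?addr0; last by move: x1; clear; lra.
by rewrite divff// gt_eqF// flat_gt0// (lt_le_trans ltr01).
Qed.

Lemma step_mono x y : x <= y -> step x <= step y.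
Proof.
move=> xy; rewrite ler_pdivrMr ?step_den// mulrAC ler_pdivlMr ?step_den//.
rewrite !mulrDr [flat 0 x * flat 0 y]mulrC lerD2l.
apply: ler_pM; rewrite ?flat_ge0 ?flat_mono//; move: xy; clear; lra.
Qed.

Definition chi z : R := step (2 * (1 - z)) * step (2 * (1 + z)).

Lemma smooth_chi : sm chi.
Proof.
have e1 : (fun z : R => step (2 * (1 - z))) = (fun z => step ((-2) * z + 2)).
  by apply/funext => z; congr step; ring.
have e2 : (fun z : R => step (2 * (1 + z))) = (fun z => step (2 * z + 2)).
  by apply/funext => z; congr step; ring.
by apply: smooth_mul; rewrite ?e1 ?e2; apply: smooth_comp_affine; exact: smooth_step.
Qed.

Lemma chi_ge0 z : 0 <= chi z.
Proof. by rewrite mulr_ge0 ?step_ge0. Qed.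

Lemma chi_le1 z : chi z <= 1.
Proof. by rewrite mulr_ile1 ?step_ge0 ?step_le1. Qed.

Lemma chi1 z : `|z| <= 2^-1 -> chi z = 1.
Proof.
rewrite ler_norml => /andP[h1 h2].
by rewrite /chi !step1 ?mulr1//; move: h1 h2; clear; lra.
Qed.

Lemma chi0 z : 1 <= `|z| -> chi z = 0.
Proof.
rewrite ler_normr /chi => /orP[] z1; last rewrite mulrC.
  by rewrite step0 ?mul0r//; move: z1; clear; lra.
by rewrite step0 ?mul0r//; move: z1; clear; lra.
Qed.

Lemma supp_chi : supp_in (-1) 1 chi.
Proof. by move=> z; apply: contraNT; rewrite -ler_norml -ltNge => /ltW /chi0 ->. Qed.

Definition plateau (A B d : R) y : R := step ((y - A) / d + 1) * step ((B - y) / d + 1).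

Lemma smooth_plateau A B d : sm (plateau A B d).
Proof.
have e1 : (fun y => step ((y - A) / d + 1)) = (fun y => step (d^-1 * y + (1 - A / d))).
  by apply/funext => y; congr step; ring.
have e2 : (fun y => step ((B - y) / d + 1)) = (fun y => step ((- d^-1) * y + (1 + B / d))).
  by apply/funext => y; congr step; ring.
by apply: smooth_mul; rewrite ?e1 ?e2; apply: smooth_comp_affine; exact: smooth_step.
Qed.

Lemma plateau_ge0 A B d y : 0 <= plateau A B d y.
Proof. by rewrite mulr_ge0 ?step_ge0. Qed.

Lemma plateau_le1 A B d y : plateau A B d y <= 1.
Proof. by rewrite mulr_ile1 ?step_ge0 ?step_le1. Qed.

Lemma plateau1 A B d y : 0 < d -> A <= y <= B -> plateau A B d y = 1.
Proof.
move=> d0 /andP[Ay yB].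
by rewrite /plateau !step1 ?mulr1// lerDr divr_ge0 ?subr_ge0// ltW.
Qed.

Lemma supp_plateau A B d : 0 < d -> supp_in (A - d) (B + d) (plateau A B d).
Proof.
move=> d0 y; apply: contraNT; rewrite negb_and -!ltNge /plateau => /orP[] h; apply/eqP.
  rewrite step0 ?mul0r//.
  have -> : (y - A) / d + 1 = (y - A + d) / d by field; rewrite gt_eqF.
  rewrite ler_pdivrMr// mul0r; move: h; clear; lra.
rewrite mulrC step0 ?mul0r//.
have -> : (B - y) / d + 1 = (B - y + d) / d by field; rewrite gt_eqF.
  rewrite ler_pdivrMr// mul0r; move: h; clear; lra.
Qed.

End SmoothStep.

(** * Functionals of compact support *)
Section CompactlySupportedFunctionals.
Context {R : realType}.
Implicit Types (f g : R -> R) (n : nat) (x y z h e c B r : R) (T S : (R -> R) -> R).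

Definition seg (A B : R) : set R := [set y | A <= y <= B].

(* A distribution of compact support, as a continuous functional on all
   smooth functions. *)
Record edist T : Prop := Edist {
  ed_lin : forall c f g, sm f -> sm g -> T (fun y => c * f y + g y) = c * T f + T g ;
  ed_bd : exists A C N, 0 <= C /\
    forall f B, sm f -> dbound N (seg (- A) A) B f -> `|T f| <= C * B }.

Lemma ed_scale T c f : edist T -> sm f -> T (fun y => c * f y) = c * T f.
Proof.
move=> hT sf; have s0 : sm (fun=> 0 : R) by exact: smooth_cst.
have T0 : T (fun=> 0) = 0.
  have := ed_lin hT 1 s0 s0; rewrite mul1r.
  rewrite [X in T X = _](_ : _ = fun=> 0); last by apply/funext => y; ring.
  by move=> h; move: h; clear; lra.
have := ed_lin hT c sf s0; rewrite T0 addr0 => <-.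
by congr T; apply/funext => y; rewrite addr0.
Qed.

Lemma ed0 T : edist T -> T (fun=> 0) = 0.
Proof.
move=> hT; rewrite -[RHS](mul0r (T (fun=> 0))) -(ed_scale 0 hT (smooth_cst 0)).
by congr T; apply/funext => y; rewrite mul0r.
Qed.

Lemma ed_add T f g : edist T -> sm f -> sm g -> T (fun y => f y + g y) = T f + T g.
Proof.
move=> hT sf sg; rewrite -[T f]mul1r -(ed_lin hT)//.
by congr T; apply/funext => y; rewrite mul1r.
Qed.

Lemma ed_opp T f : edist T -> sm f -> T (fun y => - f y) = - T f.
Proof.
move=> hT sf; rewrite -mulN1r -ed_scale//.
by congr T; apply/funext => y; rewrite mulN1r.
Qed.

Lemma ed_sub T f g : edist T -> sm f -> sm g -> T (fun y => f y - g y) = T f - T g.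
Proof. by move=> hT sf sg; rewrite ed_add ?ed_opp//; exact: smooth_opp. Qed.

Lemma edist_lin c T S : edist T -> edist S -> edist (fun f => c * T f + S f).
Proof.
move=> hT hS; split=> [a f g sf sg|].
  by rewrite (ed_lin hT)// (ed_lin hS)//; ring.
have [A [C [N [C0 hC]]]] := ed_bd hT; have [A' [C' [N' [C'0 hC']]]] := ed_bd hS.
exists (Num.max A A'), (`|c| * C + C'), (maxn N N'); split.
  by rewrite addr_ge0// mulr_ge0.
move=> f B sf hB; apply: le_trans (ler_normD _ _) _; rewrite mulrDl; apply: lerD.
  rewrite normrM -mulrA ler_wpM2l// hC//; apply: dbound_le hB => //.
    exact: leq_maxl.
  move=> y /= /andP[h1 h2]; rewrite /seg /=; apply/andP; split.
    by apply: le_trans h1; rewrite lerN2 le_max lexx.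
  by apply: le_trans h2 _; rewrite le_max lexx.
apply: hC' => //; apply: dbound_le hB => //; first exact: leq_maxr.
move=> y /= /andP[h1 h2]; rewrite /seg /=; apply/andP; split.
  by apply: le_trans h1; rewrite lerN2 le_max lexx orbT.
by apply: le_trans h2 _; rewrite le_max lexx orbT.
Qed.

Lemma edist_mul chi T : sm chi -> edist T -> edist (fun f => T (fun y => chi y * f y)).
Proof.
move=> sc hT; split=> [a f g sf sg|].
  rewrite -(ed_lin hT); [|exact: smooth_mul..].
  by congr T; apply/funext => y; ring.
have [A [C [N [C0 hC]]]] := ed_bd hT.
have [M M0 hM] := dbound_segment N (- A) A sc.
exists A, (C * (2 ^+ N * M)), N; split; first by rewrite !mulr_ge0 ?exprn_ge0.
move=> f B sf hB; rewrite -!mulrA; apply: hC; first exact: smooth_mul.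
exact: dbound_mul.
Qed.

(** All products chi f are supported in one compact set, so the seminorm estimate of g there, with
    Leibniz's rule, gives a bound for every smooth f. *)
Lemma edist_distrib (g : distrib R) chi : test_fun chi ->
  edist (fun f => g (fun y => chi y * f y)).
Proof.
move=> /test_funP [sc [A0 hA0]].
have [A hA A0_ge0] : exists2 A, supp_in (- A) A chi & 0 <= A.
  exists `|A0| => //; apply: supp_in_le hA0; last exact: ler_norm.
  by rewrite lerN2 ler_norm.
have tf f : sm f -> test_fun (fun y => chi y * f y).
  move=> sf; apply/test_funP; split; first exact: smooth_mul.
  by exists A => y h; apply: hA; apply: contraNN h => /eqP ->; rewrite mul0r.
split=> [a f h sf sh|].
  rewrite -distrib_linear; [|exact: tf..].
  by congr (distrib_fun g); apply/funext => y; ring.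
have [C [N hC]] := distrib_continuous g (@segment_compact _ (- A) A).
have [M M0 hM] := dbound_segment N (- A) A sc.
exists A, (`|C| * (N.+1%:R * (2 ^+ N * M))), N; split.
  by rewrite !mulr_ge0 ?exprn_ge0.
move=> f B sf hB.
have spt : supp_in (- A) A (fun y => chi y * f y).
  by move=> y h; apply: hA; apply: contraNN h => /eqP ->; rewrite mul0r.
have s := smooth_mul sc sf.
have /dboundP hD := dbound_mul sc sf hM hB.
have B0 : 0 <= B.
  apply: (@dbound_ge0 _ N (seg (- A) A) B f 0) => //.
  by rewrite /seg /= oppr_le0 A0_ge0.
have hk (k : 'I_N.+1) : 0 <= sup (range (fun y => `|derive1n k (fun y => chi y * f y) y|))
    <= 2 ^+ N * (M * B).
  have ub : ubound (range (fun y => `|derive1n k (fun y => chi y * f y) y|))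
      (2 ^+ N * (M * B)).
    move=> _ [y _ <-]; rewrite -dnE.
    have [Ay|nAy] := boolP (- A <= y <= A); first by apply: hD => //; rewrite -ltnS.
    rewrite (supp_in_eq0 (supp_in_dn (k := k) s spt)); last exact/negP.
    by rewrite normr0 !mulr_ge0 ?exprn_ge0.
  have ne : range (fun y => `|derive1n k (fun y => chi y * f y) y|) !=set0.
    by exists `|derive1n k (fun y => chi y * f y) 0|; exists 0.
  apply/andP; split; last exact: ge_sup.
  apply: le_trans (normr_ge0 _) _; apply: sup_upper_bound; last by exists 0.
  by split=> //; exists (2 ^+ N * (M * B)).
have := hC _ (tf f sf) (supp_in_closure spt) => /le_trans; apply.
apply: le_trans (ler_norm _) _; rewrite normrM -mulrA ler_wpM2l//.
rewrite ger0_norm; last by apply: sumr_ge0 => k _; have /andP[] := hk k.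
rewrite -!mulrA [leRHS](_ : _ = \sum_(k < N.+1) (2 ^+ N * (M * B))).
  by apply: ler_sum => k _; have /andP[] := hk k.
by rewrite sumr_const card_ord mulr_natl.
Qed.

Definition sc c r f : R -> R := fun y => f ((y - c) / r).

Lemma smooth_sc c r f : sm f -> sm (sc c r f).
Proof.
move=> sf; have -> : sc c r f = fun y => f (r^-1 * y + (- c / r)).
  by apply/funext => y; rewrite /sc; congr f; ring.
exact: smooth_comp_affine.
Qed.

Lemma dn_sc c r f k : sm f -> dn k (sc c r f) = fun y => r ^- k * dn k f ((y - c) / r).
Proof.
move=> sf; have -> : sc c r f = fun y => f (r^-1 * y + (- c / r)).
  by apply/funext => y; rewrite /sc; congr f; ring.
rewrite dn_comp_affine//; apply/funext => y; rewrite exprVn; congr (_ * dn k f _); ring.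
Qed.

Lemma dbound_sc c r f N B : sm f -> 0 < r <= 1 -> 0 <= B -> dbound N setT B f ->
  dbound N setT (r ^- N * B) (sc c r f).
Proof.
move=> sf /andP[r0 r1] B0 /dboundP hB; apply/dboundP => k y kN _.
rewrite dn_sc// normrM; apply: ler_pM => //; last exact: hB.
rewrite ger0_norm ?invr_ge0 ?exprn_ge0 ?(ltW r0)//.
rewrite lef_pV2 ?posrE ?exprn_gt0//.
by apply: ler_wiXn2l => //; exact: ltW.
Qed.

Lemma supp_sc c r f : 0 < r -> supp_in (-1) 1 f -> supp_in (c - r) (c + r) (sc c r f).
Proof.
move=> r0 h y /h; rewrite ler_pdivlMr// ler_pdivrMr// mulN1r mul1r => /andP[h1 h2].
by apply/andP; split; move: h1 h2; clear; lra.
Qed.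

Lemma half01 : 0 <= (2^-1 : R) < 1.
Proof. by apply/andP; split; lra. Qed.

Lemma geo_small (q e : R) : 0 <= q < 1 -> 0 < e ->
  exists k, forall m, (k <= m)%N -> q ^+ m <= e.
Proof.
move=> /andP[q0 q1] e0.
have : (fun n => q ^+ n) @ \oo --> (0 : R) by apply: cvg_expr; rewrite ger0_norm.
move=> /cvgrPdist_le /(_ e e0) [k _ hk]; exists k => m km.
by have := hk m km; rewrite /= sub0r normrN ger0_norm ?exprn_ge0.
Qed.

(** T is O(r ^ b) on dilations by r about c, uniformly on bounded sets of test functions. Absence of
    an atom yields b = 0, a point value yields b = 1. *)
Definition scale_bounded T c (b : nat) := exists N C, 0 <= C /\
  forall f B r, sm f -> supp_in (-1) 1 f -> dbound N setT B f -> 0 < r <= 1 ->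
    `|T (sc c r f)| <= C * r ^+ b * B.

End CompactlySupportedFunctionals.

(** * The uniform boundedness principle for dilations *)

Section BanachSteinhaus.
Context {R : realType}.
Implicit Types (f g S : R -> R) (n k : nat) (x y z h e c B r d : R) (T : (R -> R) -> R).

Context (T : (R -> R) -> R) (c : R) (b : nat) (hT : edist T).

Lemma ed_sc_bound : exists N C, 0 <= C /\ forall f B r, sm f -> 0 < r <= 1 -> 0 <= B ->
  dbound N setT B f -> `|T (sc c r f)| <= C * (r ^- N * B).
Proof.
have [A [C [N [C0 hC]]]] := ed_bd hT; exists N, C; split=> // f B r sf r01 B0 hB.
apply: hC; first exact: smooth_sc.
by apply: dbound_le (dbound_sc c sf r01 B0 hB).
Qed.

Context (pointwise : forall f, sm f -> supp_in (-1) 1 f ->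
  exists K, forall r, 0 < r <= 1 -> `|T (sc c r f)| <= K * r ^+ b).

(* One step of the gliding hump: if no uniform bound holds, every small ball of
   test functions contains a smaller one on which some dilate exceeds k. *)
Lemma hump_step N0 (N0P : exists C, 0 <= C /\ forall f B r, sm f -> 0 < r <= 1 -> 0 <= B ->
    dbound N0 setT B f -> `|T (sc c r f)| <= C * (r ^- N0 * B)) :
  ~ scale_bounded T c b ->
  forall k S d, sm S -> supp_in (-1) 1 S -> 0 < d ->
  exists S' d', [/\ sm S', supp_in (-1) 1 S', 0 < d' <= d / 2,
    dbound (N0 + k) setT (d / 2) (fun y => S' y - S y) &
    exists2 r, 0 < r <= 1 & forall F, sm F -> supp_in (-1) 1 F ->
      dbound N0 setT d' (fun y => F y - S' y) -> k%:R * r ^+ b < `|T (sc c r F)|].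
Proof.
move=> nb k S d sS pS d0; have [C [C0 hC]] := N0P.
have [psi [r [spsi ppsi dpsi r01 big]]] : exists psi r, [/\ sm psi, supp_in (-1) 1 psi,
    dbound (N0 + k) setT (d / 2) psi, 0 < r <= 1 &
    2 * k.+1%:R * r ^+ b < `|T (sc c r psi)|].
  (* A function violating the bound with this constant, rescaled to size d / 2, exceeds 2 (k + 1) r
     ^ b. *)
  apply: contra_notP nb => hn; exists (N0 + k)%N, (4 * k.+1%:R / d).
  split=> [|f B r sf pf hB r01]; first by rewrite divr_ge0 ?mulr_ge0 ?(ltW d0).
  have B0 : 0 <= B by apply: (@dbound_ge0 _ (N0 + k) setT B f 0).
  have r0 : 0 < r by have /andP[] := r01.
  have rb : 0 <= r ^+ b by rewrite exprn_ge0// ltW.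
  rewrite leNgt; apply/negP => hlt; apply: hn.
  have {}B0 : 0 < B.
    rewrite lt_neqAle B0 andbT eq_sym; apply/eqP => B00; move: hlt.
    have -> : sc c r f = fun=> 0.
      apply/funext => y; rewrite /sc; apply/eqP; rewrite -normr_le0.
      by have /dboundP hf := hB; rewrite -B00; exact: (hf 0%N).
    by rewrite ed0// normr0 B00 mulr0 ltxx.
  exists (fun y => (d / (2 * B)) * f y), r.
  have dB : 0 < d / (2 * B) by rewrite divr_gt0// mulr_gt0.
  split=> //.
  - exact: smooth_scale.
  - by move=> y h; apply: pf; apply: contraNN h => /eqP ->; rewrite mulr0.
  - have := dbound_scale (d / (2 * B)) sf hB; rewrite gtr0_norm//.
    by have -> : d / (2 * B) * B = d / 2 by field; rewrite gt_eqF.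
  - have -> : sc c r (fun y => d / (2 * B) * f y) = fun y => d / (2 * B) * sc c r f y by [].
    rewrite ed_scale//; last exact: smooth_sc.
    rewrite normrM gtr0_norm// -ltr_pdivrMl//.
    apply: le_lt_trans hlt; rewrite le_eqVlt; apply/orP; left; apply/eqP.
    by field; rewrite !gt_eqF.
have r0 : 0 < r by have /andP[] := r01.
have rb : 0 < r ^+ b by rewrite exprn_gt0.
have rN : 0 < r ^- N0 by rewrite invr_gt0 exprn_gt0.
pose D := C * r ^- N0 + 1.
have D0 : 0 < D by rewrite ltr_wpDl// mulr_ge0// ltW.
(* Within this radius the value on the dilation by r moves by at most r ^ b, which is the difference
   between the levels k + 1 and k. *)
pose d' := Num.min (d / 2) (r ^+ b / D).
have d'0 : 0 < d' by rewrite lt_min !divr_gt0.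
have d'b : C * (r ^- N0 * d') <= r ^+ b.
  rewrite mulrA; apply: (@le_trans _ _ (D * d')).
    by rewrite ler_wpM2r ?(ltW d'0)// lerDl.
  by rewrite mulrC -ler_pdivlMr// ge_min lexx orbT.
have [S' [sS' pS' hS' hbig]] : exists S', [/\ sm S', supp_in (-1) 1 S',
    dbound (N0 + k) setT (d / 2) (fun y => S' y - S y) &
    k.+1%:R * r ^+ b < `|T (sc c r S')|].
  (* If S is not large itself, then S + psi is, since psi contributes twice the required level. *)
  have [hS|hS] := ltP (k.+1%:R * r ^+ b) `|T (sc c r S)|.
    exists S; split=> //; apply/dboundP => j y _ _.
    by rewrite dn_sub// subrr normr0 divr_ge0// ltW.
  exists (fun y => S y + psi y); split; first exact: smooth_add.
  - move=> y; have [->|/pS //] := eqVneq (S y) 0; rewrite add0r; exact: ppsi.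
  - by have -> : (fun y => S y + psi y - S y) = psi by apply/funext => y; ring.
  - have -> : sc c r (fun y => S y + psi y) = fun y => sc c r S y + sc c r psi y by [].
    rewrite ed_add//; [|exact: smooth_sc..].
    have := lerB_normD (T (sc c r psi)) (T (sc c r S)).
    rewrite [T (sc c r psi) + _]addrC.
    by move: hS big; rewrite -mulrA; clear; lra.
exists S', d'; split=> //; first by rewrite d'0 ge_min lexx.
exists r => // F sF pF hF.
have := hC _ _ _ (smooth_sub sF sS') r01 (ltW d'0) hF.
have -> : sc c r (fun y => F y - S' y) = fun y => sc c r F y - sc c r S' y by [].
rewrite ed_sub//; [|exact: smooth_sc..].
move=> /le_trans/(_ d'b) hd.
have := lerB_dist (T (sc c r S')) (T (sc c r F)); rewrite distrC.
move: hbig hd; rewrite -natr1 mulrDl mul1r; clear; lra.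
Qed.

(** The uniform boundedness principle in the Fréchet space of test functions supported in [-1, 1].
    The limit F of the humps stays in every chosen ball, so for each m some dilate of F exceeds m r
    ^ b, against [pointwise]. *)
Theorem uniform_bound : scale_bounded T c b.
Proof.
apply: contrapT => nb; have [N0 N0P] := ed_sc_bound.
have step := hump_step N0P nb.
pose st := {p : (R -> R) * R | [/\ sm p.1, supp_in (-1) 1 p.1 & 0 < p.2]}.
pose good k (s s' : st) := [/\ (sval s').2 <= (sval s).2 / 2,
  dbound (N0 + k) setT ((sval s).2 / 2) (fun y => (sval s').1 y - (sval s).1 y) &
  exists2 r, 0 < r <= 1 & forall F, sm F -> supp_in (-1) 1 F ->
    dbound N0 setT (sval s').2 (fun y => F y - (sval s').1 y) ->
    k%:R * r ^+ b < `|T (sc c r F)|].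
have next k (s : st) : exists s' : st, good k s s'.
  case: s => -[S d] [/= sS pS d0].
  have [S' [d' [sS' pS' /andP[d'0 d'd] hS' hr]]] := step k S d sS pS d0.
  exists (exist _ (S', d') (And3 sS' pS' d'0)); split => //.
pose nx k s := sval (cid (next k s)).
have nxP k s : good k s (nx k s) by rewrite /nx; case: cid.
have s0P : [/\ sm (fun=> 0 : R), supp_in (-1) 1 (fun=> 0 : R) & (0 : R) < 1].
  by split=> // [|y]; [exact: smooth_cst|rewrite eqxx].
pose s0 : st := exist _ ((fun=> 0), 1) s0P.
pose sq := fix sq k : st := if k is k'.+1 then nx k' (sq k') else s0.
pose S k := (sval (sq k)).1; pose d k := (sval (sq k)).2.
have sS k : sm (S k) by rewrite /S; case: (sq k) => p [].
have pS k : supp_in (-1) 1 (S k) by rewrite /S; case: (sq k) => p [].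
have d0 k : 0 < d k by rewrite /d; case: (sq k) => p [].
have dS k : d k.+1 <= d k / 2 by have [] := nxP k (sq k).
have dl k : d k <= 2^-1 ^+ k.
  elim: k => [|k IH]; first by rewrite expr0.
  apply: le_trans (dS k) _; rewrite exprS mulrC; apply: ler_wpM2l => //.
(* The step at stage i has size d i / 2 <= d i - d (i + 1), so the bounds telescope. *)
have SS k m : (k <= m)%N -> dbound (N0 + k) setT (d k - d m) (fun y => S m y - S k y).
  move=> /subnK <-; elim: (m - k)%N => [|i IH].
    apply/dboundP => j y _ _; by rewrite dn_sub// !subrr normr0.
  have [_ h _] := nxP (i + k)%N (sq (i + k)%N).
  have -> : (fun y => S (i.+1 + k)%N y - S k y)
      = fun y => (S (i.+1 + k)%N y - S (i + k)%N y) + (S (i + k)%N y - S k y).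
    by apply/funext => y; ring.
  have h' : dbound (N0 + k) setT (d (i + k)%N / 2) (fun y => S (i.+1 + k)%N y - S (i + k)%N y).
    by apply: dbound_le h => //; rewrite leq_add2l leq_addl.
  apply: dbound_le (dbound_add _ _ h' IH) => //; try exact: smooth_sub.
  by have := dS (i + k)%N; rewrite addSn; clear; lra.
have [F sF hF] : exists2 F, sm F & forall k, dbound (N0 + k) setT (d k) (fun y => F y - S k y).
  apply: smooth_limit => // [k m km|e e0].
    by apply: dbound_le (SS k m km) => //; have := d0 m; clear; lra.
  have [k hk] := geo_small half01 e0.
  by exists k => m /hk; apply: le_trans.
have pF : supp_in (-1) 1 F.
  move=> y; apply: contraNT => /negP hy; rewrite -normr_le0.
  apply/ler_addgt0Pr => e e0; rewrite add0r.
  have [k hk] := geo_small half01 e0.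
  have [h _] : dbound 0 setT (d k) (fun y => F y - S k y).
    by apply: dbound_le (hF k).
  have := h y I; rewrite (supp_in_eq0 (pS k) hy) subr0 => /le_trans; apply.
  by apply: le_trans (dl k) _; exact: hk.
have [K hK] := pointwise sF pF.
have [m hm] : exists m : nat, K <= m%:R.
  exists (Num.bound `|K|); apply: le_trans (ler_norm K) _; apply: ltW; exact: archi_boundP.
have [_ _ [r r01 hr]] := nxP m (sq m).
have : m%:R * r ^+ b < `|T (sc c r F)|.
  by apply: hr => //; apply: dbound_le (hF m.+1) => //; exact: leq_addr.
apply/negP; rewrite -leNgt; apply: le_trans (hK r r01) _.
by rewrite ler_wpM2r// exprn_ge0//; have /andP[/ltW] := r01.
Qed.

End BanachSteinhaus.

(** * Test functions with algebraic decay *)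

Section DyadicTails.
Context {R : realType}.
Implicit Types (f g : R -> R) (n k m j N : nat) (x y z h e c B r d q : R) (T : (R -> R) -> R).

(** Decay by a factor q per dyadic scale, each derivative gaining one more power of |z|. Recording q
    instead of an exponent turns sums over annuli into geometric series. *)
Definition ddecay N q B (theta : R -> R) := forall j k z, (k <= N)%N ->
  2 ^+ j <= `|z| -> `|dn k theta z| * 2 ^+ (j * k) <= B * q ^+ j.

(** Vanishes for |z| <= 2 ^ m and equals theta for |z| >= 2 ^ (m + 1). *)
Definition tail m (theta : R -> R) : R -> R := fun z => theta z * (1 - chi (z / 2 ^+ m.+1)).

Lemma pow2SS m : 2 ^+ m.+2 = 4 * 2 ^+ m :> R.
Proof. by rewrite !exprS; ring. Qed.

Lemma div_pow2S m z : z / 2 ^+ m.+1 = 2 * (z / 2 ^+ m.+2).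
Proof.
have : 2 ^+ m.+1 != 0 :> R by rewrite expf_neq0// pnatr_eq0.
rewrite (exprS 2 m.+1); move: (2 ^+ m.+1) => p p0; by field.
Qed.

Lemma smooth_scaled_chi a : sm (fun z : R => chi (a * z)).
Proof.
have -> : (fun z : R => chi (a * z)) = (fun z => chi (a * z + 0)).
  by apply/funext => z; rewrite addr0.
by apply: smooth_comp_affine; exact: smooth_chi.
Qed.

Lemma smooth_tail m f : sm f -> sm (tail m f).
Proof.
move=> sf; apply: smooth_mul => //; apply: smooth_sub; first exact: smooth_cst.
have -> : (fun z : R => chi (z / 2 ^+ m.+1)) = (fun z => chi ((2 ^+ m.+1)^-1 * z)).
  by apply/funext => z; rewrite mulrC.
exact: smooth_scaled_chi.
Qed.

Lemma dbound_chi N a : exists2 M, 0 <= M & dbound N setT M (fun z : R => chi (a * z)).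
Proof.
have [M M0 /dboundP hM] := dbound_supp N (@smooth_chi R) (@supp_chi R).
exists ((1 + `|a|) ^+ N * M); first by rewrite mulr_ge0// exprn_ge0// addr_ge0.
apply/dboundP => k y kN _.
have -> : (fun z : R => chi (a * z)) = (fun z => chi (a * z + 0)).
  by apply/funext => z; rewrite addr0.
rewrite dn_comp_affine; last exact: smooth_chi.
rewrite normrM; apply: ler_pM => //; last exact: hM.
have a1 : 1 <= 1 + `|a| by rewrite lerDl.
rewrite normrX; apply: le_trans (ler_weXn2l a1 kN).
by apply: lerXn2r; rewrite ?nnegrE ?addr_ge0// lerDr.
Qed.

Lemma dilate_decay N q B m f : sm f -> 0 <= q -> 0 <= B -> ddecay N q B f ->
  dbound N [set w | 4^-1 <= `|w|] (4 ^+ N * (B * q ^+ m)) (fun w => f (2 ^+ m.+2 * w)).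
Proof.
move=> sf q0 B0 hd; apply/dboundP => k w kN /= hw.
have -> : (fun w => f (2 ^+ m.+2 * w)) = (fun w => f (2 ^+ m.+2 * w + 0)).
  by apply/funext => z; rewrite addr0.
rewrite dn_comp_affine// addr0 normrM normrX ger0_norm ?exprn_ge0//.
have hz : 2 ^+ m <= `|2 ^+ m.+2 * w|.
  rewrite normrM ger0_norm ?exprn_ge0// !exprS mulrA mulrAC ler_peMl ?exprn_ge0//.
  by move: hw; clear; lra.
have := hd m k _ kN hz; set D := `|dn k f _|; move=> hD.
have -> : (2 ^+ m.+2) ^+ k * D = 4 ^+ k * (D * 2 ^+ (m * k)) :> R.
  by rewrite pow2SS exprMn -exprM; ring.
apply: ler_pM; rewrite ?exprn_ge0 ?mulr_ge0//.
  exact: normr_ge0.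
by apply: ler_weXn2l => //; rewrite ler1n.
Qed.

(** Since g vanishes near every point of the open ball of radius 1/4, the size of f there is
    irrelevant; this is where decaying functions are not small. *)
Lemma dbound_annulus N B B' f g : sm f -> sm g -> 0 <= B -> 0 <= B' ->
  (forall w, `|w| < 4^-1 -> g w = 0) ->
  dbound N [set w | 4^-1 <= `|w|] B f -> dbound N setT B' g ->
  dbound N setT (2 ^+ N * (B * B')) (fun w => f w * g w).
Proof.
move=> sf sg B0 B'0 g0 hf hg.
have hg' : dbound N [set w | 4^-1 <= `|w|] B' g by apply: dbound_le hg.
have /dboundP h := dbound_mul sf sg hf hg'; apply/dboundP => k w kN _.
have [hw|hw] := leP 4^-1 `|w|; first exact: h.
have e0 : 0 < 4^-1 - `|w| by rewrite subr_gt0.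
rewrite (@dn_eq_near _ k _ (fun=> 0) w (4^-1 - `|w|)) ?dn0 ?normr0//.
- by rewrite !mulr_ge0 ?exprn_ge0.
- exact: smooth_mul.
- exact: smooth_cst.
- move=> y yw; rewrite g0 ?mulr0//.
  have -> : y = w + (y - w) by ring.
  by apply: le_lt_trans (ler_normD _ _) _; rewrite addrC -ltrBrDr.
Qed.

(** Brought to unit size, the annulus between two successive tails is a function in [-1, 1] of norm
    O(B q ^ m), dilated by 2 ^ (m + 2) r. The scale bound makes its contribution r ^ b B (2 ^ b q) ^
    m up to a constant, and these sum as a geometric series. *)
Theorem dyadic_tail T c b q : edist T -> scale_bounded T c b -> 0 <= q -> 2 ^+ b * q < 1 -> exists N K, 0 <= K /\
  forall f B m r, sm f -> 0 <= B -> ddecay N q B f -> 0 < r <= 1 ->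
    `|T (sc c r (tail m f))| <= K * r ^+ b * B * (2 ^+ b * q) ^+ m.
Proof.
move=> hT sbT q0 s1; have [N1 [C1 [C10 h1]]] := sbT; have [A [C2 [N2 [C20 h2]]]] := ed_bd hT.
pose N := maxn N1 N2; pose s := 2 ^+ b * q.
have s0 : 0 <= s by rewrite mulr_ge0// exprn_ge0.
pose ann (w : R) := chi (1 * w) - chi (2 * w); pose cut (w : R) := 1 - chi (2 * w).
have sann : sm ann by apply: smooth_sub; exact: smooth_scaled_chi.
have scut : sm cut by apply: smooth_sub; [exact: smooth_cst|exact: smooth_scaled_chi].
have [Ma Ma0 hMa] := dbound_chi N 1; have [Mb Mb0 hMb] := dbound_chi N 2.
have ban : dbound N setT (Ma + Mb) ann by apply: dbound_sub => //; exact: smooth_scaled_chi.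
have bcu : dbound N setT (1 + Mb) cut.
  apply: dbound_sub => //; [exact: smooth_cst|exact: smooth_scaled_chi|].
  by apply/dboundP => -[|k] y _ _; rewrite ?dn_cst ?normr0 ?normr1.
have h24 (w : R) : `|w| < 4^-1 -> `|2 * w| <= 2^-1.
  by rewrite normrM ger0_norm//; clear; lra.
have an0 w : `|w| < 4^-1 -> ann w = 0.
  move=> hw; rewrite /ann mul1r !chi1 ?subrr//; first exact: h24.
  by move: hw; clear; lra.
have cu0 w : `|w| < 4^-1 -> cut w = 0.
  by move=> hw; rewrite /cut chi1 ?subrr//; exact: h24.
pose E := 2 ^+ N * 4 ^+ N : R.
have E0 : 0 <= E by rewrite mulr_ge0// exprn_ge0.
pose K1 := C2 * E * (1 + Mb); pose K2 := C1 * E * (Ma + Mb) * 4 ^+ b.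
have K10 : 0 <= K1 by rewrite !mulr_ge0// addr_ge0.
have K20 : 0 <= K2 by rewrite !mulr_ge0// ?addr_ge0// exprn_ge0.
(* Chosen so that K1 * 4 ^ b <= K starts the summation and K2 + K s <= K continues it; 4 ^ b comes
   from 2 ^ (m + 2) = 4 * 2 ^ m. *)
pose K := (K1 * 4 ^+ b + K2) / (1 - s).
have s1' : 0 < 1 - s by rewrite subr_gt0.
have K0 : 0 <= K by rewrite divr_ge0 ?(ltW s1')// addr_ge0// mulr_ge0// exprn_ge0.
have Ks : K2 + K * s <= K.
  rewrite -lerBrDr -[K in K - _]mulr1 -mulrBr /K divfK ?gt_eqF//.
  by rewrite lerDr mulr_ge0// exprn_ge0.
have K1K : K1 * 4 ^+ b <= K.
  rewrite /K ler_pdivlMr//; apply: le_trans (_ : K1 * 4 ^+ b <= _).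
    have h4 : 0 <= K1 * 4 ^+ b by rewrite mulr_ge0 ?exprn_ge0.
    by apply: ler_piMr => //; rewrite gerBl.
  by rewrite lerDl.
exists N, K; split=> // f B m r sf B0 hd /andP[r0 r1].
have r0' := ltW r0.
have scE m' g : sc c r (fun z => g (z / 2 ^+ m'.+2)) = sc c (2 ^+ m'.+2 * r) g.
  by apply/funext => y; rewrite /sc; congr g; move: (2 ^+ m'.+2) => p; rewrite invfM mulrA mulrAC.
have tw (m' : nat) (z : R) : 2 ^+ m'.+2 * (z / 2 ^+ m'.+2) = z.
  by rewrite mulrC divfK// expf_neq0.
have hfar rho g D : 1 <= rho -> sm g -> dbound N setT D g -> `|T (sc c rho g)| <= C2 * D.
  move=> hrho sg /dboundP hD; apply: h2; first exact: smooth_sc.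
  apply/dboundP => k y kN _; rewrite dn_sc// normrM -[leRHS]mul1r.
  have rho0 : 0 < rho by apply: lt_le_trans hrho.
  apply: ler_pM => //; last by apply: hD => //; apply: leq_trans kN _; exact: leq_maxr.
  rewrite ger0_norm ?invr_ge0 ?exprn_ge0 ?(ltW rho0)//.
  by rewrite invf_le1 ?exprn_gt0// exprn_ege1.
(* A dilation by a factor at least 1 does not increase derivatives, so the order of T controls the
   entire tail at once. *)
have far m' : 1 <= 2 ^+ m'.+2 * r -> `|T (sc c r (tail m' f))| <= K * r ^+ b * B * s ^+ m'.
  move=> hr; pose Q := fun w => f (2 ^+ m'.+2 * w) * cut w.
  have sQ : sm Q.
    apply: smooth_mul => //.
    have -> : (fun w => f (2 ^+ m'.+2 * w)) = (fun w => f (2 ^+ m'.+2 * w + 0)).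
      by apply/funext => z; rewrite addr0.
    exact: smooth_comp_affine.
  have -> : tail m' f = fun z => Q (z / 2 ^+ m'.+2).
    apply/funext => z; rewrite /Q tw /tail /cut; congr (_ * (1 - chi _)).
    exact: div_pow2S.
  have bQ : dbound N setT (E * (B * q ^+ m') * (1 + Mb)) Q.
    have -> : E * (B * q ^+ m') * (1 + Mb) = 2 ^+ N * (4 ^+ N * (B * q ^+ m') * (1 + Mb)).
      by rewrite /E; ring.
    apply: dbound_annulus => //.
    - have -> : (fun w => f (2 ^+ m'.+2 * w)) = (fun w => f (2 ^+ m'.+2 * w + 0)).
        by apply/funext => z; rewrite addr0.
      exact: smooth_comp_affine.
    - by rewrite !mulr_ge0 ?exprn_ge0.
    - by rewrite addr_ge0.
    - exact: dilate_decay.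
  rewrite scE; apply: le_trans (hfar _ _ _ hr sQ bQ) _.
  have -> : C2 * (E * (B * q ^+ m') * (1 + Mb)) = K1 * (B * q ^+ m') by rewrite /K1; ring.
  have -> : K * r ^+ b * B * s ^+ m' = K * (r ^+ b * (2 ^+ b) ^+ m') * (B * q ^+ m').
    by rewrite /s exprMn; ring.
  rewrite ler_wpM2r ?mulr_ge0 ?exprn_ge0//.
  apply: le_trans (_ : K1 * 4 ^+ b * (r ^+ b * (2 ^+ b) ^+ m') <= _); last first.
    by rewrite ler_wpM2r// mulr_ge0 ?exprn_ge0.
  have -> : K1 * 4 ^+ b * (r ^+ b * (2 ^+ b) ^+ m') = K1 * (2 ^+ m'.+2 * r) ^+ b.
    by rewrite pow2SS !exprMn -!exprM mulnC; ring.
  by rewrite ler_peMr// exprn_ege1.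
(* One annulus, at a scale where the scale bound applies. *)
have near m' : 2 ^+ m'.+2 * r <= 1 ->
    `|T (sc c r (tail m' f)) - T (sc c r (tail m'.+1 f))| <= K2 * (r ^+ b * B * s ^+ m').
  move=> hr; pose P := fun w => f (2 ^+ m'.+2 * w) * ann w.
  have sf' : sm (fun w => f (2 ^+ m'.+2 * w)).
    have -> : (fun w => f (2 ^+ m'.+2 * w)) = (fun w => f (2 ^+ m'.+2 * w + 0)).
      by apply/funext => z; rewrite addr0.
    exact: smooth_comp_affine.
  have sP : sm P by exact: smooth_mul.
  rewrite -ed_sub//; [|by apply: smooth_sc; exact: smooth_tail..].
  have -> : (fun y => sc c r (tail m' f) y - sc c r (tail m'.+1 f) y)
      = sc c (2 ^+ m'.+2 * r) P.
    rewrite -scE; apply/funext => y; rewrite /sc /P tw /tail /ann mul1r -mulrBr.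
    congr (_ * _); rewrite opprB addrC addrA subrK; congr (chi _ - chi _).
    exact: div_pow2S.
  have pP : supp_in (-1) 1 P.
    move=> w; apply: contraNT; rewrite -ler_norml -ltNge => hw.
    rewrite /P /ann mul1r !chi0 ?subrr ?mulr0//; last exact: ltW.
    by rewrite normrM ger0_norm//; move: hw; clear; lra.
  have bP : dbound N setT (2 ^+ N * (4 ^+ N * (B * q ^+ m') * (Ma + Mb))) P.
    apply: dbound_annulus => //.
    - by rewrite !mulr_ge0 ?exprn_ge0.
    - by rewrite addr_ge0.
    - exact: dilate_decay.
  apply: le_trans (h1 P _ _ sP pP _ _) _.
  - by apply: dbound_le bP => //; exact: leq_maxl.
  - by rewrite mulr_gt0 ?exprn_gt0.
  rewrite le_eqVlt; apply/orP; left; apply/eqP.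
  by rewrite /K2 /s /E pow2SS !exprMn -!exprM [(m' * b)%N]mulnC; ring.
have [i hi] : exists i, 1 <= 2 ^+ (m.+2 + i) * r.
  have [i hi] := geo_small half01 r0; exists i.
  have /hi : (i <= m.+2 + i)%N by exact: leq_addl.
  by rewrite exprVn -ler_pdivrMl ?exprn_gt0// mulr1.
(* Induction on the number of scales that remain before 2 ^ (m + 2) r reaches 1. *)
elim: i m hi => [|i IH] m; first by rewrite addn0; exact: far.
rewrite addnS -addSn => /IH h.
have [hr|/ltW hr] := leP 1 (2 ^+ m.+2 * r); first exact: far.
have -> : T (sc c r (tail m f)) = (T (sc c r (tail m f)) - T (sc c r (tail m.+1 f)))
  + T (sc c r (tail m.+1 f)) by ring.
apply: le_trans (ler_normD _ _) _; apply: le_trans (lerD (near m hr) h) _.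
rewrite -/s exprS.
have -> : K2 * (r ^+ b * B * s ^+ m) + K * r ^+ b * B * (s * s ^+ m)
  = (K2 + K * s) * (r ^+ b * B * s ^+ m) by ring.
have -> : K * r ^+ b * B * s ^+ m = K * (r ^+ b * B * s ^+ m) by ring.
by rewrite ler_wpM2r// !mulr_ge0 ?exprn_ge0.
Qed.

End DyadicTails.

(** * The heat extension of a functional *)
Section GaussianKernel.
Context {R : realType}.
Implicit Types (f g : R -> R) (n k m j N : nat) (x y z h e c B r d q t u : R) (T : (R -> R) -> R).

Lemma mvt_local f (df : R -> R) (M x y : R) :
  (forall z, Num.min x y <= z <= Num.max x y -> is_derive z 1 f (df z)) ->
  (forall z, Num.min x y <= z <= Num.max x y -> `|df z| <= M) ->
  `|f y - f x| <= M * `|y - x|.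
Proof.
wlog xy : x y / x <= y.
  move=> W hd hM; case: (leP x y) => [|/ltW] xy; first exact: W.
  by rewrite distrC [`|y - x|]distrC; apply: W => //; rewrite minC maxC.
rewrite min_l// max_r// => hd hM.
have hc : {within `[x, y], continuous f}.
  apply: derivable_within_continuous => z; rewrite in_itv /= => zxy.
  by have := hd z zxy => ?; exact: ex_derive.
have hd' z : z \in `]x, y[ -> is_derive z 1 f (df z).
  by rewrite in_itv /= => /andP[/ltW h1 /ltW h2]; apply: hd; rewrite h1 h2.
have [c cxy ->] := @MVT_segment R f df x y xy hd' hc.
rewrite normrM ler_wpM2r ?normr_ge0//; apply: hM.
by move: cxy; rewrite in_itv.
Qed.

Lemma taylor2 f (g k : R -> R) (M x h : R) :
  (forall z, `|z - x| <= `|h| -> is_derive z 1 f (g z)) ->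
  (forall z, `|z - x| <= `|h| -> is_derive z 1 g (k z)) ->
  (forall z, `|z - x| <= `|h| -> `|k z| <= M) ->
  `|f (x + h) - f x - h * g x| <= M * h ^+ 2.
Proof.
move=> hf hg hk.
have btw u v z : `|u - x| <= `|h| -> `|v - x| <= `|h| ->
    Num.min u v <= z <= Num.max u v -> `|z - x| <= `|h|.
  rewrite !ler_norml ge_min le_max; move: (`|h|) => H.
  by move=> /andP[? ?] /andP[? ?] /andP[/orP[] ? /orP[] ?]; apply/andP; split; lra.
have xx : `|x - x| <= `|h| by rewrite subrr normr0.
have xh : `|x + h - x| <= `|h| by rewrite addrC addKr.
have hd z : `|z - x| <= `|h| ->
    is_derive z 1 (fun y => f y - y * g x) (g z - g x).
  move=> /hf hz; have h2 : is_derive z 1 (fun y : R => y * g x) (g x).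
    have -> : (fun y : R => y * g x) = (fun y => g x * y + 0).
      by apply/funext => y; ring.
    exact: is_derive_affine.
  exact: is_deriveB.
have hb z : `|z - x| <= `|h| -> `|g z - g x| <= M * `|h|.
  move=> zx; have M0 : 0 <= M by apply: le_trans (hk x xx).
  apply: le_trans (@mvt_local g k M x z _ _) _.
  - by move=> w /(btw _ _ _ xx zx); exact: hg.
  - by move=> w /(btw _ _ _ xx zx); exact: hk.
  - by rewrite ler_wpM2l.
have := @mvt_local (fun y => f y - y * g x) (fun z => g z - g x) (M * `|h|) x (x + h).
move=> /(_ (fun z hz => hd z (btw _ _ _ xx xh hz)) (fun z hz => hb z (btw _ _ _ xx xh hz))).
rewrite [x + h - x]addrC addKr -mulrA -expr2 real_normK ?num_real//.
by rewrite (_ : f (x + h) - (x + h) * g x - (f x - x * g x) = f (x + h) - f x - h * g x)//; ring.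
Qed.

(** Differentiation under T. The order of T is not known in advance, so the remainder has to be O(h
    ^ 2) in every C^N norm. *)
Lemma ed_is_derive T (F : R -> R -> R) (F' : R -> R) s : edist T ->
  (exists2 d, 0 < d & forall v, `|v - s| < d -> sm (F v)) -> sm F' ->
  (forall N, exists C d, 0 < d /\ forall h, `|h| < d ->
    dbound N setT (C * h ^+ 2) (fun y => F (s + h) y - F s y - h * F' y)) ->
  is_derive s 1 (fun v => T (F v)) (T F').
Proof.
move=> hT [d1 d10 sF] sF' hF; have [A [C [N [C0 hC]]]] := ed_bd hT.
have [D [d [d0 hD]]] := hF N; apply/is_derive_eps => e e0.
pose K := C * `|D| + 1; have K0 : 0 < K by rewrite ltr_wpDl// mulr_ge0.
have ss : sm (F s) by apply: sF; rewrite subrr normr0.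
exists (Num.min (Num.min d d1) (e / K)); first by rewrite !lt_min d0 d10 divr_gt0.
move=> h; rewrite !lt_min => /andP[/andP[hd hd1] he].
have sh : sm (F (s + h)) by apply: sF; rewrite addrC addKr.
have sb : sm (fun y => h * F' y) by exact: smooth_scale.
rewrite -ed_scale// -!ed_sub//; last exact: smooth_sub.
apply: le_trans (hC _ (D * h ^+ 2) _ _) _.
- by apply: smooth_sub => //; exact: smooth_sub.
- exact: dbound_le (hD h hd).
apply: (@le_trans _ _ (K * `|h| * `|h|)).
  rewrite -mulrA -expr2 real_normK ?num_real// mulrA ler_wpM2r ?sqr_ge0//.
  by apply: le_trans (_ : C * `|D| <= _); [rewrite ler_wpM2l// ler_norm|rewrite lerDl].
by rewrite ler_wpM2r// mulrC -ler_pdivlMr// ltW.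
Qed.

Definition gam (z : R) : R := expR (- z ^+ 2).

Lemma is_derive_gam z : is_derive z 1 gam (-2 * (z * gam z)).
Proof.
have h : is_derive z 1 (fun y : R => - y ^+ 2) (-2 * z).
  have -> : (fun y : R => - y ^+ 2) = (fun y => - (y * y)) by apply/funext => y; rewrite expr2.
  have hi := is_derive_id z (1 : R).
  have := is_deriveN (is_deriveM hi hi); rewrite /GRing.scale /= => h.
  by apply: is_derive_eq h _; ring.
have := @is_derive1_comp _ expR (fun y => - y ^+ 2) z _ _ (is_derive_expR _) h.
by move=> h'; apply: is_derive_eq h' _; rewrite /gam; ring.
Qed.

Lemma smooth_gam : sm gam.
Proof.
apply: smooth_comp; first exact: smooth_expR.
have -> : (fun z : R => - z ^+ 2) = (fun z => - (z * z)) by apply/funext => y; rewrite expr2.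
by apply: smooth_opp; apply: smooth_mul; exact: smooth_id.
Qed.

Lemma dn_mulX f k x : sm f ->
  dn k.+1 (fun y => y * f y) x = x * dn k.+1 f x + k.+1%:R * dn k f x.
Proof.
move=> sf; elim: k x => [|k IH] x.
  rewrite dnS /= der_mul; [|by move=> y; apply: smooth_derivable => //; exact: smooth_id..].
  have -> : der (fun y : R => y) = fun=> 1.
    by apply: is_derive_der => y; exact: is_derive_id.
  by rewrite /=; ring.
rewrite dnS; have e : dn k.+1 (fun y => y * f y)
    = fun x => k.+1%:R * dn k f x + x * dn k.+1 f x.
  by apply/funext => y; rewrite IH addrC.
rewrite e der_lin; [|by move=> y; apply: smooth_derivable; exact: smooth_dn|by move=> y; apply: smooth_derivable; apply: smooth_mul; [exact: smooth_id|exact: smooth_dn]].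
rewrite der_mul; [|by move=> y; apply: smooth_derivable; exact: smooth_id|by move=> y; apply: smooth_derivable; exact: smooth_dn].
have -> : der (fun y : R => y) = fun=> 1.
  by apply: is_derive_der => y; exact: is_derive_id.
by rewrite -!dnS /= -[in RHS]natr1; ring.
Qed.

(** The recursion of the Hermite functions, from gam' = -2 z gam. It is the source of the heat
    equation in [is_derive_gk_t]. *)
Lemma dn_gam k z : dn k.+2 gam z = -2 * (z * dn k.+1 gam z + k.+1%:R * dn k gam z).
Proof.
rewrite [LHS](_ : _ = dn k.+1 (der gam) z); last by rewrite -dSn.
rewrite (is_derive_der is_derive_gam) dn_scale; last first.
  by apply: smooth_mul; [exact: smooth_id|exact: smooth_gam].
by rewrite dn_mulX//; exact: smooth_gam.
Qed.

Lemma gam_poly k : exists2 C, 0 <= C &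
  forall z, `|dn k gam z| <= C * (1 + `|z|) ^+ k * gam z.
Proof.
have gp z : 0 < gam z by exact: expR_gt0.
suff [] : (exists2 C, 0 <= C & forall z, `|dn k gam z| <= C * (1 + `|z|) ^+ k * gam z) /\
  (exists2 C, 0 <= C & forall z, `|dn k.+1 gam z| <= C * (1 + `|z|) ^+ k.+1 * gam z) by [].
have w z : 1 <= 1 + `|z| by rewrite lerDl.
have w0 z : 0 <= 1 + `|z| by rewrite addr_ge0.
elim: k => [|k [[C C0 hC] [D D0 hD]]]; split.
- by exists 1 => // z; rewrite expr0 !mul1r ger0_norm// ltW.
- exists 2 => // z; rewrite [dn 1 gam z](_ : _ = -2 * (z * gam z)); last first.
    by rewrite /= (is_derive_der is_derive_gam).
  have -> : `|-2 * (z * gam z)| = 2 * `|z| * gam z.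
    by rewrite !normrM (ger0_norm (ltW (gp z))) normrN (@ger0_norm _ 2)//; ring.
  rewrite expr1.
  by rewrite ler_wpM2r ?(ltW (gp z))// ler_wpM2l// lerDr.
- by exists D.
- exists (2 * (D + k.+1%:R * C)).
    by rewrite mulr_ge0// addr_ge0// mulr_ge0.
  move=> z; rewrite dn_gam normrM normrN (@ger0_norm _ 2)//.
  set W := 1 + `|z|; have W1 : 1 <= W := w z; have W0 : 0 <= W := w0 z.
  have -> : 2 * (D + k.+1%:R * C) * W ^+ k.+2 * gam z
      = 2 * (W * (D * W ^+ k.+1 * gam z) + k.+1%:R * (C * W ^+ k.+2 * gam z)).
    by rewrite !exprS; ring.
  rewrite ler_wpM2l//; apply: le_trans (ler_normD _ _) _; apply: lerD.
    by rewrite normrM; apply: ler_pM => //; rewrite /W lerDr.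
  rewrite normrM (@ger0_norm _ k.+1%:R)// ler_wpM2l//; apply: le_trans (hC z) _.
  rewrite ler_wpM2r ?(ltW (gp z))// ler_wpM2l//.
  exact: (ler_weXn2l W1 (leq_trans (leqnSn k) (leqnSn _))).
Qed.

Lemma poly_le_gauss k : exists2 C, 0 <= C &
  forall z, (1 + `|z|) ^+ k <= C * expR (z ^+ 2 / 2).
Proof.
(* From (1 + |z|) ^ 2 <= 2 (1 + z ^ 2) and [expR_ge_pow] at (1 + z ^ 2) / 2. *)
pose C := (4 * k.+1%:R) ^+ k.+1 * expR 2^-1 : R.
exists C; first by rewrite mulr_ge0 ?expR_ge0 ?exprn_ge0 ?mulr_ge0.
move=> z; have w : 1 <= 1 + `|z| by rewrite lerDl.
have h1 : (1 + `|z|) ^+ k <= ((1 + `|z|) ^+ 2) ^+ k.+1.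
  by rewrite -exprM; apply: (ler_weXn2l w); exact: leq_trans (leqnSn k) (leq_pmull _ _).
apply: le_trans h1 _.
have h2 : (1 + `|z|) ^+ 2 <= 4 * k.+1%:R * ((1 + z ^+ 2) / 2 / k.+1%:R).
  have -> : 4 * k.+1%:R * ((1 + z ^+ 2) / 2 / k.+1%:R) = 2 * (1 + z ^+ 2).
    have : k.+1%:R != 0 :> R by rewrite pnatr_eq0.
    by move: (k.+1%:R) => p p0; field.
  rewrite -[z ^+ 2]real_normK ?num_real//; move: (`|z|) => v.
  rewrite -subr_ge0 (_ : _ - _ = (1 - v) ^+ 2) ?sqr_ge0//; ring.
apply: le_trans (_ : (4 * k.+1%:R * ((1 + z ^+ 2) / 2 / k.+1%:R)) ^+ k.+1 <= _).
  by apply: lerXn2r; rewrite ?nnegrE ?sqr_ge0// (le_trans _ h2)// sqr_ge0.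
have -> : C * expR (z ^+ 2 / 2) = (4 * k.+1%:R) ^+ k.+1 * expR ((1 + z ^+ 2) / 2).
  by rewrite /C -[LHS]mulrA -expRD; congr (_ * expR _); field.
rewrite exprMn; apply: ler_wpM2l; first by rewrite exprn_ge0// mulr_ge0.
by apply: expR_ge_pow; rewrite divr_ge0// addr_ge0// sqr_ge0.
Qed.

Lemma gam_bound k : exists2 C, 0 <= C &
  forall z, `|dn k gam z| <= C * expR (- (z ^+ 2 / 2)).
Proof.
have [C C0 hC] := gam_poly k; have [D D0 hD] := poly_le_gauss k.
exists (C * D); first exact: mulr_ge0.
move=> z; apply: le_trans (hC z) _.
have -> : C * D * expR (- (z ^+ 2 / 2)) = C * (D * expR (z ^+ 2 / 2)) * gam z.
  rewrite -[LHS]mulrA -[RHS]mulrA; congr (_ * _); rewrite -[RHS]mulrA /gam -expRD.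
  by congr (_ * expR _); field.
by rewrite ler_wpM2r ?expR_ge0// ler_wpM2l.
Qed.

Lemma gam_bounded k : exists2 C, 0 <= C & forall z, `|dn k gam z| <= C.
Proof.
have [C C0 hC] := gam_bound k; exists C => // z; apply: le_trans (hC z) _.
by rewrite ler_piMr// -expR0 ler_expR oppr_le0 divr_ge0// sqr_ge0.
Qed.

Lemma gam_bounded_upto N : exists2 C, 0 <= C & forall k z, (k <= N)%N -> `|dn k gam z| <= C.
Proof.
elim: N => [|N [C C0 hC]].
  by have [C C0 hC] := gam_bounded 0; exists C => // -[|k] z.
have [D D0 hD] := gam_bounded N.+1; exists (C + D); first exact: addr_ge0.
move=> k z; rewrite leq_eqVlt => /orP[/eqP ->|kN].
  by apply: le_trans (hD z) _; rewrite lerDr.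
by apply: le_trans (hC k z kN) _; rewrite lerDl.
Qed.

End GaussianKernel.

(** * The heat equation with the width as time *)

Section HeatExtension.
Context {R : realType}.
Implicit Types (f g : R -> R) (n k m j N : nat) (x y z h e c B r d q t u : R) (T : (R -> R) -> R).

Lemma dn_remainder f g (k : R -> R) h j : sm f -> sm g -> sm k ->
  dn j (fun y => f y - g y - h * k y) = fun y => dn j f y - dn j g y - h * dn j k y.
Proof.
move=> sf sg sk; rewrite dn_sub; [|exact: smooth_sub|exact: smooth_scale].
by rewrite dn_sub// dn_scale.
Qed.

(** The k-th derivative in u of the Gaussian of width t, whose mass does not depend on t. *)
Definition gk k t (u : R) : R := t ^- k.+1 * dn k gam (u / t).

Definition hk T k x t : R := T (fun y => gk k t (y - x)).

Lemma gk_sc k t x : (fun y => gk k t (y - x)) = (fun y => t ^- k.+1 * sc x t (dn k gam) y).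
Proof. by []. Qed.

Lemma smooth_gk k t x : sm (fun y => gk k t (y - x)).
Proof. by rewrite gk_sc; apply: smooth_scale; apply: smooth_sc; apply: smooth_dn; exact: smooth_gam. Qed.

Lemma dn_gk j k t x : dn j (fun y => gk k t (y - x)) = fun y => gk (j + k) t (y - x).
Proof.
rewrite gk_sc dn_scale; last by apply: smooth_sc; apply: smooth_dn; exact: smooth_gam.
rewrite dn_sc; last by apply: smooth_dn; exact: smooth_gam.
by apply/funext => y; rewrite dn_dn /gk mulrA -invfM -exprD addSn [(k + j)%N]addnC.
Qed.

Lemma is_derive_gk_u k t u : is_derive u 1 (gk k t) (gk k.+1 t u).
Proof.
have := smooth_is_derive 0 u (@smooth_gk k t 0); rewrite !dn_gk add0n add1n subr0.
by have -> : (fun y => gk k t (y - 0)) = gk k t by apply/funext => y; rewrite subr0.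
Qed.

(** The heat equation: t ^ 2 = 4 s for the usual time s, so that d/dt is t / 2 times the second
    space derivative. *)
Lemma is_derive_gk_t k t u : t != 0 ->
  is_derive t 1 (fun v => gk k v u) (t / 2 * gk k.+2 t u).
Proof.
move=> t0.
have h1 := is_derive_exprVn k.+1 t0.
have h2 : is_derive t 1 (fun v => u / v) (- u * t ^- 2).
  have := is_derive_exprVn 1 t0 => h.
  have hu := is_derive_cst u t (1 : R).
  have := is_deriveM hu h; rewrite /GRing.scale /= => h'.
  by apply: is_derive_eq h' _; rewrite mulr0 addr0; ring.
have h3 : is_derive t 1 (fun v => dn k gam (u / v)) (dn k.+1 gam (u / t) * (- u * t ^- 2)).
  exact: (@is_derive1_comp _ (dn k gam) (fun v => u / v) t _ _
    (smooth_is_derive k (u / t) (@smooth_gam R)) h2).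
have := is_deriveM h1 h3; rewrite /GRing.scale /= => h'.
apply: is_derive_eq h' _; rewrite /gk -?dnS dn_gam !exprS expr0.
have tk : t ^+ k != 0 by rewrite expf_neq0.
move: (dn k.+1 gam _) (dn k gam _) (k.+1%:R) => D1 D0 p.
by field; rewrite t0 tk.
Qed.

Lemma gk_bound N : exists2 C, 0 <= C & forall k t u, (k <= N)%N -> 0 < t ->
  `|gk k t u| <= C * t ^- k.+1.
Proof.
have [C C0 hC] := @gam_bounded_upto R N; exists C => // k t u kN t0.
rewrite /gk normrM ger0_norm ?invr_ge0 ?exprn_ge0 ?(ltW t0)// mulrC.
by rewrite ler_wpM2r ?invr_ge0 ?exprn_ge0 ?(ltW t0)// hC.
Qed.

Lemma invrX_le n t1 t : 0 < t1 -> t1 <= t -> t ^- n <= t1 ^- n.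
Proof.
move=> t10 h; have t0 := lt_le_trans t10 h.
by rewrite lef_pV2 ?posrE ?exprn_gt0// lerXn2r// nnegrE ltW.
Qed.

Lemma is_derive_hk_x T k x t : edist T -> 0 < t ->
  is_derive x 1 (fun v => hk T k v t) (- hk T k.+1 x t).
Proof.
move=> hT t0; rewrite /hk -ed_opp//; last exact: smooth_gk.
apply: ed_is_derive => //.
- by exists 1 => // v _; exact: smooth_gk.
- by apply: smooth_opp; exact: smooth_gk.
- move=> N; have [C C0 hC] := gk_bound (N + k).+2.
  exists (C * Num.max 1 (t ^-1) ^+ (N + k).+3), 1; split=> // h _.
  have s1 := smooth_gk k t; have s2 := smooth_gk k.+1 t.
  apply/dboundP => j y jN _.
  rewrite (dn_remainder _ _ (s1 _) (s1 _) (smooth_opp (s2 _))).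
  have -> : (fun y => - gk k.+1 t (y - x)) = (fun y => (-1) * gk k.+1 t (y - x)).
    by apply/funext => z; rewrite mulN1r.
  rewrite (dn_scale _ _ (s2 _)) !dn_gk addnS.
  have := @taylor2 _ (gk (j + k) t) (gk (j + k).+1 t) (gk (j + k).+2 t)
    (C * t ^- (j + k).+3) (y - x) (- h).
  rewrite normrN => /(_ (fun z _ => is_derive_gk_u _ _ _) (fun z _ => is_derive_gk_u _ _ _)).
  have hM z : `|z - (y - x)| <= `|h| -> `|gk (j + k).+2 t z| <= C * t ^- (j + k).+3.
    by move=> _; apply: hC; rewrite // !ltnS leq_add2r.
  move=> /(_ hM); rewrite sqrrN opprD addrA mulN1r mulNr mulrN.
  move=> /le_trans; apply; rewrite ler_wpM2r ?sqr_ge0// ler_wpM2l//.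
  rewrite -exprVn; have m1 : 1 <= Num.max 1 t^-1 by rewrite le_max lexx.
  apply: le_trans (_ : Num.max 1 t^-1 ^+ (j + k).+3 <= _).
    by apply: lerXn2r; rewrite ?nnegrE ?invr_ge0 ?(ltW t0) ?(le_trans ler01 m1)// le_max lexx orbT.
  by apply: (ler_weXn2l m1); rewrite !ltnS leq_add2r.
Qed.

Lemma is_derive_hk_t T k x t : edist T -> 0 < t ->
  is_derive t 1 (fun v => hk T k x v) (t / 2 * hk T k.+2 x t).
Proof.
move=> hT t0; rewrite /hk -ed_scale//; last exact: smooth_gk.
apply: ed_is_derive => //.
- by exists 1 => // v _; exact: smooth_gk.
- by apply: smooth_scale; exact: smooth_gk.
- move=> N; have [C C0 hC] := gk_bound (N + k).+4.
  (* For |h| < t / 2 the width stays above t / 2, so its negative powers are bounded by powers of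
     w. *)
  pose w := Num.max 1 (2 / t); have w1 : 1 <= w by rewrite le_max lexx.
  exists (C * (1 + t ^+ 2) * w ^+ (N + k).+4.+1), (t / 2); split; first by rewrite divr_gt0.
  move=> h ht; have s1 := smooth_gk k; have s2 := smooth_gk k.+2.
  apply/dboundP => j y jN _.
  rewrite (dn_remainder _ _ (s1 _ _) (s1 _ _) (smooth_scale (t / 2) (s2 _ _))).
  rewrite (dn_scale _ _ (s2 _ _)) !dn_gk !addnS.
  have hz z : `|z - t| <= `|h| -> t / 2 <= z <= 2 * t.
    move=> zt; have : `|z - t| <= t / 2 by exact: le_trans zt (ltW ht).
    by rewrite ler_norml => /andP[]; move: t0; clear => *; apply/andP; split; lra.
  have hz0 z : `|z - t| <= `|h| -> z != 0.
    by move=> /hz /andP[h1 _]; rewrite gt_eqF// (lt_le_trans _ h1)// divr_gt0.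
  pose k2 v := 2^-1 * gk (j + k).+2 v (y - x) + v / 2 * (v / 2 * gk (j + k).+4 v (y - x)).
  apply: (@taylor2 _ (fun v => gk (j + k) v (y - x))
    (fun v => v / 2 * gk (j + k).+2 v (y - x)) k2) => z /[dup] /hz0 z0 /hz /andP[z1 z2].
  - exact: is_derive_gk_t.
  - have h1 : is_derive z 1 (fun v : R => v / 2) 2^-1.
      have -> : (fun v : R => v / 2) = (fun v => 2^-1 * v + 0) by apply/funext => v; ring.
      exact: is_derive_affine.
    have := is_deriveM h1 (is_derive_gk_t (j + k).+2 (y - x) z0).
    rewrite /GRing.scale /= => h'; apply: is_derive_eq h' _; rewrite /k2; ring.
  - have hw n : (n <= (N + k).+4)%N -> `|gk n z (y - x)| <= C * w ^+ (N + k).+4.+1.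
      move=> nN; have zp : 0 < z by apply: lt_le_trans z1; rewrite divr_gt0.
      apply: le_trans (hC n z (y - x) nN zp) _; rewrite ler_wpM2l//.
      rewrite -exprVn; apply: le_trans (_ : w ^+ n.+1 <= _); last exact: (ler_weXn2l w1).
      apply: lerXn2r; rewrite ?nnegrE ?invr_ge0 ?(ltW zp) ?(le_trans ler01 w1)//.
      rewrite le_max; apply/orP; right; rewrite -[2 / t]invrK lef_pV2 ?posrE//.
        by rewrite invf_div.
      by rewrite invr_gt0 divr_gt0.
    have := hw (j + k).+2 ltac:(by rewrite !ltnS; apply: leq_trans (leqW (leqnSn _)); rewrite leq_add2r).
    have := hw (j + k).+4 ltac:(by rewrite !ltnS leq_add2r).
    set P := C * w ^+ _ => b1 b2.
    have P0 : 0 <= P by apply: le_trans b1.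
    have -> : C * (1 + t ^+ 2) * w ^+ (N + k).+4.+1 = (1 + t ^+ 2) * P by rewrite /P; ring.
    apply: le_trans (ler_normD _ _) _; rewrite mulrDl; apply: lerD.
      by rewrite normrM ger0_norm// -[leRHS]/(1 * P); apply: ler_pM => //; clear; lra.
    rewrite mulrA normrM; apply: ler_pM => //.
    have zp : 0 <= z by apply: le_trans z1; rewrite divr_ge0// ltW.
    rewrite ger0_norm ?mulr_ge0// expr2; apply: ler_pM; rewrite ?divr_ge0//.
      by move: z2; clear; lra.
    by move: z2; clear; lra.
Qed.

(** Away from t = 0 this gives the continuity behind both the attained minimum of the minimum
    principle and the closedness of the sets in the Baire arguments. *)
Lemma hk_lip T k t1 : edist T -> 0 < t1 -> exists2 L, 0 <= L &
  forall x x' t t', t1 <= t -> t1 <= t' ->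
    `|hk T k x t - hk T k x' t'| <= L * (`|x - x'| + `|t - t'|).
Proof.
move=> hT t10; have [A [D [N [D0 hD]]]] := ed_bd hT.
have [C C0 hC] := gk_bound (N + k).+2.
pose w := Num.max 1 (t1^-1); have w1 : 1 <= w by rewrite le_max lexx.
pose P := C * w ^+ (N + k).+3.
have P0 : 0 <= P by rewrite mulr_ge0// exprn_ge0// (le_trans ler01).
exists (D * P); first exact: mulr_ge0.
have wt m t : t1 <= t -> t ^- m <= w ^+ m.
  move=> ht; apply: le_trans (invrX_le m t10 ht) _; rewrite -exprVn.
  by apply: lerXn2r; rewrite ?nnegrE ?invr_ge0 ?(ltW t10) ?(le_trans ler01 w1)// le_max lexx orbT.
move=> x x' t t' ht ht'; rewrite /hk -ed_sub//; [|exact: smooth_gk..].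
have -> : D * P * (`|x - x'| + `|t - t'|) = D * (P * `|x - x'| + P * `|t - t'|) by ring.
apply: hD; first by apply: smooth_sub; exact: smooth_gk.
apply/dboundP => j y jN _; rewrite dn_sub; [|exact: smooth_gk..]; rewrite !dn_gk.
have -> : gk (j + k) t (y - x) - gk (j + k) t' (y - x')
  = (gk (j + k) t (y - x) - gk (j + k) t (y - x'))
    + (gk (j + k) t (y - x') - gk (j + k) t' (y - x')) by ring.
apply: le_trans (ler_normD _ _) _; apply: lerD.
  have -> : `|x - x'| = `|(y - x) - (y - x')| by rewrite -normrN; congr `|_|; ring.
  apply: (@mvt_local _ (gk (j + k) t) (gk (j + k).+1 t)) => z _; first exact: is_derive_gk_u.
  apply: le_trans (hC _ t z _ (lt_le_trans t10 ht)) _.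
    by rewrite ltnS; apply: leqW; rewrite leq_add2r.
  rewrite ler_wpM2l//; apply: le_trans (wt _ _ ht) _.
  by apply: (ler_weXn2l w1); rewrite !ltnS; apply: leqW; rewrite leq_add2r.
apply: (@mvt_local _ (fun v => gk (j + k) v (y - x')) (fun v => v / 2 * gk (j + k).+2 v (y - x'))).
  move=> z /andP[hz _]; apply: is_derive_gk_t; rewrite gt_eqF//.
  by apply: lt_le_trans hz; rewrite lt_min !(lt_le_trans t10).
move=> z /andP[hz _]; have tz : t1 <= z by apply: le_trans hz; rewrite le_min ht ht'.
have z0 : 0 < z by apply: lt_le_trans tz.
rewrite normrM (ger0_norm (divr_ge0 (ltW z0) _))//.
apply: (@le_trans _ _ (z / 2 * (C * z ^- (j + k).+3))).
  rewrite ler_wpM2l ?divr_ge0 ?(ltW z0)//; apply: hC => //.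
  by rewrite !ltnS leq_add2r.
have -> : z / 2 * (C * z ^- (j + k).+3) = C / 2 * z ^- (j + k).+2.
  rewrite [z ^+ (j + k).+3]exprS.
  have : z ^+ (j + k).+2 != 0 by rewrite expf_neq0// gt_eqF.
  by move: (z ^+ (j + k).+2) => p p0; field; rewrite p0 gt_eqF.
apply: ler_pM; rewrite ?divr_ge0 ?invr_ge0 ?exprn_ge0 ?(ltW z0)//.
  by move: C0; clear; lra.
apply: le_trans (wt _ _ tz) _; apply: (ler_weXn2l w1).
by rewrite !ltnS; apply: leqW; rewrite leq_add2r.
Qed.

End HeatExtension.

(** * Gaussians seen from beyond an end point *)

Section CornerBound.
Context {R : realType}.
Implicit Types (f g : R -> R) (n k m j N : nat) (x y z h e c B r d q t u s M : R) (T : (R -> R) -> R).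

Lemma dbound_comp_affine N f M (a b : R) : sm f -> 0 <= M -> dbound N setT M f ->
  dbound N setT ((1 + `|a|) ^+ N * M) (fun z => f (a * z + b)).
Proof.
move=> sf M0 /dboundP hM; apply/dboundP => k y kN _.
rewrite dn_comp_affine// normrM; apply: ler_pM => //; last exact: hM.
have a1 : 1 <= 1 + `|a| by rewrite lerDl.
rewrite normrX; apply: le_trans (ler_weXn2l a1 kN).
by apply: lerXn2r; rewrite ?nnegrE ?addr_ge0// lerDr.
Qed.

Lemma dbound_step N : exists2 M, 0 <= M & dbound N setT M (@step R).
Proof.
have ss := @smooth_step R.
have sd : supp_in 0 1 (dn 1 (@step R)).
  move=> y; apply: contraNT; rewrite negb_and -!ltNge => /orP[] hy; apply/eqP.
    rewrite (@dn_eq_near R 1 _ (fun=> 0) y (- y) ss (smooth_cst 0)) ?dn0 ?oppr_gt0//.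
    move=> z hz; apply: step0; have := ler_norm (z - y); move: hz; clear; lra.
  rewrite (@dn_eq_near R 1 _ (fun=> 1) y (y - 1) ss (smooth_cst 1)) ?dn_cst ?subr_gt0//.
  move=> z hz; apply: step1; have := ler_norm (y - z); rewrite distrC; move: hz; clear; lra.
have [M M0 hM] := dbound_supp N (smooth_der ss) sd.
exists (1 + M); first by rewrite addr_ge0.
apply/dboundP => -[|k] y kN _.
  rewrite /= ger0_norm ?step_ge0//; apply: le_trans (step_le1 y) _; by rewrite lerDl.
rewrite dSn; apply: (@le_trans _ _ M); last by rewrite lerDr.
by have /dboundP := hM; apply => //; exact: ltnW.
Qed.

(** [dyadic_tail] controls f away from 0. The rest lives on [-2, 2]; viewed as a dilation by 2 r of
    a function on [-1, 1] it falls under the scale bound, whence r <= 1/2. *)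
Lemma dyadic_bound T c b q : edist T -> scale_bounded T c b -> 0 <= q -> 2 ^+ b * q < 1 ->
  exists N K, 0 <= K /\ forall f B r, sm f -> 0 <= B -> dbound N (seg (-2) 2) B f ->
    ddecay N q B f -> 0 < r <= 2^-1 -> `|T (sc c r f)| <= K * r ^+ b * B.
Proof.
move=> hT sb q0 s1.
have [N1 [K1 [K10 h1]]] := dyadic_tail hT sb q0 s1.
have [N2 [K2 [K20 h2]]] := sb.
pose N := maxn N1 N2.
have [Mc Mc0 hMc] := dbound_supp N (@smooth_chi R) (@supp_chi R).
have E0 : 0 <= 2 ^+ N * 2 ^+ N * Mc by rewrite !mulr_ge0 ?exprn_ge0.
pose K3 := K2 * 2 ^+ b * (2 ^+ N * 2 ^+ N * Mc).
have K30 : 0 <= K3 by rewrite !mulr_ge0 ?exprn_ge0.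
exists N, (K1 + K3); split; first exact: addr_ge0.
move=> f B r sf B0 hB hd /andP[r0 r1].
have r01 : 0 < r <= 1 by rewrite r0; apply: le_trans r1 _; clear; lra.
have sf2 : sm (fun w => f (2 * w)).
  have -> : (fun w => f (2 * w)) = (fun w => f (2 * w + 0)) by apply/funext => w; rewrite addr0.
  exact: smooth_comp_affine.
pose P w := f (2 * w) * chi w.
have sP : sm P by apply: smooth_mul => //; exact: smooth_chi.
have pP : supp_in (-1) 1 P.
  by move=> w h; apply: supp_chi; apply: contraNN h => /eqP; rewrite /P => ->; rewrite mulr0.
have bP : dbound N setT (2 ^+ N * (2 ^+ N * B * Mc)) P.
  have h : dbound N (seg (-1) 1) (2 ^+ N * (2 ^+ N * B * Mc)) P.
    apply: dbound_mul => //; [exact: smooth_chi| |exact: dbound_le hMc].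
    have -> : (fun w => f (2 * w)) = (fun w => f (2 * w + 0)) by apply/funext => w; rewrite addr0.
    apply/dboundP => k y kN /= /andP[y1 y2].
    rewrite dn_comp_affine// normrM addr0; apply: ler_pM => //.
      by rewrite ger0_norm ?exprn_ge0//; apply: ler_weXn2l => //; rewrite ler1n.
    have /dboundP := hB; apply => //; rewrite /seg /=; apply/andP; move: y1 y2; clear; lra.
  move/dboundP: h => h; apply/dboundP => k y kN _.
  have [yi|/negP ni] := boolP (-1 <= y <= 1); first exact: h.
  by rewrite (supp_in_eq0 (supp_in_dn (k := k) sP pP) ni) normr0 !mulr_ge0 ?exprn_ge0.
have -> : sc c r f = fun y => sc c r (tail 0 f) y + sc c (2 * r) P y.
  apply/funext => y; rewrite /sc /tail /P expr1.
  have -> : (y - c) / (2 * r) = (y - c) / r / 2 by field; rewrite gt_eqF.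
  have -> : 2 * ((y - c) / r / 2) = (y - c) / r by field; rewrite gt_eqF.
  ring.
rewrite ed_add//; [|by apply: smooth_sc; exact: smooth_tail|exact: smooth_sc].
apply: le_trans (ler_normD _ _) _.
rewrite (_ : (K1 + K3) * r ^+ b * B = K1 * r ^+ b * B + K3 * r ^+ b * B); last by ring.
apply: lerD.
  have hd1 : ddecay N1 q B f by move=> j k z kN; apply: hd; exact: leq_trans kN (leq_maxl _ _).
  by have := h1 f B 0%N r sf B0 hd1 r01; rewrite expr0 mulr1.
apply: le_trans (h2 P (2 ^+ N * (2 ^+ N * B * Mc)) (2 * r) sP pP _ _) _.
- by apply: dbound_le bP => //; exact: leq_maxr.
- by apply/andP; move: r0 r1; clear; lra.
by rewrite le_eqVlt; apply/orP; left; apply/eqP; rewrite /K3 exprMn; ring.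
Qed.

Definition lcut (z : R) : R := step (2 - 4 * z).

Lemma lcut_affine : lcut = fun z => step ((-4) * z + 2).
Proof. by apply/funext => z; rewrite /lcut; congr step; ring. Qed.

Lemma smooth_lcut : sm lcut.
Proof. by rewrite lcut_affine; apply: smooth_comp_affine; exact: smooth_step. Qed.

Lemma lcut_le1 z : lcut z <= 1. Proof. exact: step_le1. Qed.

Lemma lcut1 z : z <= 4^-1 -> lcut z = 1.
Proof. by move=> hz; rewrite /lcut step1//; move: hz; clear; lra. Qed.

Lemma lcut0 z : 2^-1 <= z -> lcut z = 0.
Proof. by move=> hz; rewrite /lcut step0//; move: hz; clear; lra. Qed.

(* A Gaussian centred at distance s >= 0 to the right of the origin, cut to a
   neighbourhood of the left half line: there it gains the factor exp (- s^2/4). *)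
Definition lgauss s (z : R) : R := gam (z - s) * lcut z.

Lemma smooth_lgauss s : sm (lgauss s).
Proof.
apply: smooth_mul; last exact: smooth_lcut.
have -> : (fun z => gam (z - s)) = (fun z => gam (1 * z + - s)).
  by apply/funext => z; rewrite mul1r.
by apply: smooth_comp_affine; exact: smooth_gam.
Qed.

Lemma lgauss_bound N : exists2 C, 0 <= C & forall s k z, 0 <= s -> (k <= N)%N ->
  `|dn k (lgauss s) z| <= C * expR (- (s ^+ 2 / 4)) * expR (- (z ^+ 2 / 4)).
Proof.
have hg : exists2 C, 0 <= C & forall k z, (k <= N)%N -> `|dn k gam z| <= C * expR (- (z ^+ 2 / 2)).
  elim: N => [|N [C C0 hC]].
    by have [C C0 hC] := @gam_bound R 0; exists C => // -[|k] z.
  have [D D0 hD] := @gam_bound R N.+1; exists (C + D); first exact: addr_ge0.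
  move=> k z; rewrite leq_eqVlt => /orP[/eqP ->|kN].
    by apply: le_trans (hD z) _; rewrite ler_wpM2r ?expR_ge0// lerDr.
  by apply: le_trans (hC k z kN) _; rewrite ler_wpM2r ?expR_ge0// lerDl.
have [C C0 hC] := hg; have [M M0 hM] := dbound_step N.
have hM' := dbound_comp_affine (-4) 2 (@smooth_step R) M0 hM.
rewrite -lcut_affine in hM'; move: hM'; set M' := _ * M => hM'.
have M'0 : 0 <= M' by rewrite mulr_ge0// exprn_ge0// addr_ge0.
exists (2 ^+ N * (C * M') * expR (4^-1)).
  by rewrite !mulr_ge0 ?exprn_ge0 ?expR_ge0.
move=> s k z s0 kN.
have [hz|hz] := ltP 2^-1 z.
  rewrite (@dn_eq_near R k _ (fun=> 0) z (z - 2^-1) (smooth_lgauss s) (smooth_cst 0)).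
  - by rewrite dn0 normr0 !mulr_ge0 ?exprn_ge0 ?expR_ge0.
  - by rewrite subr_gt0.
  - move=> y hy; rewrite /lgauss lcut0 ?mulr0//.
    by have := ler_norm (z - y); rewrite distrC; move: hy; clear; lra.
have sg : sm (fun z => gam (z - s)).
  have -> : (fun z => gam (z - s)) = (fun z => gam (1 * z + - s)).
    by apply/funext => w; rewrite mul1r.
  by apply: smooth_comp_affine; exact: smooth_gam.
have b1 : dbound N [set z] (C * expR (- ((z - s) ^+ 2 / 2))) (fun z => gam (z - s)).
  apply/dboundP => i y iN ->.
  have -> : (fun z => gam (z - s)) = (fun z => gam (1 * z + - s)).
    by apply/funext => w; rewrite mul1r.
  by rewrite dn_comp_affine ?expr1n ?mul1r; [exact: hC|exact: smooth_gam].
have b2 : dbound N [set z] M' lcut by apply: dbound_le hM'.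
have /dboundP h := dbound_mul sg smooth_lcut b1 b2.
apply: le_trans (h k z kN erefl) _.
have -> : 2 ^+ N * (C * expR (- ((z - s) ^+ 2 / 2)) * M')
  = 2 ^+ N * (C * M') * expR (- ((z - s) ^+ 2 / 2)) by ring.
have -> : 2 ^+ N * (C * M') * expR 4^-1 * expR (- (s ^+ 2 / 4)) * expR (- (z ^+ 2 / 4))
  = 2 ^+ N * (C * M') * expR (4^-1 - s ^+ 2 / 4 - z ^+ 2 / 4) by rewrite !expRD; ring.
apply: ler_wpM2l; first by rewrite !mulr_ge0 ?exprn_ge0.
(* On the support of the cut-off z <= 1/2, so z s <= s / 2 <= (s ^ 2 + 1) / 4: the mixed term of (z
   - s) ^ 2 costs only half of s ^ 2 / 2 and a constant. *)
rewrite ler_expR; have : 2 * z * s <= s ^+ 2 / 2 + 2^-1.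
  have : 2 * z * s <= 1 * s by rewrite ler_wpM2r//; move: hz; clear; lra.
  have : 0 <= (s - 1) ^+ 2 by exact: sqr_ge0.
  by rewrite !expr2; clear; lra.
by rewrite !expr2; clear; nra.
Qed.

(** The Gaussian pays for the k powers of |z| and one more, which yields decay with q = 1/2. *)
Lemma dyadic_gauss N : exists2 C, 0 <= C & forall j k z, (k <= N)%N -> 2 ^+ j <= `|z| ->
  expR (- (z ^+ 2 / 4)) * 2 ^+ (j * k) <= C * 2^-1 ^+ j.
Proof.
have [C C0 hC] := @poly_le_gauss R N.+1.
exists (2 ^+ N.+1 * C); first by rewrite mulr_ge0// exprn_ge0.
move=> j k z kN hz.
have p0 : 0 < 2 ^+ j :> R by rewrite exprn_gt0.
have z1 : 1 <= `|z| by apply: le_trans hz; rewrite exprn_ege1// ler1n.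
rewrite exprVn ler_pdivlMr// -mulrA -exprD -mulnSr [leLHS]mulrC.
have h1 : 2 ^+ (j * k.+1) <= (2 * (1 + `|z / 2|)) ^+ N.+1.
  have w : `|z| <= 2 * (1 + `|z / 2|).
    by rewrite normrM [`|2^-1|]ger0_norm ?invr_ge0//; have := normr_ge0 z; clear; lra.
  rewrite exprM; apply: le_trans (_ : `|z| ^+ k.+1 <= _).
    by apply: lerXn2r; rewrite ?nnegrE// ltW.
  apply: le_trans (_ : `|z| ^+ N.+1 <= _); first exact: (ler_weXn2l z1).
  by apply: lerXn2r; rewrite ?nnegrE// mulr_ge0// addr_ge0.
rewrite -ler_pdivlMr ?expR_gt0// -expRN opprK.
apply: le_trans h1 _; rewrite exprMn -mulrA ler_wpM2l ?exprn_ge0//.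
apply: le_trans (hC (z / 2)) _; rewrite ler_wpM2l// ler_expR.
by have := sqr_ge0 z; rewrite exprMn expr2; move: (z * z) => w; rewrite expr2; clear; lra.
Qed.

(** With b = 0 and q = 1/2 the series of [dyadic_bound] converges, and the factor exp (- s ^ 2 / 4)
    comes out of the norm of [lgauss s]. The reflected version serves the right end point of a
    gap. *)
Lemma lgauss_corner T c : edist T -> scale_bounded T c 0 ->
  exists2 K, 0 <= K & forall s r, 0 <= s -> 0 < r <= 2^-1 ->
    `|T (sc c r (lgauss s))| <= K * expR (- (s ^+ 2 / 4)) /\
    `|T (sc c r (fun z => lgauss s (- z)))| <= K * expR (- (s ^+ 2 / 4)).
Proof.
move=> hT sb.
have h1 : 2 ^+ 0 * 2^-1 < 1 :> R by rewrite expr0 mul1r; clear; lra.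
have h0 : 0 <= 2^-1 :> R by rewrite invr_ge0.
have [N [K [K0 hK]]] := dyadic_bound hT sb h0 h1.
have [C C0 hC] := lgauss_bound N; have [D D0 hD] := dyadic_gauss N.
exists (K * (C * (1 + D))); first by rewrite !mulr_ge0// addr_ge0.
move=> s r s0 r01.
pose B := C * (1 + D) * expR (- (s ^+ 2 / 4)).
have B0 : 0 <= B by rewrite !mulr_ge0 ?expR_ge0// addr_ge0.
have Bz z : expR (- (z ^+ 2 / 4)) <= 1 by rewrite -expR0 ler_expR oppr_le0 divr_ge0// sqr_ge0.
have gen f : sm f -> (forall k z, (k <= N)%N -> `|dn k f z| <= C * expR (- (s ^+ 2 / 4)) * expR (- (z ^+ 2 / 4))) ->
    `|T (sc c r f)| <= K * (C * (1 + D)) * expR (- (s ^+ 2 / 4)).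
  move=> sf hf; rewrite -mulrA -/B.
  apply: le_trans (hK f B r sf B0 _ _ r01) _; last by rewrite expr0 mulr1.
    apply/dboundP => k y kN _; apply: le_trans (hf k y kN) _.
    rewrite /B; apply: le_trans (_ : C * expR (- (s ^+ 2 / 4)) * 1 <= _).
      by rewrite ler_wpM2l// mulr_ge0// expR_ge0.
    rewrite mulr1 ler_wpM2r ?expR_ge0// -[leLHS]mulr1 ler_wpM2l//.
    by rewrite lerDl.
  move=> j k z kN hz.
  apply: (@le_trans _ _ (C * expR (- (s ^+ 2 / 4)) * (expR (- (z ^+ 2 / 4)) * 2 ^+ (j * k)))).
    by rewrite mulrA ler_wpM2r ?exprn_ge0// hf.
  rewrite /B; have := hD j k z kN hz => h.
  have -> : C * (1 + D) * expR (- (s ^+ 2 / 4)) * 2^-1 ^+ j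
    = C * expR (- (s ^+ 2 / 4)) * ((1 + D) * 2^-1 ^+ j) by ring.
  rewrite ler_wpM2l ?mulr_ge0 ?expR_ge0//; apply: le_trans h _.
  by rewrite ler_wpM2r ?exprn_ge0 ?invr_ge0// lerDr.
split; apply: gen.
- exact: smooth_lgauss.
- by move=> k z; exact: hC.
- have -> : (fun z => lgauss s (- z)) = (fun z => lgauss s ((-1) * z + 0)).
    by apply/funext => z; rewrite mulN1r addr0.
  by apply: smooth_comp_affine; exact: smooth_lgauss.
- move=> k z kN.
  have -> : (fun z => lgauss s (- z)) = (fun z => lgauss s ((-1) * z + 0)).
    by apply/funext => w; rewrite mulN1r addr0.
  rewrite dn_comp_affine; last exact: smooth_lgauss.
  rewrite normrM normrX normrN1 expr1n mul1r mulN1r addr0 -[z ^+ 2]sqrrN.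
  exact: hC.
Qed.

End CornerBound.

(** * The minimum principle for the heat equation *)

Section ParabolicMinimumPrinciple.
Context {R : realType}.
Implicit Types (f g : R -> R) (n k m j N : nat) (x y z h e c B r d q t u s M L : R) (T : (R -> R) -> R).

Lemma rect_min_attained (f : R -> R -> R) L (a b s u : R) : a <= b -> s <= u ->
  (forall x x' t t', a <= x <= b -> a <= x' <= b -> s <= t <= u -> s <= t' <= u ->
    `|f x t - f x' t'| <= L * (`|x - x'| + `|t - t'|)) ->
  exists x0 t0, [/\ a <= x0 <= b, s <= t0 <= u &
    forall x t, a <= x <= b -> s <= t <= u -> f x0 t0 <= f x t].
Proof.
move=> ab su hL; pose A := `[a, b]%classic `*` `[s, u]%classic.
have A0 : A !=set0 by exists (a, s); split; rewrite /= in_itv /= lexx.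
have cA : compact A by apply: compact_setX; exact: segment_compact.
have cf : {within A, continuous (fun p => f p.1 p.2)}.
  apply/subspace_continuousP => -[x t] [/=]; rewrite !in_itv /= => hx ht.
  apply/cvgrPdist_le => e e0; rewrite near_withinE.
  pose K := `|L| + 1; have K0 : 0 < K by rewrite ltr_wpDl.
  pose r := e / (2 * K); have r0 : 0 < r by rewrite divr_gt0// mulr_gt0.
  exists (ball x r, ball t r); first by split; exact: nbhsx_ballx.
  move=> [x' t'] [/= bx bt] [/=]; rewrite !in_itv /= => hx' ht'.
  apply: le_trans (hL _ _ _ _ hx hx' ht ht') _.
  move: bx bt; rewrite /ball /= => bx bt.
  apply: (@le_trans _ _ (K * (`|x - x'| + `|t - t'|))).
    by rewrite ler_wpM2r ?addr_ge0// (le_trans (ler_norm L))// lerDl.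
  apply: (@le_trans _ _ (K * (r + r))).
    by rewrite ler_wpM2l ?(ltW K0)// lerD// ltW.
  by rewrite /r -mulr2n -mulr_natl le_eqVlt; apply/orP; left; apply/eqP; field; rewrite gt_eqF.
have [[x0 t0]] := compact_EVT_min A0 cA cf.
rewrite inE => -[/=]; rewrite !in_itv /= => hx ht hm.
exists x0, t0; split=> // x t hx' ht'.
have := hm (x, t); rewrite inE; apply; split; by rewrite /= in_itv.
Qed.

(** Only neighbours on the left are compared, because in [parabolic_min] the minimum may be attained
    at the final time. *)
Lemma left_deriv_at_min f (l : R) x d : 0 < d -> is_derive x 1 f l ->
  (forall y, x - d < y <= x -> f x <= f y) -> l <= 0.
Proof.
move=> d0 /is_derive_eps hl hm; apply/ler_addgt0Pr => e e0; rewrite add0r.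
have [d1 d10 h1] := hl e e0.
have md : 0 < Num.min d d1 by rewrite lt_min d0.
pose h := Num.min d d1 / 2; have h0 : 0 < h by rewrite divr_gt0.
have hmin : h < Num.min d d1 by rewrite /h ltr_pdivrMr// mulr2n mulrDr mulr1 ltrDr.
move: hmin; rewrite lt_min => /andP[hd hd1].
have := h1 (- h); rewrite normrN gtr0_norm// => /(_ hd1) /ler_normlP[_ a1].
have := hm (x - h); have -> : x - d < x - h <= x by apply/andP; move: hd h0; clear => *; split; lra.
move=> /(_ isT) b1; rewrite -(ler_pM2r h0) mulrC.
by move: a1 b1; rewrite mulNr; clear; lra.
Qed.

Lemma right_deriv_at_min f (l : R) x d : 0 < d -> is_derive x 1 f l ->
  (forall y, x <= y < x + d -> f x <= f y) -> 0 <= l.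
Proof.
move=> d0 hl hm; rewrite -oppr_le0.
have h1 : is_derive (- x) 1 (fun y : R => - y) (-1 : R).
  by have := is_derive_affine (-1 : R) 0 (- x); under eq_fun do rewrite mulN1r addr0.
have h2 : is_derive (- x) 1 (fun y => f (- y)) (l * -1).
  apply: (@is_derive1_comp _ f (fun y => - y) (- x)) => //; by rewrite opprK.
rewrite mulrN1 in h2; apply: (left_deriv_at_min d0 h2).
move=> y /andP[y1 y2]; rewrite opprK; apply: hm; apply/andP.
by move: y1 y2; clear => *; split; lra.
Qed.

Lemma second_deriv_at_min f (g : R -> R) (l : R) x d : 0 < d ->
  (forall y, is_derive y 1 f (g y)) -> is_derive x 1 g l ->
  (forall y, `|y - x| < d -> f x <= f y) -> 0 <= l.
Proof.
move=> d0 hf hg hm.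
have gx : g x = 0.
  apply/eqP; rewrite eq_le; apply/andP; split.
    apply: (left_deriv_at_min d0 (hf x)) => y /andP[y1 y2]; apply: hm.
    by rewrite ler0_norm ?subr_le0//; move: y1; clear; lra.
  apply: (right_deriv_at_min d0 (hf x)) => y /andP[y1 y2]; apply: hm.
  by rewrite ger0_norm ?subr_ge0//; move: y2; clear; lra.
rewrite leNgt; apply/negP => l0.
have e0 : 0 < - l / 2 by rewrite divr_gt0// oppr_gt0.
move/is_derive_eps : hg => /(_ _ e0) [d1 d10 h1].
have md : 0 < Num.min d d1 by rewrite lt_min d0.
pose h := Num.min d d1 / 2; have h0 : 0 < h by rewrite divr_gt0.
have hmin : h < Num.min d d1 by rewrite /h ltr_pdivrMr// mulr2n mulrDr mulr1 ltrDr.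
move: hmin; rewrite lt_min => /andP[hd hd1].
have xh : x < x + h by rewrite ltrDl.
have hc : {within `[x, x + h], continuous f}.
  apply: derivable_within_continuous => z _.
  by have := hf z => ?; exact: ex_derive.
have [c cx fE] := @MVT R f g x (x + h) xh (fun z _ => hf z) hc.
move: cx; rewrite in_itv /= => /andP[c1 c2].
have gc : g c < 0.
  have ch : `|c - x| < d1.
    by rewrite gtr0_norm ?subr_gt0//; move: c2 hd1; clear; lra.
  have xc : x + (c - x) = c by ring.
  have := h1 _ ch; rewrite gx subr0 xc [`|c - x|]gtr0_norm ?subr_gt0//.
  move=> /ler_normlP[_ h2]; pose v := c - x; move: h2; rewrite -/v => h2.
  have v0 : 0 < v by rewrite /v subr_gt0.
  have := mulr_gt0 e0 v0; move: h2.
  have -> : - l / 2 * v = - (l * v) / 2 by ring.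
  have -> : v * l = l * v by ring.
  by move: (l * v) => w; clear; lra.
have xh' : x + h - x = h by ring.
have := hm (x + h); rewrite xh' gtr0_norm// => /(_ hd).
rewrite -subr_ge0 fE xh' pmulr_lge0// => hh.
by move: (lt_le_trans gc hh); rewrite ltxx.
Qed.

(* The heat operator is d/dt - (t/2) d^2/dx^2: in these variables the Gaussian
   kernel of width t is a solution. *)
Lemma parabolic_min (f fx fxx ft : R -> R -> R) L (c d s u e : R) :
  c <= d -> 0 < s -> s <= u -> 0 < e ->
  (forall x x' t t', c <= x <= d -> c <= x' <= d -> s <= t <= u -> s <= t' <= u ->
    `|f x t - f x' t'| <= L * (`|x - x'| + `|t - t'|)) ->
  (forall x t, 0 < t -> is_derive x 1 (f ^~ t) (fx x t)) ->
  (forall x t, 0 < t -> is_derive x 1 (fx ^~ t) (fxx x t)) ->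
  (forall x t, 0 < t -> is_derive t 1 (f x) (ft x t)) ->
  (forall x t, 0 < t -> ft x t = t / 2 * fxx x t + e) ->
  (forall t, s <= t <= u -> 0 <= f c t) -> (forall t, s <= t <= u -> 0 <= f d t) ->
  (forall x, c <= x <= d -> 0 <= f x s) ->
  forall x t, c <= x <= d -> s <= t <= u -> 0 <= f x t.
Proof.
move=> cd s0 su e0 hL hx hxx ht heq hc hd hs x t xcd tsu.
have [x0 [t0 [x0cd t0su hm]]] := rect_min_attained cd su hL.
apply: le_trans (hm x t xcd tsu).
have [x0c x0d] := andP x0cd; have [t0s t0u] := andP t0su.
rewrite leNgt; apply/negP => neg.
have x0c' : c < x0.
  by rewrite lt_neqAle x0c andbT; apply/eqP => E; move: neg; rewrite -E ltNge hc.
have x0d' : x0 < d.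
  by rewrite lt_neqAle x0d andbT; apply/eqP => E; move: neg; rewrite E ltNge hd.
have t0s' : s < t0.
  by rewrite lt_neqAle t0s andbT; apply/eqP => E; move: neg; rewrite -E ltNge hs.
have t00 : 0 < t0 by apply: lt_trans t0s'.
have l1 : ft x0 t0 <= 0.
  have dd : 0 < t0 - s by rewrite subr_gt0.
  apply: (left_deriv_at_min dd (ht x0 t0 t00)) => y /andP[y1 y2]; apply: hm => //.
  by apply/andP; split; [move: y1; clear; lra|exact: le_trans t0u].
have l2 : 0 <= fxx x0 t0.
  pose r := Num.min (x0 - c) (d - x0); have r0 : 0 < r by rewrite lt_min !subr_gt0 x0c' x0d'.
  apply: (second_deriv_at_min r0 (fun y => hx y t0 t00) (hxx x0 t0 t00)) => y.
  rewrite lt_min => /andP[y1 y2]; apply: hm; last by rewrite t0s t0u.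
  have := ler_norm (y - x0); have := ler_norm (x0 - y); rewrite distrC.
  by move: y1 y2; clear => *; apply/andP; split; lra.
(* The source term e > 0 yields the contradiction even if the second derivative vanishes at the
   minimum. *)
move: l1; rewrite heq// leNgt => /negP; apply.
by rewrite ltr_wpDl// mulr_ge0// divr_ge0// ltW.
Qed.

End ParabolicMinimumPrinciple.

(** * Lower bounds across an interval of positivity *)

Section GapBound.
Context {R : realType}.
Implicit Types (f g : R -> R) (n k m j N : nat) (x y z h e c B r d q t u s M L : R) (T : (R -> R) -> R).

Definition pos_on T c d := forall f (c' d' : R), sm f -> (forall y, 0 <= f y) ->
  c < c' -> d' < d -> supp_in c' d' f -> 0 <= T f.

(** The Gaussian is split into a part inside ]c, d[, where T is nonnegative, and two parts around
    and beyond the end points. The latter are the functions [lgauss], at distance (x - c) / r and (d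
    - x) / r. *)
Lemma gap_bottom T c d : edist T -> scale_bounded T c 0 -> scale_bounded T d 0 ->
  pos_on T c d -> exists2 K, 0 <= K & forall r x, 0 < r <= 2^-1 -> r <= d - c ->
    c <= x <= d ->
    - (K / r * (expR (- (((x - c) / r) ^+ 2 / 4)) + expR (- (((d - x) / r) ^+ 2 / 4))))
      <= hk T 0 x r.
Proof.
move=> hT sc1 sc2 pos.
have [K1 K10 h1] := lgauss_corner hT sc1; have [K2 K20 h2] := lgauss_corner hT sc2.
exists (K1 + K2); first exact: addr_ge0.
move=> r x r01 rcd /andP[cx xd]; have /andP[r0 _] := r01.
pose s1 := (x - c) / r; pose s2 := (d - x) / r.
have s10 : 0 <= s1 by rewrite divr_ge0 ?subr_ge0// ltW.
have s20 : 0 <= s2 by rewrite divr_ge0 ?subr_ge0// ltW.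
pose l y := lcut ((y - c) / r); pose l' y := lcut (- ((y - d) / r)).
have sl : sm l by apply: smooth_sc; exact: smooth_lcut.
have sl' : sm l'.
  have -> : l' = sc d r (fun z => lcut ((-1) * z + 0)).
    by apply/funext => y; rewrite /l' /sc mulN1r addr0.
  by apply: smooth_sc; apply: smooth_comp_affine; exact: smooth_lcut.
pose g := sc x r gam; have sg : sm g by apply: smooth_sc; exact: smooth_gam.
pose mid y := g y * ((1 - l y) * (1 - l' y)).
have smid : sm mid.
  apply: smooth_mul => //; apply: smooth_mul; apply: smooth_sub => //; exact: smooth_cst.
have g0 y : 0 <= g y by exact: expR_ge0.
have mid0 : 0 <= T mid.
  apply: (pos _ (c + r / 4) (d - r / 4)) => //.
  - move=> y; rewrite !mulr_ge0 ?subr_ge0//; exact: lcut_le1.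
  - by rewrite ltrDl divr_gt0.
  - by rewrite gtrBl divr_gt0.
  move=> y; apply: contraNT; rewrite negb_and -!ltNge => /orP[] hy; apply/eqP.
    rewrite /mid /l lcut1 ?subrr ?mul0r ?mulr0//.
    by rewrite ler_pdivrMr//; move: hy; clear; lra.
  rewrite /mid /l' lcut1 ?subrr ?mulr0//.
  by rewrite -mulNr ler_pdivrMr//; move: hy; clear; lra.
(* Since r <= d - c, the two end point cut-offs have no common support, and (1 - l) (1 - l') expands
   without a mixed term. *)
have disj y : l y * l' y = 0.
  rewrite /l /l'; have [hy|/ltW hy] := leP (y - c) (r / 2); last first.
    by rewrite lcut0 ?mul0r// ler_pdivlMr//; move: hy; clear; lra.
  rewrite mulrC lcut0 ?mul0r// -mulNr ler_pdivlMr//.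
  by move: hy rcd; clear; lra.
have e1 : (fun y => g y * l y) = sc c r (lgauss s1).
  apply/funext => y; rewrite /g /l /sc /lgauss /s1; congr (gam _ * _).
  by field; rewrite gt_eqF.
have e2 : (fun y => g y * l' y) = sc d r (fun z => lgauss s2 (- z)).
  apply/funext => y; rewrite /g /l' /sc /lgauss /s2; congr (_ * _).
  by rewrite /gam -[in RHS]sqrrN; congr (expR (- _ ^+ 2)); field; rewrite gt_eqF.
have hdec : T g = T (fun y => g y * l y) + T (fun y => g y * l' y) + T mid.
  have s1' : sm (fun y => g y * l y) by exact: smooth_mul.
  have s2' : sm (fun y => g y * l' y) by exact: smooth_mul.
  rewrite -ed_add// -ed_add//; last exact: smooth_add.
  congr T; apply/funext => y; rewrite /mid.
  have := disj y; move: (l y) (l' y) (g y) => a b w ab.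
  have -> : (1 - a) * (1 - b) = 1 - a - b + a * b by ring.
  by rewrite ab; ring.
have hH : hk T 0 x r = r^-1 * T g.
  rewrite -ed_scale//; congr T; apply/funext => y; by rewrite /gk expr1.
have [a1 _] := h1 s1 r s10 r01; have [_ a2] := h2 s2 r s20 r01.
rewrite hH hdec e1 e2 mulrAC -mulNr [leRHS]mulrC ler_pM2r ?invr_gt0//.
rewrite -/s1 -/s2.
have p1 := expR_ge0 (- (s1 ^+ 2 / 4)); have p2 := expR_ge0 (- (s2 ^+ 2 / 4)).
have q1 := mulr_ge0 K10 p2; have q2 := mulr_ge0 K20 p1.
move/ler_normlP : a1 => [a1 _]; move/ler_normlP : a2 => [a2 _].
move: a1 a2 mid0 q1 q2; move: (expR _) (expR _) => E1 E2.
by rewrite mulrDl !mulrDr; clear; lra.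
Qed.

Lemma edist_dirac0 : edist (fun f : R -> R => f 0).
Proof.
split=> //; exists 0, 1, 0%N; split=> // f B sf [h _].
by rewrite mul1r; apply: h; rewrite /seg /= oppr0 lexx.
Qed.

(** The kernel is the heat extension of the Dirac mass at 0. *)
Lemma gk_lip k t1 : 0 < t1 -> exists2 L, 0 <= L &
  forall u u' t t', t1 <= t -> t1 <= t' ->
    `|gk k t u - gk k t' u'| <= L * (`|u - u'| + `|t - t'|).
Proof.
move=> t10; have [L L0 hL] := hk_lip k edist_dirac0 t10.
exists L => // u u' t t' ht ht'; have := hL (- u) (- u') t t' ht ht'.
by rewrite /hk !sub0r !opprK [- u + u']addrC [`|u' - u|]distrC.
Qed.

(** A translation of the usual time t ^ 2 / 4, so Gaussians of width [tau r t] still solve the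
    equation. The constant 15 gives width 4 r at t = r, wide enough to dominate the corner terms of
    [gap_bottom]. *)
Definition tau r t : R := Num.sqrt (t ^+ 2 + 15 * r ^+ 2).

Lemma tau_arg r t : 0 < r -> 0 < t ^+ 2 + 15 * r ^+ 2.
Proof. by move=> r0; rewrite ltr_wpDl ?sqr_ge0// mulr_gt0// exprn_gt0. Qed.

Lemma tau_gt0 r t : 0 < r -> 0 < tau r t.
Proof. by move=> r0; rewrite sqrtr_gt0 tau_arg. Qed.

Lemma tau_ge r t : 0 <= t -> t <= tau r t.
Proof.
move=> t0; rewrite -[leLHS]ger0_norm// -sqrtr_sqr; apply: ler_wsqrtr.
by rewrite lerDl mulr_ge0// sqr_ge0.
Qed.

Lemma tau_ge_r r t : 0 <= r -> r <= tau r t.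
Proof.
move=> r0; rewrite -[leLHS]ger0_norm// -sqrtr_sqr; apply: ler_wsqrtr.
by have := sqr_ge0 r; have := sqr_ge0 t; clear; lra.
Qed.

Lemma tau_diag r : 0 <= r -> tau r r = 4 * r.
Proof.
move=> r0; rewrite /tau (_ : _ + _ = (4 * r) ^+ 2); last by rewrite !expr2; ring.
by rewrite sqrtr_sqr ger0_norm// mulr_ge0.
Qed.

Lemma is_derive_tau r t : 0 < r -> is_derive t 1 (tau r) (t / tau r t).
Proof.
move=> r0; have h1 : is_derive t 1 (fun v : R => v ^+ 2 + 15 * r ^+ 2) (2 * t).
  have h := is_derive_id t (1 : R); have := is_deriveM h h.
  rewrite /GRing.scale /= => h'; have := is_deriveD h' (is_derive_cst (15 * r ^+ 2) t 1).
  by move=> h2; apply: is_derive_eq h2 _; ring.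
have h2 : is_derive (t ^+ 2 + 15 * r ^+ 2) 1 (@Num.sqrt R) (2 * tau r t)^-1.
  by apply: is_derive1_sqrt; exact: tau_arg.
have := @is_derive1_comp _ Num.sqrt (fun v => v ^+ 2 + 15 * r ^+ 2) t _ _ h2 h1.
move=> h3; apply: is_derive_eq h3 _; field; rewrite gt_eqF// tau_gt0//.
Qed.

Lemma tau_lip r t t' : 0 < r -> 0 <= t -> 0 <= t' -> `|tau r t - tau r t'| <= `|t - t'|.
Proof.
move=> r0 t0 t'0; rewrite -[leRHS]mul1r.
apply: (@mvt_local _ (tau r) (fun v => v / tau r v)) => z /andP[z1 _].
  exact: is_derive_tau.
have z0 : 0 <= z by apply: le_trans z1; rewrite le_min t'0 t0.
have tz := tau_gt0 z r0.
by rewrite ger0_norm ?divr_ge0 ?(ltW tz)// ler_pdivrMr// mul1r tau_ge.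
Qed.

Lemma is_derive_gk_tau k r t u : 0 < r ->
  is_derive t 1 (fun v => gk k (tau r v) u) (t / 2 * gk k.+2 (tau r t) u).
Proof.
move=> r0; have t0 := tau_gt0 t r0; have tn0 : tau r t != 0 by rewrite gt_eqF.
have := @is_derive1_comp _ (fun v => gk k v u) (tau r) t _ _
  (is_derive_gk_t k u tn0) (is_derive_tau t r0).
by move=> h; apply: is_derive_eq h _; field.
Qed.

Lemma gk1E t u : gk 1 t u = - (2 * t ^- 2 * (u / t) * gam (u / t)).
Proof. by rewrite /gk /= (is_derive_der is_derive_gam); ring. Qed.

Lemma gk1_le0 t u : 0 < t -> 0 <= u -> gk 1 t u <= 0.
Proof.
move=> t0 u0; rewrite gk1E oppr_le0 !mulr_ge0 ?invr_ge0 ?exprn_ge0 ?expR_ge0//; exact: ltW.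
Qed.

(** With z = s / r the claim reduces to ((z + 1) / 4) ^ 2 <= z ^ 2 / 4 + 1/8. The space derivative
    of a Gaussian of width 4 r, centred at distance r outside the gap, is of order r ^ -2 at this
    scale, so the weight r suffices. *)
Lemma barrier_bottom r s : 0 < r -> 0 <= s ->
  r^-1 * expR (- ((s / r) ^+ 2 / 4))
    <= 32 * expR (8^-1) * r * (- gk 1 (tau r r) (s + r)).
Proof.
move=> r0 s0; rewrite (tau_diag (ltW r0)) gk1E opprK.
pose z := s / r; have z0 : 0 <= z by rewrite divr_ge0// ltW.
have -> : (s + r) / (4 * r) = (z + 1) / 4 by rewrite /z; field; rewrite gt_eqF.
have -> : 32 * expR 8^-1 * r * (2 * (4 * r) ^- 2 * ((z + 1) / 4) * gam ((z + 1) / 4))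
  = r^-1 * ((z + 1) * (expR 8^-1 * gam ((z + 1) / 4))).
  by rewrite expr2; field; rewrite gt_eqF.
rewrite -/z ler_pM2l ?invr_gt0// /gam -expRD -[leLHS]mul1r.
apply: ler_pM; rewrite ?expR_ge0//; first by rewrite lerDr.
rewrite ler_expR (_ : ((z + 1) / 4) ^+ 2 = (z ^+ 2 + 2 * z + 1) / 16); last by field.
have := sqr_ge0 (z - 1); have := sqr_ge0 z.
rewrite (_ : (z - 1) ^+ 2 = z ^+ 2 - 2 * z + 1); last by ring.
by move: (z ^+ 2); clear => *; lra.
Qed.

(** For small r the minimum principle is applied from time r on to [hk] plus M, plus barriers for
    both corners, plus a small source. At the given point (x, t) the barriers are O(r), so they
    disappear as r tends to 0. *)
Lemma gap_bound T c d M u : edist T -> c < d -> scale_bounded T c 0 -> scale_bounded T d 0 ->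
  pos_on T c d -> 0 <= M ->
  (forall t, 0 < t <= u -> - M <= hk T 0 c t) -> (forall t, 0 < t <= u -> - M <= hk T 0 d t) ->
  forall x t, c <= x <= d -> 0 < t <= u -> - M <= hk T 0 x t.
Proof.
move=> hT cd sc1 sc2 pos M0 hc hd x t xcd /andP[t0 tu].
have [K K0 hK] := gap_bottom hT sc1 sc2 pos.
have [C C0 hC] := @gk_bound R 1.
apply/ler_addgt0Pr => e e0.
pose E := 32 * expR (8^-1 : R); have E0 : 0 < E by rewrite mulr_gt0// expR_gt0.
pose A := 2 * (K * E) * (C * t ^- 2) + 1.
have A0 : 0 < A.
  by rewrite ltr_wpDl// !mulr_ge0 ?invr_ge0 ?exprn_ge0 ?(ltW E0)// ltW.
(* The last bound makes the barriers contribute at most e / 2 at time t. *)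
pose r := Num.min (Num.min t 2^-1) (Num.min (d - c) (e / 2 / A)).
have r0 : 0 < r by rewrite !lt_min t0 subr_gt0 cd invr_gt0 ltr0n /= !divr_gt0.
have rt : r <= t by rewrite !ge_min lexx.
have rh : r <= 2^-1 by rewrite !ge_min lexx orbT.
have rcd : r <= d - c by rewrite !ge_min lexx !orbT.
have rA : r * A <= e / 2 by rewrite -ler_pdivlMr// !ge_min lexx !orbT.
(* The constant of [gap_bottom] times that of [barrier_bottom]: F is then nonnegative at time r. *)
pose b := K * E * r; have b0 : 0 <= b by rewrite !mulr_ge0// ltW.
(* The strict source of [parabolic_min]; it adds at most e / 2 by time t. *)
pose e' := e / (2 * t); have e'0 : 0 < e' by rewrite divr_gt0// mulr_gt0.
pose F x t := hk T 0 x t + M + b * (- gk 1 (tau r t) (x - c + r) + - gk 1 (tau r t) (d - x + r))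
  + e' * (t - r).
pose Fx x t := - hk T 1 x t + b * (- gk 2 (tau r t) (x - c + r) + gk 2 (tau r t) (d - x + r)).
pose Fxx x t := hk T 2 x t + b * (- gk 3 (tau r t) (x - c + r) + - gk 3 (tau r t) (d - x + r)).
pose Ft x t := t / 2 * hk T 2 x t + b * (- (t / 2 * gk 3 (tau r t) (x - c + r))
  + - (t / 2 * gk 3 (tau r t) (d - x + r))) + e'.
have [L1 L10 hL1] := hk_lip 0 hT r0; have [L2 L20 hL2] := @gk_lip 1 r r0.
have gpos x1 t1 : 0 <= x1 -> 0 <= - gk 1 (tau r t1) x1.
  by move=> h; rewrite oppr_ge0 gk1_le0// tau_gt0.
have hlip x1 x' t1 t' : c <= x1 <= d -> c <= x' <= d -> r <= t1 <= u -> r <= t' <= u ->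
    `|F x1 t1 - F x' t'| <= (L1 + 2 * b * L2 + e') * (`|x1 - x'| + `|t1 - t'|).
  move=> _ _ /andP[rt1 _] /andP[rt' _].
  have t10 : 0 <= t1 by apply: le_trans rt1; exact: ltW.
  have t'0 : 0 <= t' by apply: le_trans rt'; exact: ltW.
  have htau := tau_lip r0 t10 t'0.
  have tg v : r <= tau r v by apply: tau_ge_r; exact: ltW.
  have a1 := hL1 x1 x' t1 t' rt1 rt'.
  have a2 := hL2 (x1 - c + r) (x' - c + r) _ _ (tg t1) (tg t').
  have a3 := hL2 (d - x1 + r) (d - x' + r) _ _ (tg t1) (tg t').
  rewrite (_ : x1 - c + r - (x' - c + r) = x1 - x') in a2; last by ring.
  rewrite (_ : d - x1 + r - (d - x' + r) = - (x1 - x')) ?normrN in a3; last by ring.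
  pose D := `|x1 - x'| + `|t1 - t'|.
  have hD : `|x1 - x'| + `|tau r t1 - tau r t'| <= D by rewrite lerD2l.
  have b2 := le_trans a2 (ler_wpM2l L20 hD); have b3 := le_trans a3 (ler_wpM2l L20 hD).
  have b4 : `|e' * (t1 - t')| <= e' * D.
    by rewrite normrM gtr0_norm// ler_wpM2l ?(ltW e'0)// lerDr.
  rewrite -/D in a1 *.
  have -> : F x1 t1 - F x' t' = (hk T 0 x1 t1 - hk T 0 x' t')
    - b * (gk 1 (tau r t1) (x1 - c + r) - gk 1 (tau r t') (x' - c + r))
    - b * (gk 1 (tau r t1) (d - x1 + r) - gk 1 (tau r t') (d - x' + r)) + e' * (t1 - t').
    by rewrite /F; ring.
  have -> : (L1 + 2 * b * L2 + e') * D = L1 * D + b * (L2 * D) + b * (L2 * D) + e' * D by ring.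
  apply: le_trans (ler_normD _ _) _; apply: lerD => //.
  apply: le_trans (ler_normB _ _) _; apply: lerD; last first.
    by rewrite normrM ger0_norm// ler_wpM2l.
  apply: le_trans (ler_normB _ _) _; apply: lerD => //.
  by rewrite normrM ger0_norm// ler_wpM2l.
have aff1 k x1 t1 : is_derive x1 1 (fun v => gk k t1 (v - c + r)) (gk k.+1 t1 (x1 - c + r)).
  have h : is_derive x1 1 (fun v : R => v - c + r) 1.
    have -> : (fun v : R => v - c + r) = (fun v => 1 * v + (r - c)) by apply/funext => v; ring.
    exact: is_derive_affine.
  have := @is_derive1_comp _ (gk k t1) (fun v => v - c + r) x1 _ _ (is_derive_gk_u k t1 _) h.
  by rewrite mulr1.
have aff2 k x1 t1 : is_derive x1 1 (fun v => gk k t1 (d - v + r)) (- gk k.+1 t1 (d - x1 + r)).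
  have h : is_derive x1 1 (fun v : R => d - v + r) (-1).
    have -> : (fun v : R => d - v + r) = (fun v => (-1) * v + (d + r)) by apply/funext => v; ring.
    exact: is_derive_affine.
  have := @is_derive1_comp _ (gk k t1) (fun v => d - v + r) x1 _ _ (is_derive_gk_u k t1 _) h.
  by rewrite mulrN1.
have hFx x1 t1 : 0 < t1 -> is_derive x1 1 (F ^~ t1) (Fx x1 t1).
  move=> t10; rewrite /F.
  have h1 := is_derive_hk_x 0 x1 hT t10.
  have h2 := aff1 1%N x1 (tau r t1); have h3 := aff2 1%N x1 (tau r t1).
  by apply: is_derive_eq; rewrite /Fx /GRing.scale /=; ring.
have hFxx x1 t1 : 0 < t1 -> is_derive x1 1 (Fx ^~ t1) (Fxx x1 t1).
  move=> t10; rewrite /Fx.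
  have h1 := is_derive_hk_x 1 x1 hT t10.
  have h2 := aff1 2%N x1 (tau r t1); have h3 := aff2 2%N x1 (tau r t1).
  by apply: is_derive_eq; rewrite /Fxx /GRing.scale /=; ring.
have hFt x1 t1 : 0 < t1 -> is_derive t1 1 (F x1) (Ft x1 t1).
  move=> t10; rewrite /F.
  have h1 := is_derive_hk_t 0 x1 hT t10.
  have h2 := is_derive_gk_tau 1 t1 (x1 - c + r) r0.
  have h3 := is_derive_gk_tau 1 t1 (d - x1 + r) r0.
  by apply: is_derive_eq; rewrite /Ft /GRing.scale /=; ring.
have ru : r <= u by apply: le_trans tu.
have side x1 : c <= x1 <= d -> forall t1, r <= t1 ->
    0 <= b * (- gk 1 (tau r t1) (x1 - c + r) + - gk 1 (tau r t1) (d - x1 + r)) + e' * (t1 - r).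
  move=> /andP[h1 h2] t1 h3; apply: addr_ge0; last by rewrite mulr_ge0 ?subr_ge0// ltW.
  by rewrite mulr_ge0// addr_ge0// gpos// addr_ge0 ?subr_ge0// ltW.
have pF : 0 <= F x t.
  apply: (@parabolic_min _ F Fx Fxx Ft (L1 + 2 * b * L2 + e') c d r u e') => //.
  - exact: ltW.
  - by move=> x1 t1 t10; rewrite /Ft /Fxx; ring.
  - move=> t1 /andP[h1 h2]; have := side c; rewrite lexx (ltW cd) => /(_ isT t1 h1).
    have := hc t1; rewrite (lt_le_trans r0 h1) h2 => /(_ isT); rewrite /F; clear; lra.
  - move=> t1 /andP[h1 h2]; have := side d; rewrite lexx (ltW cd) => /(_ isT t1 h1).
    have := hd t1; rewrite (lt_le_trans r0 h1) h2 => /(_ isT); rewrite /F; clear; lra.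
  - move=> x1 /[dup] x1cd /andP[h1 h2].
    have r0h : 0 < r <= 2^-1 by rewrite r0 rh.
    have hb := hK r x1 r0h rcd x1cd.
    have s1 : 0 <= x1 - c by rewrite subr_ge0.
    have s2 : 0 <= d - x1 by rewrite subr_ge0.
    have b1 := ler_wpM2l K0 (barrier_bottom r0 s1).
    have b2 := ler_wpM2l K0 (barrier_bottom r0 s2).
    rewrite -/E in b1 b2; rewrite /F subrr mulr0 addr0.
    move: hb b1 b2; rewrite mulrDr.
    have -> : K * (E * r * - gk 1 (tau r r) (x1 - c + r)) = b * - gk 1 (tau r r) (x1 - c + r) by rewrite /b; ring.
    have -> : K * (E * r * - gk 1 (tau r r) (d - x1 + r)) = b * - gk 1 (tau r r) (d - x1 + r) by rewrite /b; ring.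
    rewrite mulrDr !mulrA; move: M0; clear; lra.
  - by rewrite rt tu.
have bnd u1 : - gk 1 (tau r t) u1 <= C * t ^- 2.
  apply: le_trans (ler_norm _) _; rewrite normrN.
  apply: le_trans (hC 1%N _ u1 isT (tau_gt0 t r0)) _.
  by rewrite ler_wpM2l//; apply: invrX_le => //; apply: tau_ge; exact: ltW.
have q1 := ler_wpM2l b0 (bnd (x - c + r)); have q2 := ler_wpM2l b0 (bnd (d - x + r)).
have q3 : b * (C * t ^- 2) + b * (C * t ^- 2) <= e / 2.
  apply: le_trans rA; have -> : b * (C * t ^- 2) + b * (C * t ^- 2) = r * (2 * (K * E) * (C * t ^- 2)).
    by rewrite /b; ring.
  by rewrite ler_wpM2l ?(ltW r0)// /A lerDl.
have q4 : e' * (t - r) <= e / 2.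
  have -> : e / 2 = e' * t by rewrite /e'; field; rewrite gt_eqF.
  by rewrite ler_wpM2l ?(ltW e'0)// gerBl ltW.
move: pF q1 q2 q3 q4; rewrite /F mulrDr; clear; lra.
Qed.

End GapBound.

(** * Positive functionals *)
Section Locality.
Context {R : realType}.
Implicit Types (f g : R -> R) (n k m j N : nat) (x y z h e c B r d q t u s M L : R) (T : (R -> R) -> R).

(** The ratio 2/3 leaves room for two overlapping pieces, as a smooth partition requires; the stage
    n is for Baire's theorem, where stage n avoids the first n sets. *)
Lemma nested_intervals (Q : nat -> R -> R -> Prop) (a0 b0 : R) :
  (forall n a b, a < b -> Q n a b -> exists a' b', [/\ a <= a', a' < b', b' <= b,
    b' - a' <= 2 / 3 * (b - a) & Q n.+1 a' b']) ->
  a0 < b0 -> Q 0%N a0 b0 ->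
  exists x, exists a b : nat -> R, a0 <= x <= b0 /\ forall n, [/\ a n <= x <= b n,
    a n < b n, b n - a n <= (2 / 3) ^+ n * (b0 - a0) & Q n (a n) (b n)].
Proof.
move=> hQ ab0 Q0; pose st n := {p : R * R | p.1 < p.2 /\ Q n p.1 p.2}.
have next n (s : st n) : {s' : st n.+1 | [/\ (sval s).1 <= (sval s').1,
    (sval s').2 <= (sval s).2 &
    (sval s').2 - (sval s').1 <= 2 / 3 * ((sval s).2 - (sval s).1)]}.
  apply: cid; case: s => -[a b] /= [ab Qab].
  have [a' [b' [h1 h2 h3 h4 h5]]] := hQ n a b ab Qab.
  by exists (exist _ (a', b') (conj h2 h5)).
pose sq := fix sq n : st n := if n is n'.+1 return st n then sval (next n' (sq n'))
  else exist _ (a0, b0) (conj ab0 Q0).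
pose a n := (sval (sq n)).1; pose b n := (sval (sq n)).2.
have sS n : [/\ a n <= a n.+1, b n.+1 <= b n & b n.+1 - a n.+1 <= 2 / 3 * (b n - a n)].
  by rewrite /a /b /=; case: (next n (sq n)).
have ab n : a n < b n by rewrite /a /b; case: (sq n) => p [].
have Qn n : Q n (a n) (b n) by rewrite /a /b; case: (sq n) => p [].
have am k m : (k <= m)%N -> a k <= a m.
  by move=> /subnK <-; elim: (m - k)%N => // i IH; apply: le_trans IH _; case: (sS (i + k)%N).
have bm k m : (k <= m)%N -> b m <= b k.
  by move=> /subnK <-; elim: (m - k)%N => // i IH; apply: le_trans IH; case: (sS (i + k)%N).
have amb k m : a k <= b m.
  have [km|/ltnW mk] := leqP k m.
    exact: le_trans (am _ _ km) (ltW (ab m)).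
  exact: le_trans (ltW (ab k)) (bm _ _ mk).
have len n : b n - a n <= (2 / 3) ^+ n * (b0 - a0).
  elim: n => [|n IH]; first by rewrite expr0 mul1r.
  have [_ _ h] := sS n; apply: le_trans h _.
  by rewrite exprS -[leRHS]mulrA ler_wpM2l// divr_ge0.
have ne : range a !=set0 by exists (a 0%N); exists 0%N.
pose x := sup (range a).
have hx n : a n <= x <= b n.
  apply/andP; split.
    apply: sup_upper_bound; last by exists n.
    by split=> //; exists (b 0%N) => _ [k _ <-]; exact: amb.
  by apply: ge_sup => // _ [k _ <-]; exact: amb.
exists x, a, b; split; first exact: (hx 0%N).
by move=> n; split.
Qed.

Lemma nested_small (b0 e : R) : 0 <= b0 -> 0 < e -> exists n, (2 / 3) ^+ n * b0 < e.
Proof.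
move=> b00 e0; have q : 0 <= (2 / 3 : R) < 1 by apply/andP; split; lra.
have K0 : 0 < b0 + 1 by rewrite ltr_wpDl.
have e0' : 0 < e / (b0 + 1) / 2 by rewrite !divr_gt0.
have [n hn] := geo_small q e0'; exists n.
apply: (@le_lt_trans _ _ (e / (b0 + 1) / 2 * (b0 + 1))).
  have p : 0 <= (2 / 3 : R) ^+ n by rewrite exprn_ge0// divr_ge0.
  by rewrite (ler_pM p b00 (hn n (leqnn n)))// lerDl.
have -> : e / (b0 + 1) / 2 * (b0 + 1) = e / 2 by field; rewrite gt_eqF.
by move: e0; clear; lra.
Qed.

Lemma supp_in_mull A B f g : supp_in A B f -> supp_in A B (fun y => f y * g y).
Proof. by move=> h y hy; apply: h; apply: contraNN hy => /eqP ->; rewrite mul0r. Qed.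

Lemma supp_in_mulr A B f g : supp_in A B g -> supp_in A B (fun y => f y * g y).
Proof. by move=> h y hy; apply: h; apply: contraNN hy => /eqP ->; rewrite mulr0. Qed.

(* Otherwise the functional is negative on some f * theta with theta supported
   in an interval two thirds as long, and so on down to a point. *)
Lemma local_sign T f (A B : R) : edist T -> sm f -> supp_in A B f ->
  (forall x, A <= x <= B -> exists2 e, 0 < e & forall g, sm g -> (forall y, 0 <= g y) ->
    supp_in (x - e) (x + e) g -> 0 <= T (fun y => f y * g y)) -> 0 <= T f.
Proof.
move=> hT sf pf hx; rewrite leNgt; apply/negP => neg.
have hx' x : exists2 e, 0 < e & forall g, sm g -> (forall y, 0 <= g y) ->
    supp_in (x - e) (x + e) g -> 0 <= T (fun y => f y * g y).
  have [/hx //|/negP nx] := boolP (A <= x <= B).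
  have [e e0 he] : exists2 e, 0 < e & forall z, `|z - x| <= e -> ~ (A <= z <= B).
    move/negP: nx; rewrite negb_and -!ltNge => /orP[] h.
      exists ((A - x) / 2); first by rewrite divr_gt0// subr_gt0.
      move=> z hz /andP[z1 _]; have := ler_norm (z - x); move: hz z1 h; clear; lra.
    exists ((x - B) / 2); first by rewrite divr_gt0// subr_gt0.
    by move=> z hz /andP[_ z1]; have := ler_norm (x - z); rewrite distrC; move: hz z1 h; clear; lra.
  exists e => // g sg g0 pg.
  have -> : (fun y => f y * g y) = fun=> 0.
    apply/funext => y; have [->|/pg /andP[y1 y2]] := eqVneq (g y) 0; first by rewrite mulr0.
    rewrite (supp_in_eq0 pf) ?mul0r//; apply: he; rewrite ler_norml; apply/andP.
    by move: y1 y2; clear => *; split; lra.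
  by rewrite ed0.
pose Q (n : nat) a b := exists g, [/\ sm g, forall y, 0 <= g y, supp_in a b g &
  T (fun y => f y * g y) < 0].
have step_ n a b : a < b -> Q n a b -> exists a' b', [/\ a <= a', a' < b', b' <= b,
    b' - a' <= 2 / 3 * (b - a) & Q n.+1 a' b'].
  move=> ab [g [sg g0 pg ng]]; pose l := (b - a) / 3.
  have l0 : 0 < l by rewrite divr_gt0// subr_gt0.
  (* The transition takes place in the middle third, so g (1 - s) and g s live in the first and the
     last two thirds; T is negative on one of them. *)
  pose s := sc (a + l) l (@step R).
  have ss : sm s by apply: smooth_sc; exact: smooth_step.
  have s1' : sm (fun y => 1 - s y) by apply: smooth_sub => //; exact: smooth_cst.
  have p1 : supp_in a (a + 2 * l) (fun y => g y * (1 - s y)).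
    move=> y hy; apply/andP; split.
      by have /pg /andP[] : g y != 0 by apply: contraNN hy => /eqP ->; rewrite mul0r.
    rewrite leNgt; apply: contraNN hy => hy; rewrite /s /sc step1 ?subrr ?mulr0//.
    by rewrite ler_pdivlMr//; move: hy; clear; lra.
  have p2 : supp_in (a + l) b (fun y => g y * s y).
    move=> y hy; apply/andP; split; last first.
      by have /pg /andP[] : g y != 0 by apply: contraNN hy => /eqP ->; rewrite mul0r.
    rewrite leNgt; apply: contraNN hy => hy; rewrite /s /sc step0 ?mulr0//.
    by rewrite ler_pdivrMr// mul0r; move: hy; clear; lra.
  have sg1 : sm (fun y => g y * (1 - s y)) by exact: smooth_mul.
  have sg2 : sm (fun y => g y * s y) by exact: smooth_mul.
  have hsum : T (fun y => f y * g y)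
      = T (fun y => f y * (g y * (1 - s y))) + T (fun y => f y * (g y * s y)).
    rewrite -ed_add//; [|exact: smooth_mul..].
    by congr T; apply/funext => y; ring.
  have lE : 3 * l = b - a by rewrite /l; field.
  have [h1|h1] := ltP (T (fun y => f y * (g y * (1 - s y)))) 0.
    exists a, (a + 2 * l); split => //; try (by move: l0 lE; clear; lra).
    by exists (fun y => g y * (1 - s y)); split=> // y; rewrite mulr_ge0// subr_ge0 step_le1.
  exists (a + l), b; split => //; try (by move: l0 lE; clear; lra).
  exists (fun y => g y * s y); split=> // [y|]; first by rewrite mulr_ge0// step_ge0.
  by move: ng; rewrite hsum; move: h1; clear; lra.
pose a0 := Num.min A B - 1; pose b0 := Num.max A B + 1.
have ab0 : a0 < b0.
  rewrite /a0 /b0; have : Num.min A B <= Num.max A B by rewrite ge_min !le_max lexx.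
  by clear; lra.
have Q0 : Q 0%N a0 b0.
  exists (plateau (Num.min A B) (Num.max A B) 1); split.
  - exact: smooth_plateau.
  - exact: plateau_ge0.
  - exact: supp_plateau.
  rewrite (_ : (fun y => _) = f)//; apply/funext => y.
  have [->|/pf /andP[y1 y2]] := eqVneq (f y) 0; first by rewrite mul0r.
  by rewrite plateau1 ?mulr1// ge_min le_max y1 y2 orbT.
have [x [a [b [_ hab]]]] := nested_intervals step_ ab0 Q0.
have [e e0 he] := hx' x.
have ab0' : 0 <= b0 - a0 by rewrite subr_ge0 ltW.
have [n hn] := nested_small ab0' e0.
have [/andP[ax xb] ab len [g [sg g0 pg]]] := hab n.
rewrite ltNge he//; apply: supp_in_le pg.
  by move: ax xb ab (le_lt_trans len hn); clear; lra.
by move: ax xb ab (le_lt_trans len hn); clear; lra.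
Qed.

Definition pos_near T x := exists2 e, 0 < e & pos_on T (x - e) (x + e).

Lemma pos_local T c d : edist T -> (forall x, c < x < d -> pos_near T x) -> pos_on T c d.
Proof.
move=> hT hx f c' d' sf f0 cc dd pf; apply: (local_sign hT sf pf) => x /andP[x1 x2].
have [e e0 he] := hx x ltac:(by rewrite (lt_le_trans cc x1) (le_lt_trans x2 dd)).
exists (e / 2); first by rewrite divr_gt0.
move=> g sg g0 pg; apply: (he _ (x - e / 2) (x + e / 2)).
- exact: smooth_mul.
- by move=> y; rewrite mulr_ge0.
- by move: e0; clear; lra.
- by move: e0; clear; lra.
- exact: supp_in_mulr.
Qed.

Lemma pos_onW T c d c' d' : c <= c' -> d' <= d -> pos_on T c d -> pos_on T c' d'.
Proof.
move=> cc dd h f a b sf f0 h1 h2 pf; apply: (h f a b) => //.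
  exact: le_lt_trans h1.
exact: lt_le_trans dd.
Qed.

Lemma pos_on_near T c d x : pos_on T c d -> c < x < d -> pos_near T x.
Proof.
move=> h /andP[cx xd]; exists (Num.min (x - c) (d - x)); first by rewrite lt_min !subr_gt0 cx.
apply: pos_onW h.
  have : Num.min (x - c) (d - x) <= x - c by rewrite ge_min lexx.
  by clear; lra.
have : Num.min (x - c) (d - x) <= d - x by rewrite ge_min lexx orbT.
by clear; lra.
Qed.

Lemma gk0_ge0 t u : 0 < t -> 0 <= gk 0 t u.
Proof.
move=> t0; apply: mulr_ge0; last exact: expR_ge0.
by rewrite invr_ge0 exprn_ge0// ltW.
Qed.

(** Off the centre the Gaussian is smaller than any power of t: of N + 2 powers, at most N + 1 pay
    for the factor t ^ -(k + 1) of the k-th derivative and one is left. *)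
Lemma gk_far N r : 0 < r -> exists2 D, 0 <= D & forall t, 0 < t <= 1 ->
  dbound N [set w | 4^-1 <= `|w|] (D * t) (fun w => gk 0 t (r * w)).
Proof.
move=> r0; have hg : exists2 C, 0 <= C & forall k z, (k <= N)%N -> `|dn k gam z| <= C * expR (- (z ^+ 2 / 2)).
  elim: N => [|N [C C0 hC]].
    by have [C C0 hC] := @gam_bound R 0; exists C => // -[|k] z.
  have [D D0 hD] := @gam_bound R N.+1; exists (C + D); first exact: addr_ge0.
  move=> k z; rewrite leq_eqVlt => /orP[/eqP ->|kN].
    by apply: le_trans (hD z) _; rewrite ler_wpM2r ?expR_ge0// lerDr.
  by apply: le_trans (hC k z kN) _; rewrite ler_wpM2r ?expR_ge0// lerDl.
have [C C0 hC] := hg; have [P P0 hP] := @poly_le_gauss R N.+2.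
pose v := 4 / r; pose w1 := 1 + r.
have v0 : 0 < v by rewrite divr_gt0.
have w10 : 1 <= w1 by rewrite lerDl ltW.
have w1p : 0 <= w1 by apply: le_trans w10.
have vp : 0 <= v ^+ N.+2 by rewrite exprn_ge0// ltW.
exists (w1 ^+ N * (C * P * v ^+ N.+2)).
  by apply: mulr_ge0; [exact: exprn_ge0|exact: mulr_ge0 (mulr_ge0 C0 P0) vp].
move=> t /andP[t0 t1]; apply/dboundP => k w kN /= hw.
have -> : (fun w => gk 0 t (r * w)) = (fun w => (fun u => gk 0 t (u - 0)) (r * w + 0)).
  by apply/funext => y; rewrite addr0 subr0.
rewrite (dn_comp_affine r 0 k (smooth_gk 0 t 0)).
rewrite dn_gk addn0 subr0 addr0 normrM normrX (gtr0_norm r0) -[leRHS]mulrA.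
apply: ler_pM; rewrite ?exprn_ge0 ?(ltW r0)//.
  apply: le_trans (_ : w1 ^+ k <= _); last exact: (ler_weXn2l w10).
  by apply: lerXn2r; rewrite ?nnegrE ?(ltW r0) ?(le_trans ler01 w10)// lerDr.
rewrite /gk normrM ger0_norm ?invr_ge0 ?exprn_ge0 ?(ltW t0)//.
pose z := r * w / t; have hz : (v * t)^-1 <= `|z|.
  rewrite /z !normrM normfV (gtr0_norm r0) (gtr0_norm t0) invfM.
  by rewrite ler_pM2r ?invr_gt0// /v invf_div -[_ / 4]/(r * 4^-1) ler_pM2l.
have vt0 : 0 < v * t by rewrite mulr_gt0.
have hE : expR (- (z ^+ 2 / 2)) <= P * (v * t) ^+ N.+2.
  rewrite expRN -[leLHS]mul1r ler_pdivrMr ?expR_gt0//.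
  have := hP z => /(le_trans _) h.
  have : (v * t) ^- N.+2 <= P * expR (z ^+ 2 / 2).
    apply: h; rewrite -exprVn; apply: lerXn2r; rewrite ?nnegrE ?invr_ge0 ?(ltW vt0) ?addr_ge0//.
    by apply: le_trans hz _; rewrite lerDr.
  by rewrite -[leLHS]mul1r ler_pdivrMr ?exprn_gt0// mulrAC.
rewrite -/z; apply: (@le_trans _ _ (t ^- k.+1 * (C * (P * (v * t) ^+ N.+2)))).
  rewrite ler_wpM2l ?invr_ge0 ?exprn_ge0 ?(ltW t0)//; apply: le_trans (hC k z kN) _.
  by rewrite ler_wpM2l.
rewrite exprMn.
have -> : t ^- k.+1 * (C * (P * (v ^+ N.+2 * t ^+ N.+2)))
  = C * P * v ^+ N.+2 * (t ^- k.+1 * t ^+ N.+2) by ring.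
apply: ler_wpM2l; first exact: mulr_ge0 (mulr_ge0 C0 P0) vp.
rewrite mulrC ler_pdivrMr ?exprn_gt0// -exprS.
by apply: ler_wiXn2l => //; exact: ltW.
Qed.

(** The Gaussian is cut into a part near x, on which T is nonnegative, and a far part, on which T is
    O(t) by [gk_far]. *)
Lemma hk_ge_near T x e : edist T -> pos_near T x -> 0 < e ->
  exists2 u, 0 < u & forall t, 0 < t <= u -> - e <= hk T 0 x t.
Proof.
move=> hT [r1 r10 hr1] e0; pose r := Num.min r1 1 / 2.
have mr : 0 < Num.min r1 1 by rewrite lt_min r10 ltr01.
have r0 : 0 < r by rewrite divr_gt0.
have rr1 : r < r1.
  have : Num.min r1 1 <= r1 by rewrite ge_min lexx.
  by rewrite /r; move: mr; clear; lra.
have r1' : r <= 1.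
  have : Num.min r1 1 <= 1 by rewrite ge_min lexx orbT.
  by rewrite /r; move: mr; clear; lra.
have [N [C [C0 hC]]] := ed_sc_bound x hT.
have [D D0 hD] := gk_far N r0; have [M M0 hM] := @dbound_chi R N 2.
pose cut (w : R) := 1 - chi (2 * w).
have scut : sm cut by apply: smooth_sub; [exact: smooth_cst|exact: smooth_scaled_chi].
have bcu : dbound N setT (1 + M) cut.
  apply: dbound_sub => //; [exact: smooth_cst|exact: smooth_scaled_chi|].
  by apply/dboundP => -[|k] y _ _; rewrite ?dn_cst ?normr0 ?normr1.
have cu0 w : `|w| < 4^-1 -> cut w = 0.
  by move=> hw; rewrite /cut chi1 ?subrr// normrM ger0_norm//; move: hw; clear; lra.
pose K := C * (r ^- N * (2 ^+ N * (D * (1 + M)))) + 1.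
have K0 : 0 < K.
  by rewrite ltr_wpDl// !mulr_ge0 ?invr_ge0 ?exprn_ge0 ?addr_ge0// ltW.
exists (Num.min 1 (e / K)); first by rewrite lt_min ltr01 divr_gt0.
move=> t /andP[t0]; rewrite le_min => /andP[t1 te].
have sw : sm (fun w => gk 0 t (r * w)).
  have -> : (fun w => gk 0 t (r * w)) = (fun w => (fun u => gk 0 t (u - 0)) (r * w + 0)).
    by apply/funext => y; rewrite addr0 subr0.
  exact: (smooth_comp_affine r 0 (smooth_gk 0 t 0)).
pose P w := gk 0 t (r * w) * cut w; have sP : sm P by exact: smooth_mul.
have t01 : 0 < t <= 1 by rewrite t0 t1.
have bP : dbound N setT (2 ^+ N * (D * t * (1 + M))) P.
  apply: dbound_annulus => //; [by rewrite mulr_ge0// ltW|by rewrite addr_ge0|exact: hD].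
have b0 : 0 <= 2 ^+ N * (D * t * (1 + M)).
  by rewrite !mulr_ge0 ?exprn_ge0 ?addr_ge0// ltW.
have r01 : 0 < r <= 1 by rewrite r0 r1'.
have h1 := hC P _ r sP r01 b0 bP.
pose Q y := gk 0 t (y - x) * chi (2 * ((y - x) / r)).
have sQ : sm Q.
  apply: smooth_mul; first exact: smooth_gk.
  exact: (smooth_sc x r (smooth_scaled_chi 2)).
have hQ : 0 <= T Q.
  apply: (hr1 _ (x - r) (x + r)) => //.
  - by move=> y; apply: mulr_ge0; [exact: gk0_ge0|exact: chi_ge0].
  - by move: rr1; clear; lra.
  - by move: rr1; clear; lra.
  - have := @supp_sc R x r (fun w => chi (2 * w)) r0; move=> h y hy; apply: h.
      move=> w hw; have /andP := supp_chi hw; clear => -[*]; apply/andP; split; lra.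
    by rewrite /sc; apply: contraNN hy => /eqP; rewrite /Q => ->; rewrite mulr0.
have -> : hk T 0 x t = T Q + T (sc x r P).
  rewrite -ed_add//; last exact: smooth_sc.
  congr T; apply/funext => y; rewrite /Q /sc /P /cut.
  have -> : r * ((y - x) / r) = y - x by field; rewrite gt_eqF.
  ring.
have h2 : `|T (sc x r P)| <= e.
  apply: le_trans h1 _; apply: (@le_trans _ _ (K * t)).
    have -> : C * (r ^- N * (2 ^+ N * (D * t * (1 + M))))
      = C * (r ^- N * (2 ^+ N * (D * (1 + M)))) * t by ring.
    by rewrite ler_wpM2r ?(ltW t0)// lerDl.
  by rewrite mulrC -ler_pdivlMr.
by move: h2 hQ => /ler_normlP[h2 _]; move: h2; clear; lra.
Qed.

End Locality.

(** * Primitives and convolution with Gaussians *)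

Section Recovery.
Context {R : realType}.
Implicit Types (f g : R -> R) (n k m j N : nat) (x y z h e c v w B r d q t u s M L : R) (T : (R -> R) -> R).
Local Notation mu := (@lebesgue_measure R).

Lemma integrable_segment g (a b : R) : continuous g -> mu.-integrable `[a, b] (EFin \o g).
Proof.
move=> cg; apply: continuous_compact_integrable; first exact: segment_compact.
exact: continuous_subspaceT.
Qed.

Lemma antiderivative_ray g (a : R) : continuous g -> a < 0 ->
  exists2 G : R -> R, G 0 = 0 & forall z, a < z -> is_derive z 1 G (g z).
Proof.
move=> cg a0; pose F x := (\int[mu]_(v in `[a, x]) g v)%R.
have hF z : a < z -> is_derive z 1 F (g z).
  move=> az; have zu : z < z + 1 by rewrite ltrDl.
  have [dF eF] := @continuous_FTC1_closed R g a z (z + 1) zu (integrable_segment _ _ cg) az (cg z).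
  by rewrite -eF derive1E; exact/derivableP.
exists (fun z => F z - F 0) => [|z /hF hz]; first by rewrite subrr.
by have h2 := is_derive_cst (F 0) z (1 : R); have := is_deriveB hz h2; rewrite subr0.
Qed.

(** Integration from a gives a primitive only to the right of a. Those on the rays beyond -1, -2,
    ..., normalized at 0, agree where they are both defined and are glued. *)
Lemma antiderivative g : continuous g ->
  exists2 G : R -> R, G 0 = 0 & forall z, is_derive z 1 G (g z).
Proof.
move=> cg.
have /choice[G hG] : forall n, exists G : R -> R, G 0 = 0 /\
    forall z, - n.+1%:R < z -> is_derive z 1 G (g z).
  move=> n; have n0 : - n.+1%:R < 0 :> R by rewrite oppr_lt0.
  by have [G G0 hG] := antiderivative_ray cg n0; exists G.
have uniq n m z : - n.+1%:R < z -> - m.+1%:R < z -> G n z = G m z.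
  move=> nz mz; have [Gn0 dn] := hG n; have [Gm0 dm] := hG m.
  have h1 w : Num.min 0 z <= w <= Num.max 0 z -> is_derive w 1 (fun v => G n v - G m v) 0.
    move=> /andP[w1 _]; have mn : forall p : nat, - p.+1%:R < z -> - p.+1%:R < w.
      move=> p pz; apply: lt_le_trans w1; rewrite lt_min pz andbT oppr_lt0 ltr0n//.
    by have := is_deriveB (dn w (mn _ nz)) (dm w (mn _ mz)); rewrite subrr.
  have := @mvt_local _ (fun v => G n v - G m v) (fun=> 0) 0 0 z h1 (fun _ _ => ltac:(by rewrite normr0)).
  rewrite Gn0 Gm0 subrr subr0 mul0r normr_le0 subr_eq0 => /eqP //.
pose i z := Num.bound `|z|.
have iz z : - (i z).+1%:R < z.
  rewrite ltrNl; apply: le_lt_trans (ler_norm _) _; rewrite normrN.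
  by apply: lt_trans (archi_boundP (normr_ge0 z)) _; rewrite ltr_nat.
exists (fun z => G (i z) z) => [|z]; first by case: (hG (i 0)).
pose m := (i z).+1.
have mz w : `|w| < 1 -> - m.+1%:R < z + w.
  move=> w1; have := iz z; rewrite /m -(natr1 (i z).+1).
  by have := ler_norm (- w); rewrite normrN; move: w1; clear; lra.
have mz0 : - m.+1%:R < z by have := mz 0; rewrite normr0 addr0 ltr01; exact.
have /is_derive_eps hd := (hG m).2 z mz0.
apply/is_derive_eps => e e0; have [d d0 h] := hd e e0.
exists (Num.min d 1); first by rewrite lt_min d0 ltr01.
move=> w; rewrite lt_min => /andP[wd w1].
by rewrite (uniq _ m _ (iz _) (mz w w1)) (uniq _ m _ (iz z) mz0); exact: h.
Qed.

Lemma integral_antiderivative g (G : R -> R) (a b : R) : a < b -> continuous g ->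
  (forall z, is_derive z 1 G (g z)) ->
  (\int[mu]_(x in `[a, b]) (g x)%:E = (G b - G a)%:E)%E.
Proof.
move=> ab cg dG.
have cG z : {for z, continuous G}.
  apply/differentiable_continuous/derivable1_diffP; have := dG z => ?; exact: ex_derive.
rewrite EFinB; apply: continuous_FTC2 => //.
- exact: continuous_subspaceT.
- split=> [z _||]; first by have := dG z => ?; exact: ex_derive.
  + by apply: cvg_at_right_filter; exact: cG.
  + by apply: cvg_at_left_filter; exact: cG.
- by move=> z _; rewrite derive1E; have := dG z => ?; exact: derive_val.
Qed.

Lemma compare_derivs (F S : R -> R) (f s : R -> R) (a b : R) : a <= b ->
  (forall z, is_derive z 1 F (f z)) -> (forall z, is_derive z 1 S (s z)) ->
  (forall z, `|f z| <= s z) -> `|F b - F a| <= S b - S a.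
Proof.
move=> ab hF hS hfs.
have mono (G : R -> R) (g' : R -> R) : (forall z, is_derive z 1 G (g' z)) ->
    (forall z, 0 <= g' z) -> 0 <= G b - G a.
  move=> hG g0; have hc : {within `[a, b], continuous G}.
    by apply: derivable_within_continuous => z _; have := hG z => ?; exact: ex_derive.
  have [c _ ->] := @MVT_segment R G g' a b ab (fun z _ => hG z) hc.
  by rewrite mulr_ge0// subr_ge0.
have h1 : 0 <= (S b - F b) - (S a - F a).
  apply: (mono (fun z => S z - F z) _ (fun z => is_deriveB (hS z) (hF z))) => z.
  by rewrite subr_ge0 (le_trans (ler_norm _) (hfs z)).
have h2 : 0 <= (S b + F b) - (S a + F a).
  apply: (mono (fun z => S z + F z) _ (fun z => is_deriveD (hS z) (hF z))) => z.
  rewrite -[f z]opprK subr_ge0; apply: le_trans (ler_norm _) _; by rewrite normrN.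
by rewrite ler_norml; apply/andP; move: h1 h2; clear => h1 h2; split; lra.
Qed.

(** Comparison with the derivative of atan bounds primitives of v -> |v| gam v and of gam by
    explicit functions. *)
Lemma gam_atan : exists2 C, 0 <= C & forall v : R, (1 + `|v|) * gam v <= C * (1 + v ^+ 2)^-1.
Proof.
have [C C0 hC] := @poly_le_gauss R 3; exists C => // v.
have p0 : 0 < 1 + v ^+ 2 by rewrite ltr_wpDr ?sqr_ge0.
rewrite ler_pdivlMr// /gam expRN mulrAC ler_pdivrMr ?expR_gt0//.
apply: le_trans (_ : (1 + `|v|) ^+ 3 <= _).
  rewrite -[v ^+ 2]real_normK ?num_real// (exprS (1 + `|v|) 2) ler_wpM2l ?addr_ge0//.
  by have := normr_ge0 v; move: (`|v|) => w w0; rewrite !expr2; clear -w0; nra.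
apply: le_trans (hC v) _; rewrite ler_wpM2l// ler_expR.
by have := sqr_ge0 v; clear; lra.
Qed.

(* E is a primitive of the Gaussian, ka half of its total mass. *)
Lemma gauss_primitive : exists E : R -> R, exists2 ka : R, 0 < ka &
  [/\ forall v, is_derive v 1 E (gam v), forall v, E (- v) = - E v &
      forall e, 0 < e -> exists2 V, 0 < V & forall v, V <= v -> `|E v - ka| <= e].
Proof.
have [E E0 hE] := antiderivative (smooth_continuous (@smooth_gam R)).
have [C C0 hC] := gam_atan.
have mono a b : a <= b -> E a <= E b.
  move=> ab; have hc : {within `[a, b], continuous E}.
    by apply: derivable_within_continuous => z _; have := hE z => ?; exact: ex_derive.
  rewrite -subr_ge0; have [c _ ->] := @MVT_segment R E gam a b ab (fun z _ => hE z) hc.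
  by rewrite mulr_ge0 ?subr_ge0// expR_ge0.
have hat z : is_derive z 1 (fun v : R => C * atan v) (C * (1 + z ^+ 2)^-1).
  by have := is_deriveZ C (is_derive1_atan z); rewrite /GRing.scale /=.
have ub v : 0 <= v -> E v <= C * (pi / 2).
  move=> v0; have h z : `|gam z| <= C * (1 + z ^+ 2)^-1.
    rewrite ger0_norm ?expR_ge0//; apply: le_trans (hC z).
    by rewrite ler_peMl ?expR_ge0// lerDl.
  have := compare_derivs v0 hE hat h; rewrite E0 subr0 atan0 mulr0 subr0 => h'.
  apply: le_trans (ler_norm _) (le_trans h' _).
  by rewrite ler_wpM2l// ltW// atan_ltpi2.
pose A := [set E v | v in [set v | 0 <= v]]; pose ka := sup A.
have hA : has_sup A.
  split; first by exists (E 0), 0 => /=.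
  by exists (C * (pi / 2)) => _ [v v0 <-]; exact: ub.
have leka v : 0 <= v -> E v <= ka.
  by move=> v0; apply: sup_upper_bound => //; exists v.
exists E, ka.
  apply: lt_le_trans (leka 1 ler01); rewrite -E0 -subr_gt0.
  have hc : {within `[0, 1], continuous E}.
    by apply: derivable_within_continuous => z _; have := hE z => ?; exact: ex_derive.
  have [c _ ->] := @MVT_segment R E gam 0 1 ler01 (fun z _ => hE z) hc.
  by rewrite subr0 mulr1 expR_gt0.
split=> // [v|e e0].
  have h1 z : is_derive z 1 (fun w => E (- w)) (- gam z).
    have hN : is_derive z 1 (fun w : R => - w) (-1 : R).
      by have := is_derive_affine (-1 : R) 0 z; under eq_fun do rewrite mulN1r addr0.
    have := @is_derive1_comp _ E (fun w => - w) z _ _ (hE (- z)) hN.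
    by rewrite mulrN1 /gam sqrrN.
  have h2 z : is_derive z 1 (fun w => E (- w) + E w) 0.
    by have := is_deriveD (h1 z) (hE z); rewrite addNr.
  have z0 : `|0 : R| <= 0 by rewrite normr0.
  have := mvt_bound h2 (fun _ _ => z0) => /(_ 0 v).
  rewrite oppr0 E0 addr0 subr0 mul0r normr_le0 addr_eq0 => /eqP //.
have [_ [V V0 <-] hV] := sup_adherent e0 hA.
exists (V + 1); first by rewrite ltr_wpDl.
move=> v Vv; have Vv' : V <= v by apply: le_trans Vv; rewrite lerDl.
have v0 := le_trans V0 Vv'.
rewrite ler0_norm ?subr_le0 ?leka// opprB.
by move: (mono _ _ Vv') hV; rewrite -/ka; clear; lra.
Qed.

Lemma unit_ball_itv z v : `|v - z| <= 1 -> z - 1 <= v <= z + 1.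
Proof. by rewrite ler_norml => /andP[]; clear => *; apply/andP; split; lra. Qed.

(** * Convolutions: [G j k y z] stands for the integral of [dn j theta w * gk k t (y - w)] in w from
    A to z *)

Section ConvolutionFamily.
Context (theta : R -> R) (t : R) (A : R) (G : nat -> nat -> R -> R -> R)
  (sth : sm theta) (t0 : 0 < t) (G0 : forall j k y, G j k y A = 0)
  (dG : forall j k y z, is_derive z 1 (G j k y) (dn j theta z * gk k t (y - z))).

(** Differentiation in y under the integral: the Taylor remainder of the kernel is O(h ^ 2)
    uniformly for w between A and z, and integrating it multiplies it by |z - A| at most. *)
Lemma conv_smooth j z : sm (fun y => G j 0 y z) /\
  forall k, dn k (fun y => G j 0 y z) = fun y => G j k y z.
Proof using sth t0 G0 dG.
apply: (@smooth_family R (fun k y => G j k y z)) => k y.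
have [C C0 hC] := @gk_bound R k.+2.
have [M M0 [hM _]] := dbound_segment 0 (Num.min A z) (Num.max A z) (smooth_dn j sth).
pose K := M * (C * t ^- k.+3) * `|z - A| + 1.
have K0 : 0 < K.
  by rewrite ltr_wpDl// !mulr_ge0// invr_ge0 exprn_ge0// ltW.
apply/is_derive_eps => e e0; exists (e / K); first by rewrite divr_gt0.
move=> h hh.
have hD w : is_derive w 1 (fun v => G j k (y + h) v - G j k y v - h * G j k.+1 y v)
    (dn j theta w * (gk k t (y - w + h) - gk k t (y - w) - h * gk k.+1 t (y - w))).
  have d1 := dG j k (y + h) w; have d2 := dG j k y w; have d3 := dG j k.+1 y w.
  apply: is_derive_eq; rewrite /GRing.scale /=.
  rewrite (_ : y + h - w = y - w + h); last by ring.
  by ring.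
have hb w : Num.min A z <= w <= Num.max A z ->
    `|dn j theta w * (gk k t (y - w + h) - gk k t (y - w) - h * gk k.+1 t (y - w))|
    <= M * (C * t ^- k.+3 * h ^+ 2).
  move=> hw; rewrite normrM; apply: ler_pM => //; first exact: hM.
  apply: (@taylor2 _ (gk k t) (gk k.+1 t) (gk k.+2 t)) => v _.
  - exact: is_derive_gk_u.
  - exact: is_derive_gk_u.
  - exact: hC.
have := mvt_bound hD hb; rewrite !G0 mulr0 !subr0 => /le_trans; apply.
have -> : M * (C * t ^- k.+3 * h ^+ 2) * `|z - A| = M * (C * t ^- k.+3) * `|z - A| * `|h| * `|h|.
  by rewrite -[h ^+ 2]real_normK ?num_real//; ring.
rewrite ler_wpM2r//; apply: (@le_trans _ _ (K * `|h|)).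
  by rewrite ler_wpM2r// lerDl.
by rewrite mulrC -ler_pdivlMr// ltW.
Qed.

(** The interchange of T with the integral, in differentiated form: T of the partial convolution is
    a primitive of theta times the heat extension. *)
Lemma conv_derive T j z : edist T ->
  is_derive z 1 (fun v => T (fun y => G j 0 y v)) (dn j theta z * hk T 0 z t).
Proof using sth t0 G0 dG.
move=> hT; rewrite /hk -ed_scale//; last exact: smooth_gk.
have sg : sm (fun y => gk 0 t (y - z)) by exact: smooth_gk.
apply: ed_is_derive => //.
- by exists 1 => // v _; case: (conv_smooth j v).
- exact: smooth_scale.
- move=> N; have [C C0 hC] := @gk_bound R N.+1.
  have [M M0 /dboundP hM] := dbound_segment 1 (z - 1) (z + 1) (smooth_dn j sth).
  pose w := Num.max 1 t^-1; have w1 : 1 <= w by rewrite le_max lexx.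
  have wk k : t ^- k <= w ^+ k.
    rewrite -exprVn; apply: lerXn2r; rewrite ?nnegrE ?invr_ge0 ?(ltW t0) ?(le_trans ler01 w1)//.
    by rewrite le_max lexx orbT.
  exists (2 * (M * (C * w ^+ N.+2))), 1; split=> // h /ltW h1.
  have [s1 e1] := conv_smooth j (z + h); have [s2 e2] := conv_smooth j z.
  apply/dboundP => k y kN _.
  rewrite (dn_remainder _ _ s1 s2 (smooth_scale (dn j theta z) sg)) e1 e2.
  rewrite (dn_scale _ _ sg) dn_gk addn0.
  apply: (@taylor2 _ (G j k y) (fun v => dn j theta v * gk k t (y - v))
    (fun v => dn j.+1 theta v * gk k t (y - v) - dn j theta v * gk k.+1 t (y - v))) => v hv.
  - have d1 := smooth_is_derive j v sth.
    have d2 : is_derive v 1 (fun v => gk k t (y - v)) (- gk k.+1 t (y - v)).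
      have h2 : is_derive v 1 (fun v : R => y - v) (-1 : R).
        have -> : (fun v : R => y - v) = (fun v => (-1) * v + y) by apply/funext => v'; ring.
        exact: is_derive_affine.
      have := @is_derive1_comp _ (gk k t) (fun v => y - v) v _ _ (is_derive_gk_u k t _) h2.
      by rewrite mulrN1.
    by apply: is_derive_eq; rewrite /GRing.scale /=; ring.
  - have vz : z - 1 <= v <= z + 1 by apply: unit_ball_itv; exact: le_trans hv h1.
    have b1 : `|dn j theta v| <= M by exact: (hM 0%N v isT vz).
    have b2 : `|dn j.+1 theta v| <= M by exact: (hM 1%N v isT vz).
    have b3 i u : (i <= N.+1)%N -> `|gk i t u| <= C * w ^+ N.+2.
      move=> iN; apply: le_trans (hC i t u iN t0) _; rewrite ler_wpM2l//.
      apply: le_trans (wk _) _; exact: (ler_weXn2l w1).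
    apply: le_trans (ler_normB _ _) _; rewrite mulr2n mulrDl mul1r.
    by apply: lerD; rewrite normrM; apply: ler_pM => //; apply: b3; [exact: leqW|].
Qed.

(** Integration by parts; the boundary terms vanish because theta is supported strictly inside
    [A, B]. *)
Lemma conv_parts (B : R) (A' B' : R) j k y : supp_in A' B' theta -> A < A' -> B' < B ->
  G j k.+1 y B = G j.+1 k y B.
Proof using sth t0 G0 dG.
move=> pth AA BB.
have thA i : dn i theta A = 0.
  by apply: supp_in_eq0 (supp_in_dn (k := i) sth pth) _; rewrite leNgt AA.
have thB i : dn i theta B = 0.
  by apply: supp_in_eq0 (supp_in_dn (k := i) sth pth) _; rewrite [B <= _]leNgt BB andbF.
have hd z : is_derive z 1 (fun v => G j k.+1 y v - G j.+1 k y v + dn j theta v * gk k t (y - v)) 0.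
  have d1 := dG j k.+1 y z; have d2 := dG j.+1 k y z; have d3 := smooth_is_derive j z sth.
  have d4 : is_derive z 1 (fun v => gk k t (y - v)) (- gk k.+1 t (y - z)).
    have h2 : is_derive z 1 (fun v : R => y - v) (-1 : R).
      have -> : (fun v : R => y - v) = (fun v => (-1) * v + y) by apply/funext => v'; ring.
      exact: is_derive_affine.
    have := @is_derive1_comp _ (gk k t) (fun v => y - v) z _ _ (is_derive_gk_u k t _) h2.
    by rewrite mulrN1.
  by apply: is_derive_eq; rewrite /GRing.scale /=; ring.
have z0 : `|0 : R| <= 0 by rewrite normr0.
have := mvt_bound hd (fun _ _ => z0) => /(_ A B).
by rewrite !G0 thA thB !mul0r subrr !addr0 subr0 normr_le0 subr_eq0 => /eqP.
Qed.

(** All y-derivatives of the convolution fall on theta, so no negative power of t appears and its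
    C^N convergence reduces to uniform convergence. *)
Lemma conv_shift (B : R) (A' B' : R) k y : supp_in A' B' theta -> A < A' -> B' < B ->
  G 0 k y B = G k 0 y B.
Proof using sth t0 G0 dG.
move=> pth AA BB; rewrite -[in LHS](addn0 k) -[in LHS](add0n 0%N).
have : forall i j, G j (k + i) y B = G (j + k)%N i y B.
  elim: k => [|k IH] i j; first by rewrite addn0.
  by rewrite addSn -addnS IH (conv_parts _ _ _ pth AA BB) addnS.
by move=> /(_ 0%N 0%N) ->; rewrite add0n.
Qed.

End ConvolutionFamily.

End Recovery.

(** * Recovery of T from its heat extension; Baire's theorem on an interval *)

Section RecoveryLimit.
Context {R : realType}.
Implicit Types (f g : R -> R) (n k m j N : nat) (x y z h e c v w B r d q t u s M L : R) (T : (R -> R) -> R).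

(** Replacing theta z by theta y costs O(t) by the Lipschitz bound. The integral of the kernel
    itself tends to 2 ka, since a point y of the support has a fixed distance to A and B. *)
Lemma conv_approx (E : R -> R) (ka : R) (theta : R -> R) (A B A' B' : R) e :
  (forall v, is_derive v 1 E (gam v)) -> (forall v, E (- v) = - E v) ->
  (forall e, 0 < e -> exists2 V, 0 < V & forall v, V <= v -> `|E v - ka| <= e) ->
  sm theta -> supp_in A' B' theta -> A < A' -> B' < B -> A < B -> 0 < e ->
  exists2 u, 0 < u & forall t, 0 < t <= u -> forall y (G : R -> R), G A = 0 ->
    (forall z, is_derive z 1 G (theta z * gk 0 t (y - z))) ->
    `|G B - 2 * ka * theta y| <= e.
Proof.
move=> dE EN Elim sth pth AA BB AB e0.
have [M M0 hM] := dbound_supp 1 sth pth; have [C C0 hC] := @gam_atan R.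
have M1 : 0 < 4 * M + 1 by rewrite ltr_wpDl// mulr_ge0.
have [V V0 hV] := Elim (e / (4 * M + 1)) (divr_gt0 e0 M1).
pose K := M * C * pi + 1 : R; have K0 : 0 < K.
  by rewrite ltr_wpDl// !mulr_ge0// pi_ge0.
pose u := Num.min (Num.min ((A' - A) / V) ((B - B') / V)) (e / 2 / K).
exists u; first by rewrite !lt_min !divr_gt0 ?subr_gt0.
move=> t /andP[t0]; rewrite !le_min => /andP[/andP[tA tB] tK] y G G0 dG.
have /dboundP hM' := hM.
have lip z : `|theta z - theta y| <= M * `|z - y|.
  apply: (@mvt_bound _ theta (der theta)) => w; first exact: smooth_is_derive1.
  by move=> _; exact: (hM' 1%N w isT I).
have dN z : is_derive z 1 (fun w : R => (y - w) / t) (- t^-1).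
  have -> : (fun w : R => (y - w) / t) = (fun w => (- t^-1) * w + y / t).
    by apply/funext => w; ring.
  exact: is_derive_affine.
have dEz z : is_derive z 1 (fun w => E ((y - w) / t)) (- gk 0 t (y - z)).
  have := @is_derive1_comp _ E (fun w => (y - w) / t) z _ _ (dE _) (dN z) => h.
  by apply: is_derive_eq h _; rewrite /gk expr1 /=; ring.
pose D z := G z - theta y * (E ((y - A) / t) - E ((y - z) / t)).
have dD z : is_derive z 1 D ((theta z - theta y) * gk 0 t (y - z)).
  have h1 := dG z; have h2 := dEz z; rewrite /D.
  by apply: is_derive_eq; rewrite /GRing.scale /=; ring.
(* S' dominates |D'| because |v| gam v <= C / (1 + v ^ 2) at v = (y - z) / t, and S grows by at most
   M C pi t in total. *)
pose S z := - (M * C * t) * atan ((y - z) / t).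
have dS z : is_derive z 1 S (M * (C * (1 + ((y - z) / t) ^+ 2)^-1)).
  have := @is_derive1_comp _ atan (fun w => (y - w) / t) z _ _ (is_derive1_atan _) (dN z) => h.
  have := is_deriveZ (- (M * C * t)) h; rewrite /GRing.scale /= => h'.
  apply: is_derive_eq h' _; move: (_^-1) => P; by field; rewrite gt_eqF.
have hDS z : `|(theta z - theta y) * gk 0 t (y - z)| <= M * (C * (1 + ((y - z) / t) ^+ 2)^-1).
  pose v := (y - z) / t; rewrite normrM (ger0_norm (gk0_ge0 _ t0)).
  apply: le_trans (_ : M * (`|v| * gam v) <= _).
    have -> : M * (`|v| * gam v) = M * `|z - y| * gk 0 t (y - z).
      rewrite /v normrM normfV (gtr0_norm t0) [`|y - z|]distrC /gk expr1 /=; ring.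
    by rewrite ler_wpM2r ?gk0_ge0.
  rewrite ler_wpM2l//; apply: le_trans (hC v).
  by rewrite ler_wpM2r ?expR_ge0// lerDr.
have hcmp := compare_derivs (ltW AB) dD dS hDS.
have SS : S B - S A <= e / 2.
  have -> : S B - S A = M * C * t * (atan ((y - A) / t) - atan ((y - B) / t)) by rewrite /S; ring.
  have hpi : atan ((y - A) / t) - atan ((y - B) / t) <= pi.
    have := atan_ltpi2 ((y - A) / t); have := atan_gtNpi2 ((y - B) / t).
    by clear; lra.
  apply: le_trans (_ : M * C * t * pi <= _); first by rewrite ler_wpM2l// !mulr_ge0// ltW.
  have -> : M * C * t * pi = t * (M * C * pi) by ring.
  apply: le_trans (_ : t * K <= _); first by rewrite ler_wpM2l ?(ltW t0)// lerDl.
  by rewrite -ler_pdivlMr.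
have DA : D A = 0 by rewrite /D G0 subrr mulr0 subrr.
have DB : D B = G B - theta y * (E ((y - A) / t) + E ((B - y) / t)).
  rewrite /D; have -> : (y - B) / t = - ((B - y) / t) by ring.
  by rewrite EN opprK.
have hth : `|theta y * (E ((y - A) / t) + E ((B - y) / t) - 2 * ka)| <= e / 2.
  have [->|/pth /andP[y1 y2]] := eqVneq (theta y) 0.
    by rewrite mul0r normr0 divr_ge0// ltW.
  have v1 : V <= (y - A) / t.
    rewrite ler_pdivlMr// mulrC; move: tA; rewrite ler_pdivlMr//.
    by move: y1; clear; lra.
  have v2 : V <= (B - y) / t.
    rewrite ler_pdivlMr// mulrC; move: tB; rewrite ler_pdivlMr//.
    by move: y2; clear; lra.
  have := hV _ v1; have := hV _ v2; set e1 := e / (4 * M + 1) => h2 h1.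
  have hs : `|E ((y - A) / t) + E ((B - y) / t) - 2 * ka| <= 2 * e1.
    rewrite (_ : _ - _ = (E ((y - A) / t) - ka) + (E ((B - y) / t) - ka)); last by ring.
    by apply: le_trans (ler_normD _ _) _; rewrite mulr_natl mulr2n lerD.
  rewrite normrM; apply: (@le_trans _ _ (M * (2 * e1))).
    by apply: ler_pM => //; exact: (hM' 0%N y isT I).
  rewrite (_ : M * (2 * e1) = e * (2 * M) / (4 * M + 1)); last by rewrite /e1; ring.
  rewrite ler_pdivrMr// (_ : e / 2 * (4 * M + 1) = e * (2 * M) + e / 2); last by field.
  by rewrite lerDl divr_ge0// ltW.
move: hcmp; rewrite DA subr0 DB => hcmp.
have -> : G B - 2 * ka * theta y = (G B - theta y * (E ((y - A) / t) + E ((B - y) / t)))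
  + theta y * (E ((y - A) / t) + E ((B - y) / t) - 2 * ka) by ring.
apply: le_trans (ler_normD _ _) _.
by move: (le_trans hcmp SS) hth; clear; lra.
Qed.

(* Averaging hk T against theta amounts to pairing T with the Gaussian
   regularization of theta, whose derivatives converge uniformly. *)
Theorem hk_recover : exists2 ka : R, 0 < ka & forall T theta (A B A' B' : R) e,
  edist T -> sm theta -> supp_in A' B' theta -> A < A' -> B' < B -> A < B -> 0 < e ->
  exists2 u, 0 < u & forall t, 0 < t <= u -> exists F : R -> R,
    (forall z, is_derive z 1 F (theta z * hk T 0 z t)) /\
    `|F B - F A - ka * T theta| <= e.
Proof.
have [E [k2 k20 [dE EN Elim]]] := @gauss_primitive R.
exists (2 * k2); first by rewrite mulr_gt0.
move=> T theta A B A' B' e hT sth pth AA BB AB e0.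
have [a [C [N [C0 hC]]]] := ed_bd hT.
have C1 : 0 < C + 1 by rewrite ltr_wpDl.
have e1 : 0 < e / (C + 1) by rewrite divr_gt0.
(* One width for all derivatives up to the order N of T. *)
have [u u0 hu] : exists2 u, 0 < u & forall k, (k <= N)%N -> forall t, 0 < t <= u ->
    forall y (G : R -> R), G A = 0 ->
    (forall z, is_derive z 1 G (dn k theta z * gk 0 t (y - z))) ->
    `|G B - 2 * k2 * dn k theta y| <= e / (C + 1).
  have ck k := conv_approx dE EN Elim (smooth_dn k sth) (supp_in_dn (k := k) sth pth) AA BB AB e1.
  elim: N {hC} => [|n [u u0 hu]].
    by have [u u0 hu] := ck 0%N; exists u => // k; rewrite leqn0 => /eqP ->.
  have [u' u'0 hu'] := ck n.+1; exists (Num.min u u'); first by rewrite lt_min u0.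
  move=> k; rewrite leq_eqVlt => /orP[/eqP ->|kn] t /andP[t0]; rewrite le_min => /andP[tu tu'].
    by apply: hu'; rewrite t0.
  by apply: hu => //; rewrite t0.
exists u => // t tu; have /andP[t0 _] := tu.
have cG j k y : exists G : R -> R, G A = 0 /\
    forall z, is_derive z 1 G (dn j theta z * gk k t (y - z)).
  have cg : continuous (fun z => dn j theta z * gk k t (y - z)).
    apply: smooth_continuous; apply: smooth_mul; first exact: smooth_dn.
    have -> : (fun z => gk k t (y - z)) = (fun z => (fun w => gk k t (w - 0)) ((-1) * z + y)).
      by apply/funext => z; congr (gk k t _); ring.
    exact: (smooth_comp_affine (-1) y (smooth_gk k t 0)).
  have [G _ dG] := antiderivative cg.
  exists (fun z => G z - G A); split=> [|z]; first by rewrite subrr.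
  by have := is_deriveB (dG z) (is_derive_cst (G A) z 1); rewrite subr0.
pose G j k y := sval (cid (cG j k y)).
have G0 j k y : G j k y A = 0 by rewrite /G; case: cid => g [].
have dG j k y z : is_derive z 1 (G j k y) (dn j theta z * gk k t (y - z)).
  by rewrite /G; case: cid => g [].
exists (fun z => T (fun y => G 0%N 0%N y z)); split.
  by move=> z; exact: (conv_derive sth t0 G0 dG 0 z hT).
have [sB eB] := conv_smooth sth t0 G0 dG 0 B.
rewrite [X in _ - T X - _](_ : _ = fun=> 0); last by apply/funext => y; exact: G0.
rewrite (ed0 hT) subr0 -ed_scale// -ed_sub//; last exact: smooth_scale.
apply: le_trans (hC _ (e / (C + 1)) _ _) _.
- by apply: smooth_sub => //; exact: smooth_scale.
- apply/dboundP => k y kN _; rewrite dn_sub//; last exact: smooth_scale.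
  rewrite dn_scale// eB (conv_shift sth t0 G0 dG _ _ pth AA BB).
  exact: (hu k kN t tu y (G k 0%N y)).
- by rewrite mulrA ler_pdivrMr// mulrC ler_wpM2l ?(ltW e0)// lerDl.
Qed.

(** On the dilate f - f c is O(r) together with its rescaled derivatives, which gains one power of r
    in the scale bound. *)
Lemma freeze T c b f (phi : R -> R) : edist T -> scale_bounded T c b -> sm f -> sm phi ->
  supp_in (-1) 1 phi -> exists2 K, 0 <= K & forall r, 0 < r <= 1 ->
    `|T (fun y => f y * sc c r phi y) - f c * T (sc c r phi)| <= K * r ^+ b.+1.
Proof.
move=> hT [N [C [C0 hC]]] sf sphi pphi.
have [M M0 /dboundP hM] := dbound_segment N.+1 (c - 1) (c + 1) sf.
have [P P0 hP] := dbound_supp N sphi pphi.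
exists (C * (2 ^+ N * (M * P))); first by rewrite !mulr_ge0// exprn_ge0.
move=> r r01; have /andP[r0 r1] := r01.
pose g w := f (r * w + c) - f c.
have sg : sm g by apply: smooth_sub; [exact: smooth_comp_affine|exact: smooth_cst].
have sgp : sm (fun w => g w * phi w) by exact: smooth_mul.
have pgp : supp_in (-1) 1 (fun w => g w * phi w) by exact: supp_in_mulr.
have rw w : -1 <= w <= 1 -> c - 1 <= r * w + c <= c + 1.
  move=> /andP[w1 w2].
  have : `|r * w| <= 1 by rewrite normrM gtr0_norm// mulr_ile1// ?(ltW r0)// ler_norml w1.
  by rewrite ler_norml => /andP[]; clear => *; apply/andP; split; lra.
have bg : dbound N (seg (-1) 1) (M * r) g.
  apply/dboundP => -[|k] w kN hw.
    have := @mvt_local _ f (der f) M c (r * w + c) => h.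
    apply: le_trans (h _ _) _.
    - by move=> z _; exact: smooth_is_derive1.
    - move=> z /andP[z1 z2]; apply: (hM 1%N) => //=; apply/andP.
      have /andP[h1 h2] := rw w hw; split.
        by apply: le_trans z1; rewrite le_min h1 andbT; clear; lra.
      by apply: le_trans z2 _; rewrite ge_max h2 andbT; clear; lra.
    - rewrite addrK normrM gtr0_norm// ler_wpM2l// ler_piMr ?(ltW r0)//.
      by rewrite ler_norml.
  rewrite /g dn_sub; [|exact: smooth_comp_affine|exact: smooth_cst].
  rewrite dn_cst subr0 dn_comp_affine// normrM mulrC; apply: ler_pM => //.
    by apply: hM; [exact: leqW|exact: rw].
  rewrite normrX gtr0_norm// exprS ler_piMr ?(ltW r0)//.
  by rewrite exprn_ile1// ltW.
have bgp : dbound N setT (2 ^+ N * (M * r * P)) (fun w => g w * phi w).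
  have bp : dbound N (seg (-1) 1) P phi by apply: dbound_le hP.
  have /dboundP h := dbound_mul sg sphi bg bp; apply/dboundP => k w kN _.
  have [wi|/negP ni] := boolP (-1 <= w <= 1); first exact: h.
  rewrite (supp_in_eq0 (supp_in_dn (k := k) sgp pgp) ni) normr0.
  by rewrite !mulr_ge0 ?exprn_ge0// ltW.
have ssc := smooth_sc c r sphi.
rewrite -ed_scale// -ed_sub//; [|exact: smooth_mul|exact: smooth_scale].
have -> : (fun y => f y * sc c r phi y - f c * sc c r phi y) = sc c r (fun w => g w * phi w).
  apply/funext => y; rewrite /sc /g (_ : r * ((y - c) / r) + c = y); first by ring.
  by field; rewrite gt_eqF.
apply: le_trans (hC _ _ r sgp pgp bgp r01) _.
by rewrite exprS le_eqVlt; apply/orP; left; apply/eqP; ring.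
Qed.

(** Baire's theorem for a set N closed in ]p, q[ and covered by countably many closed sets. If none
    of them contained a portion of N, shrinking intervals around points of N would avoid them one
    after the other, and the limit point would lie in N but in no A i. *)
Lemma baire_interval (N : set R) (A : nat -> set R) (p q x0 : R) :
  (forall y, p < y < q -> (forall e, 0 < e -> exists2 z, `|z - y| < e & N z) -> N y) ->
  (forall i y, p < y < q -> ~ A i y -> exists2 d, 0 < d & forall z, `|z - y| < d -> ~ A i z) ->
  (forall y, p < y < q -> N y -> exists i, A i y) ->
  p < x0 < q -> N x0 ->
  exists i, exists a b : R, [/\ p < a, b < q, (exists2 x, a < x < b & N x) &
    forall y, a < y < b -> N y -> A i y].
Proof.
move=> clN clA cov /andP[px0 x0q] Nx0; apply: contrapT => none.
have find i a b : p < a -> b < q -> (exists2 x, a < x < b & N x) ->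
    exists2 y, a < y < b & N y /\ ~ A i y.
  move=> pa bq hx; apply: contrapT => nex; apply: none; exists i, a, b; split=> // y yab Ny.
  by apply: contrapT => nA; apply: nex; exists y.
pose Q (n : nat) a b := [/\ p < a, b < q, (exists2 x, a < x < b & N x) &
  forall i, (i < n)%N -> forall y, a <= y <= b -> ~ A i y].
have st n a b : a < b -> Q n a b -> exists a' b', [/\ a <= a', a' < b', b' <= b,
    b' - a' <= 2 / 3 * (b - a) & Q n.+1 a' b'].
  move=> ab [pa bq hx hA]; have [y /andP[ay yb] [Ny nA]] := find n a b pa bq hx.
  have pyq : p < y < q by rewrite (lt_trans pa ay) (lt_trans yb bq).
  have [d d0 hd] := clA n y pyq nA.
  pose r := Num.min (Num.min (d / 2) ((b - a) / 3)) (Num.min (y - a) (b - y)).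
  have r0 : 0 < r by rewrite !lt_min !divr_gt0 ?subr_gt0 ?ay ?yb.
  have r1 : r <= d / 2 by rewrite !ge_min lexx.
  have r2 : r <= (b - a) / 3 by rewrite !ge_min lexx orbT.
  have r3 : r <= y - a by rewrite !ge_min lexx !orbT.
  have r4 : r <= b - y by rewrite !ge_min lexx !orbT.
  exists (y - r), (y + r); split.
  - by move: r3; clear; lra.
  - by move: r0; clear; lra.
  - by move: r4; clear; lra.
  - by move: r2; clear; lra.
  split.
  - by move: r3 pa; clear; lra.
  - by move: r4 bq; clear; lra.
  - by exists y => //; apply/andP; move: r0; clear; lra.
  move=> i; rewrite ltnS leq_eqVlt => /orP[/eqP -> z /andP[z1 z2]|iltn z /andP[z1 z2]].
    apply: hd; have : `|z - y| <= r by rewrite ler_norml; apply/andP; move: z1 z2; clear; lra.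
    by move: r1 d0; clear; lra.
  by apply: hA => //; apply/andP; move: z1 z2 r3 r4; clear; lra.
pose a0 := (p + x0) / 2; pose b0 := (x0 + q) / 2.
have ab0 : a0 < b0 by rewrite /a0 /b0; move: px0 x0q; clear; lra.
have Q0 : Q 0%N a0 b0.
  split=> //; rewrite /a0 /b0; try (by move: px0 x0q; clear; lra).
  by exists x0 => //; apply/andP; move: px0 x0q; clear; lra.
have [x [a [b [xab hab]]]] := nested_intervals st ab0 Q0.
have pxq : p < x < q.
  by apply/andP; move: xab px0 x0q; rewrite /a0 /b0; clear => /andP[]; lra.
have Nx : N x.
  apply: clN => // e e0; have ab0' : 0 <= b0 - a0 by rewrite subr_ge0 ltW.
  have [n hn] := nested_small ab0' e0.
  have [/andP[h1 h2] h3 h4 [_ _ [y /andP[y1 y2] Ny] _]] := hab n.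
  exists y => //; rewrite ltr_norml; apply/andP.
  by move: h1 h2 y1 y2 (le_lt_trans h4 hn); clear => *; split; lra.
have [i Ai] := cov x pxq Nx.
have [hx _ _ [_ _ _ hA]] := hab i.+1.
exact: (hA i (ltnSn i) x hx).
Qed.

End RecoveryLimit.

(** * From lower bounds of the heat extension to positivity *)

Section Positivity.
Context {R : realType}.
Implicit Types (f g : R -> R) (n k m j : nat) (x y z h e c v w B r d q t u s M L : R) (T : (R -> R) -> R).
Local Notation mu := (@lebesgue_measure R).

(** Fatou's lemma, stated with a continuous minorant of the lower limit off a null set. *)
Lemma liminf_integral (h : nat -> R -> R) (l : R -> R) (Z : set R) (a b c : R) :
  (forall n, continuous (h n)) -> continuous l -> mu.-negligible Z ->
  (forall n x, x \in `[a, b] -> 0 <= h n x) -> (forall x, x \in `[a, b] -> 0 <= l x) ->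
  (forall x e, x \in `[a, b] -> ~ Z x -> 0 < e ->
    exists n0, forall n, (n0 <= n)%N -> l x - e <= h n x) ->
  (forall n, (\int[mu]_(x in `[a, b]) (h n x)%:E <= c%:E)%E) ->
  (\int[mu]_(x in `[a, b]) (l x)%:E <= c%:E)%E.
Proof.
move=> ch cl negZ h0 l0 hl hc.
have mD : measurable `[a, b]%classic by exact: measurable_itv.
have mf (g : R -> R) (cg : continuous g) :=
  measurable_int mu (@integrable_segment R g a b cg).
have mh n := mf _ (ch n).
have hpos n x : `[a, b]%classic x -> (0 <= (EFin \o h n) x)%E.
  by move=> xab; rewrite /= lee_fin h0.
have step1 : (\int[mu]_(x in `[a, b]) (l x)%:E <=
    \int[mu]_(x in `[a, b]) limn_einf (fun n => (h n x)%:E))%E.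
  apply: ae_ge0_le_integral.
  - exact: mD.
  - by move=> x xab; rewrite lee_fin l0.
  - exact: mf cl.
  - move=> x xab; rewrite limn_einf_lim; apply: lime_ge; first exact: is_cvg_einfs.
    by apply: nearW => n; apply: le_ereal_inf_tmp => _ [k _ <-]; rewrite lee_fin h0.
  - apply: (measurable_realfun.emeasurable_fun_cvg
      (fun n x => einfs (fun k => (h k x)%:E) n)) => [n|x _].
      exact: (measurable_realfun.measurable_fun_einfs mh).
    by rewrite limn_einf_lim; exact: is_cvg_einfs.
  - have [N [mN N0 ZN]] := negZ; exists N; split=> // x /= nx; apply: ZN.
    apply: contrapT => nZ; apply: nx => xab.
    rewrite limn_einf_lim; apply/lee_addgt0Pr => e e0.
    rewrite -leeBlDr//; have [n0 hn0] := hl x e xab nZ e0.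
    apply: lime_ge; first exact: is_cvg_einfs.
    exists n0 => // n /= n0n; apply: le_ereal_inf_tmp => _ [k /= nk <-].
    by rewrite -EFinB lee_fin hn0// (leq_trans n0n).
apply: le_trans step1 _; apply: le_trans (fatou _ _ mh hpos) _ => //.
rewrite limn_einf_lim; apply: lime_le; first exact: is_cvg_einfs.
apply: nearW => n; apply: le_trans (hc n).
by rewrite /einfs; apply: ereal_inf_lbound; exists n => /=.
Qed.

(** For a measure this says that the point c has mass 0. *)
Definition no_atom T c := forall f, sm f -> supp_in (-1) 1 f -> forall e, 0 < e ->
  exists2 u, 0 < u & forall r, 0 < r <= u -> `|T (sc c r f)| <= e.

(* A pointwise bound for small dilations is all that uniform_bound needs, since
   dilations by r bounded below are controlled by the order of T. *)
Lemma scale_bounded_near T c b : edist T ->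
  (forall f, sm f -> supp_in (-1) 1 f -> exists K u, 0 < u /\
    forall r, 0 < r <= u -> `|T (sc c r f)| <= K * r ^+ b) -> scale_bounded T c b.
Proof.
move=> hT hp; apply: uniform_bound => // f sf pf.
have [K [u [u0 hu]]] := hp f sf pf.
have [N [C [C0 hC]]] := ed_sc_bound c hT.
have [M M0 hM] := dbound_supp N sf pf.
have P0 : 0 <= C * (u ^- N * M) * u ^- b.
  by rewrite !mulr_ge0// invr_ge0 exprn_ge0// ltW.
exists (`|K| + C * (u ^- N * M) * u ^- b) => r r01; have /andP[r0 r1] := r01.
have rb : 0 <= r ^+ b by rewrite exprn_ge0// ltW.
have [ru|ur] := leP r u.
  apply: le_trans (hu r _) _; first by rewrite r0.
  rewrite ler_wpM2r//; apply: le_trans (ler_norm K) _; by rewrite lerDl.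
apply: le_trans (hC f M r sf r01 M0 hM) _; rewrite mulrDl.
apply: le_trans (_ : C * (u ^- N * M) * u ^- b * r ^+ b <= _); last first.
  by rewrite lerDr mulr_ge0.
rewrite -[leRHS]mulrA; apply: le_trans (_ : C * (u ^- N * M) <= _).
  by rewrite ler_wpM2l// ler_wpM2r// invrX_le// ltW.
apply: ler_peMr; first by rewrite !mulr_ge0// invr_ge0 exprn_ge0// ltW.
rewrite -exprVn -exprMn exprn_ege1// mulrC ler_pdivlMr// mul1r; exact: ltW.
Qed.

Lemma no_atom_bounded T c : edist T -> no_atom T c -> scale_bounded T c 0.
Proof.
move=> hT hc; apply: scale_bounded_near => // f sf pf.
have [u u0 hu] := hc f sf pf 1 ltr01; exists 1, u; split=> // r /hu.
by rewrite expr0 mulr1.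
Qed.

(** Split f by a dilate of [chi] about c. The outer part is supported where T is locally
    nonnegative; the inner part is f c times T of the dilate up to O(r), and tends to 0 since there
    is no atom. *)
Lemma isolated_pos T c e : edist T -> no_atom T c -> 0 < e ->
  (forall x, `|x - c| < e -> x != c -> pos_near T x) -> pos_near T c.
Proof.
move=> hT hc e0 hx; exists e => // f c' d' sf f0 cc dd pf.
apply/ler_addgt0Pr => r1 r10; have sb := no_atom_bounded hT hc.
have [K K0 hK] := freeze hT sb sf (@smooth_chi R) (@supp_chi R).
pose F := `|f c| + 1; have F0 : 0 < F by rewrite ltr_wpDl.
have [u u0 hu] := hc _ (@smooth_chi R) (@supp_chi R) (r1 / 2 / F) ltac:(by rewrite !divr_gt0).
have K1 : 0 < K + 1 by rewrite ltr_wpDl.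
pose r := Num.min (Num.min u 1) (r1 / 2 / (K + 1)).
have r0 : 0 < r by rewrite !lt_min u0 ltr01 !divr_gt0.
have ru : 0 < r <= u by rewrite r0 !ge_min lexx.
have rr1 : 0 < r <= 1 by rewrite r0 !ge_min lexx orbT.
have rK : r * (K + 1) <= r1 / 2 by rewrite -ler_pdivlMr// ge_min lexx orbT.
pose X := sc c r chi; have sX : sm X by apply: smooth_sc; exact: smooth_chi.
have sX1 : sm (fun y => 1 - X y) by apply: smooth_sub => //; exact: smooth_cst.
have h1 : 0 <= T (fun y => f y * (1 - X y)).
  apply: (@local_sign _ _ _ c' d') => //; [exact: smooth_mul|exact: supp_in_mull|].
  move=> x /andP[x1 x2]; have [->|xc] := eqVneq x c.
    exists (r / 2); first by rewrite divr_gt0.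
    move=> g sg g0 pg; rewrite (_ : (fun y => _) = fun=> 0) ?ed0//; apply/funext => y.
    have [->|/pg /andP[y1 y2]] := eqVneq (g y) 0; first by rewrite mulr0.
    rewrite /X /sc chi1 ?subrr ?mulr0 ?mul0r//.
    rewrite normrM normfV (gtr0_norm r0) ler_pdivrMr// mulrC ler_norml; apply/andP.
    by move: y1 y2; clear; lra.
  have [d d0 hd] := hx x ltac:(by rewrite ltr_norml; apply/andP; move: cc dd x1 x2; clear; lra) xc.
  exists (d / 2); first by rewrite divr_gt0.
  move=> g sg g0 pg; apply: (hd _ (x - d / 2) (x + d / 2)).
  - by apply: smooth_mul => //; exact: smooth_mul.
  - by move=> y; rewrite !mulr_ge0// subr_ge0 chi_le1.
  - by move: d0; clear; lra.
  - by move: d0; clear; lra.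
  - exact: supp_in_mulr.
have hsum : T f = T (fun y => f y * (1 - X y)) + T (fun y => f y * X y).
  rewrite -ed_add//; [|exact: smooth_mul..].
  by congr T; apply/funext => y; ring.
have h2 : `|f c * T X| <= r1 / 2.
  rewrite normrM; apply: (@le_trans _ _ (F * (r1 / 2 / F))).
    by apply: ler_pM => //; [rewrite lerDl|exact: hu].
  by rewrite mulrC divfK// gt_eqF.
have h3 := hK r rr1; rewrite expr1 -/X in h3.
have h4 : K * r <= r1 / 2.
  by apply: le_trans rK; rewrite mulrC ler_wpM2l ?(ltW r0)// lerDl.
move: h1 h2 (le_trans h3 h4); rewrite hsum => h1 /ler_normlP[h2 _] /ler_normlP[h3' _].
by move: h1 h2 h3'; clear; lra.
Qed.

(* Fatou's lemma turns the lower bound on hk, which holds everywhere, and the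
   nonnegative lower limit, which holds almost everywhere, into positivity. *)
Lemma pos_of_bound T (a b M u : R) (Z : set R) : edist T -> a < b -> 0 <= M -> 0 < u ->
  mu.-negligible Z ->
  (forall x t, a <= x <= b -> 0 < t <= u -> - M <= hk T 0 x t) ->
  (forall x e, a < x < b -> ~ Z x -> 0 < e ->
    exists2 v, 0 < v & forall t, 0 < t <= v -> - e <= hk T 0 x t) ->
  pos_on T a b.
Proof.
move=> hT ab M0 u0 negZ hM hZ f a' b' sf f0 aa bb pf.
have [ka ka0 hrec] := @hk_recover R.
rewrite leNgt; apply/negP => neg.
(* Half of the supposed negative value: the integrals of f times [hk] then stay below - dl. *)
pose dl := - (ka * T f) / 2.
have dl0 : 0 < dl by rewrite divr_gt0// oppr_gt0 pmulr_rlt0.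
have [v v0 hv] := hrec T f a b a' b' dl hT sf pf aa bb ab dl0.
pose w := Num.min u v; have w0 : 0 < w by rewrite lt_min u0.
pose tn n := w / n.+1%:R : R.
have tn0 n : 0 < tn n by rewrite divr_gt0.
have tnw n : tn n <= w.
  by rewrite ler_pdivrMr// ler_peMr ?(ltW w0)// ler1n.
have tnu n : 0 < tn n <= u by rewrite tn0 (le_trans (tnw n))// ge_min lexx.
have tnv n : 0 < tn n <= v by rewrite tn0 (le_trans (tnw n))// ge_min lexx orbT.
have cf : continuous f by exact: smooth_continuous.
have chk n : continuous (fun x => hk T 0 x (tn n)).
  move=> x; apply/differentiable_continuous/derivable1_diffP.
  by have := is_derive_hk_x 0 x hT (tn0 n) => ?; exact: ex_derive.
have [If _ dIf] := antiderivative cf.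
have cMf : continuous (fun x => M * f x).
  by move=> x; apply: cvgM; [exact: cvg_cst|exact: cf].
have intMf : (\int[mu]_(x in `[a, b]) (M * f x)%:E = (M * (If b - If a))%:E)%E.
  rewrite mulrBr.
  exact: (integral_antiderivative (G := fun x => M * If x) ab cMf (fun z => is_deriveZ M (dIf z))).
(* Adding M f makes the integrands nonnegative, as Fatou's lemma requires. *)
pose h n x := f x * hk T 0 x (tn n) + M * f x.
have ch n : continuous (h n).
  by move=> x; apply: cvgD; [apply: cvgM; [exact: cf|exact: chk]|exact: cMf].
have hint n : (\int[mu]_(x in `[a, b]) (h n x)%:E <= (- dl + M * (If b - If a))%:E)%E.
  have [F [dF hF]] := hv (tn n) (tnv n).
  have dG z : is_derive z 1 (fun x => F x + M * If x) (h n z).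
    by have h1 := is_deriveZ M (dIf z); exact: (is_deriveD (dF z) h1).
  rewrite (integral_antiderivative ab (ch n) dG) lee_fin.
  by move: hF => /ler_normlP[_]; rewrite /dl mulrBr; clear; lra.
have := @liminf_integral h (fun x => M * f x) (Z `|` [set a] `|` [set b]) a b _ ch cMf.
have negZ' : mu.-negligible (Z `|` [set a] `|` [set b]).
  apply: negligibleU; first apply: negligibleU => //.
    by exists [set a]; split=> //; exact: lebesgue_measure_set1.
  by exists [set b]; split=> //; exact: lebesgue_measure_set1.
move=> /(_ _ negZ'); move=> /(_ (- dl + M * (If b - If a))) H.
have : (\int[mu]_(x in `[a, b]) (M * f x)%:E <= (- dl + M * (If b - If a))%:E)%E.
  apply: H => //.
  - move=> n x; rewrite in_itv /= => xab; rewrite /h mulrC -mulrDl mulr_ge0//.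
    by have := hM x (tn n) xab (tnu n); clear; lra.
  - by move=> x _; rewrite mulr_ge0.
  - move=> x e; rewrite in_itv /= => /andP[ax xb] nZ e0.
    have ax' : a < x by rewrite lt_neqAle ax andbT; apply/eqP => E; apply: nZ; left; right.
    have xb' : x < b by rewrite lt_neqAle xb andbT; apply/eqP => E; apply: nZ; right.
    have nZ' : ~ Z x by move=> Zx; apply: nZ; left; left.
    have F0 : 0 < f x + 1 by rewrite ltr_wpDl.
    have [v' v'0 hv'] := hZ x (e / (f x + 1)) ltac:(by rewrite ax' xb') nZ' (divr_gt0 e0 F0).
    have [n0 hn0] : exists n0 : nat, w / v' <= n0.+1%:R.
      exists (Num.bound `|w / v'|); apply: le_trans (ler_norm _) _.
      apply: le_trans (ltW (archi_boundP (normr_ge0 _))) _.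
      by rewrite ler_nat.
    exists n0 => n n0n; rewrite /h addrC lerD2r.
    have tv : 0 < tn n <= v'.
      rewrite tn0 /tn ler_pdivrMr// mulrC -ler_pdivrMr//; apply: le_trans hn0 _.
      by rewrite ler_nat ltnS.
    apply: le_trans (_ : f x * - (e / (f x + 1)) <= _); last by rewrite ler_wpM2l// hv'.
    rewrite mulrN lerN2 mulrA ler_pdivrMr// mulrC ler_wpM2l ?(ltW e0)//.
    by rewrite lerDl.
rewrite intMf lee_fin; move: dl0; clear; lra.
Qed.

(* Baire's theorem on the set of points near which T is not known to be
   nonnegative yields an interval on which hk T is bounded below there; the
   minimum principle extends the bound across the gaps. *)
Theorem positivity T (p q : R) (E Z : set R) : edist T -> countable E -> mu.-negligible Z ->
  (forall c, p < c < q -> no_atom T c) ->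
  (forall x e, p < x < q -> ~ Z x -> 0 < e ->
    exists2 u, 0 < u & forall t, 0 < t <= u -> - e <= hk T 0 x t) ->
  (forall x, p < x < q -> ~ E x -> exists M, exists2 u, 0 < u &
    forall t, 0 < t <= u -> - M <= hk T 0 x t) ->
  pos_on T p q.
Proof.
move=> hT cE negZ hat hZ hE; apply: pos_local => // x0 x0pq; apply: contrapT => nx0.
have /countable_injP[ix ixI] := cE.
pose N := [set x | p < x < q /\ ~ pos_near T x].
(* The even sets are the single points of E, where no bound is assumed; the odd sets collect the
   points with the bound - i at all widths up to 1 / (i + 1). *)
pose Aeven i := [set x | E x /\ ix x = i].
pose Aodd (i : nat) := [set x | forall t, 0 < t <= i.+1%:R^-1 -> - i%:R <= hk T 0 x t].
pose A i := if odd i then Aodd i./2 else Aeven i./2.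
have nbhN y : pos_near T y -> exists2 e, 0 < e & forall z, `|z - y| < e -> pos_near T z.
  move=> [e e0 he]; exists e => // z; rewrite ltr_norml => /andP[z1 z2].
  by apply: (pos_on_near he); apply/andP; move: z1 z2; clear; lra.
have [i [a [b [pa bq [x /andP[ax xb] Nx] hA]]]] : exists i, exists a b : R, [/\ p < a, b < q,
    (exists2 x, a < x < b & N x) & forall y, a < y < b -> N y -> A i y].
  apply: (@baire_interval R N A p q x0) => //.
  - move=> y ypq hy; split=> // /nbhN[e e0 he].
    by have [z zy [_ nz]] := hy e e0; apply: nz; exact: he.
  - move=> i y ypq; rewrite /A; case: ifP => _ nA.
      have [t [t0 hlt]] : exists t, 0 < t <= (i./2).+1%:R^-1 /\ hk T 0 y t < - (i./2)%:R.
        apply: contrapT => ne; apply: nA => t t0; rewrite leNgt; apply/negP => hlt.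
        by apply: ne; exists t.
      have /andP[t00 _] := t0.
      have [L L0 hL] := hk_lip 0 hT t00.
      pose gap := - (i./2)%:R - hk T 0 y t; have gap0 : 0 < gap by rewrite subr_gt0.
      have L1 : 0 < L + 1 by rewrite ltr_wpDl.
      exists (gap / (L + 1)); first by rewrite divr_gt0.
      move=> z zy /(_ t t0); apply/negP; rewrite -ltNge.
      have := hL z y t t (lexx t) (lexx t); rewrite subrr normr0 addr0 => /ler_normlP[_ h1].
      have h2 : L * `|z - y| < gap.
        apply: le_lt_trans (_ : (L + 1) * `|z - y| < _).
          by rewrite ler_wpM2r// lerDl.
        by rewrite mulrC -ltr_pdivlMr.
      by move: h1 h2; rewrite /gap; clear; lra.
    have [[z [Ez iz]]|nz] := pselect (exists z, Aeven i./2 z); last first.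
      by exists 1 => // z _ Az; apply: nz; exists z.
    have zy : z != y by apply/eqP => zy; apply: nA; rewrite -zy.
    exists `|z - y|; first by rewrite normr_gt0 subr_eq0.
    move=> w wy [Ew iw]; have wz : w = z.
      by apply: ixI; [rewrite inE|rewrite inE|rewrite iw iz].
    by move: wy; rewrite wz ltxx.
  - move=> y ypq _; have [Ey|nEy] := pselect (E y).
      by exists (ix y).*2; rewrite /A odd_double doubleK.
    have [M [u u0 hu]] := hE y ypq nEy.
    pose k := maxn (Num.bound `|M|) (Num.bound u^-1).
    exists k.*2.+1; rewrite /A /= odd_double /= uphalf_double => t /andP[t0 tk].
    have Mk : M <= k%:R.
      apply: le_trans (ler_norm M) (le_trans (ltW (archi_boundP (normr_ge0 _))) _).
      by rewrite ler_nat leq_maxl.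
    apply: le_trans (_ : - M <= _); first by rewrite lerN2.
    apply: hu; rewrite t0; apply: le_trans tk _; rewrite -[leRHS]invrK lef_pV2 ?posrE ?invr_gt0//.
    have uV : 0 <= u^-1 by rewrite invr_ge0 ltW.
    apply: le_trans (ltW (archi_boundP uV)) _.
    by rewrite ler_nat; apply: leq_trans (leqnSn k); exact: leq_maxr.
have inpq y : a <= y <= b -> p < y < q.
  by move=> /andP[h1 h2]; rewrite (lt_le_trans pa h1) (le_lt_trans h2 bq).
have [_ nx] := Nx; apply: nx.
have notN y : a <= y <= b -> ~ N y -> pos_near T y.
  by move=> yab nN; apply: contrapT => ny; apply: nN; split=> //; exact: inpq.
(* For an even index the portion of N is the single point x, which [isolated_pos] removes. *)
move: hA; rewrite /A; case: ifP => _ hA; last first.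
  have [Ex ixE] := hA x ltac:(by rewrite ax xb) Nx.
  pose e := Num.min (x - a) (b - x); have e0 : 0 < e by rewrite lt_min !subr_gt0 ax xb.
  apply: (isolated_pos hT _ e0); first by apply: hat; apply: inpq; rewrite !ltW.
  move=> y; rewrite lt_min => /andP[y1 y2] yx.
  have yab : a < y < b.
    have := ler_norm (y - x); have := ler_norm (x - y); rewrite distrC.
    by move: y1 y2; clear => *; apply/andP; split; lra.
  apply: notN; first by have /andP[h1 h2] := yab; rewrite !ltW.
  move=> Ny; have [Ey iy] := hA y yab Ny; move/eqP: yx; apply.
  by apply: ixI; [rewrite inE|rewrite inE|rewrite iy ixE].
pose k := i./2; pose a1 := (a + x) / 2; pose b1 := (x + b) / 2.
have a1x : a1 < x by rewrite /a1; move: ax; clear; lra.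
have xb1 : x < b1 by rewrite /b1; move: xb; clear; lra.
have aa1 : a < a1 by rewrite /a1; move: ax; clear; lra.
have b1b : b1 < b by rewrite /b1; move: xb; clear; lra.
have inab y : a1 <= y <= b1 -> a < y < b.
  by move=> /andP[h1 h2]; rewrite (lt_le_trans aa1 h1) (le_lt_trans h2 b1b).
have inab' y : a1 <= y <= b1 -> a <= y <= b.
  by move=> /inab /andP[h1 h2]; rewrite !ltW.
have bnd y : a1 <= y <= b1 -> exists2 u, 0 < u & forall t, 0 < t <= u -> - (k%:R + 1) <= hk T 0 y t.
  move=> yab; have [Ny|/(notN _ (inab' y yab)) py] := pselect (N y).
    exists k.+1%:R^-1; first by rewrite invr_gt0.
    by move=> t /(hA y (inab y yab) Ny); apply: le_trans; rewrite lerN2 lerDl.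
  have [u u0 hu] := hk_ge_near hT py ltr01; exists u => // t /hu; apply: le_trans.
  by rewrite lerN2 lerDr.
have ab1 : a1 <= b1 by apply: ltW; exact: lt_trans xb1.
have [u1 u10 hu1] := bnd a1 ltac:(by rewrite lexx).
have [u2 u20 hu2] := bnd b1 ltac:(by rewrite lexx andbT).
pose u := Num.min (Num.min u1 u2) k.+1%:R^-1.
have u0 : 0 < u by rewrite !lt_min u10 u20 invr_gt0/=.
have uu1 t : 0 < t <= u -> 0 < t <= u1.
  by move=> /andP[-> h]; apply: le_trans h _; rewrite !ge_min lexx.
have uu2 t : 0 < t <= u -> 0 < t <= u2.
  by move=> /andP[-> h]; apply: le_trans h _; rewrite !ge_min lexx orbT.
have uu3 t : 0 < t <= u -> 0 < t <= k.+1%:R^-1.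
  by move=> /andP[-> h]; apply: le_trans h _; rewrite !ge_min lexx orbT.
(* With a1 and b1 added, S is closed and [hk] is bounded below on it; every other point of [a1, b1]
   lies in a gap whose two end points belong to S. *)
pose S := [set y | a1 <= y <= b1 /\ (N y \/ y = a1 \/ y = b1)].
have hS y t : S y -> 0 < t <= u -> - (k%:R + 1) <= hk T 0 y t.
  move=> [yab [Ny|[->|->]]] tu; last 2 first.
  - by apply: hu1; exact: uu1.
  - by apply: hu2; exact: uu2.
  by have := hA y (inab y yab) Ny t (uu3 t tu); apply: le_trans; rewrite lerN2 lerDl.
have Scl y : a1 <= y <= b1 -> (forall e, 0 < e -> exists2 z, `|z - y| < e & S z) -> S y.
  move=> yab hy; split=> //; apply: contrapT => ny.
  have /nbhN[e e0 he] : pos_near T y.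
    by apply: notN; [exact: inab'|move=> Ny; apply: ny; left].
  have ya : 0 < `|y - a1| by rewrite normr_gt0 subr_eq0; apply/eqP => h; apply: ny; right; left.
  have yb : 0 < `|y - b1| by rewrite normr_gt0 subr_eq0; apply/eqP => h; apply: ny; right; right.
  have [z] := hy (Num.min e (Num.min `|y - a1| `|y - b1|)) ltac:(by rewrite !lt_min e0 ya yb).
  rewrite !lt_min => /andP[z1 /andP[z2 z3]] [_ [[_ nz]|[zE|zE]]].
  - by apply: nz; exact: he.
  - by move: z2; rewrite zE distrC ltxx.
  - by move: z3; rewrite zE distrC ltxx.
have all y t : a1 <= y <= b1 -> 0 < t <= u -> - (k%:R + 1) <= hk T 0 y t.
  move=> yab tu; have [Sy|nSy] := pselect (S y); first exact: hS.
  have /andP[ya yb] := yab.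
  have Sa : S a1 by split; [rewrite lexx|right; left].
  have Sb : S b1 by split; [rewrite lexx andbT|right; right].
  (* The end points c and d of the gap around y are the nearest points of S on either side. *)
  pose lo := [set z | S z /\ z <= y]; pose c := sup lo.
  have hlo : has_sup lo by split; [exists a1|exists y => z []].
  have cy : c <= y by apply: ge_sup; [exists a1|move=> z []].
  have ac : a1 <= c by apply: sup_upper_bound.
  have Sc : S c.
    apply: Scl; first by rewrite ac (le_trans cy).
    move=> e e0; have [z [Sz zy] hz] := sup_adherent e0 hlo.
    exists z => //; have zc : z <= c by apply: sup_upper_bound.
    by rewrite ler0_norm ?subr_le0// -/c; move: hz; rewrite -/c; clear; lra.
  pose hi := [set z | S z /\ y <= z]; pose d := inf hi.
  have hhi : has_inf hi by split; [exists b1|exists y => z []].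
  have yd : y <= d by apply: lb_le_inf; [exists b1|move=> z []].
  have db : d <= b1 by apply: ge_inf => //; case: hhi.
  have Sd : S d.
    apply: Scl; first by rewrite db (le_trans ya).
    move=> e e0; have [z [Sz yz] hz] := inf_adherent e0 hhi.
    exists z => //; have dz : d <= z by apply: ge_inf => //; case: hhi.
    by rewrite ger0_norm ?subr_ge0// -/d; move: hz; rewrite -/d; clear; lra.
  have cy' : c < y by rewrite lt_neqAle cy andbT; apply/eqP => h; apply: nSy; rewrite -h.
  have yd' : y < d by rewrite lt_neqAle yd andbT; apply/eqP => h; apply: nSy; rewrite h.
  have pos : pos_on T c d.
    apply: pos_local => // z /andP[cz zd].
    have zab : a1 <= z <= b1 by rewrite (le_trans ac (ltW cz)) (le_trans (ltW zd) db).
    apply: notN; first exact: inab'.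
    move=> Nz; have Sz : S z by split=> //; left.
    have [zy|/ltW yz] := leP z y.
      have : z <= c by apply: sup_upper_bound.
      by rewrite leNgt cz.
    have : d <= z by apply: ge_inf => //; case: hhi.
    by rewrite leNgt zd.
  have bc : a1 <= c <= b1 by case: Sc.
  have bd : a1 <= d <= b1 by case: Sd.
  apply: (@gap_bound R T c d (k%:R + 1) u) => //.
  - exact: lt_trans yd'.
  - by apply: no_atom_bounded => //; apply: hat; apply: inpq; exact: inab'.
  - by apply: no_atom_bounded => //; apply: hat; apply: inpq; exact: inab'.
  - by move=> t'; exact: hS.
  - by move=> t'; exact: hS.
  - by rewrite cy yd.
have : pos_on T a1 b1.
  apply: (@pos_of_bound T a1 b1 (k%:R + 1) u Z) => //; first exact: lt_trans xb1.
  by move=> y e /andP[h1 h2]; apply: hZ; apply: inpq; apply: inab'; rewrite !ltW.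
by move=> h; apply: (pos_on_near h); rewrite a1x.
Qed.

End Positivity.

(** * Comparison of major and minor pairs *)
Section Comparison.
Context {R : realType}.
Implicit Types (f g phi chi : R -> R) (n k m j : nat) (x y z e c v w B r d q t u s M L : R).
Local Notation mu := (@lebesgue_measure R).

Lemma test_fun_mul chi f : test_fun chi -> sm f -> test_fun (fun y => chi y * f y).
Proof.
move=> /test_funP[sc [A hA]] sf; apply/test_funP; split; first exact: smooth_mul.
by exists A; exact: supp_in_mull.
Qed.

Lemma test_fun_plateau (A B d : R) : 0 < d -> test_fun (plateau A B d).
Proof. by move=> d0; apply: test_fun_supp (smooth_plateau _ _ _) (supp_plateau d0). Qed.

Lemma test_fun_sm f : test_fun f -> sm f. Proof. by move=> /test_funP[]. Qed.

(** [local_sign], applied to phi and to - phi, plays the part of a partition of unity: near a point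
    of the support phi vanishes, and near any other point g does. *)
Lemma vanish_off_support (g : distrib R) phi : test_fun phi ->
  (forall x, distrib_support g x -> exists2 e, 0 < e & forall y, `|y - x| < e -> phi y = 0) ->
  g phi = 0.
Proof.
move=> tphi hx; have /test_funP[sphi [A pphi]] := tphi.
pose chi := plateau (- A) A 1; have tchi : test_fun chi by exact: test_fun_plateau.
pose T f := g (fun y => chi y * f y); have hT : edist T by exact: edist_distrib.
have TE : T phi = g phi.
  congr (distrib_fun g); apply/funext => y.
  have [->|/pphi yA] := eqVneq (phi y) 0; first by rewrite mulr0.
  by rewrite /chi plateau1 ?mul1r.
have loc x : exists2 e, 0 < e & forall f, sm f -> (forall y, 0 <= f y) ->
    supp_in (x - e) (x + e) f -> T (fun y => phi y * f y) = 0.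
  have [/hx[e e0 he]|nx] := pselect (distrib_support g x).
    exists (e / 2); first by rewrite divr_gt0.
    move=> f sf _ pf; rewrite (_ : (fun y => _) = fun=> 0) ?ed0//; apply/funext => y.
    have [->|/pf /andP[y1 y2]] := eqVneq (f y) 0; first by rewrite mulr0.
    rewrite he ?mul0r// ltr_norml; apply/andP.
    by move: y1 y2 e0; clear; lra.
  have [W [oO vO] Ox] : (\bigcup_(O in [set O | open O /\ vanishes_on g O]) O) x.
    by apply: contrapT => h; apply: nx.
  have /nbhs_ballP[e /= e0 he] := open_nbhs_nbhs (conj oO Ox).
  exists (e / 2); first by rewrite divr_gt0.
  move=> f sf _ pf; apply: vO.
    by apply: test_fun_mul => //; exact: smooth_mul.
  have pp : supp_in (x - e / 2) (x + e / 2) (fun y => chi y * (phi y * f y)).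
    by apply: supp_in_mulr; exact: supp_in_mulr.
  move=> y /(supp_in_closure pp); rewrite /= in_itv /= => /andP[y1 y2].
  apply: he; rewrite /ball /= ltr_norml; apply/andP.
  by move: y1 y2 e0; clear => *; lra.
rewrite -TE; apply/eqP; rewrite eq_le; apply/andP; split.
  rewrite -oppr_ge0 -ed_opp//; apply: (@local_sign _ _ _ (- A) A hT (smooth_opp sphi)) => [y|x _].
    by rewrite oppr_eq0; exact: pphi.
  have [e e0 he] := loc x; exists e => // f sf f0 pf.
  rewrite (_ : (fun y => _) = fun y => - (phi y * f y)); last by apply/funext => y; rewrite mulNr.
  by rewrite ed_opp ?he ?oppr0//; exact: smooth_mul.
apply: (local_sign hT sphi pphi) => x _; have [e e0 he] := loc x.
by exists e => // f sf f0 pf; rewrite he.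
Qed.

(** The cut-off chosen by [get] and the given one differ by a function that vanishes near the
    support of g. *)
Lemma ext_pairingE (g : distrib R) (a b d : R) chi phi : supported_in a b g ->
  0 < d -> test_fun chi -> (forall y, a - d < y < b + d -> chi y = 1) -> sm phi ->
  ext_pairing g phi = g (fun y => chi y * phi y).
Proof.
move=> sg d0 tchi chi1 sphi.
have cut : cutoff g chi.
  split=> //; exists `]a - d, b + d[%classic; split.
  - exact: interval_open.
  - move=> y /sg; rewrite /= !in_itv /= => /andP[y1 y2]; apply/andP.
    by move: y1 y2 d0; clear; lra.
  - by move=> y; rewrite /= in_itv /=; exact: chi1.
pose V := [set v | exists2 chi, cutoff g chi & v = g (fun y => chi y * phi y)].
have exV : exists v, V v by exists (g (fun y => chi y * phi y)), chi.
have := getPex exV; rewrite -/(ext_pairing g phi) => -[chi' [tchi' [W [oO sO O1]]] ->].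
pose T f := g (fun y => plateau 0 0 1 y * f y).
have t1 := test_fun_mul tchi' sphi; have t2 := test_fun_mul tchi sphi.
have t3 : test_fun (fun y => (-1) * (chi y * phi y) + chi' y * phi y).
  have -> : (fun y => (-1) * (chi y * phi y) + chi' y * phi y) = fun y => (chi' y - chi y) * phi y.
    by apply/funext => y; ring.
  apply: test_fun_mul => //; apply/test_funP.
  have /test_funP[s1 [A1 h1]] := tchi; have /test_funP[s2 [A2 h2]] := tchi'.
  split; first exact: smooth_sub.
  exists (Num.max A1 A2) => y hy; have [E|/h1 /andP[y1 y2]] := eqVneq (chi y) 0.
    have /h2 /andP[y1 y2] : chi' y != 0 by move: hy; rewrite E subr0.
    rewrite le_max y2 orbT andbT; apply: le_trans y1; by rewrite lerN2 le_max lexx orbT.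
  rewrite le_max y2 andbT; apply: le_trans y1; by rewrite lerN2 le_max lexx.
apply/eqP; rewrite -subr_eq0 addrC -mulN1r -distrib_linear//; apply/eqP.
apply: vanish_off_support => // x gx.
have /nbhs_ballP[e1 /= e10 he1] := open_nbhs_nbhs (conj oO (sO x gx)).
exists (Num.min e1 d); first by rewrite lt_min e10.
move=> y; rewrite lt_min => /andP[y1 y2].
have cy : chi y = 1.
  apply: chi1; have := sg x gx; rewrite /= in_itv /= => /andP[x1 x2].
  by move: y2; rewrite ltr_norml => /andP[]; move: x1 x2; clear => *; apply/andP; split; lra.
by rewrite cy (O1 y) ?mulN1r ?mul1r ?addNr//; apply: he1; rewrite /ball /= distrC.
Qed.

Lemma edist_ext (g : distrib R) (a b : R) : supported_in a b g -> edist (ext_pairing g).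
Proof.
move=> sg; pose chi := plateau (a - 1) (b + 1) 1.
have tchi : test_fun chi by apply: test_fun_plateau.
have chi1 y : a - 1 < y < b + 1 -> chi y = 1.
  by move=> /andP[y1 y2]; apply: plateau1 => //; rewrite !ltW.
have E f : sm f -> ext_pairing g f = g (fun y => chi y * f y).
  by move=> sf; exact: (ext_pairingE sg ltr01 tchi chi1 sf).
have hT := edist_distrib g tchi.
split=> [c f h sf sh|].
  rewrite !E//; last by apply: smooth_add => //; exact: smooth_scale.
  exact: (ed_lin hT c sf sh).
have [A [C [N [C0 hC]]]] := ed_bd hT.
by exists A, C, N; split=> // f B sf hB; rewrite E//; exact: hC.
Qed.

Lemma ext_test (g : distrib R) (a b : R) f : supported_in a b g -> test_fun f ->
  ext_pairing g f = g f.
Proof.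
move=> sg /test_funP[sf [A pf]].
pose P := Num.min (a - 1) (- A); pose Q := Num.max (b + 1) A.
rewrite (@ext_pairingE g a b 1 (plateau P Q 1) f sg ltr01) => //.
- congr (distrib_fun g); apply/funext => y.
  have [->|/pf /andP[y1 y2]] := eqVneq (f y) 0; first by rewrite mulr0.
  by rewrite plateau1 ?mul1r// ge_min y1 orbT le_max y2 orbT.
- exact: test_fun_plateau.
- move=> y /andP[/ltW y1 /ltW y2]; apply: plateau1 => //.
  by rewrite ge_min y1 le_max y2.
Qed.

Lemma ext_vanish (g : distrib R) (a b : R) f e : supported_in a b g -> sm f -> 0 < e ->
  (forall y, a - e < y < b + e -> f y = 0) -> ext_pairing g f = 0.
Proof.
move=> sg sf e0 f0; pose chi := plateau (a - 1) (b + 1) 1.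
have tchi : test_fun chi by apply: test_fun_plateau.
have chi1 y : a - 1 < y < b + 1 -> chi y = 1.
  by move=> /andP[y1 y2]; apply: plateau1 => //; rewrite !ltW.
rewrite (ext_pairingE sg ltr01 tchi chi1 sf).
apply: vanish_off_support; first exact: test_fun_mul.
move=> x /sg; rewrite /= in_itv /= => /andP[x1 x2]; exists e => // y.
rewrite ltr_norml => /andP[y1 y2]; rewrite f0 ?mulr0//; apply/andP.
by move: x1 x2 y1 y2; clear; lra.
Qed.

Lemma pv_right (U : distrib R) x c phi : point_value U x c -> test_fun phi -> forall e, 0 < e ->
  exists2 u, 0 < u & forall r, 0 < r <= u ->
    `|r^-1 * U (sc x r phi) - c * \int[mu]_y phi y| <= e.
Proof.
move=> hU tphi e e0; have /cvgrPdist_le /(_ e e0) [d /= d0 hd] := hU phi tphi.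
exists (d / 2); first by rewrite divr_gt0.
move=> r /andP[r0 rd]; have := hd r; rewrite /= sub0r normrN gtr0_norm// => h.
have {}h := h ltac:(by move: rd d0; clear; lra) ltac:(by rewrite gt_eqF).
by rewrite distrC; move: h; rewrite /affine_pairing [`|r|]gtr0_norm.
Qed.

Lemma Rintegral_primitive f (G : R -> R) (A B A' B' : R) : A < A' -> B' < B -> A < B ->
  continuous f -> supp_in A' B' f -> (forall z, is_derive z 1 G (f z)) ->
  \int[mu]_y f y = G B - G A.
Proof.
move=> AA BB AB cf pf dG.
rewrite /Rintegral; have -> : (\int[mu]_y (f y)%:E = \int[mu]_(y in `[A, B]) (f y)%:E)%E.
  rewrite [RHS]integral_mkcond; apply: eq_integral => y _.
  rewrite patchE; case: ifPn => // /negP; rewrite inE /= in_itv /= => ny.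
  congr (_%:E); apply: (supp_in_eq0 pf) => /andP[y1 y2]; apply: ny.
  by rewrite !ltW// ?(lt_le_trans AA)// (le_lt_trans y2).
by rewrite (integral_antiderivative AB cf dG).
Qed.

Lemma integral_der phi : test_fun phi -> \int[mu]_y der phi y = 0.
Proof.
move=> /test_funP[sphi [A pphi]]; pose B := Num.max A 0 + 1.
have AB : A < B by rewrite /B ltr_pwDr// le_max lexx.
have B0 : 0 < B by rewrite /B ltr_pwDr// le_max lexx orbT.
have z1 : phi B = 0 by apply: (supp_in_eq0 pphi); rewrite [B <= A]leNgt AB andbF.
have z2 : phi (- B) = 0 by apply: (supp_in_eq0 pphi); rewrite lerN2 leNgt AB.
have h1 : - B < - A by rewrite ltrN2.
have h2 : - B < B by move: B0; clear; lra.
have hc : continuous (der phi) by exact/smooth_continuous/smooth_der.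
have hp : supp_in (- A) A (der phi) by exact: (supp_in_dn (k := 1) sphi pphi).
rewrite (Rintegral_primitive h1 AB h2 hc hp (fun z => smooth_is_derive1 z sphi)).
by rewrite z1 z2 subrr.
Qed.

Lemma der_sc c r phi : sm phi -> der (sc c r phi) = fun y => r^-1 * sc c r (der phi) y.
Proof. by move=> sphi; have := dn_sc c r 1 sphi. Qed.

Lemma test_fun_sc c r phi : 0 < r -> test_fun phi -> test_fun (sc c r phi).
Proof.
move=> r0 /test_funP[sphi [A pphi]].
apply: (@test_fun_supp R (c - r * A) (c + r * A)); first exact: smooth_sc.
move=> y /pphi; rewrite ler_pdivlMr// ler_pdivrMr// => /andP[y1 y2]; apply/andP.
by move: y1 y2; rewrite mulNr mulrC; clear; lra.
Qed.

Lemma test_fun_der phi : test_fun phi -> test_fun (der phi).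
Proof.
move=> /test_funP[sphi [A pphi]]; apply/test_funP; split; first exact: smooth_der.
by exists A; exact: (supp_in_dn (k := 1) sphi pphi).
Qed.

Lemma distrib_scale (g : distrib R) c phi : test_fun phi -> g (fun y => c * phi y) = c * g phi.
Proof.
move=> tphi; have hT := edist_distrib g (test_fun_plateau 0 0 ltr01).
have t0 : test_fun (fun=> 0 : R).
  apply/test_funP; split; first exact: smooth_cst.
  by exists 0 => y; rewrite eqxx.
have g0 : g (fun=> 0) = 0.
  by rewrite -[RHS](ed0 hT); congr (distrib_fun g); apply/funext => y; rewrite mulr0.
by rewrite -[RHS]addr0 -g0 -distrib_linear//; congr (distrib_fun g); apply/funext => y; rewrite addr0.
Qed.

(** On a dilate of phi, u equals - r ^ -1 times U on the dilate of phi', which tends to the point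
    value times the integral of phi', that is to 0. *)
Lemma primitive_no_atom (u U : distrib R) c v phi : is_derivative U u -> point_value U c v ->
  test_fun phi -> forall e, 0 < e ->
  exists2 d, 0 < d & forall r, 0 < r <= d -> `|u (sc c r phi)| <= e.
Proof.
move=> dU hU tphi e e0.
have [d d0 hd] := pv_right hU (test_fun_der tphi) e0.
exists d => // r rd; have /andP[r0 _] := rd.
have := hd r rd; rewrite integral_der// mulr0 subr0 => h.
rewrite (dU _ (test_fun_sc c r0 tphi)) -derE der_sc; last exact: test_fun_sm.
rewrite distrib_scale ?normrN//; exact: test_fun_sc (test_fun_der tphi).
Qed.

Lemma limf_einf_right (F : R -> R) (l : R) : (l%:E <= limf_einf (fun t => (F t)%:E) 0^'+)%E ->
  forall e, 0 < e -> exists2 u, 0 < u & forall t, 0 < t <= u -> l - e <= F t.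
Proof.
move=> hl e e0; have : ((l - e)%:E < limf_einf (fun t => (F t)%:E) 0^'+)%E.
  by apply: lt_le_trans hl; rewrite lte_fin gtrBl.
rewrite limf_einfE => /ereal_sup_gt [_ [A /= FA <-]] hlt.
have [d /= d0 hd] := FA; exists (d / 2); first by rewrite divr_gt0.
move=> t /andP[t0 td]; rewrite -lee_fin; apply: le_trans (ltW hlt) _.
apply: ereal_inf_lbound; exists t => //; apply: hd => //=.
by rewrite sub0r normrN gtr0_norm//; move: td d0; clear; lra.
Qed.

Lemma limf_einf_bounded (F : R -> R) : (-oo < limf_einf (fun t => (F t)%:E) 0^'+)%E ->
  exists M, exists2 u, 0 < u & forall t, 0 < t <= u -> - M <= F t.
Proof.
rewrite limf_einfE => /ereal_sup_gt [_ [A /= FA <-]] hlt.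
have [d /= d0 hd] := FA.
have lb t : 0 < t <= d / 2 -> (ereal_inf ((fun t => (F t)%:E) @` A) <= (F t)%:E)%E.
  move=> /andP[t0 td]; apply: ereal_inf_lbound; exists t => //; apply: hd => //=.
  by rewrite sub0r normrN gtr0_norm//; move: td d0; clear; lra.
have d20 : 0 < d / 2 by rewrite divr_gt0.
move: hlt lb; case: (ereal_inf _) => [m| |] // _ lb.
  exists (- m), (d / 2) => // t /lb; by rewrite lee_fin opprK.
by have := lb (d / 2) ltac:(by rewrite d20 lexx).
Qed.

Lemma limf_esup_right (F : R -> R) (l : R) : (limf_esup (fun t => (F t)%:E) 0^'+ <= l%:E)%E ->
  forall e, 0 < e -> exists2 u, 0 < u & forall t, 0 < t <= u -> F t <= l + e.
Proof.
move=> hl e e0; have h : ((- l)%:E <= limf_einf (fun t => (- F t)%:E) 0^'+)%E.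
  have -> : (fun t => (- F t)%:E) = (\- (fun t => (F t)%:E))%E by [].
  by rewrite limf_einfN EFinN leeN2.
have [u u0 hu] := limf_einf_right h e0; exists u => // t /hu; clear; lra.
Qed.

Lemma limf_esup_bounded (F : R -> R) : (limf_esup (fun t => (F t)%:E) 0^'+ < +oo)%E ->
  exists M, exists2 u, 0 < u & forall t, 0 < t <= u -> F t <= M.
Proof.
move=> hl; have h : (-oo < limf_einf (fun t => (- F t)%:E) 0^'+)%E.
  have -> : (fun t => (- F t)%:E) = (\- (fun t => (F t)%:E))%E by [].
  by rewrite limf_einfN lteNr.
have [M [u u0 hu]] := limf_einf_bounded h; exists M, u => // t /hu; clear; lra.
Qed.

(** The test function against which major and minor pairs are used: it belongs to [T1], hence to
    both classes. *)
Definition ngam y : R := (Num.sqrt pi)^-1 * gam y.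

Lemma sqrt_pi_gt0 : 0 < Num.sqrt (@pi R).
Proof. by rewrite sqrtr_gt0 pi_gt0. Qed.

Lemma smooth_ngam : sm ngam.
Proof. by apply: smooth_scale; exact: smooth_gam. Qed.

Lemma T0_ngam : T0 ngam.
Proof.
have p0 := sqrt_pi_gt0; split.
- by apply/smP; exact: smooth_ngam.
- by move=> x; rewrite mulr_ge0 ?expR_ge0// invr_ge0 ltW.
- have gE : (\int[mu]_x (gam x)%:E = (Num.sqrt pi)%:E)%E by exact: integralT_gauss.
  rewrite /ngam /Rintegral.
  under eq_integral do rewrite EFinM.
  rewrite integralZl//; last exact: integrableT_gauss.
  by rewrite gE -EFinM /= mulVf// gt_eqF.
- exists (-2); first by clear; lra.
  move=> m; have [C C0 hC] := @gam_bound R m; have [P P0 hP] := @poly_le_gauss R m.+2.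
  exists ((Num.sqrt pi)^-1 * (C * P)), 1 => x x1.
  have x0 : 0 < `|x| by apply: lt_le_trans x1.
  rewrite -dnE (dn_scale _ _ smooth_gam) normrM gtr0_norm ?invr_gt0// -[leRHS]mulrA.
  rewrite ler_wpM2l ?invr_ge0 ?(ltW p0)//; apply: le_trans (hC x) _.
  rewrite -[leRHS]mulrA ler_wpM2l//.
  have -> : `|x| `^ (-2 - m%:R) = `|x| ^- m.+2.
    rewrite (_ : -2 - m%:R = - (m.+2)%:R); last by rewrite -addn2 natrD; ring.
    by rewrite powRN powR_mulrn// ltW.
  rewrite expRN ler_pdivlMr ?exprn_gt0// mulrC ler_pdivrMr ?expR_gt0//.
  apply: le_trans (hP x); by apply: lerXn2r; rewrite ?nnegrE ?addr_ge0// lerDr.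
Qed.

Lemma T1_ngam : T1 ngam.
Proof.
split; first exact: T0_ngam.
move=> x; rewrite -derE; have -> : der ngam = fun y => (Num.sqrt pi)^-1 * (-2 * (y * gam y)).
  apply: is_derive_der => y.
  by have := is_deriveZ (Num.sqrt pi)^-1 (is_derive_gam y).
have -> : x * ((Num.sqrt pi)^-1 * (-2 * (x * gam x)))
  = - (x ^+ 2 * (2 * (Num.sqrt pi)^-1 * gam x)) by ring.
rewrite oppr_le0; apply: mulr_ge0 (sqr_ge0 x) _.
by rewrite !mulr_ge0 ?expR_ge0// invr_ge0 ltW// sqrt_pi_gt0.
Qed.

Lemma affine_ngam T x t : edist T -> 0 < t ->
  affine_pairing T x t ngam = (Num.sqrt pi)^-1 * hk T 0 x t.
Proof.
move=> hT t0; rewrite /affine_pairing gtr0_norm//.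
have ss : sm (sc x t gam) by apply: smooth_sc; exact: smooth_gam.
have -> : (fun y => ngam ((y - x) / t)) = fun y => (Num.sqrt pi)^-1 * sc x t gam y by [].
rewrite ed_scale// /hk gk_sc expr1 ed_scale//; ring.
Qed.

(** The derivative of the tested function consists of a normalized bump at a and minus one at b, so
    the pairing tends to the difference of the point values of U at b and a. *)
Lemma pairing_step (u U : distrib R) (a b c e : R) : is_derivative U u -> a < b ->
  point_value U a 0 -> point_value U b c -> 0 < e ->
  exists2 d, 0 < d & forall r, 0 < r <= d ->
    `|u (fun y => sc a r step y - sc b r step y) - c| <= e.
Proof.
move=> dU ab ha hb e0.
have ss := @smooth_step R.
have trho : test_fun (der (@step R)).
  apply: (@test_fun_supp R 0 1); first exact: smooth_der ss.
  move=> y; apply: contraNT; rewrite negb_and -!ltNge => /orP[] hy; apply/eqP.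
    rewrite [LHS](@dn_eq_near R 1 _ (fun=> 0) y (- y) ss (smooth_cst 0)) ?dn0 ?oppr_gt0//.
    by move=> z hz; apply: step0; have := ler_norm (z - y); move: hz; clear; lra.
  rewrite [LHS](@dn_eq_near R 1 _ (fun=> 1) y (y - 1) ss (smooth_cst 1)) ?dn_cst ?subr_gt0//.
  by move=> z hz; apply: step1; have := ler_norm (y - z); rewrite distrC; move: hz; clear; lra.
have irho : \int[mu]_y der (@step R) y = 1.
  have /test_funP[_ [A pA]] := trho.
  have q1 : - (`|A| + 1) < - A by rewrite ltrN2 ltr_pwDr// ler_norm.
  have q2 : A < `|A| + 1 by rewrite ltr_pwDr// ler_norm.
  have q3 : - (`|A| + 1) < `|A| + 1 by have := normr_ge0 A; clear; lra.
  have hc : continuous (der (@step R)) by exact/smooth_continuous/smooth_der.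
  rewrite (Rintegral_primitive q1 q2 q3 hc pA (fun z => smooth_is_derive1 z ss)).
  by rewrite step1 ?lerDr// step0 ?subr0// oppr_le0 addr_ge0.
have e20 : 0 < e / 2 by rewrite divr_gt0.
have [d1 d10 h1] := pv_right ha trho e20; have [d2 d20 h2] := pv_right hb trho e20.
exists (Num.min d1 d2); first by rewrite lt_min d10.
move=> r /andP[r0]; rewrite le_min => /andP[rd1 rd2].
have sa : sm (sc a r (@step R)) by exact: smooth_sc.
have sb : sm (sc b r (@step R)) by exact: smooth_sc.
have tf : test_fun (fun y => sc a r step y - sc b r step y).
  apply: (@test_fun_supp R a (b + r)); first exact: smooth_sub.
  move=> y; apply: contraNT; rewrite negb_and -!ltNge => /orP[] hy; rewrite /sc.
    have hb' : (y - b) / r <= 0 by rewrite ler_pdivrMr// mul0r; move: hy ab; clear; lra.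
    have ha' : (y - a) / r <= 0 by rewrite ler_pdivrMr// mul0r; move: hy ab; clear; lra.
    by rewrite !step0 ?subrr.
  have hb' : 1 <= (y - b) / r by rewrite ler_pdivlMr// mul1r; move: hy ab; clear; lra.
  have ha' : 1 <= (y - a) / r by rewrite ler_pdivlMr// mul1r; move: hy ab; clear; lra.
  by rewrite !step1 ?subrr.
rewrite (dU _ tf) -derE.
have -> : der (fun y => sc a r step y - sc b r step y)
    = fun y => r^-1 * sc a r (der step) y + (- r^-1) * sc b r (der step) y.
  have -> : der (fun y => sc a r step y - sc b r step y)
    = (fun y => der (sc a r step) y - der (sc b r step) y) := dn_sub 1 sa sb.
  by apply/funext => y; rewrite (der_sc a r ss) (der_sc b r ss) mulNr.
have ta := test_fun_sc a r0 trho; have tb := test_fun_sc b r0 trho.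
have tb' : test_fun (fun y => (- r^-1) * sc b r (der step) y).
  have /test_funP[s1 [A1 p1]] := tb; apply/test_funP; split; first exact: smooth_scale.
  by exists A1; exact: supp_in_mulr.
rewrite distrib_linear// distrib_scale//.
have := h1 r; rewrite r0 rd1 mul0r subr0 => /(_ isT) /ler_normlP[q1 q2].
have := h2 r; rewrite r0 rd2 irho mulr1 => /(_ isT) /ler_normlP[q3 q4].
by rewrite ler_norml; apply/andP; move: q1 q2 q3 q4; rewrite mulNr; clear; lra.
Qed.

(** Positivity is proved for u - v on a neighbourhood of [a, b], where the end points are interior,
    and then tested on smooth approximations of the indicator of [a, b]. *)
Theorem minor_le_major (a b : R) (F : R -> R) (u U v V : distrib R) c d : a < b ->
  major_pair a b (EFin \o F) u U -> minor_pair a b (EFin \o F) v V ->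
  point_value U b c -> point_value V b d -> d <= c.
Proof.
move=> ab [su LU dU Ua [E1 [Z1 [cE1 nZ1 hZ1 hE1]]]] [sv LV dV Va [E2 [Z2 [cE2 nZ2 hZ2 hE2]]]] Ub Vb.
have eu := edist_ext su; have ev := edist_ext sv.
pose T f := (-1) * ext_pairing v f + ext_pairing u f.
have hT : edist T by exact: edist_lin.
have TE f : test_fun f -> T f = u f - v f.
  by move=> tf; rewrite /T (ext_test su tf) (ext_test sv tf) mulN1r addrC.
have hkT x t : hk T 0 x t = hk (ext_pairing u) 0 x t - hk (ext_pairing v) 0 x t.
  by rewrite /hk /T mulN1r addrC.
have hu t x : 0 < t -> affine_pairing (ext_pairing u) x t ngam
    = (Num.sqrt pi)^-1 * hk (ext_pairing u) 0 x t by exact: affine_ngam.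
have hv t x : 0 < t -> affine_pairing (ext_pairing v) x t ngam
    = (Num.sqrt pi)^-1 * hk (ext_pairing v) 0 x t by exact: affine_ngam.
have P0 := sqrt_pi_gt0; pose P := Num.sqrt (@pi R).
have hkT' x t : 0 < t -> hk T 0 x t = P * (affine_pairing (ext_pairing u) x t ngam
    - affine_pairing (ext_pairing v) x t ngam).
  move=> t0; rewrite hu// hv// hkT -mulrBr mulrA divff ?mul1r//.
  by rewrite gt_eqF.
(* Off [a, b] the pairs assert nothing, but both functionals vanish there. *)
have outside x : ~~ (x \in `[a, b]) -> pos_near T x.
  rewrite in_itv /= negb_and -!ltNge => /orP xab.
  have [e e0 he] : exists2 e, 0 < e & x + e < a - e / 2 \/ b + e / 2 < x - e.
    case: xab => h; [exists ((a - x) / 2)|exists ((x - b) / 2)].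
    - by rewrite divr_gt0 ?subr_gt0.
    - by left; move: h; clear; lra.
    - by rewrite divr_gt0 ?subr_gt0.
    - by right; move: h; clear; lra.
  exists e => // f c' d' sf f0 cc dd pf.
  have fz y : a - e / 2 < y < b + e / 2 -> f y = 0.
    move=> /andP[y1 y2]; apply: (supp_in_eq0 pf) => /andP[y3 y4].
    by case: he => he; move: he e0 y1 y2 y3 y4 cc dd; clear; lra.
  have e20 : 0 < e / 2 by rewrite divr_gt0.
  by rewrite /T (ext_vanish su sf e20 fz) (ext_vanish sv sf e20 fz) mulr0 addr0.
have pos : pos_on T (a - 1) (b + 1).
  apply: (@positivity R T (a - 1) (b + 1) (E1 `|` E2) (Z1 `|` Z2)) => //.
  - by rewrite -bigcup2E; apply: bigcup_countable => //; case=> [|[|i]] _ //=.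
  - exact: negligibleU.
  - move=> x _ phi sphi pphi e e0.
    have tphi := test_fun_supp sphi pphi.
    have e20 : 0 < e / 2 by rewrite divr_gt0.
    have [cu hcu] := LU x; have [cv hcv] := LV x.
    have [d1 d10 h1] := primitive_no_atom dU hcu tphi e20.
    have [d2 d20 h2] := primitive_no_atom dV hcv tphi e20.
    exists (Num.min d1 d2); first by rewrite lt_min d10.
    move=> r /andP[r0]; rewrite le_min => /andP[rd1 rd2].
    rewrite TE; last exact: test_fun_sc.
    have := h1 r; rewrite r0 rd1 => /(_ isT) q1; have := h2 r; rewrite r0 rd2 => /(_ isT) q2.
    by apply: le_trans (ler_normB _ _) _; move: q1 q2; clear; lra.
  - move=> x e _ nZ e0; have [xab|nx] := boolP (x \in `[a, b]); last first.
      exact: (hk_ge_near hT (outside x nx) e0).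
    have nZ1' : ~ Z1 x by move=> z; apply: nZ; left.
    have nZ2' : ~ Z2 x by move=> z; apply: nZ; right.
    have e'0 : 0 < e / P / 2 by rewrite !divr_gt0.
    have [u1 u10 h1] := limf_einf_right (hZ1 x ngam xab nZ1' T0_ngam) e'0.
    have [u2 u20 h2] := limf_esup_right (hZ2 x ngam xab nZ2' T0_ngam) e'0.
    exists (Num.min u1 u2); first by rewrite lt_min u10.
    move=> t /andP[t0]; rewrite le_min => /andP[tu1 tu2].
    have q1 := h1 t ltac:(by rewrite t0 tu1); have q2 := h2 t ltac:(by rewrite t0 tu2).
    rewrite hkT'//; apply: le_trans (_ : P * (- (e / P)) <= _).
      by rewrite mulrN lerN2 mulrC divfK// gt_eqF.
    rewrite ler_wpM2l ?(ltW P0)//; move: q1 q2; rewrite /affine_pairing.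
    by move: (e / P) => k; clear; lra.
  - move=> x _ nE; have [xab|nx] := boolP (x \in `[a, b]); last first.
      have [u1 u10 h1] := hk_ge_near hT (outside x nx) ltr01.
      by exists 1, u1.
    have nE1 : ~ E1 x by move=> z; apply: nE; left.
    have nE2 : ~ E2 x by move=> z; apply: nE; right.
    have [M1 [u1 u10 h1]] := limf_einf_bounded (hE1 x ngam xab nE1 T1_ngam).
    have [M2 [u2 u20 h2]] := limf_esup_bounded (hE2 x ngam xab nE2 T1_ngam).
    exists (P * (M1 + M2)), (Num.min u1 u2); first by rewrite lt_min u10.
    move=> t /andP[t0]; rewrite le_min => /andP[tu1 tu2].
    have q1 := h1 t ltac:(by rewrite t0 tu1); have q2 := h2 t ltac:(by rewrite t0 tu2).
    rewrite hkT'// -mulrN ler_wpM2l ?(ltW P0)//.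
    by move: q1 q2; rewrite /affine_pairing; clear; lra.
apply/ler_addgt0Pr => e e0; have e20 : 0 < e / 2 by rewrite divr_gt0.
have [d1 d10 h1] := pairing_step dU ab Ua Ub e20.
have [d2 d20 h2] := pairing_step dV ab Va Vb e20.
pose r := Num.min (Num.min d1 d2) 2^-1.
have r0 : 0 < r by rewrite !lt_min d10 d20 invr_gt0/=.
have rd1 : 0 < r <= d1 by rewrite r0 !ge_min lexx.
have rd2 : 0 < r <= d2 by rewrite r0 !ge_min lexx orbT.
have r1 : r <= 2^-1 by rewrite ge_min lexx orbT.
(* Nonnegative because [step] is monotone and a < b; T f tends to c - d. *)
pose f y := sc a r (@step R) y - sc b r step y.
have sf : sm f by apply: smooth_sub; apply: smooth_sc; exact: smooth_step.
have pf : supp_in (a - 1 / 2) (b + 1 / 2) f.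
  move=> y; apply: contraNT; rewrite negb_and -!ltNge => /orP[] hy; rewrite /f /sc.
    have hb' : (y - b) / r <= 0 by rewrite ler_pdivrMr// mul0r; move: hy ab; clear; lra.
    have ha' : (y - a) / r <= 0 by rewrite ler_pdivrMr// mul0r; move: hy ab; clear; lra.
    by rewrite !step0 ?subrr.
  have hb' : 1 <= (y - b) / r by rewrite ler_pdivlMr// mul1r; move: hy ab r1; clear; lra.
  have ha' : 1 <= (y - a) / r by rewrite ler_pdivlMr// mul1r; move: hy ab r1; clear; lra.
  by rewrite !step1 ?subrr.
have f0 y : 0 <= f y.
  rewrite subr_ge0; apply: step_mono; rewrite ler_pM2r ?invr_gt0//.
  by move: ab; clear; lra.
have : 0 <= T f.
  apply: (pos f _ _ sf f0 _ _ pf); by clear; lra.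
rewrite TE; last exact: test_fun_supp pf.
move: (h1 r rd1) (h2 r rd2) => /ler_normlP[q1 q2] /ler_normlP[q3 q4].
by move: q1 q2 q3 q4; rewrite /f; clear; lra.
Qed.

End Comparison.

(** * Products with functions smooth up to the end points *)
Section CutProduct.
Context {R : realType}.
Implicit Types (f g phi psi rho : R -> R) (n k m j : nat) (x y z e c v w B r s d q t M L : R) (T u : (R -> R) -> R).

(** The one-sided quotients give continuity up to the end points but two-sided derivatives only
    inside: off [a, b] nothing is known of the D n. *)
Lemma smooth_on_derivs (a b : R) psi : smooth_on a b psi ->
  exists D : nat -> R -> R, [/\ {in `[a, b], D 0%N =1 psi},
    forall n x, a < x < b -> is_derive x 1 (D n) (D n.+1 x) &
    forall n, {within `[a, b], continuous (D n)}].
Proof.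
move=> [D [D0 hD]].
have quo n x e : a <= x <= b -> 0 < e -> exists2 d, 0 < d & forall y, `|y - x| < d ->
    a <= y <= b -> `|D n y - D n x - (y - x) * D n.+1 x| <= e * `|y - x|.
  move=> xab e0; have xI : x \in `[a, b] by rewrite in_itv.
  have /cvgrPdist_le /(_ e e0) := hD n x xI.
  rewrite /prop_near1 /= /within /= => -[d /= d0 hd]; exists d => // y yx yab.
  have [->|nyx] := eqVneq y x; first by rewrite !subrr mul0r subrr normr0 mulr0.
  have := hd y; rewrite /= distrC => /(_ yx nyx); rewrite in_itv /= yab => /(_ isT).
  move=> h; have yx0 : y - x != 0 by rewrite subr_eq0.
  have -> : D n y - D n x - (y - x) * D n.+1 x
    = - ((D n.+1 x - (D n y - D n x) / (y - x)) * (y - x)) by field.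
  by rewrite normrN normrM ler_wpM2r.
exists D; split=> // n.
- move=> x /andP[ax xb]; apply/is_derive_eps => e e0.
  have [d d0 hd] := quo n x e ltac:(by rewrite !ltW) e0.
  exists (Num.min d (Num.min (x - a) (b - x))); first by rewrite !lt_min d0 !subr_gt0 ax.
  move=> h; rewrite !lt_min => /and3P[h1 h2 h3].
  have := hd (x + h); have -> : x + h - x = h by ring.
  apply=> //; apply/andP; move: h2 h3 (ler_norm h) (ler_norm (- h)); rewrite normrN.
  by clear; lra.
- apply/subspace_continuousP => x /=; rewrite in_itv /= => xab.
  apply/cvgrPdist_le => e e0; have [d d0 hd] := quo n x 1 xab ltr01.
  pose L := `|D n.+1 x| + 1; have L0 : 0 < L by rewrite ltr_pwDr.
  have m0 : 0 < Num.min d (e / L) by rewrite lt_min d0 divr_gt0.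
  rewrite /prop_near1 /= /within /=; exists (Num.min d (e / L)) => //= y /=.
  rewrite distrC lt_min => /andP[y1 y2]; rewrite in_itv /= => yab.
  have := hd y y1 yab; rewrite mul1r => h; rewrite distrC.
  rewrite (_ : D n y - D n x = (D n y - D n x - (y - x) * D n.+1 x) + (y - x) * D n.+1 x);
    last by ring.
  apply: le_trans (ler_normD _ _) _; rewrite normrM.
  apply: le_trans (_ : `|y - x| * L <= _); first by move: h; rewrite /L mulrDr; clear; lra.
  by rewrite -ler_pdivlMr// ltW.
Qed.

Lemma within_bounded f (a b : R) : a <= b -> {within `[a, b], continuous f} ->
  exists2 M, 0 <= M & forall y, a <= y <= b -> `|f y| <= M.
Proof.
move=> ab cf; have [c1 _ h1] := EVT_max ab cf; have [c2 _ h2] := EVT_min ab cf.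
exists (`|f c1| + `|f c2|) => // y yab; have yI : y \in `[a, b] by rewrite in_itv.
have := h1 y yI; have := h2 y yI; rewrite ler_norml => q1 q2.
by move: q1 q2 (ler_norm (f c1)) (ler_norm (- f c2)); rewrite normrN
  => q1 q2 q3 q4; apply/andP; move: q1 q2 q3 q4 (normr_ge0 (f c1)) (normr_ge0 (f c2)); clear; lra.
Qed.

Section Cut.
Context (a b : R) (D : nat -> R -> R)
  (dD : forall n x, a < x < b -> is_derive x 1 (D n) (D n.+1 x)).

(** At a point off ]a, b[ the product vanishes nearby together with rho, so the behaviour of [D k]
    there does not matter. *)
Lemma is_derive_cut rho a' b' k x : sm rho -> supp_in a' b' rho -> a < a' -> b' < b ->
  is_derive x 1 (fun y => rho y * D k y) (der rho x * D k x + rho x * D k.+1 x).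
Proof.
move=> srho prho aa bb; have dr := smooth_is_derive1 x srho.
have [xab|nx] := boolP (a < x < b).
  have dk := dD k xab; have := is_deriveM dr dk => h.
  apply: (is_derive_eq h); rewrite /= /GRing.scale /=; ring.
have z1 : rho x = 0.
  by apply: (supp_in_eq0 prho) => /andP[h1 h2]; case/negP: nx; rewrite (lt_le_trans aa)// (le_lt_trans h2).
have z2 : der rho x = 0.
  apply: (supp_in_eq0 (supp_in_dn (k := 1) srho prho)) => /andP[h1 h2].
  by case/negP: nx; rewrite (lt_le_trans aa)// (le_lt_trans h2).
rewrite z1 z2 !mul0r addr0; apply/is_derive_eps => e e0.
exists (Num.min (a' - a) (b - b')); first by rewrite lt_min !subr_gt0 aa.
move=> h; rewrite lt_min => /andP[h1 h2].
rewrite (_ : rho (x + h) = 0) ?z1 ?mul0r ?mulr0 ?subrr ?normr0 ?mulr_ge0 ?(ltW e0)//.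
apply: (supp_in_eq0 prho) => /andP[h3 h4]; case/negP: nx; apply/andP.
by move: h1 h2 h3 h4 (ler_norm h) (ler_norm (- h)); rewrite normrN; clear => *; split; lra.
Qed.

Lemma der_cut rho a' b' k : sm rho -> supp_in a' b' rho -> a < a' -> b' < b ->
  der (fun y => rho y * D k y) = fun x => der rho x * D k x + rho x * D k.+1 x.
Proof. by move=> h1 h2 h3 h4; apply: is_derive_der => x; exact: is_derive_cut h2 h3 h4. Qed.

Lemma smooth_cut rho a' b' k : sm rho -> supp_in a' b' rho -> a < a' -> b' < b ->
  sm (fun y => rho y * D k y).
Proof.
move=> srho prho aa bb; apply/smoothCn => n; elim: n rho k srho prho => [//|n IH] rho k srho prho.
split=> [x|].
  by have [h _] := is_derive_cut k x srho prho aa bb.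
rewrite (der_cut k srho prho aa bb); apply: Cn_add; last exact: IH.
by apply: IH; [exact: smooth_der|exact: (supp_in_dn (k := 1))].
Qed.

Lemma dn_cut rho a' b' j k x e : sm rho -> supp_in a' b' rho -> a < a' -> b' < b -> 0 < e ->
  (forall y, `|y - x| < e -> rho y = 1) -> dn j (fun y => rho y * D k y) x = D (j + k) x.
Proof.
move=> srho prho aa bb e0 r1; elim: j k => [|j IH] k.
  by rewrite /dn /= r1 ?mul1r// subrr normr0.
rewrite dSn addSnnS -IH; apply: (@dn_eq_near R j _ _ x e) => //.
- by apply: smooth_der; exact: smooth_cut prho aa bb.
- exact: smooth_cut prho aa bb.
move=> y yx; rewrite (der_cut k srho prho aa bb) (_ : der rho y = 0) ?mul0r ?add0r//.
rewrite [LHS](@dn_eq_near R 1 _ (fun=> 1) y (e - `|y - x|) srho (smooth_cst 1)) ?dn_cst ?subr_gt0//.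
move=> z zy; apply: r1; have -> : z - x = (z - y) + (y - x) by ring.
by apply: le_lt_trans (ler_normD _ _) _; rewrite -ltrBrDr.
Qed.

End Cut.

(** The weights r ^ k are those of the rescaled functions z -> f (r z + c), so the whole product is
    one dilate with a controlled norm. *)
Lemma annulus_bound T c eta (al be : R) : scale_bounded T c 1 -> sm eta -> -1 <= al -> be <= 1 ->
  supp_in al be eta -> exists N K, 0 <= K /\ forall r f phi B B', 0 < r <= 1 -> sm f -> sm phi ->
    0 <= B -> 0 <= B' ->
    (forall k z, (k <= N)%N -> al <= z <= be -> `|dn k f (r * z + c)| * r ^+ k <= B') ->
    (forall k z, (k <= N)%N -> al <= z <= be -> `|dn k phi (r * z + c)| * r ^+ k <= B) ->
    `|T (fun y => sc c r eta y * (f y * phi y))| <= K * r * (B' * B).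
Proof.
move=> [N [C [C0 hC]]] seta al1 be1 peta; have [M M0 hM] := dbound_supp N seta peta.
exists N, (C * (2 ^+ N * (M * 2 ^+ N))); split; first by rewrite !mulr_ge0// exprn_ge0.
move=> r f phi B B' r01 sf sphi B0 B'0 hf hphi; have /andP[r0 r1] := r01.
pose h z := eta z * (f (r * z + c) * phi (r * z + c)).
have s1 : sm (fun z => f (r * z + c)) by exact: smooth_comp_affine.
have s2 : sm (fun z => phi (r * z + c)) by exact: smooth_comp_affine.
have sh : sm h by apply: smooth_mul => //; exact: smooth_mul.
have ph : supp_in al be h by apply: supp_in_mull.
have -> : (fun y => sc c r eta y * (f y * phi y)) = sc c r h.
  apply/funext => y; rewrite /sc /h; have -> // : r * ((y - c) / r) + c = y.
  by field; rewrite gt_eqF.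
have bh : dbound N setT (2 ^+ N * (M * (2 ^+ N * (B' * B)))) h.
  have bf : dbound N (seg al be) B' (fun z => f (r * z + c)).
    apply/dboundP => k z kN zI; rewrite dn_comp_affine// normrM ger0_norm ?exprn_ge0 ?(ltW r0)//.
    by rewrite mulrC; exact: hf.
  have bp : dbound N (seg al be) B (fun z => phi (r * z + c)).
    apply/dboundP => k z kN zI; rewrite dn_comp_affine// normrM ger0_norm ?exprn_ge0 ?(ltW r0)//.
    by rewrite mulrC; exact: hphi.
  have be' : dbound N (seg al be) M eta by apply: dbound_le hM.
  have /dboundP hh := dbound_mul seta (smooth_mul s1 s2) be' (dbound_mul s1 s2 bf bp).
  apply/dboundP => k z kN _; have [zI|nz] := boolP (al <= z <= be); first exact: hh.
  rewrite (supp_in_eq0 (supp_in_dn (k := k) sh ph)) ?normr0; last exact/negP.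
  by rewrite !mulr_ge0// exprn_ge0.
have ph1 : supp_in (-1) 1 h by exact: supp_in_le ph.
apply: le_trans (hC h _ r sh ph1 bh r01) _.
rewrite le_eqVlt; apply/orP; left; apply/eqP; rewrite expr1.
by move: (2 ^+ N) => P; ring.
Qed.

Definition cut (a b s : R) y := step ((y - a) / s - 1) * step ((b - y) / s - 1).

Lemma cutE a b s : cut a b s = fun y => step (s^-1 * y + (- a / s - 1)) * step ((- s^-1) * y + (b / s - 1)).
Proof. by apply/funext => y; rewrite /cut; congr (step _ * step _); ring. Qed.

Lemma sm_cut a b s : sm (cut a b s).
Proof.
by rewrite cutE; apply: smooth_mul; apply: smooth_comp_affine; exact: smooth_step.
Qed.

Lemma cut_supp a b s y : 0 < s -> cut a b s y != 0 -> a + s < y < b - s.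
Proof.
move=> s0; apply: contraNT; rewrite negb_and -!leNgt /cut => /orP[] h; apply/eqP.
  by rewrite step0 ?mul0r// subr_le0 ler_pdivrMr// mul1r; move: h; clear; lra.
by rewrite mulrC step0 ?mul0r// subr_le0 ler_pdivrMr// mul1r; move: h; clear; lra.
Qed.

Lemma supp_in_cut a b s : 0 < s -> supp_in (a + s) (b - s) (cut a b s).
Proof. by move=> s0 y /(cut_supp s0) /andP[/ltW -> /ltW ->]. Qed.

Lemma cut1 a b s y : 0 < s -> a + 2 * s <= y <= b - 2 * s -> cut a b s y = 1.
Proof.
move=> s0 /andP[h1 h2]; rewrite /cut !step1 ?mulr1//.
  by rewrite lerBrDr ler_pdivlMr//; move: h2; clear; lra.
by rewrite lerBrDr ler_pdivlMr//; move: h1; clear; lra.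
Qed.

Lemma cut_ge0 a b s y : 0 <= cut a b s y.
Proof. by rewrite mulr_ge0 ?step_ge0. Qed.

(** Profile, in the variable distance / (2 s), of the layer that is added at an end point when the
    cut-off parameter s is halved. *)
Definition rim z : R := step (4 * z - 1) - step (2 * z - 1).

Lemma smooth_rim s : sm (fun z => rim (s * z)).
Proof.
apply: smooth_sub.
  have -> : (fun y => step (4 * (s * y) - 1)) = fun y => step ((4 * s) * y + (-1)).
    by apply/funext => y; rewrite mulrA.
  by apply: smooth_comp_affine; exact: smooth_step.
have -> : (fun y => step (2 * (s * y) - 1)) = fun y => step ((2 * s) * y + (-1)).
  by apply/funext => y; rewrite mulrA.
by apply: smooth_comp_affine; exact: smooth_step.
Qed.

Lemma supp_rim z : rim z != 0 -> 4^-1 <= z <= 1.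
Proof.
apply: contraNT; rewrite negb_and -!ltNge /rim => /orP[] h; apply/eqP.
  by rewrite !step0 ?subrr//; move: h; clear; lra.
by rewrite !step1 ?subrr//; move: h; clear; lra.
Qed.

Lemma cut_half a b s y : 0 < s -> 4 * s <= b - a ->
  cut a b (s / 2) y - cut a b s y
  = sc a (2 * s) (fun z => rim (1 * z)) y + sc b (2 * s) (fun z => rim ((-1) * z)) y.
Proof.
move=> s0 sab; rewrite /cut /sc /rim.
have n0 : s != 0 by rewrite gt_eqF.
have -> : 4 * (1 * ((y - a) / (2 * s))) - 1 = (y - a) / (s / 2) - 1 by field.
have -> : 2 * (1 * ((y - a) / (2 * s))) - 1 = (y - a) / s - 1 by field.
have -> : 4 * (-1 * ((y - b) / (2 * s))) - 1 = (b - y) / (s / 2) - 1 by field.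
have -> : 2 * (-1 * ((y - b) / (2 * s))) - 1 = (b - y) / s - 1 by field.
have one w : 2 * s <= w -> step (w / (s / 2) - 1) = 1 /\ step (w / s - 1) = 1.
  move=> h; split; apply: step1; rewrite lerBrDr ler_pdivlMr ?divr_gt0//.
  by move: h s0; clear; lra.
have [h|h] := leP y ((a + b) / 2).
  have [-> ->] : step ((b - y) / (s / 2) - 1) = 1 /\ step ((b - y) / s - 1) = 1.
    by apply: one; move: h sab; clear; lra.
  ring.
have [-> ->] : step ((y - a) / (s / 2) - 1) = 1 /\ step ((y - a) / s - 1) = 1.
  by apply: one; move: h sab; clear; lra.
ring.
Qed.

(* The weights r ^ k make this a bound on phi (c + r z), uniformly in r, for both
   end points c. *)
Definition end_bound (a b : R) N r B phi := forall k y, (k <= N)%N ->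
  `|y - a| <= r \/ `|y - b| <= r -> `|dn k phi y| * r ^+ k <= B.

Lemma end_bound_le a b N r r' B phi : 0 <= r' -> r' <= r -> end_bound a b N r B phi ->
  end_bound a b N r' B phi.
Proof.
move=> r0 rr h k y kN hy; apply: le_trans (_ : `|dn k phi y| * r ^+ k <= _).
  by rewrite ler_wpM2l// lerXn2r ?nnegrE// (le_trans r0).
by apply: h => //; case: hy => hy; [left|right]; exact: le_trans rr.
Qed.

(** The two cut-offs differ by layers of size s at a and b, on which T is O(s): such errors are
    summable over dyadic s. *)
Lemma cut_step T (a b : R) (D : nat -> R -> R) : a < b -> edist T ->
  scale_bounded T a 1 -> scale_bounded T b 1 ->
  (forall n x, a < x < b -> is_derive x 1 (D n) (D n.+1 x)) ->
  (forall n, exists2 M, 0 <= M & forall y, a <= y <= b -> `|D n y| <= M) ->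
  exists N K, 0 <= K /\ forall s B phi, 0 < s -> 2 * s <= 1 -> 4 * s <= b - a -> sm phi -> 0 <= B ->
    end_bound a b N (2 * s) B phi ->
    `|T (fun y => cut a b (s / 2) y * D 0%N y * phi y) - T (fun y => cut a b s y * D 0%N y * phi y)|
      <= K * s * B.
Proof.
move=> ab hT sa sb dD bD.
have pa : supp_in 4^-1 1 (fun z : R => rim (1 * z)) by move=> z; rewrite mul1r; exact: supp_rim.
have pb : supp_in (-1) (- 4^-1) (fun z : R => rim ((-1) * z)).
  by move=> z /supp_rim /andP[z1 z2]; apply/andP; move: z1 z2; clear; lra.
have q1 : -1 <= 4^-1 :> R by clear; lra.
have q2 : - 4^-1 <= 1 :> R by clear; lra.
have [Na [Ka [Ka0 ha]]] := annulus_bound sa (smooth_rim 1) q1 (lexx 1) pa.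
have [Nb [Kb [Kb0 hb]]] := annulus_bound sb (smooth_rim (-1)) (lexx _) q2 pb.
pose N := maxn Na Nb.
have [M M0 hM] : exists2 M, 0 <= M & forall k y, (k <= N)%N -> a <= y <= b -> `|D k y| <= M.
  elim: N => [|N [M M0 hM]].
    have [M M0 hM] := bD 0%N; exists M => // k y; rewrite leqn0 => /eqP ->; exact: hM.
  have [M' M'0 hM'] := bD N.+1; exists (M + M'); first exact: addr_ge0.
  move=> k y; rewrite leq_eqVlt => /orP[/eqP ->|] yab.
    by apply: le_trans (hM' y _) _ => //; rewrite lerDr.
  by move=> hy; apply: le_trans (hM k y _ hy) _ => //; rewrite lerDl.
exists N, ((Ka + Kb) * 2 * M); split; first by rewrite !mulr_ge0// addr_ge0.
move=> s B phi s0 s1 sab sphi B0 hB.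
have s80 : 0 < s / 8 by rewrite divr_gt0.
have r01 : 0 < 2 * s <= 1 by rewrite mulr_gt0.
have s20 : 0 < s / 2 by rewrite divr_gt0.
(* A smooth function equal to [D 0] near both layers, which keep at least the distance s / 2 from a
   and b. *)
pose f y := cut a b (s / 8) y * D 0%N y.
have sup t : 0 < t -> sm (fun y => cut a b t y * D 0%N y).
  move=> t0; apply: (smooth_cut dD (a' := a + t) (b' := b - t)); rewrite ?ltrDl ?gtrBl//.
    exact: sm_cut.
  exact: supp_in_cut.
have sf : sm f by exact: sup.
have nf k y : a + s / 2 <= y <= b - s / 2 -> (k <= N)%N -> `|dn k f y| * (2 * s) ^+ k <= M.
  move=> /andP[y1 y2] kN; have -> : dn k f y = D k y.
    rewrite -[in RHS](addn0 k) /f.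
    apply: (@dn_cut a b D dD (cut a b (s / 8)) (a + s / 8) (b - s / 8) k 0 y (s / 8)) => //.
    - exact: sm_cut.
    - exact: supp_in_cut.
    - by rewrite ltrDl.
    - by rewrite gtrBl.
    - move=> z zy; apply: cut1 => //; have := ler_norm (z - y); have := ler_norm (y - z).
      by rewrite distrC; move: zy y1 y2; clear; lra.
  apply: le_trans (_ : `|D k y| * 1 <= _).
    by rewrite ler_wpM2l// exprn_ile1// ltW// mulr_gt0.
  by rewrite mulr1; apply: hM => //; move: y1 y2 s0; clear; lra.
have fE : (fun y => cut a b (s / 2) y * D 0%N y * phi y - cut a b s y * D 0%N y * phi y)
  = fun y => sc a (2 * s) (fun z => rim (1 * z)) y * (f y * phi y)
           + sc b (2 * s) (fun z => rim ((-1) * z)) y * (f y * phi y).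
  apply/funext => y; rewrite -[RHS]mulrDl -cut_half// /f.
  have [yI|ny] := boolP (a + s / 4 <= y <= b - s / 4).
    rewrite (@cut1 a b (s / 8)) ?mul1r//; first by ring.
    by move: yI; clear; lra.
  have z1 : cut a b (s / 2) y = 0.
    apply/eqP; apply: contraNT ny => /(cut_supp s20) /andP[y1 y2]; apply/andP.
    by move: y1 y2 s0; clear; lra.
  have z2 : cut a b s y = 0.
    apply/eqP; apply: contraNT ny => /(cut_supp s0) /andP[y1 y2]; apply/andP.
    by move: y1 y2 s0; clear; lra.
  by rewrite z1 z2 !mul0r subrr mul0r.
have s1' := smooth_mul (sup _ s20) sphi; have s2' := smooth_mul (sup _ s0) sphi.
rewrite -(ed_sub hT s1' s2') fE.
rewrite ed_add//; last first.
- by apply: smooth_mul; [apply: smooth_sc; exact: smooth_rim|exact: smooth_mul].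
- by apply: smooth_mul; [apply: smooth_sc; exact: smooth_rim|exact: smooth_mul].
apply: le_trans (ler_normD _ _) _.
have -> : (Ka + Kb) * 2 * M * s * B = Ka * (2 * s) * (M * B) + Kb * (2 * s) * (M * B) by ring.
apply: lerD; [apply: ha|apply: hb] => //.
- move=> k z kN /andP[z1 z2]; apply: nf; last by rewrite leq_max kN.
  have := @ler_wpM2l R s (ltW s0) _ _ z1; have := @ler_wpM2l R s (ltW s0) _ _ z2.
  by move: sab s0; clear; lra.
- move=> k z kN /andP[z1 z2]; apply: hB; first by rewrite leq_max kN.
  left; rewrite addrK normrM gtr0_norm ?mulr_gt0// ger_pMr ?mulr_gt0// ler_norml.
  by apply/andP; move: z1 z2; clear; lra.
- move=> k z kN /andP[z1 z2]; apply: nf; last by rewrite leq_max kN orbT.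
  have := @ler_wpM2l R s (ltW s0) _ _ z1; have := @ler_wpM2l R s (ltW s0) _ _ z2.
  by move: sab s0; clear; lra.
- move=> k z kN /andP[z1 z2]; apply: hB; first by rewrite leq_max kN orbT.
  right; rewrite addrK normrM gtr0_norm ?mulr_gt0// ger_pMr ?mulr_gt0// ler_norml.
  by apply/andP; move: z1 z2; clear; lra.
Qed.

End CutProduct.

(** * The limit of the cut-off products *)

Section CutLimit.
Context {R : realType}.
Implicit Types (f g phi psi rho : R -> R) (n k m j : nat) (x y z e c v w B r s d q t M L K : R) (T u : (R -> R) -> R).

Lemma half_small c e : 0 <= c -> 0 < e -> exists k, forall m, (k <= m)%N -> c * 2^-1 ^+ m <= e.
Proof.
move=> c0 e0; have c1 : 0 < c + 1 by rewrite ltr_wpDl.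
have [k hk] := @geo_small R 2^-1 (e / (c + 1)) half01 ltac:(by rewrite divr_gt0).
exists k => m /hk; rewrite ler_pdivlMr// => h; apply: le_trans h.
rewrite mulrC ler_wpM2l ?lerDl// exprn_ge0// invr_ge0; by clear; lra.
Qed.

Lemma half_exp_gt0 s j : 0 < s -> 0 < s * 2^-1 ^+ j.
Proof. by move=> s0; rewrite mulr_gt0// exprn_gt0// invr_gt0. Qed.

Lemma half_exp_le s j : 0 < s -> s * 2^-1 ^+ j <= s.
Proof.
move=> s0; rewrite ger_pMr// exprn_ile1//; by clear; lra.
Qed.

Lemma end_bound_exists (a b : R) N phi : sm phi ->
  exists2 B, 0 <= B & forall r, 0 <= r -> r <= 1 -> end_bound a b N r B phi.
Proof.
move=> sphi; have [M M0 /dboundP hM] := dbound_segment N (- (`|a| + `|b| + 1)) (`|a| + `|b| + 1) sphi.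
exists M => // r r0 r1 k y kN hy; apply: le_trans (_ : `|dn k phi y| * 1 <= _).
  by rewrite ler_wpM2l// exprn_ile1.
rewrite mulr1; apply: hM => //=; rewrite -ler_norml.
case: hy => hy.
  have -> : y = (y - a) + a by ring.
  apply: le_trans (ler_normD _ _) _; move: hy r1 (normr_ge0 b); clear; lra.
have -> : y = (y - b) + b by ring.
apply: le_trans (ler_normD _ _) _; move: hy r1 (normr_ge0 a); clear; lra.
Qed.

(* u plays the role of the product of T, f and the indicator of [a, b]; the rate
   of convergence controls u on dilations about a and b. *)
Definition cut_product T (a b : R) f u := edist u /\
  exists s0 N K, [/\ 0 < s0, 2 * s0 <= 1, 4 * s0 <= b - a, 0 <= K &
    forall j phi B, sm phi -> 0 <= B -> end_bound a b N (2 * (s0 * 2^-1 ^+ j)) B phi ->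
      `|u phi - T (fun y => cut a b (s0 * 2^-1 ^+ j) y * f y * phi y)| <= K * (s0 * 2^-1 ^+ j) * B].

(** The errors of [cut_step] at s, s / 2, s / 4, ... add up to O(s), so the pairings form a Cauchy
    sequence with an explicit rate. *)
Lemma cut_product_exists T (a b : R) (D : nat -> R -> R) : a < b -> edist T ->
  scale_bounded T a 1 -> scale_bounded T b 1 ->
  (forall n x, a < x < b -> is_derive x 1 (D n) (D n.+1 x)) ->
  (forall n, exists2 M, 0 <= M & forall y, a <= y <= b -> `|D n y| <= M) ->
  exists u, cut_product T a b (D 0%N) u.
Proof.
move=> ab hT sa sb dD bD; have [N [K [K0 hK]]] := cut_step ab hT sa sb dD bD.
pose s0 := Num.min 2^-1 ((b - a) / 4).
have s00 : 0 < s0 by rewrite lt_min invr_gt0 ltr0n divr_gt0 ?subr_gt0.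
have s01 : 2 * s0 <= 1.
  have : s0 <= 2^-1 by rewrite ge_min lexx.
  by clear; lra.
have s0b : 4 * s0 <= b - a.
  have : s0 <= (b - a) / 4 by rewrite ge_min lexx orbT.
  by clear; lra.
pose s j := s0 * 2^-1 ^+ j; pose F phi j := T (fun y => cut a b (s j) y * D 0%N y * phi y).
have sp j : 0 < s j by exact: half_exp_gt0.
have ss j : s j <= s0 by exact: half_exp_le.
have sF phi j : sm phi -> sm (fun y => cut a b (s j) y * D 0%N y * phi y).
  move=> sphi; apply: smooth_mul => //.
  apply: (smooth_cut dD (a' := a + s j) (b' := b - s j)); rewrite ?ltrDl ?gtrBl//.
    exact: sm_cut.
  exact: supp_in_cut.
have mono phi i j B : (j <= i)%N -> end_bound a b N (2 * s j) B phi -> end_bound a b N (2 * s i) B phi.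
  move=> ji; apply: end_bound_le; first by rewrite mulr_ge0// ltW.
  rewrite ler_wpM2l// ler_wpM2l ?(ltW s00)// ler_wiXn2l//; by clear; lra.
(* The factor 1 - 2 ^ -i is the partial geometric sum; it makes the induction close. *)
have tel phi j B i : sm phi -> 0 <= B -> end_bound a b N (2 * s j) B phi ->
    `|F phi (j + i)%N - F phi j| <= 2 * K * s j * B * (1 - 2^-1 ^+ i).
  move=> sphi B0 hB; elim: i => [|i IH]; first by rewrite addn0 !subrr normr0 mulr0.
  have hi : `|F phi (j + i.+1)%N - F phi (j + i)%N| <= K * s (j + i)%N * B.
    rewrite /F (_ : s (j + i.+1)%N = s (j + i)%N / 2); last by rewrite addnS /s exprSr mulrA.
    apply: hK => //; last exact: mono (leq_addr _ _) hB.
    - by apply: le_trans s01; rewrite ler_wpM2l.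
    - by apply: le_trans s0b; rewrite ler_wpM2l.
  have -> : F phi (j + i.+1)%N - F phi j
    = (F phi (j + i.+1)%N - F phi (j + i)%N) + (F phi (j + i)%N - F phi j) by ring.
  apply: le_trans (ler_normD _ _) _; apply: le_trans (lerD hi IH) _.
  rewrite /s exprD exprSr le_eqVlt; apply/orP; left; apply/eqP.
  by move: (2^-1 ^+ j) (2^-1 ^+ i) => P Q; field.
have small phi : sm phi -> exists B, [/\ 0 <= B, forall j, end_bound a b N (2 * s j) B phi &
    forall c e, 0 <= c -> 0 < e -> exists k, forall m, (k <= m)%N -> c * s m * B <= e].
  move=> sphi; have [B B0 hB] := end_bound_exists a b N sphi; exists B; split=> //.
    move=> j; apply: hB; first by rewrite mulr_ge0// ltW.
    by apply: le_trans s01; rewrite ler_wpM2l.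
  move=> c e c0 e0.
  have [k hk] := half_small (mulr_ge0 (mulr_ge0 c0 (ltW s00)) B0) e0.
  by exists k => m /hk; rewrite /s mulrA mulrAC.
(* The limit is selected through its rate for all j and B at once, which is what [cut_product] has
   to record. *)
pose lim phi l := forall j B, 0 <= B -> end_bound a b N (2 * s j) B phi ->
  `|l - F phi j| <= 2 * K * s j * B.
have ex phi : sm phi -> exists l, lim phi l.
  move=> sphi; have [B [B0 hB sB]] := small phi sphi.
  have K20 : 0 <= 2 * K by rewrite mulr_ge0.
  have [l hl] : exists l, forall k, `|l - F phi k| <= 2 * K * s k * B.
    apply: (cauchy_limit (a := F phi)).
      move=> k m km; rewrite -(subnKC km); apply: le_trans (tel phi k B _ sphi B0 (hB k)) _.
      apply: ler_piMr; first by rewrite !mulr_ge0// ltW.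
      by rewrite gerBl exprn_ge0// invr_ge0.
    by move=> e e0; exact: sB.
  exists l => j B' B'0 hB'; apply/ler_addgt0Pr => e e0.
  have [k hk] := sB (2 * K) e K20 e0.
  have -> : l - F phi j = (l - F phi (j + k)%N) + (F phi (j + k)%N - F phi j) by ring.
  apply: le_trans (ler_normD _ _) _; rewrite addrC; apply: lerD.
    apply: le_trans (tel phi j B' k sphi B'0 hB') _.
    apply: ler_piMr; first by rewrite !mulr_ge0// ltW.
    by rewrite gerBl exprn_ge0// invr_ge0.
  by apply: le_trans (hl _) _; apply: hk; rewrite leq_addl.
pose u phi := get [set l | lim phi l].
have uP phi : sm phi -> lim (phi) (u phi).
  by move=> /ex[l hl]; exact: (@getPex _ [set l | lim phi l] (ex_intro _ l hl)).
have conv phi e : sm phi -> 0 < e -> exists k, forall m, (k <= m)%N -> `|u phi - F phi m| <= e.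
  move=> sphi e0; have [B [B0 hB sB]] := small phi sphi.
  have [k hk] := sB (2 * K) e ltac:(by rewrite mulr_ge0) e0.
  by exists k => m km; apply: le_trans (uP phi sphi m B B0 (hB m)) _; exact: hk.
exists u; split; last first.
  exists s0, N, (2 * K); split=> //; first by rewrite mulr_ge0.
  by move=> j phi B sphi B0 hB; exact: uP.
split=> [c f g sf sg|].
  apply/eqP; rewrite -subr_eq0 -normr_le0; apply/ler_addgt0Pr => e e0; rewrite add0r.
  pose c1 := 2 + `|c|; have c10 : 0 < c1 by rewrite ltr_wpDr.
  have e'0 : 0 < e / c1 by rewrite divr_gt0.
  have slin : sm (fun y => c * f y + g y) by apply: smooth_add => //; exact: smooth_scale.
  have [k1 h1] := conv _ _ slin e'0; have [k2 h2] := conv _ _ sf e'0.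
  have [k3 h3] := conv _ _ sg e'0.
  pose m := (k1 + k2 + k3)%N.
  have {}h1 := h1 m ltac:(by rewrite /m -addnA leq_addr).
  have {}h2 := h2 m ltac:(by rewrite /m addnAC leq_addl).
  have {}h3 := h3 m ltac:(by rewrite /m leq_addl).
  have FE : F (fun y => c * f y + g y) m = c * F f m + F g m.
    rewrite /F -(ed_lin hT)//; [|exact: sF..].
    by congr T; apply/funext => y; ring.
  have -> : u (fun y => c * f y + g y) - (c * u f + u g)
    = (u (fun y => c * f y + g y) - F (fun y => c * f y + g y) m)
      + (- c * (u f - F f m) - (u g - F g m)) by rewrite FE; ring.
  apply: le_trans (ler_normD _ _) _.
  apply: le_trans (lerD h1 (le_trans (ler_normB _ _) (lerD (lexx _) h3))) _.
  rewrite normrM normrN; have := ler_wpM2l (normr_ge0 c) h2.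
  rewrite [X in _ -> _ <= X](_ : e = 2 * (e / c1) + `|c| * (e / c1)); last by rewrite -mulrDl -/c1 mulrC divfK// gt_eqF.
  by move: (e / c1) => e'; clear; lra.
(* The order of u: the rate at j = 0 bounds its distance to the product with the first cut-off,
   which is a functional of compact support. *)
pose c0 y := cut a b s0 y * D 0%N y.
have sc0 : sm c0.
  have := @sF (fun=> 1) 0%N (smooth_cst 1); rewrite /s expr0 mulr1.
  by congr sm; apply/funext => y; rewrite mulr1.
have [A' [C' [M' [C'0 hC']]]] := ed_bd (edist_mul sc0 hT).
pose P := `|a| + `|b| + 1 + `|A'|.
exists P, (C' + 2 * K * s0), (maxn M' N); split.
  by rewrite addr_ge0// !mulr_ge0// ltW.
move=> phi B sphi /dboundP hB.
have P0 : 0 <= P by rewrite !addr_ge0.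
have B0 : 0 <= B.
  have := hB 0%N 0 (leq0n _); rewrite /seg /= oppr_le0 P0 => /(_ isT); exact: le_trans.
have hb : end_bound a b N (2 * s 0%N) B phi.
  move=> k y kN hy; apply: le_trans (_ : `|dn k phi y| * 1 <= _).
    rewrite ler_wpM2l// exprn_ile1//; first by rewrite mulr_ge0// ltW.
    by apply: le_trans s01; rewrite ler_wpM2l.
  rewrite mulr1; apply: hB; first by rewrite leq_max kN orbT.
  rewrite /seg /= -ler_norml /P; have q : 2 * s 0%N <= 1 by apply: le_trans s01; rewrite ler_wpM2l.
  case: hy => hy.
    have -> : y = (y - a) + a by ring.
    apply: le_trans (ler_normD _ _) _; move: hy q (normr_ge0 b) (normr_ge0 A'); clear; lra.
  have -> : y = (y - b) + b by ring.
  apply: le_trans (ler_normD _ _) _; move: hy q (normr_ge0 a) (normr_ge0 A'); clear; lra.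
have s0E : s 0%N = s0 by rewrite /s expr0 mulr1.
have := uP phi sphi 0%N B B0 hb; rewrite s0E => h1.
have h2 : `|F phi 0%N| <= C' * B.
  rewrite /F /s expr0 mulr1; apply: hC' => //; apply/dboundP => k y kM hy; apply: hB.
    by rewrite leq_max kM.
  move: hy; rewrite /seg /= -!ler_norml => /le_trans; apply; rewrite /P.
  by move: (normr_ge0 a) (normr_ge0 b) (ler_norm A'); clear; lra.
have -> : u phi = (u phi - F phi 0%N) + F phi 0%N by ring.
apply: le_trans (ler_normD _ _) _; move: h1 h2; clear; lra.
Qed.

Lemma cut_product_cvg T (a b : R) f u : cut_product T a b f u ->
  exists2 s, 0 < s & forall phi e, sm phi -> 0 < e -> exists k, forall m, (k <= m)%N ->
    `|u phi - T (fun y => cut a b (s * 2^-1 ^+ m) y * f y * phi y)| <= e.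
Proof.
move=> [_ [s0 [N [K [s00 s01 s0b K0 hu]]]]]; exists s0 => // phi e sphi e0.
have [B B0 hB] := end_bound_exists a b N sphi.
have [k hk] := half_small (mulr_ge0 (mulr_ge0 K0 (ltW s00)) B0) e0.
exists k => m /hk h; apply: le_trans h.
have -> : K * s0 * B * 2^-1 ^+ m = K * (s0 * 2^-1 ^+ m) * B by ring.
apply: hu => //; apply: hB; first by rewrite mulr_ge0// ltW// half_exp_gt0.
by apply: le_trans s01; rewrite ler_wpM2l// half_exp_le.
Qed.

Lemma cut_product_vanish T (a b : R) f u phi : edist T -> cut_product T a b f u -> sm phi ->
  (forall y, a <= y <= b -> phi y = 0) -> u phi = 0.
Proof.
move=> hT hu sphi z; apply/eqP; rewrite -normr_le0; apply/ler_addgt0Pr => e e0; rewrite add0r.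
have [s s0 /(_ phi e sphi e0)[k /(_ k (leqnn k))]] := cut_product_cvg hu.
have -> : (fun y => cut a b (s * 2^-1 ^+ k) y * f y * phi y) = fun=> 0.
  apply/funext => y; have [yI|ny] := boolP (a <= y <= b); first by rewrite z ?mulr0.
  have [->|/(cut_supp (half_exp_gt0 k s0)) /andP[h1 h2]] := eqVneq (cut a b (s * 2^-1 ^+ k) y) 0.
    by rewrite !mul0r.
  case/negP: ny; have := half_exp_gt0 k s0; move: h1 h2.
  by clear => *; apply/andP; split; lra.
by rewrite ed0// subr0.
Qed.

(** On functions supported in [a', b'] the cut-offs have no effect once s is small, so the sequence
    is eventually constant and its limit is exact. *)
Lemma cut_product_local T (a b : R) f u (a' b' : R) : cut_product T a b f u -> a < a' -> b' < b ->
  exists s, [/\ 0 < s, forall y, a' <= y <= b' -> cut a b s y = 1 &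
    forall phi, sm phi -> supp_in a' b' phi -> u phi = T (fun y => cut a b s y * f y * phi y)].
Proof.
move=> hu aa bb; have [_ [s0 [N [K [s00 s01 s0b K0 hK]]]]] := hu.
have d0 : 0 < Num.min (a' - a) (b - b') by rewrite lt_min !subr_gt0 aa.
have [k hk] := half_small (ltW (mulr_gt0 (ltr0n R 2) s00)) d0.
have one i y : (k <= i)%N -> a' <= y <= b' -> cut a b (s0 * 2^-1 ^+ i) y = 1.
  move=> /hk; rewrite le_min => /andP[h1 h2] /andP[h3 h4].
  apply: cut1; first exact: half_exp_gt0.
  by apply/andP; move: h1 h2 h3 h4; rewrite -mulrA; clear; lra.
exists (s0 * 2^-1 ^+ k); split; [exact: half_exp_gt0|by move=> y; exact: one|].
move=> phi sphi pphi; apply/eqP; rewrite -subr_eq0 -normr_le0; apply/ler_addgt0Pr => e e0; rewrite add0r.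
have [B B0 hB] := end_bound_exists a b N sphi.
have [k' hk'] := half_small (mulr_ge0 (mulr_ge0 K0 (ltW s00)) B0) e0.
pose m := maxn k k'.
have E i : (k <= i)%N -> (fun y => cut a b (s0 * 2^-1 ^+ i) y * f y * phi y) = fun y => f y * phi y.
  move=> ki; apply/funext => y.
  have [->|/pphi h] := eqVneq (phi y) 0; first by rewrite !mulr0.
  by rewrite one ?mul1r.
rewrite (E k)// -(E m) ?leq_maxl//; apply: le_trans (hK m phi B sphi B0 _) _.
  apply: hB; first by rewrite mulr_ge0// ltW// half_exp_gt0.
  by apply: le_trans s01; rewrite ler_wpM2l// half_exp_le.
have -> : K * (s0 * 2^-1 ^+ m) * B = K * s0 * B * 2^-1 ^+ m by ring.
by apply: hk'; rewrite leq_maxr.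
Qed.

Lemma dyadic_scale s r : 0 < r -> r <= s -> exists j, s * 2^-1 ^+ j.+1 < r <= s * 2^-1 ^+ j.
Proof.
move=> r0 rs; have s0 := lt_le_trans r0 rs.
have ex : exists j, s * 2^-1 ^+ j < r.
  have r20 : 0 < r / 2 by rewrite divr_gt0.
  have [k /(_ k (leqnn k)) hk] := half_small (ltW s0) r20.
  by exists k; apply: le_lt_trans hk _; move: r0; clear; lra.
have [[|j] hj hmin] := ex_minnP ex; first by move: hj; rewrite expr0 mulr1 ltNge rs.
exists j; rewrite hj leNgt; apply/negP => /hmin; by rewrite ltnn.
Qed.

(** For the dilate by r take a dyadic s with r <= s < 2 r. Its cut-off kills the dilate, so u is
    bounded by the rate K s B alone, and the weights of [end_bound] keep B independent of r. *)
Lemma cut_product_end T (a b c : R) f u : edist T -> cut_product T a b f u -> a < b ->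
  c = a \/ c = b -> scale_bounded u c 1.
Proof.
move=> hT [hu [s0 [N [K [s00 s01 s0b K0 hK]]]]] ab cab.
apply: scale_bounded_near => // phi sphi pphi.
have [M M0 /dboundP hM] := dbound_supp N sphi pphi.
exists (K * 2 * 4 ^+ N * M), s0; split=> // r /andP[r0 rs].
have [j /andP[j1 j2]] := dyadic_scale r0 rs.
pose s := s0 * 2^-1 ^+ j; have sp : 0 < s by exact: half_exp_gt0.
have s2r : s <= 2 * r.
  by move: j1; rewrite exprSr mulrA -/s; clear; lra.
have ps := supp_sc (c := c) r0 pphi.
have z0 : (fun y => cut a b s y * f y * sc c r phi y) = fun=> 0.
  apply/funext => y; have [->|/ps /andP[h1 h2]] := eqVneq (sc c r phi y) 0; first by rewrite mulr0.
  have [->|/(cut_supp sp) /andP[h3 h4]] := eqVneq (cut a b s y) 0; first by rewrite !mul0r.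
  exfalso; have rs' : r <= s by [].
  by case: cab => cE; move: h1 h2 h3 h4 rs'; rewrite cE; clear; lra.
(* The weighted k-th derivative of the dilate is at most (2 s / r) ^ k M, and 2 s / r <= 4. *)
have B0 : 0 <= 4 ^+ N * M by rewrite mulr_ge0// exprn_ge0.
have hb : end_bound a b N (2 * s) (4 ^+ N * M) (sc c r phi).
  move=> k y kN _; rewrite dn_sc// normrM ger0_norm; last by rewrite invr_ge0 exprn_ge0// ltW.
  rewrite mulrAC mulrC -exprVn -exprMn mulrC; apply: ler_pM => //.
  - by rewrite exprn_ge0// mulr_ge0 ?invr_ge0 ?(ltW r0)// mulr_ge0// ltW.
  - apply: le_trans (_ : 4 ^+ k <= _); last by rewrite ler_weXn2l// ler1n.
    rewrite lerXn2r ?nnegrE//; first by rewrite mulr_ge0 ?invr_ge0 ?(ltW r0)// mulr_ge0// ltW.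
    by rewrite mulrC ler_pdivrMr//; move: s2r; clear; lra.
  - exact: hM.
have := hK j (sc c r phi) _ (smooth_sc c r sphi) B0 hb.
rewrite -/s z0 ed0// subr0 => /le_trans; apply; rewrite expr1.
have := ler_wpM2l (mulr_ge0 K0 B0) s2r.
by move: (4 ^+ N) => P; clear; lra.
Qed.

End CutLimit.

(** * Point values of the product and of its primitive *)
Section PointValues.
Context {R : realType}.
Implicit Types (f g phi psi rho : R -> R) (n k m j : nat) (x y z e c v w B r s d q t M L K : R) (T u : (R -> R) -> R).
Local Notation mu := (@lebesgue_measure R).

(* The point value, tested from r > 0 only. *)
Definition epv T x v := forall phi, test_fun phi -> forall e, 0 < e ->
  exists2 d, 0 < d & forall r, 0 < r <= d ->
    `|r^-1 * T (sc x r phi) - v * \int[mu]_y phi y| <= e.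

(** A point value gives O(r) for each test function separately; uniformity comes from
    [uniform_bound]. *)
Lemma epv_scale_bounded T x v : edist T -> epv T x v -> scale_bounded T x 1.
Proof.
move=> hT pv; apply: scale_bounded_near => // phi sphi pphi.
have [d d0 hd] := pv phi (test_fun_supp sphi pphi) 1 ltr01.
exists (1 + `|v * \int[mu]_y phi y|), d; split=> // r rd; have /andP[r0 _] := rd.
have := hd r rd; move: (v * \int[mu]_y phi y) => w h.
have -> : T (sc x r phi) = (r^-1 * T (sc x r phi) - w + w) * r.
  by rewrite subrK mulrC mulVKf// gt_eqF.
rewrite normrM expr1 [X in _ * X]gtr0_norm// ler_wpM2r ?(ltW r0)//.
by apply: le_trans (ler_normD _ _) _; rewrite lerD2r.
Qed.

(** With q = 2 ^ alpha, the condition alpha < -1 of [T0] is the convergence condition 2 q < 1 of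
    [dyadic_tail] for b = 1. *)
Lemma T0_decay phi : T0 phi -> exists q, [/\ 0 <= q, 2 * q < 1 &
  forall N, exists2 B, 0 <= B & ddecay N q B phi].
Proof.
move=> [/smP sphi _ _ [al al1 hal]]; pose q := 2 `^ al; exists q.
have q0 : 0 < q by exact: powR_gt0.
split; first exact: ltW.
  rewrite /q /powR pnatr_eq0 /= -[X in X * _](@lnK R) ?posrE// -expRD expR_lt1.
  by rewrite -[X in X + _]mul1r -mulrDl nmulr_rlt0 ?ln_gt0 ?ltr1n//; move: al1; clear; lra.
suff one k : exists2 B, 0 <= B & forall j z, 2 ^+ j <= `|z| ->
    `|dn k phi z| * 2 ^+ (j * k) <= B * q ^+ j.
  elim=> [|N [B B0 hB]].
    have [B B0 hB] := one 0%N; exists B => // j k z; rewrite leqn0 => /eqP ->; exact: hB.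
  have [B' B'0 hB'] := one N.+1; exists (B + B'); first exact: addr_ge0.
  have qj j : 0 <= q ^+ j by rewrite exprn_ge0// ltW.
  move=> j k z; rewrite leq_eqVlt => /orP[/eqP ->|kN] hz.
    by apply: le_trans (hB' j z hz) _; rewrite ler_wpM2r// lerDr.
  by apply: le_trans (hB j k z kN hz) _; rewrite ler_wpM2r// lerDl.
have [C [M hM]] := hal k.
have [S S0 /dboundP hS] := dbound_segment k (- M) M sphi.
pose J := Num.bound M; have hJ : M < 2 ^+ J by exact: upper_nthrootP.
have q1 : q <= 1 by rewrite -(powRr0 (2 : R)); apply: ler_powR; [rewrite ler1n|move: al1; clear; lra].
have P0 : 0 <= S * 2 ^+ (J * k) / q ^+ J.
  by rewrite !mulr_ge0 ?invr_ge0 ?exprn_ge0// ltW.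
exists (`|C| + S * 2 ^+ (J * k) / q ^+ J); first exact: addr_ge0.
move=> j z hz; have qj0 : 0 <= q ^+ j by rewrite exprn_ge0// ltW.
have p0 : 0 < 2 ^+ j :> R by rewrite exprn_gt0.
(* Before the decay sets in, |z| < M allows only the scales j <= J, which the constant absorbs. *)
have [Mz|zM] := leP M `|z|.
  apply: le_trans (_ : `|C| * q ^+ j <= _); last by rewrite ler_wpM2r// lerDl.
  have := hM z Mz; rewrite -dnE => h.
  have h' : `|dn k phi z| <= `|C| * (2 ^+ j) `^ (al - k%:R).
    apply: le_trans h _; apply: le_trans (_ : `|C| * `|z| `^ (al - k%:R) <= _).
      by rewrite ler_wpM2r ?powR_ge0// ler_norm.
    have z0 : 0 < `|z| by exact: lt_le_trans hz.
    have g0 : 0 <= - (al - k%:R) by rewrite opprB; have := ler0n R k; move: al1; clear; lra.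
    rewrite ler_wpM2l// -[al - _]opprK; move: (- (al - k%:R)) g0 => p g0.
    rewrite !powRN lef_pV2 ?posrE ?powR_gt0//.
    by apply: ge0_ler_powR => //; rewrite nnegrE ltW.
  apply: le_trans (ler_wpM2r _ h') _; first by rewrite exprn_ge0.
  rewrite -mulrA ler_wpM2l// powRB; last by rewrite (gt_eqF p0) implybT.
  rewrite powR_mulrn ?(ltW p0)// -exprM divfK ?expf_neq0 ?pnatr_eq0//.
  by rewrite -powR_mulrn// -powRrM mulrC powRrM powR_mulrn// ltW.
have jJ : (j <= J)%N.
  rewrite leqNgt; apply/negP => /ltnW Jj; have := lt_trans (le_lt_trans hz zM) hJ.
  by rewrite ltNge ler_weXn2l ?ler1n.
apply: le_trans (_ : S * 2 ^+ (J * k) / q ^+ J * q ^+ j <= _); last by rewrite ler_wpM2r// lerDr.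
have d1 : `|dn k phi z| <= S by apply: hS => //=; rewrite -ler_norml ltW.
have d2 : 2 ^+ (j * k) <= 2 ^+ (J * k) :> R by rewrite ler_weXn2l ?ler1n// leq_mul2r jJ orbT.
apply: le_trans (ler_pM _ _ d1 d2) _ => //.
rewrite -mulrA; apply: ler_peMr; first by rewrite mulr_ge0// exprn_ge0.
by rewrite mulrC ler_pdivlMr ?exprn_gt0// mul1r ler_wiXn2l// ltW.
Qed.

Lemma T0_integral_cut phi e : T0 phi -> 0 < e -> exists k, forall m, (k <= m)%N ->
  `|\int[mu]_y (phi y * chi (y / 2 ^+ m.+1)) - 1| <= e.
Proof.
move=> [/smP sphi phi0 int1 _] e0.
have iphi : mu.-integrable setT (EFin \o phi).
  apply/integrableP; split.
    by apply/measurable_realfun.measurable_EFinP; apply: measurable_realfun.continuous_measurable_fun; exact: smooth_continuous.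
  have -> : (fun x => `|(EFin \o phi) x|)%E = EFin \o phi.
    by apply/funext => x /=; rewrite ger0_norm.
  (* An infinite integral would be turned into the real number 0 by [fine], whereas the integral of
     phi is 1. *)
  rewrite ltey; apply/eqP => E; move: int1; rewrite /Rintegral E /= => /eqP.
  by rewrite eq_sym oner_eq0.
pose F m := EFin \o (fun y => phi y * chi (y / 2 ^+ m.+1)).
have schi m : sm (fun y : R => chi (y / 2 ^+ m.+1)).
  have -> : (fun y : R => chi (y / 2 ^+ m.+1)) = fun y => chi ((2 ^+ m.+1)^-1 * y).
    by apply/funext => y; rewrite mulrC.
  exact: smooth_scaled_chi.
have cF x : setT x -> F ^~ x @ \oo --> (phi x)%:E.
  move=> _; apply: cvg_near_cst; exists (Num.bound (2 * `|x|)) => //= m /= hm.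
  rewrite /F /= chi1 ?mulr1// normrM normfV [`|2 ^+ _|]gtr0_norm ?exprn_gt0//.
  rewrite ler_pdivrMr ?exprn_gt0//.
  have : 2 * `|x| < 2 ^+ m.+1 by apply: upper_nthrootP; exact: leq_trans hm _.
  by clear; lra.
have bF m x : setT x -> (`|F m x| <= (EFin \o phi) x)%E.
  move=> _; rewrite /F /= lee_fin ger0_norm; last exact: mulr_ge0 (phi0 x) (chi_ge0 _).
  by apply: ler_piMr => //; exact: chi_le1.
have iF m : mu.-integrable setT (F m).
  apply: (le_integrable measurableT) iphi => [|x Tx].
    apply/measurable_realfun.measurable_EFinP; apply: measurable_realfun.continuous_measurable_fun; apply: smooth_continuous.
    exact: smooth_mul.
  by apply: le_trans (bF m x Tx) _; rewrite /= lee_fin ler_norm.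
have := @dominated_cvg _ _ R mu setT measurableT F (EFin \o phi) (EFin \o phi)
  (fun m => measurable_int _ (iF m)) cF (fun x _ => isT) iphi bF.
have -> : (\int[mu]_x (EFin \o phi) x)%E = 1%:E.
  rewrite -int1 /Rintegral fineK//; exact: integrable_fin_num.
move=> /fine_cvgP[_] /cvgrPdist_le /(_ e e0) [k _ hk].
by exists k => m km; rewrite distrC; exact: hk.
Qed.

(** Point values extend from test functions to [T0]: cut phi at distance 2 ^ m, where the tail
    contributes O(r (2 q) ^ m) uniformly in r and the truncation changes the integral of phi
    little. *)
Lemma epv_T0 T x v phi e : edist T -> epv T x v -> T0 phi -> 0 < e ->
  exists2 d, 0 < d & forall r, 0 < r <= d -> `|affine_pairing T x r phi - v| <= e.
Proof.
move=> hT pv hphi e0; have sT := epv_scale_bounded hT pv; have [/smP sphi _ _ _] := hphi.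
have [q [q0 q1 hq]] := T0_decay hphi.
have q1' : 2 ^+ 1 * q < 1 by rewrite expr1.
have [N [K [K0 hK]]] := dyadic_tail hT sT q0 q1'.
have [B B0 hB] := hq N.
have e30 : 0 < e / 3 by rewrite divr_gt0.
have KB0 : 0 < K * B + 1 by rewrite ltr_wpDl// mulr_ge0.
have v10 : 0 < `|v| + 1 by rewrite ltr_wpDl.
have [k1 hk1] := @geo_small R (2 * q) (e / 3 / (K * B + 1))
  ltac:(by rewrite mulr_ge0//= q1) ltac:(by rewrite divr_gt0).
have [k2 hk2] := T0_integral_cut hphi (divr_gt0 e30 v10).
pose m := (k1 + k2)%N.
have t1 : K * B * (2 * q) ^+ m <= e / 3.
  have := hk1 m (leq_addr _ _); rewrite ler_pdivlMr// mulrC; apply: le_trans.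
  by rewrite ler_wpM2r ?lerDl// exprn_ge0// mulr_ge0.
have t2 := hk2 m (leq_addl _ _).
pose h y := phi y * chi (y / 2 ^+ m.+1).
have schi : sm (fun y : R => chi (y / 2 ^+ m.+1)).
  have -> : (fun y : R => chi (y / 2 ^+ m.+1)) = fun y => chi ((2 ^+ m.+1)^-1 * y).
    by apply/funext => y; rewrite mulrC.
  exact: smooth_scaled_chi.
have sh : sm h by exact: smooth_mul.
have P0 : 0 < 2 ^+ m.+1 :> R by rewrite exprn_gt0.
have th : test_fun h.
  apply/test_funP; split=> //; exists (2 ^+ m.+1); apply: supp_in_mulr => y.
  by move=> /supp_chi; rewrite ler_pdivlMr// ler_pdivrMr// mulN1r mul1r.
have [d d0 hd] := pv h th (e / 3) e30.
exists (Num.min d 1); first by rewrite lt_min d0 ltr01.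
move=> r /andP[r0]; rewrite le_min => /andP[rd r1].
rewrite /affine_pairing [`|r|]gtr0_norm//.
have st : sm (tail m phi) by exact: smooth_tail.
have -> : T (fun y => phi ((y - x) / r)) = T (sc x r h) + T (sc x r (tail m phi)).
  rewrite -ed_add//; [|exact: smooth_sc..].
  by congr T; apply/funext => y; rewrite /sc /h /tail; ring.
have := hK phi B m r sphi B0 hB ltac:(by rewrite r0 r1); rewrite !expr1 => t3.
have {t3} t3 : `|r^-1 * T (sc x r (tail m phi))| <= e / 3.
  rewrite normrM [`|r^-1|]gtr0_norm ?invr_gt0// mulrC ler_pdivrMr//.
  apply: le_trans t3 _; rewrite (_ : _ * _ = K * B * (2 * q) ^+ m * r); last first.
    by move: ((2 * q) ^+ m) => Q; ring.
  by rewrite ler_wpM2r// ltW.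
have t4 := hd r ltac:(by rewrite r0 rd).
have t5 : `|v * \int[mu]_y h y - v| <= e / 3.
  rewrite -[X in _ - X]mulr1 -mulrBr normrM.
  apply: le_trans (ler_wpM2l (normr_ge0 v) t2) _; rewrite mulrA ler_pdivrMr// mulrC.
  by rewrite ler_wpM2l ?(ltW e30)// lerDl.
move: t3 t4 t5; rewrite mulrDr; move: (r^-1 * _) (r^-1 * _) (v * _) => A1 A2 A3 t3 t4 t5.
have -> : A1 + A2 - v = A2 + (A1 - A3) + (A3 - v) by ring.
apply: le_trans (ler_normD _ _) _; have := ler_normD A2 (A1 - A3); move: t3 t4 t5; clear; lra.
Qed.

(** Near x the product has a smooth factor, and [freeze] replaces it by its value at x up to O(r ^
    2). *)
Lemma cut_product_epv T (a b x v : R) (D : nat -> R -> R) u : edist T ->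
  (forall n x, a < x < b -> is_derive x 1 (D n) (D n.+1 x)) ->
  cut_product T a b (D 0%N) u -> a < x < b -> epv T x v -> epv u x (v * D 0%N x).
Proof.
move=> hT dD hu /andP[ax xb] pv phi tphi e e0.
have sT := epv_scale_bounded hT pv; have /test_funP[sphi [A0 pA0]] := tphi.
pose A := `|A0| + 1; have A1 : 0 < A by rewrite ltr_wpDl.
have pA : supp_in (- A) A phi.
  apply: supp_in_le pA0; rewrite ?lerN2 /A; have := ler_norm A0; clear; lra.
pose d := Num.min (x - a) (b - x) / 2.
have d0 : 0 < d by rewrite divr_gt0// lt_min !subr_gt0 ax.
have dl : x - d > a /\ x + d < b.
  have : Num.min (x - a) (b - x) <= x - a by rewrite ge_min lexx.
  have : Num.min (x - a) (b - x) <= b - x by rewrite ge_min lexx orbT.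
  by move: d0; rewrite /d; clear; lra.
have [s [s0 one hs]] := cut_product_local hu dl.1 dl.2.
pose f y := cut a b s y * D 0%N y.
have sf : sm f.
  apply: (smooth_cut dD (a' := a + s) (b' := b - s)); rewrite ?ltrDl ?gtrBl//.
    exact: sm_cut.
  exact: supp_in_cut.
have fx : f x = D 0%N x by rewrite /f one ?mul1r//; move: d0; clear => *; apply/andP; split; lra.
pose phi1 z := phi (A * z + 0).
have sphi1 : sm phi1 by exact: smooth_comp_affine.
have pphi1 : supp_in (-1) 1 phi1.
  move=> z /pA; rewrite addr0 => /andP[h1 h2]; rewrite -(ler_pM2l A1) -[X in _ && X](ler_pM2l A1).
  by rewrite mulrN1 mulr1 h1.
have [K K0 hK] := freeze hT sT sf sphi1 pphi1.
have scE r : 0 < r -> sc x (r * A) phi1 = sc x r phi.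
  move=> r0; apply/funext => y; rewrite /sc /phi1 addr0; congr phi.
  by field; rewrite !gt_eqF.
pose w := `|D 0%N x| + 1; have w0 : 0 < w by rewrite ltr_wpDl.
have [d1 d10 hd1] := pv phi tphi (e / 2 / w) ltac:(by rewrite !divr_gt0).
pose L := K * A ^+ 2 + 1; have L0 : 0 < L by rewrite ltr_wpDl// mulr_ge0// sqr_ge0.
exists (Num.min d1 (Num.min (A^-1) (Num.min (d / A) (e / 2 / L)))).
  by rewrite !lt_min d10 invr_gt0 A1 (divr_gt0 d0 A1) (divr_gt0 (divr_gt0 e0 (ltr0n R 2)) L0).
move=> r /andP[r0]; rewrite !le_min => /and4P[r1 r2 r3 r4].
have rA : 0 < r * A <= 1 by rewrite mulr_gt0//= -ler_pdivlMr// div1r.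
rewrite (hs _ (smooth_sc x r sphi)); last first.
  move: r3; rewrite ler_pdivlMr// => r3 y /pA.
  rewrite ler_pdivlMr// ler_pdivrMr// => /andP[h1 h2]; apply/andP.
  by move: h1 h2 r3; rewrite mulNr (mulrC A r); clear; lra.
have := hK _ rA; rewrite scE// fx => k1.
have k2 := hd1 r ltac:(by rewrite r0 r1).
rewrite -[X in r^-1 * X](subrK (D 0%N x * T (sc x r phi))) mulrDr.
have {}k1 : `|r^-1 * (T (fun y => f y * sc x r phi y) - D 0%N x * T (sc x r phi))| <= e / 2.
  rewrite normrM [`|r^-1|]gtr0_norm ?invr_gt0// mulrC ler_pdivrMr//.
  apply: le_trans k1 _; rewrite (_ : _ * _ = K * A ^+ 2 * r * r); last by ring.
  rewrite ler_wpM2r ?(ltW r0)//; move: r4; rewrite ler_pdivlMr// => r4.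
  apply: le_trans r4; rewrite mulrC ler_wpM2l ?(ltW r0)// /L; by clear; lra.
have {}k2 : `|r^-1 * (D 0%N x * T (sc x r phi)) - v * D 0%N x * \int[mu]_y phi y| <= e / 2.
  rewrite (_ : _ - _ = D 0%N x * (r^-1 * T (sc x r phi) - v * \int[mu]_y phi y)); last by ring.
  rewrite normrM; apply: le_trans (ler_wpM2l (normr_ge0 _) k2) _.
  rewrite mulrA ler_pdivrMr// mulrC ler_wpM2l ?divr_ge0 ?(ltW e0)// /w; by clear; lra.
move: k1 k2; rewrite /f; move: (r^-1 * (_ - _)) (r^-1 * (D _ _ * _)) (v * _ * _) => A1' A2' A3' k1 k2.
rewrite -addrA; apply: le_trans (ler_normD _ _) _; move: k1 k2; clear; lra.
Qed.

End PointValues.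

(** * Normalized primitives of test functions *)

Section Primitive.
Context {R : realType}.
Implicit Types (f g phi psi rho : R -> R) (n k m j : nat) (x y z e c v w B r s d q t M L K : R) (T u : (R -> R) -> R).
Local Notation mu := (@lebesgue_measure R).

Lemma distrib_of_functional (F : (R -> R) -> R) :
  (forall c f g, test_fun f -> test_fun g -> F (fun y => c * f y + g y) = c * F f + F g) ->
  (forall A, exists C N, 0 <= C /\ forall phi B, sm phi -> supp_in (- A) A phi ->
    dbound N setT B phi -> `|F phi| <= C * B) ->
  exists g : distrib R, distrib_fun g = F.
Proof.
move=> linF hF.
suff cF (Q : set R) : compact Q -> exists C : R, exists N : nat, forall phi,
    test_fun phi -> fun_support phi `<=` Q ->
    `|F phi| <= C * \sum_(k < N.+1) sup (range (fun y => `|derive1n k phi y|)).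
  by exists (Distrib linF cF).
move=> /compact_bounded [M [_ hM]]; have [C [N [C0 hC]]] := hF (M + 1).
exists C, N => phi /test_funP[sphi _] sub.
have pphi : supp_in (- (M + 1)) (M + 1) phi.
  move=> y fy; rewrite -ler_norml; apply: (hM (M + 1)); first by rewrite ltrDl.
  by apply: sub; apply: subset_closure.
have [B B0 /dboundP hB] := dbound_supp N sphi pphi.
apply: hC => //; apply/dboundP => k y kN _.
have hs i z : (i <= N)%N -> `|dn i phi z| <= sup (range (fun y => `|derive1n i phi y|)).
  move=> iN; rewrite dnE; apply: sup_upper_bound; last by exists z.
  split; first by exists `|derive1n i phi 0|; exists 0.
  by exists B => _ [w _ <-]; rewrite -dnE; exact: hB.
apply: le_trans (hs k y kN) _; rewrite (bigD1 (Ordinal (kN : (k < N.+1)%N)))//= lerDl.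
apply: sumr_ge0 => i _; apply: le_trans (hs i 0 _) => //; by rewrite -ltnS.
Qed.

Lemma cst_of_derive0 f (x y : R) : (forall z, Num.min x y <= z <= Num.max x y -> is_derive z 1 f 0) ->
  f y = f x.
Proof.
move=> h; apply/eqP; rewrite -subr_eq0 -normr_le0.
have := @mvt_local R f (fun=> 0) 0 x y h; rewrite mul0r; apply=> z _; by rewrite normr0.
Qed.

(** Normalized to vanish far to the right. Far to the left it is minus the integral of phi, so it is
    in general no test function and is paired with functionals of compact support only. *)
Definition is_primitive phi (F : R -> R) :=
  (forall x, is_derive x 1 F (phi x)) /\ exists A, forall y, A <= y -> F y = 0.

Lemma primitive_unique phi F F' : is_primitive phi F -> is_primitive phi F' -> F = F'.
Proof.
move=> [dF [A hA]] [dF' [A' hA']]; apply/funext => y.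
have E : F y - F' y = F (Num.max A A') - F' (Num.max A A').
  apply: (@cst_of_derive0 (fun y => F y - F' y)) => z _.
  by have := is_deriveB (dF z) (dF' z); rewrite subrr.
apply/eqP; rewrite -subr_eq0 E hA ?hA' ?subrr//; rewrite le_max lexx ?orbT//.
Qed.

Definition primitive phi : R -> R := get (is_primitive phi).

Lemma primitiveE phi F : is_primitive phi F -> primitive phi = F.
Proof.
move=> h; apply: (@primitive_unique phi) => //.
exact: (@getPex _ (is_primitive phi) (ex_intro _ F h)).
Qed.

Lemma primitiveP phi A : sm phi -> supp_in (- A) A phi -> 0 <= A ->
  [/\ forall x, is_derive x 1 (primitive phi) (phi x), sm (primitive phi),
      forall y, A <= y -> primitive phi y = 0 &
      forall y, y <= - A -> primitive phi y = - \int[mu]_z phi z].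
Proof.
move=> sphi pphi A0; have [G _ dG] := antiderivative (smooth_continuous sphi).
pose F y := G y - G A.
have dF x : is_derive x 1 F (phi x).
  by have := is_deriveB (dG x) (is_derive_cst (G A) x 1); rewrite subr0.
have z1 y : A <= y -> F y = 0.
  move=> Ay; rewrite -(subrr (G A)) -[RHS]/(F A); apply: cst_of_derive0 => z.
  rewrite (min_l Ay) (max_r Ay) => /andP[Az zy].
  (* At A itself phi vanishes by continuity from the right. *)
  have [->|nz] := eqVneq z A; last first.
    have := dF z; rewrite (supp_in_eq0 pphi) // => /andP[_ zA].
    by case/negP: nz; rewrite eq_le zA Az.
  have := dF A; rewrite (_ : phi A = 0)//.
  apply/eqP; apply: contraT => nA.
  have cphi := @smooth_continuous R phi sphi A.
  have /cvgrPdist_lt /(_ `|phi A| ltac:(by rewrite normr_gt0)) [d /= d0 hd] := cphi.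
  have := hd (A + d / 2); rewrite /= opprD addNKr normrN gtr0_norm ?divr_gt0//.
  move=> /(_ ltac:(by move: d0; clear; lra)).
  rewrite (supp_in_eq0 pphi (y := A + d / 2)) ?subr0 ?ltxx// => /andP[_].
  by move: d0; clear; lra.
have P : primitive phi = F by apply: primitiveE; split=> //; exists A.
have sF : sm F.
  apply/smoothCn => -[//|n]; split=> [x|]; first by have [h _] := dF x.
  by rewrite (is_derive_der dF); exact: Cn_smooth.
rewrite P; split=> // y yA.
have q1 : y - 1 < - A by move: yA; clear; lra.
have q2 : A < A + 1 by rewrite ltrDl.
have q3 : y - 1 < A + 1 by move: yA A0; clear; lra.
have := Rintegral_primitive q1 q2 q3 (smooth_continuous sphi) pphi dF => ->.
rewrite (z1 (A + 1)) ?sub0r ?opprK ?ltW//.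
apply: (@cst_of_derive0 F) => z; rewrite min_l ?max_r; [|by clear; lra..].
move=> /andP[h1 h2]; have := dF z; have [->|nz] := eqVneq z (- A).
  rewrite (_ : phi (- A) = 0)//; apply/eqP; apply: contraT => nA.
  have cphi := @smooth_continuous R phi sphi (- A).
  have /cvgrPdist_lt /(_ `|phi (- A)| ltac:(by rewrite normr_gt0)) [d /= d0 hd] := cphi.
  have := hd (- A - d / 2); rewrite /= opprB addrCA subrr addr0 gtr0_norm ?divr_gt0//.
  move=> /(_ ltac:(by move: d0; clear; lra)).
  rewrite (supp_in_eq0 pphi (y := - A - d / 2)) ?subr0 ?ltxx// => /andP[].
  by move: d0; clear; lra.
rewrite (supp_in_eq0 pphi)// => /andP[h3 _]; case/negP: nz.
by rewrite eq_le h3 (le_trans h2 yA).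
Qed.

End Primitive.

(** * Point values of the primitive of a functional *)

Section ProductPair.
Context {R : realType}.
Implicit Types (f g phi psi rho : R -> R) (n k m j : nat) (x y z e c v w B r s d q t M L K : R) (T u : (R -> R) -> R).
Local Notation mu := (@lebesgue_measure R).

Lemma test_fun_sym phi : test_fun phi -> exists A, [/\ sm phi, 0 < A & supp_in (- A) A phi].
Proof.
move=> /test_funP[sphi [A pA]]; exists (`|A| + 1); split=> //.
by apply: supp_in_le pA; have := ler_norm A; clear; lra.
Qed.

Lemma integral_reflect phi : test_fun phi -> \int[mu]_y phi (- y) = \int[mu]_y phi y.
Proof.
move=> /test_fun_sym[A [sphi A0 pA]]; have [dP sP z1 z2] := primitiveP sphi pA (ltW A0).
pose P := primitive phi; pose G y := (-1) * P ((-1) * y + 0).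
have sG : sm G by apply: smooth_scale; exact: smooth_comp_affine.
have E y : (-1) * y + 0 = - y by rewrite addr0 mulN1r.
have dG y : is_derive y 1 G (phi (- y)).
  have := smooth_is_derive1 y sG.
  have -> // : der G y = phi (- y).
  rewrite [LHS](_ : _ = dn 1 G y)// dn_scale; last exact: smooth_comp_affine.
  by rewrite dn_comp_affine// E /= expr1 [der P](is_derive_der dP); ring.
have cphi : continuous (fun y => phi (- y)).
  have -> : (fun y => phi (- y)) = fun y => phi ((-1) * y + 0) by apply/funext => y; rewrite E.
  by apply: smooth_continuous; exact: smooth_comp_affine.
have pphi : supp_in (- A) A (fun y => phi (- y)).
  by move=> y /pA /andP[h1 h2]; apply/andP; move: h1 h2; clear; lra.
have q1 : - (A + 1) < - A by clear; lra.
have q2 : A < A + 1 by clear; lra.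
have q3 : - (A + 1) < A + 1 by move: A0; clear; lra.
rewrite (Rintegral_primitive q1 q2 q3 cphi pphi dG) /G !E opprK /P.
by rewrite (z1 (A + 1)) ?(z2 (- (A + 1))) ?(ltW q1) ?(ltW q2)//; ring.
Qed.

(** A negative dilation factor amounts to testing the reflected function, which has the same
    integral. *)
Lemma epv_point_value (g : distrib R) x v : epv g x v -> point_value g x v.
Proof.
move=> pv phi tphi; apply/cvgrPdist_le => e e0.
have E y : (-1) * y + 0 = - y by rewrite addr0 mulN1r.
have tr : test_fun (fun y => phi (- y)).
  have [A [sphi A0 pA]] := test_fun_sym tphi; apply: (@test_fun_supp R (- A) A).
    have -> : (fun y => phi (- y)) = fun y => phi ((-1) * y + 0) by apply/funext => y; rewrite E.
    exact: smooth_comp_affine.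
  by move=> y /pA /andP[h1 h2]; apply/andP; move: h1 h2; clear; lra.
have [d1 d10 h1] := pv phi tphi e e0; have [d2 d20 h2] := pv _ tr e e0.
exists (Num.min d1 d2) => /=; first by rewrite lt_min d10.
move=> r /=; rewrite sub0r normrN lt_min => /andP[r1 r2] r0; rewrite distrC /affine_pairing.
have [rp|rn|rz] := ltgtP r 0; last by move: r0; rewrite rz eqxx.
- rewrite -(integral_reflect tphi); have := h2 `|r|; rewrite normr_gt0 r0 (ltW r2) => /(_ isT).
  congr (`| _ * distrib_fun g _ - _| <= _).
  by apply/funext => y; rewrite /sc (ltr0_norm rp) invrN mulrN opprK.
- have := h1 `|r|; rewrite normr_gt0 r0 (ltW r1) => /(_ isT).
  congr (`| _ * distrib_fun g _ - _| <= _).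
  by apply/funext => y; rewrite /sc (gtr0_norm rn).
Qed.

Lemma scale_small T x (w : R -> R) A : scale_bounded T x 1 -> sm w -> supp_in (- A) A w ->
  exists K d, [/\ 0 <= K, 0 < d & forall r, 0 < r <= d -> `|T (sc x r w)| <= K * r].
Proof.
move=> [N [C [C0 hC]]] sw pw; pose A' := `|A| + 1; have A1 : 0 < A' by rewrite ltr_wpDl.
pose w1 z := w (A' * z + 0); have sw1 : sm w1 by exact: smooth_comp_affine.
have pw1 : supp_in (-1) 1 w1.
  move=> z; rewrite /w1 addr0 => /pw /andP[h1 h2].
  rewrite -(ler_pM2l A1) -[X in _ && X](ler_pM2l A1) mulrN1 mulr1.
  by apply/andP; move: h1 h2 (ler_norm A); rewrite /A'; clear; lra.
have [M M0 hM] := dbound_supp N sw1 pw1.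
exists (C * A' * M), A'^-1; split; first by rewrite !mulr_ge0// ltW.
  by rewrite invr_gt0.
move=> r /andP[r0 r1]; have rA : 0 < r * A' <= 1 by rewrite mulr_gt0//= -ler_pdivlMr// div1r.
have -> : sc x r w = sc x (r * A') w1.
  apply/funext => y; rewrite /sc /w1 addr0; congr w.
  by field; rewrite !gt_eqF.
have := hC w1 M (r * A') sw1 pw1 hM rA; rewrite expr1 => /le_trans; apply.
by rewrite le_eqVlt; apply/orP; left; apply/eqP; ring.
Qed.

Lemma half_cauchy (a : nat -> R) L : 0 <= L ->
  (forall n, `|a n.+1 - a n| <= L * 2^-1 ^+ n) ->
  exists l, forall n, `|l - a n| <= 2 * L * 2^-1 ^+ n.
Proof.
move=> L0 ha; have hp n : 0 <= 2^-1 ^+ n :> R by rewrite exprn_ge0// invr_ge0.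
apply: cauchy_limit => [k m km|e e0]; last first.
  by apply: half_small => //; rewrite mulr_ge0.
rewrite -(subnKC km); move: (m - k)%N => i {m km}.
suff h : `|a (k + i)%N - a k| <= 2 * L * 2^-1 ^+ k * (1 - 2^-1 ^+ i).
  by apply: le_trans h _; apply: ler_piMr; rewrite ?mulr_ge0// gerBl.
elim: i => [|i IH]; first by rewrite addn0 !subrr normr0 mulr0.
have -> : a (k + i.+1)%N - a k = (a (k + i).+1 - a (k + i)%N) + (a (k + i)%N - a k).
  by rewrite addnS; ring.
apply: le_trans (ler_normD _ _) _; apply: le_trans (lerD (ha _) IH) _.
rewrite exprD exprSr le_eqVlt; apply/orP; left; apply/eqP.
by move: (2^-1 ^+ k) (2^-1 ^+ i) => P Q; field.
Qed.

Definition costep z : R := 1 - step z.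

Lemma smooth_costep : sm costep.
Proof. by apply: smooth_sub; [exact: smooth_cst|exact: smooth_step]. Qed.

(** The limit is the mass of u to the left of x. Changing r by a factor between 1 and 2 adds a
    dilate of a function on [-1, 1], hence O(r): the values converge along 2 ^ -n, and in between as
    well. *)
Lemma costep_limit u x : edist u -> scale_bounded u x 1 -> exists l, forall e, 0 < e ->
  exists2 d, 0 < d & forall r, 0 < r <= d -> `|u (sc x r costep) - l| <= e.
Proof.
move=> hu [N [C [C0 hC]]]; have [M M0 hM] := @dbound_step R N.
have ss := @smooth_step R.
pose L := C * (M + 3 ^+ N * M); have L0 : 0 <= L by rewrite mulr_ge0// addr_ge0// mulr_ge0// exprn_ge0.
have H r lam : 0 < r <= 1 -> 1 <= lam <= 2 ->
    `|u (sc x (r / lam) costep) - u (sc x r costep)| <= L * r.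
  move=> r01 /andP[l1 l2]; have /andP[r0 r1] := r01; have l0 : 0 < lam by apply: lt_le_trans l1.
  pose g z := step z - step (lam * z + 0).
  have sl : sm (fun z => step (lam * z + 0)) by exact: smooth_comp_affine.
  have sg : sm g by exact: smooth_sub.
  have pg : supp_in (-1) 1 g.
    move=> z; apply: contraNT; rewrite negb_and -!ltNge /g addr0 => /orP[] h; apply/eqP.
      rewrite !step0 ?subrr//; last by move: h; clear; lra.
      by rewrite pmulr_rle0//; move: h; clear; lra.
    rewrite !step1 ?subrr//; last exact: ltW.
    by apply: le_trans l1 _; apply: ler_peMr; [exact: ltW|exact: ltW].
  have bg : dbound N setT (M + 3 ^+ N * M) g.
    apply: dbound_sub => //; apply: dbound_le (dbound_comp_affine lam 0 ss M0 hM) => //.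
    rewrite ler_wpM2r// lerXn2r ?nnegrE//.
    by rewrite ger0_norm ?(ltW l0)//; move: l2; clear; lra.
  rewrite -ed_sub//; [|apply: smooth_sc; exact: smooth_costep..].
  have -> : (fun y => sc x (r / lam) costep y - sc x r costep y) = sc x r g.
    apply/funext => y; rewrite /sc /costep /g addr0.
    have -> : (y - x) / (r / lam) = lam * ((y - x) / r) by field; rewrite !gt_eqF.
    ring.
  apply: le_trans (hC g _ r sg pg bg r01) _; rewrite expr1 /L.
  by rewrite le_eqVlt; apply/orP; left; apply/eqP; move: (3 ^+ N) => P; ring.
have hp n : 0 < (2^-1 : R) ^+ n <= 1.
  by rewrite exprn_gt0 ?invr_gt0//= exprn_ile1//; clear; lra.
have [l hl] : exists l, forall n, `|l - u (sc x (2^-1 ^+ n) costep)| <= 2 * L * 2^-1 ^+ n.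
  apply: half_cauchy => // n; rewrite exprSr.
  have := H (2^-1 ^+ n) 2 (hp n); apply; by apply/andP; split; clear; lra.
exists l => e e0; have L60 : 0 < 6 * L + 1 by rewrite ltr_wpDl// mulr_ge0.
exists (Num.min 1 (e / (6 * L + 1))); first by rewrite lt_min ltr01 divr_gt0.
move=> r /andP[r0]; rewrite le_min => /andP[r1 re].
have [j] := dyadic_scale r0 r1; rewrite !mul1r exprSr => /andP[j1 j2].
have := hl j; have := H (2^-1 ^+ j) (2^-1 ^+ j / r) (hp j); have /andP[p0 _] := hp j.
move: (2^-1 ^+ j) p0 j1 j2 => p p0 j1 j2.
have -> : p / (p / r) = r by field; rewrite !gt_eqF.
have -> : 1 <= p / r <= 2 by rewrite ler_pdivlMr// ler_pdivrMr// mul1r j2; move: j1; clear; lra.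
move=> /(_ isT) h1 h2; have p2 : p <= 2 * r by move: j1; clear; lra.
have h3 := ler_wpM2l L0 p2; move: re; rewrite ler_pdivlMr// => re.
have -> : u (sc x r costep) - l = (u (sc x r costep) - u (sc x p costep)) - (l - u (sc x p costep)).
  by ring.
by apply: le_trans (ler_normB _ _) _; move: h1 h2 h3 re r0; clear; lra.
Qed.

Lemma primitive_lin c f g : test_fun f -> test_fun g ->
  primitive (fun y => c * f y + g y) = fun y => c * primitive f y + primitive g y.
Proof.
move=> /test_fun_sym[A [sf A0 pA]] /test_fun_sym[A' [sg A'0 pA']].
have [d1 _ z1 _] := primitiveP sf pA (ltW A0); have [d2 _ z2 _] := primitiveP sg pA' (ltW A'0).
apply: primitiveE; split=> [x|].
  have := is_deriveD (is_deriveZ c (d1 x)) (d2 x); by [].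
exists (Num.max A A') => y; rewrite ge_max => /andP[y1 y2].
by rewrite z1// z2// mulr0 addr0.
Qed.

Lemma primitive_sc x r phi : 0 < r -> test_fun phi ->
  primitive (sc x r phi) = fun y => r * sc x r (primitive phi) y.
Proof.
move=> r0 /test_fun_sym[A [sphi A0 pA]]; have [dP sP z1 _] := primitiveP sphi pA (ltW A0).
apply: primitiveE; split=> [y|].
  have ss : sm (fun y => r * sc x r (primitive phi) y) by apply: smooth_scale; exact: smooth_sc.
  have := smooth_is_derive1 y ss.
  have -> // : der (fun y => r * sc x r (primitive phi) y) y = sc x r phi y.
  rewrite [LHS](_ : _ = dn 1 (fun y => r * sc x r (primitive phi) y) y)//.
  rewrite dn_scale; last exact: smooth_sc.
  rewrite dn_sc// /sc expr1 mulrA mulfV ?mul1r ?gt_eqF//.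
  by rewrite [dn 1 _](is_derive_der dP).
exists (x + r * A) => y hy; rewrite /sc z1 ?mulr0// ler_pdivlMr//; move: hy; rewrite mulrC.
by clear; lra.
Qed.

Lemma primitive_der phi : test_fun phi -> primitive (der phi) = phi.
Proof.
move=> /test_fun_sym[A [sphi A0 pA]]; apply: primitiveE; split.
  by move=> x; exact: smooth_is_derive1.
exists (A + 1) => y hy; apply: (supp_in_eq0 pA) => /andP[_ h]; move: hy h; clear; lra.
Qed.

Lemma primitive_distrib u : edist u -> exists U : distrib R,
  distrib_fun U = fun phi => - u (primitive phi).
Proof.
move=> hu; apply: distrib_of_functional => [c f g tf tg|A].
  have [A [sf A0 pA]] := test_fun_sym tf; have [A' [sg A'0 pA']] := test_fun_sym tg.
  have [_ s1 _ _] := primitiveP sf pA (ltW A0); have [_ s2 _ _] := primitiveP sg pA' (ltW A'0).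
  by rewrite primitive_lin// (ed_lin hu)//; ring.
have [P [C [N [C0 hC]]]] := ed_bd hu.
pose Q := 1 + `|A| + `|P|; have Q1 : 1 <= Q by rewrite /Q -addrA lerDl addr_ge0.
exists (C * Q), N; split; first by rewrite mulr_ge0// (le_trans _ Q1).
move=> phi B sphi pphi /dboundP hB; rewrite normrN -mulrA.
have pphi' : supp_in (- `|A|) `|A| phi by apply: supp_in_le pphi; rewrite ?lerN2 ler_norm.
have [dP sP z1 _] := primitiveP sphi pphi' (normr_ge0 A).
have B0 : 0 <= B by apply: le_trans (hB 0%N 0 (leq0n _) I).
apply: hC => //; apply/dboundP => -[|k] y kN; rewrite /seg /= => yP; last first.
  rewrite -dnS dSn (is_derive_der dP); apply: le_trans (hB k y (ltnW kN) I) _.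
  by apply: ler_peMl.
have := @mvt_bound R (primitive phi) phi B `|A| y dP (fun z _ => hB 0%N z (leq0n _) I).
rewrite (z1 `|A|)// subr0 => /le_trans; apply; rewrite mulrC ler_wpM2r//.
apply: le_trans (ler_normB _ _) _; rewrite normr_id /Q.
have : `|y| <= `|P| by rewrite ler_norml; move: yP (ler_norm P); clear => *; apply/andP; lra.
clear; lra.
Qed.

(** The primitive of phi equals - I far to the left, so adding I [costep] makes it compactly
    supported. On dilates of that sum u is O(r), which leaves I times the limit l. *)
Lemma primitive_epv u x l : edist u -> scale_bounded u x 1 ->
  (forall e, 0 < e -> exists2 d, 0 < d & forall r, 0 < r <= d -> `|u (sc x r costep) - l| <= e) ->
  epv (fun phi => - u (primitive phi)) x l.
Proof.
move=> hu su hl phi tphi e e0; have [A [sphi A0 pA]] := test_fun_sym tphi.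
have [dP sP z1 z2] := primitiveP sphi pA (ltW A0).
move: z2; set I := \int[mu]_y phi y => z2.
pose w z := I * costep z + primitive phi z.
have scs := smooth_costep.
have sw : sm w by apply: smooth_add => //; exact: smooth_scale.
have pw : supp_in (- (A + 1)) (A + 1) w.
  move=> z; apply: contraNT; rewrite negb_and -!ltNge /w => /orP[] h; apply/eqP.
    rewrite z2; last by move: h; clear; lra.
    rewrite /costep step0; last by move: h A0; clear; lra.
    by ring.
  rewrite z1; last by move: h; clear; lra.
  rewrite /costep step1; last by move: h A0; clear; lra.
  by ring.
have [K [d1 [K0 d10 h1]]] := scale_small su sw pw.
have I0 : 0 < 2 * (`|I| + 1) by rewrite mulr_gt0// ltr_wpDl.
have [d2 d20 h2] := hl (e / (2 * (`|I| + 1))) ltac:(by rewrite divr_gt0).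
have K10 : 0 < 2 * (K + 1) by rewrite mulr_gt0// ltr_wpDl.
exists (Num.min d1 (Num.min d2 (e / (2 * (K + 1))))); first by rewrite !lt_min d10 d20 divr_gt0.
move=> r /andP[r0]; rewrite !le_min => /and3P[r1 r2 r3].
rewrite primitive_sc// ed_scale//; last exact: smooth_sc.
rewrite mulrN mulKf ?gt_eqF//.
have E : u (sc x r w) = I * u (sc x r costep) + u (sc x r (primitive phi)).
  by rewrite -(ed_lin hu)//; exact: smooth_sc.
have -> : - u (sc x r (primitive phi)) - l * I = I * (u (sc x r costep) - l) - u (sc x r w).
  by rewrite E; ring.
have k1 := h1 r ltac:(by rewrite r0 r1); have k2 := h2 r ltac:(by rewrite r0 r2).
have k3 : `|I * (u (sc x r costep) - l)| <= e / 2.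
  rewrite normrM; apply: le_trans (ler_wpM2l (normr_ge0 I) k2) _.
  rewrite mulrA ler_pdivrMr// (_ : e / 2 * _ = (`|I| + 1) * e); last by field.
  by rewrite ler_wpM2r ?(ltW e0)// lerDl.
have k4 : K * r <= e / 2.
  by move: r3; rewrite ler_pdivlMr//; move: r0 K0; clear; lra.
by apply: le_trans (ler_normB _ _) _; move: k1 k3 k4; clear; lra.
Qed.

End ProductPair.

(** * The pair that is both major and minor *)

Section ProductPairExists.
Context {R : realType}.
Implicit Types (f g phi psi rho : R -> R) (n k m j : nat) (x y z e c v w B r s d q t M L K : R) (T u : (R -> R) -> R).
Local Notation mu := (@lebesgue_measure R).

Lemma le_limf_einf (F : R -> R) (l : R) :
  (forall e, 0 < e -> exists2 d, 0 < d & forall t, 0 < t <= d -> l - e <= F t) ->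
  (l%:E <= limf_einf (fun t => (F t)%:E) 0^'+)%E.
Proof.
move=> h; apply/lee_addgt0Pr => e e0; have [d d0 hd] := h e e0.
rewrite -leeBlDr// -EFinB limf_einfE; pose A := [set t : R | 0 < t <= d].
apply: le_trans (_ : ereal_inf ((fun t => (F t)%:E) @` A) <= _)%E; last first.
  apply: ereal_sup_ubound; exists A => //.
  exists d => // t /=; rewrite sub0r normrN => t1 t0.
  by rewrite /A /= t0 /= ltW// -[t]gtr0_norm.
by apply: le_ereal_inf_tmp => _ [t At <-]; rewrite lee_fin; exact: hd.
Qed.

Lemma ge_limf_esup (F : R -> R) (l : R) :
  (forall e, 0 < e -> exists2 d, 0 < d & forall t, 0 < t <= d -> F t <= l + e) ->
  (limf_esup (fun t => (F t)%:E) 0^'+ <= l%:E)%E.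
Proof.
move=> h; have : ((- l)%:E <= limf_einf (fun t => (- F t)%:E) 0^'+)%E.
  apply: le_limf_einf => e /h[d d0 hd]; exists d => // t /hd; clear; lra.
have -> : (fun t => (- F t)%:E) = (\- (fun t => (F t)%:E))%E by [].
by rewrite limf_einfN EFinN leeN2.
Qed.

(** Inside ]a, b[ the functional u has point value F x against all of [T0], so lower and upper
    values both equal F x. The end points form the exceptional sets E and Z. *)
Theorem product_pair T (a b : R) (D : nat -> R -> R) (f F : R -> R) u : a < b -> edist T ->
  (forall n x, a < x < b -> is_derive x 1 (D n) (D n.+1 x)) ->
  (forall x, a < x < b -> epv T x (f x)) -> cut_product T a b (D 0%N) u ->
  (forall x, a < x < b -> F x = f x * D 0%N x) ->
  exists v U : distrib R, [/\ major_pair a b (EFin \o F) v U, minor_pair a b (EFin \o F) v U &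
    point_value U b (u (fun=> 1))].
Proof.
move=> ab hT dD pvT cu FE; have [hu _] := cu.
have [v vE] : exists v : distrib R, distrib_fun v = u.
  apply: distrib_of_functional => [c f1 f2 /test_fun_sm s1 /test_fun_sm s2|A].
    exact: ed_lin.
  have [P [C [N [C0 hC]]]] := ed_bd hu; exists C, N; split=> // phi B sphi _ hB.
  by apply: hC => //; exact: dbound_le hB.
have [U UE] := primitive_distrib hu.
have ueq phi psi : sm phi -> sm psi -> (forall y, a <= y <= b -> phi y = psi y) -> u phi = u psi.
  move=> s1 s2 h; apply/eqP; rewrite -subr_eq0 -ed_sub//; apply/eqP.
  apply: (cut_product_vanish hT cu); first exact: smooth_sub.
  by move=> y /h ->; rewrite subrr.
have sv : supported_in a b v.
  move=> x hx; apply: contrapT => nx; apply: hx.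
  exists (~` `[a, b]%classic) => //; split.
    by apply: closed_openC; exact: interval_closed.
  move=> phi tphi sub; rewrite vE; apply: (cut_product_vanish hT cu); first exact: test_fun_sm.
  move=> y yab; apply/eqP; apply: contraT => ny.
  have : (~` `[a, b]%classic) y by apply: sub; apply: subset_closure.
  by rewrite /= in_itv /= yab.
have extE phi : sm phi -> ext_pairing v phi = u phi.
  move=> sphi; have t1 := @test_fun_plateau R (a - 1) (b + 1) 1 ltr01.
  rewrite (@ext_pairingE R v a b 1 (plateau (a - 1) (b + 1) 1) phi sv ltr01 t1)//; last first.
    by move=> y /andP[/ltW h1 /ltW h2]; apply: plateau1 => //; rewrite h1.
  rewrite vE; apply: ueq => //; first exact: (smooth_mul (test_fun_sm t1)).
  move=> y yab; rewrite plateau1 ?mul1r//; move: yab; clear; lra.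
have epvu x : a < x < b -> epv u x (F x).
  by move=> xab; rewrite FE//; exact: (cut_product_epv hT dD cu xab (pvT x xab)).
(* Inside by the point value, at a and b by [cut_product_end], outside because u vanishes: with
   [costep_limit] this gives U a point value everywhere. *)
have sbu x : scale_bounded u x 1.
  have [xab|] := boolP (a < x < b); first exact: (epv_scale_bounded hu (epvu x xab)).
  rewrite negb_and -!leNgt => nx.
  have [->|na] := eqVneq x a; first by apply: (cut_product_end hT cu ab); left.
  have [->|nb] := eqVneq x b; first by apply: (cut_product_end hT cu ab); right.
  have [d d0 hd] : exists2 d, 0 < d & x + d < a \/ b < x - d.
    case/orP: nx => h.
      exists ((a - x) / 2); first by rewrite divr_gt0// subr_gt0 lt_neqAle na.
      by left; have : x < a; [rewrite lt_neqAle na|clear; lra].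
    exists ((x - b) / 2); first by rewrite divr_gt0// subr_gt0 lt_neqAle eq_sym nb.
    by right; have : b < x; [rewrite lt_neqAle eq_sym nb|clear; lra].
  apply: scale_bounded_near => // phi sphi pphi; exists 0, d; split=> // r /andP[r0 rd].
  rewrite (cut_product_vanish hT cu) ?normr0 ?mul0r//; first exact: smooth_sc.
  move=> y /andP[y1 y2]; apply: (supp_in_eq0 (supp_sc (c := x) r0 pphi)) => /andP[h1 h2].
  by case: hd => hd; move: hd rd y1 y2 h1 h2; clear; lra.
have pvU x l : (forall e, 0 < e -> exists2 d, 0 < d & forall r, 0 < r <= d ->
    `|u (sc x r costep) - l| <= e) -> point_value U x l.
  by move=> h; apply: epv_point_value; rewrite UE; exact: primitive_epv.
have LU : Lojasiewicz_distrib U.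
  by move=> x; have [l hl] := costep_limit hu (sbu x); exists l; exact: pvU.
have dU : is_derivative U v.
  move=> phi tphi; rewrite vE UE opprK -derE primitive_der//.
(* To the left of a nothing is seen by u, so [costep] at a may be replaced by a compactly supported
   function, on whose dilates u is O(r). *)
have Ua : point_value U a 0.
  apply: pvU => e e0; pose w z : R := costep z * step (z + 2).
  have sw : sm w.
    apply: smooth_mul; first exact: smooth_costep.
    have -> : (fun z : R => step (z + 2)) = fun z => step (1 * z + 2).
      by apply/funext => z; rewrite mul1r.
    by apply: smooth_comp_affine; exact: smooth_step.
  have pw : supp_in (- 2) 2 w.
    move=> z; apply: contraNT; rewrite negb_and -!ltNge /w => /orP[] h; apply/eqP.
      by rewrite [step (z + 2)]step0 ?mulr0//; move: h; clear; lra.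
    by rewrite /costep step1 ?subrr ?mul0r//; move: h; clear; lra.
  have [K [d [K0 d0 hd]]] := scale_small (sbu a) sw pw.
  have K1 : 0 < K + 1 by rewrite ltr_wpDl.
  exists (Num.min d (e / (K + 1))); first by rewrite lt_min d0 divr_gt0.
  move=> r /andP[r0]; rewrite le_min ler_pdivlMr// => /andP[rd re].
  rewrite subr0 (ueq _ (sc a r w)).
  - apply: le_trans (hd r _) _; first by rewrite r0.
    by move: re r0; clear; lra.
  - by apply: smooth_sc; exact: smooth_costep.
  - exact: smooth_sc.
  - move=> y /andP[ya _]; rewrite /sc /w (step1 (x := _ + 2)) ?mulr1//.
    have : 0 <= (y - a) / r by rewrite divr_ge0 ?subr_ge0// ltW.
    by clear; lra.
(* On [a, b] every dilate of [costep] about b equals 1. *)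
have Ub : point_value U b (u (fun=> 1)).
  apply: pvU => e e0; exists 1 => // r /andP[r0 _].
  rewrite (ueq _ (fun=> 1)) ?subrr ?normr0 ?(ltW e0)//.
  - by apply: smooth_sc; exact: smooth_costep.
  - exact: smooth_cst.
  - move=> y /andP[_ yb]; rewrite /sc /costep step0 ?subr0//.
    by rewrite ler_pdivrMr// mul0r subr_le0.
have val x phi e : x \in `[a, b] -> ~ [set a; b] x -> T0 phi -> 0 < e ->
    exists2 d, 0 < d & forall t, 0 < t <= d ->
      `|affine_pairing (ext_pairing v) x t phi - F x| <= e.
  rewrite in_itv /= => /andP[ax xb] nx hphi e0.
  have xab : a < x < b.
    rewrite !lt_neqAle ax xb !andbT; apply/andP; split; apply/eqP => E; apply: nx.
      by left.
    by right.
  have [d d0 hd] := epv_T0 hu (epvu x xab) hphi e0; exists d => // t /hd.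
  rewrite /affine_pairing extE//; have [/smP sphi _ _ _] := hphi; exact: smooth_sc.
have cE : countable [set a; b] by exact: finite_set_countable.
have nZ : mu.-negligible [set a; b].
  apply/negligibleP; last exact: countable_lebesgue_measure0.
  by apply: measurableU; exact: measurable_set1.
have low x phi : x \in `[a, b] -> ~ [set a; b] x -> T0 phi -> ((F x)%:E <= lower_value v phi x)%E.
  move=> h1 h2 h3; apply: le_limf_einf => e /(val x phi e h1 h2 h3)[d d0 hd].
  by exists d => // t /hd; rewrite ler_norml => /andP[]; clear; lra.
have upp x phi : x \in `[a, b] -> ~ [set a; b] x -> T0 phi -> (upper_value v phi x <= (F x)%:E)%E.
  move=> h1 h2 h3; apply: ge_limf_esup => e /(val x phi e h1 h2 h3)[d d0 hd].
  by exists d => // t /hd; rewrite ler_norml => /andP[]; clear; lra.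
exists v, U; split=> //; split=> //; exists [set a; b], [set a; b]; split=> //.
  by move=> x phi h1 h2 [h3 _]; apply: lt_le_trans (low x phi h1 h2 h3); exact: ltNyr.
by move=> x phi h1 h2 [h3 _]; apply: le_lt_trans (upp x phi h1 h2 h3) _; exact: ltry.
Qed.

End ProductPairExists.

(** * The mean value property *)
Section Darboux.
Context {R : realType}.
Implicit Types (f g h phi psi : R -> R) (n k m i j : nat) (x y z e c d p q v w B r s t M L K : R) (T u : (R -> R) -> R) (P : R -> Prop).
Local Notation mu := (@lebesgue_measure R).

Definition topp T : (R -> R) -> R := fun f => - T f.

Lemma toppK T : topp (topp T) = T.
Proof. by apply/funext => f; rewrite /topp opprK. Qed.

Lemma edist_topp T : edist T -> edist (topp T).
Proof.
move=> hT; split=> [c f g sf sg|]; first by rewrite /topp (ed_lin hT)//; ring.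
have [A [C [N [C0 hC]]]] := ed_bd hT; exists A, C, N; split=> // f B sf hB.
by rewrite normrN; exact: hC.
Qed.

Lemma epv_topp T x v : epv T x v -> epv (topp T) x (- v).
Proof.
move=> pv phi tphi e e0; have [d d0 hd] := pv phi tphi e e0; exists d => // r /hd.
by rewrite /topp mulrN mulNr -opprD normrN.
Qed.

Lemma integral_plateau_gt0 (A B d : R) : 0 < d -> A < B -> 0 < \int[mu]_y plateau A B d y.
Proof.
move=> d0 AB; have sp := smooth_plateau A B d.
have [G _ dG] := antiderivative (smooth_continuous sp).
have q1 : A - d - 1 < A - d by clear; lra.
have q2 : B + d < B + d + 1 by clear; lra.
have q3 : A - d - 1 < B + d + 1 by move: AB d0; clear; lra.
rewrite (Rintegral_primitive q1 q2 q3 (smooth_continuous sp) (supp_plateau d0) dG).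
have mono y y' : y < y' -> G y <= G y'.
  move=> yy; have := integral_antiderivative yy (smooth_continuous sp) dG => E.
  rewrite -subr_ge0 -lee_fin -E; apply: integral_ge0 => z _.
  by rewrite lee_fin plateau_ge0.
have E : G B - G A = B - A.
  have -> : G B - G A = (G B - B) - (G A - A) + (B - A) by ring.
  suff -> : G B - B = G A - A by rewrite subrr add0r.
  apply: (@cst_of_derive0 R (fun y => G y - y) A B) => z.
  rewrite (min_l (ltW AB)) (max_r (ltW AB)) => zI.
  by have := is_deriveB (dG z) (is_derive_id z 1); rewrite plateau1// subrr.
have m1 : G (A - d - 1) <= G A by apply: mono; move: d0; clear; lra.
have m2 : G B <= G (B + d + 1) by apply: mono; move: d0; clear; lra.
by move: E m1 m2 AB; clear; lra.
Qed.

(** End points are included, since a point value can be tested with bumps lying entirely on one side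
    of x. *)
Lemma epv_sign T c d x v : epv T x v -> pos_on T c d -> c < d -> c <= x <= d -> 0 <= v.
Proof.
move=> pv pos cd /andP[cx xd].
have [A [A' [AA hA]]] : exists A A', A < A' /\ exists2 u, 0 < u &
    forall r, 0 < r <= u -> c < x + r * (A - 4^-1) /\ x + r * (A' + 4^-1) < d.
  have [xd'|xd'] := ltP x d.
    exists 2^-1, (3 / 4); split; first by clear; lra.
    exists ((d - x) / 2); first by rewrite divr_gt0 ?subr_gt0.
    by move=> r /andP[r0 r1]; move: r0 r1 cx xd'; clear; lra.
  exists (- (3 / 4)), (- 2^-1); split; first by clear; lra.
  exists ((d - c) / 2); first by rewrite divr_gt0 ?subr_gt0.
  by move=> r /andP[r0 r1]; move: r0 r1 cd xd xd'; clear; lra.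
have [u u0 hu] := hA; have d40 : 0 < 4^-1 :> R by clear; lra.
have I0 := integral_plateau_gt0 d40 AA; have tp := @test_fun_plateau R A A' 4^-1 d40.
apply/ler_addgt0Pr => e e0; rewrite -lerBlDl sub0r.
have [u' u'0 hu'] := pv _ tp (e * \int[mu]_y plateau A A' 4^-1 y) ltac:(by rewrite mulr_gt0).
pose r := Num.min u u'; have r0 : 0 < r by rewrite lt_min u0.
have [] := hu r ltac:(by rewrite r0 ge_min lexx) => h1 h2.
have h3 := hu' r ltac:(by rewrite r0 ge_min lexx orbT).
have Tp : 0 <= T (sc x r (plateau A A' 4^-1)).
  apply: (pos _ _ _ _ _ h1 h2); first by apply: smooth_sc; exact: smooth_plateau.
    by move=> y; exact: plateau_ge0.
  move=> y /(supp_plateau d40); rewrite ler_pdivlMr// ler_pdivrMr// => /andP[q1 q2].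
  by apply/andP; move: q1 q2; clear; lra.
have {}Tp : 0 <= r^-1 * T (sc x r (plateau A A' 4^-1)) by rewrite mulr_ge0// invr_ge0 ltW.
rewrite -(ler_pM2r I0); move: h3 Tp; rewrite ler_norml => /andP[] ; clear; lra.
Qed.

Lemma epv_hk T x v : edist T -> epv T x v -> 0 < v ->
  exists2 u, 0 < u & forall t, 0 < t <= u -> 0 <= hk T 0 x t.
Proof.
move=> hT pv v0; have [d d0 hd] := epv_T0 hT pv (@T0_ngam R) v0; exists d => // t td.
have /andP[t0 _] := td; have := hd t td; rewrite affine_ngam// ler_norml => /andP[h _].
have : 0 <= (Num.sqrt pi)^-1 * hk T 0 x t by move: h; clear; lra.
by rewrite pmulr_rge0 ?invr_gt0 ?sqrt_pi_gt0.
Qed.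

Lemma first_exit P x (n : R) : x < n -> P x -> ~ P n ->
  (forall y, x <= y <= n -> P y -> exists2 e, 0 < e & forall z, `|z - y| < e -> P z) ->
  exists d, [/\ x < d, d <= n, ~ P d & forall z, x <= z < d -> P z].
Proof.
move=> xn Px nPn opn.
pose S := [set y | x <= y <= n /\ forall z, x <= z <= y -> P z].
have Sx : S x.
  split; first by rewrite lexx ltW.
  by move=> z; rewrite -eq_le => /eqP <-.
have hS : has_sup S by split; [exists x|exists n => y [/andP[]]].
pose d := sup S.
have dn : d <= n by apply: ge_sup; [exists x|move=> y [/andP[]]].
have xd : x <= d by apply: sup_upper_bound.
have Pd z : x <= z < d -> P z.
  move=> /andP[xz zd]; have e0 : 0 < d - z by rewrite subr_gt0.
  have [y [_ Sy] hy] := sup_adherent e0 hS.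
  by apply: Sy; rewrite xz ltW//; move: hy; rewrite -/d; clear; lra.
have nPd : ~ P d.
  move=> Pd'; have [e e0 he] := opn d ltac:(by rewrite xd dn) Pd'.
  have dn' : d < n by rewrite lt_neqAle dn andbT; apply/eqP => E; apply: nPn; rewrite -E.
  pose y := Num.min (d + e / 2) n.
  have dy : d < y by rewrite lt_min dn' ltrDl divr_gt0.
  suff Sy : S y by have := sup_upper_bound hS Sy; rewrite -/d leNgt dy.
  split; first by rewrite (ltW (le_lt_trans xd dy)) ge_min lexx orbT.
  move=> z /andP[xz zy]; have [zd|dz] := ltP z d; first by apply: Pd; rewrite xz.
  apply: he; rewrite ger0_norm ?subr_ge0//.
  have : y <= d + e / 2 by rewrite ge_min lexx.
  by move: zy e0; clear; lra.
exists d; split=> //; rewrite lt_neqAle xd andbT; apply/eqP => E; apply: nPd; by rewrite -E.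
Qed.

(** The interval ]c, c'[ is the part travelled from x before P fails at d, so d is one of its end
    points; reflection reduces the leftward case to [first_exit]. *)
Lemma exit_point P p q x (n : R) : p < x < q -> p < n < q -> P x -> ~ P n ->
  (forall y, p < y < q -> P y -> exists2 e, 0 < e & forall z, `|z - y| < e -> P z) ->
  exists d c c', [/\ Num.min x n <= d <= Num.max x n, ~ P d, c < c' /\ c <= d <= c',
    p < c /\ c' < q & forall z, c < z < c' -> P z].
Proof.
move=> /andP[px xq] /andP[pn nq] Px nPn opn.
have [xn|nx|E] := ltgtP x n; last by case: nPn; rewrite -E.
- have [|d [xd dn nPd Pd]] := first_exit xn Px nPn.
    by move=> y /andP[xy yn]; apply: opn; rewrite (lt_le_trans px)// (le_lt_trans yn).
  exists d, x, d; split=> //.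
  + by rewrite (ltW xd) dn.
  + by rewrite xd (ltW xd) lexx.
  + by rewrite px (le_lt_trans dn).
  + by move=> z /andP[xz zd]; apply: Pd; rewrite (ltW xz).
- have nx' : - x < - n by rewrite ltrN2.
  have [| | |d [xd dn nPd Pd]] := @first_exit (fun y => P (- y)) (- x) (- n) nx'.
  + by rewrite opprK.
  + by rewrite opprK.
  + move=> y /andP[xy yn] Py; have [|e e0 he] := opn (- y) _ Py.
      by apply/andP; move: px xq pn nq xy yn; clear; lra.
    by exists e => // z hz; apply: he; rewrite -opprD normrN.
  exists (- d), (- d), x; split=> //.
  + by apply/andP; move: xd dn; clear; lra.
  + by move: xd; clear => *; split; [lra|apply/andP; lra].
  + by move: dn pn xq; clear => *; split; lra.
  + move=> z /andP[dz zx]; rewrite -[z]opprK; apply: Pd; apply/andP.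
    by move: dz zx; clear; lra.
Qed.

Lemma pos_near_open T y : pos_near T y -> exists2 e, 0 < e & forall z, `|z - y| < e -> pos_near T z.
Proof.
move=> [e e0 he]; exists e => // z zy; apply: (pos_on_near he).
by have := ler_norm (z - y); have := ler_norm (y - z); rewrite distrC; move: zy; clear => *; apply/andP; lra.
Qed.

Section Sign.
Context (p q : R).

(* The points of ]p, q[ near which T has no constant sign. *)
Definition unsigned T y := [/\ p < y < q, ~ pos_near T y & ~ pos_near (topp T) y].

Lemma unsigned_topp T y : unsigned T y -> unsigned (topp T) y.
Proof. by move=> [h1 h2 h3]; split; rewrite ?toppK. Qed.

Lemma pos_near_epv T x v : pos_near T x -> epv T x v -> 0 <= v.
Proof.
move=> [e e0 pos] pv; apply: (epv_sign pv pos); move: e0; clear; first by lra.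
by move=> *; apply/andP; lra.
Qed.

(** At the first point d where negativity fails, [epv_sign] on the negative side gives h d <= 0.
    Were T nonnegative near d, h would be 0 at nearby points of that side. *)
Lemma sign_change T h x (n : R) : (forall y, p < y < q -> epv T y (h y)) ->
  (forall y, p < y < q -> h y != 0) -> edist T -> p < x < q -> p < n < q ->
  pos_near (topp T) x -> ~ pos_near (topp T) n ->
  exists d, [/\ Num.min x n <= d <= Num.max x n, unsigned T d & h d <= 0].
Proof.
move=> pv h0 hT xI nI nx nn.
have [|d [c [c' [dI nd [cc' cdc] [pc cq] hP]]]] := exit_point (P := pos_near (topp T)) xI nI nx nn.
  by move=> y _; exact: pos_near_open.
have dI' : p < d < q.
  move: xI nI => /andP[x1 x2] /andP[n1 n2]; have /andP[d1 d2] := dI.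
  by rewrite (lt_le_trans _ d1) ?lt_min ?x1// (le_lt_trans d2)// gt_max x2.
have pos : pos_on (topp T) c c' by apply: pos_local hP; exact: edist_topp.
exists d; split=> //.
- split=> // pd; have [e e0 he] := pos_near_open pd.
  have [z zI zd] : exists2 z, c < z < c' & `|z - d| < e.
    have /andP[cd dc] := cdc; have [cd'|cd'] := ltP c d.
      pose k := Num.min ((d - c) / 2) (e / 2).
      have k0 : 0 < k by rewrite lt_min !divr_gt0 ?subr_gt0.
      have k1 : k <= (d - c) / 2 by rewrite ge_min lexx.
      have k2 : k <= e / 2 by rewrite ge_min lexx orbT.
      exists (d - k); first by move: k0 k1 cd' dc; clear => *; apply/andP; lra.
      by rewrite addrAC subrr sub0r normrN gtr0_norm//; move: k2 e0; clear; lra.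
    have dc' : d < c' by apply: le_lt_trans cc'.
    pose k := Num.min ((c' - d) / 2) (e / 2).
    have k0 : 0 < k by rewrite lt_min !divr_gt0 ?subr_gt0.
    have k1 : k <= (c' - d) / 2 by rewrite ge_min lexx.
    have k2 : k <= e / 2 by rewrite ge_min lexx orbT.
    exists (d + k); first by move: k0 k1 cd dc'; clear => *; apply/andP; lra.
    by rewrite addrAC subrr add0r gtr0_norm//; move: k2 e0; clear; lra.
  have zpq : p < z < q by have /andP[z1 z2] := zI; rewrite (lt_trans pc)// (lt_trans z2).
  have k1 := pos_near_epv (he z zd) (pv z zpq).
  have k2 := pos_near_epv (hP z zI) (epv_topp (pv z zpq)).
  by have := h0 z zpq; rewrite eq_le k1 andbT -oppr_ge0 k2.
- by rewrite -oppr_ge0; apply: (epv_sign (epv_topp (pv d dI')) pos).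
Qed.

(** A point of ]a', b'[ near which T is negative would yield, by [sign_change], an unsigned point
    with h <= 0. So h > 0 on the interval, and [positivity] with empty exceptional sets makes T
    nonnegative near n. *)
Lemma no_unsigned_cluster T h (a' b' n : R) : (forall y, p < y < q -> epv T y (h y)) ->
  (forall y, p < y < q -> h y != 0) -> edist T -> p < a' -> b' < q -> a' < n < b' ->
  unsigned T n -> (forall y, a' < y < b' -> unsigned T y -> 0 <= h y) -> False.
Proof.
move=> pv h0 hT pa bq nI Nn hN.
have sub y : a' < y < b' -> p < y < q.
  by move=> /andP[h1 h2]; rewrite (lt_trans pa)// (lt_trans h2).
have notneg x : a' < x < b' -> ~ pos_near (topp T) x.
  move=> xI nx; have [_ _ nn] := Nn.
  have [d [dI Nd hd]] := sign_change pv h0 hT (sub _ xI) (sub _ nI) nx nn.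
  have dI' : a' < d < b'.
    move: xI nI => /andP[x1 x2] /andP[n1 n2]; have /andP[d1 d2] := dI.
    by rewrite (lt_le_trans _ d1) ?lt_min ?x1// (le_lt_trans d2)// gt_max x2.
  by have := h0 d (sub _ dI'); rewrite eq_le hd hN.
have hp x : a' < x < b' -> 0 < h x.
  move=> xI; rewrite lt_neqAle eq_sym h0 ?sub//=.
  have [ok|nok] := pselect (pos_near T x); first exact: (pos_near_epv ok (pv x (sub _ xI))).
  by apply: hN => //; split; [exact: sub|exact: nok|exact: notneg].
have pos : pos_on T a' b'.
  apply: (@positivity R T a' b' set0 set0) => //.
  - exact: negligible_set0.
  - move=> c cI phi sphi pphi e e0.
    have sT := epv_scale_bounded hT (pv c (sub _ cI)).
    have [K [d [K0 d0 hd]]] := scale_small sT sphi pphi.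
    have K1 : 0 < K + 1 by rewrite ltr_wpDl.
    exists (Num.min d (e / (K + 1))); first by rewrite lt_min d0 divr_gt0.
    move=> r /andP[r0]; rewrite le_min ler_pdivlMr// => /andP[rd re].
    by apply: le_trans (hd r _) _; [rewrite r0|move: re r0; clear; lra].
  - move=> x e xI _ e0; have [u u0 hu] := epv_hk hT (pv x (sub _ xI)) (hp x xI).
    by exists u => // t /hu; move: e0; clear; lra.
  - move=> x xI _; have [u u0 hu] := epv_hk hT (pv x (sub _ xI)) (hp x xI).
    by exists 0, u => // t /hu; rewrite oppr0.
by have [_ np _] := Nn; apply: np; exact: (pos_on_near pos nI).
Qed.

(** Otherwise unsigned points exist. As h has no zero, they are covered by closed sets on which the
    heat extension of T or of its opposite is nonnegative up to a fixed width; Baire's theorem gives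
    a portion on which h keeps one sign, against [no_unsigned_cluster]. *)
Theorem darboux_sign T h : edist T -> p < q -> (forall y, p < y < q -> epv T y (h y)) ->
  (forall y, p < y < q -> h y != 0) -> pos_on T p q \/ pos_on (topp T) p q.
Proof.
move=> hT pq pv h0; apply: contrapT => /not_orP[np nn].
have hT' := edist_topp hT.
have pv' y : p < y < q -> epv (topp T) y (- h y) by move=> yI; apply: epv_topp; exact: pv.
have h0' y : p < y < q -> - h y != 0 by rewrite oppr_eq0; exact: h0.
have [x xI npx] : exists2 x, p < x < q & ~ pos_near T x.
  apply: contrapT => nx; apply: np; apply: pos_local => // x xI; apply: contrapT => h1.
  by apply: nx; exists x.
have [y yI nny] : exists2 y, p < y < q & ~ pos_near (topp T) y.
  apply: contrapT => nx; apply: nn; apply: pos_local => // y yI; apply: contrapT => h1.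
  by apply: nx; exists y.
have [x0 Nx0] : exists x0, unsigned T x0.
  have [nx|nnx] := pselect (pos_near (topp T) x); last by exists x.
  by have [d [_ Nd _]] := sign_change pv h0 hT xI yI nx nny; exists d.
pose S i := if odd i then topp T else T.
have hS i : edist (S i) by rewrite /S; case: ifP.
(* The parity of i encodes the sign, its half the width. *)
pose A i := [set z : R | forall t, 0 < t <= i./2.+1%:R^-1 -> 0 <= hk (S i) 0 z t].
have bNc z : p < z < q -> (forall e, 0 < e -> exists2 w, `|w - z| < e & unsigned T w) -> unsigned T z.
  move=> zI cl; split=> // pz; have [e e0 he] := pos_near_open pz.
    by have [w /he pw [_ npw _]] := cl e e0.
  by have [w /he pw [_ _ npw]] := cl e e0.
have bAc i z : p < z < q -> ~ A i z -> exists2 d, 0 < d & forall w, `|w - z| < d -> ~ A i w.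
  move=> _ nA; have [t [tI ht]] : exists t, 0 < t <= i./2.+1%:R^-1 /\ hk (S i) 0 z t < 0.
    apply: contrapT => nex; apply: nA => t tI; rewrite leNgt; apply/negP => ht.
    by apply: nex; exists t.
  have /andP[t0 _] := tI; have [L L0 hL] := hk_lip 0 (hS i) t0.
  have L1 : 0 < L + 1 by rewrite ltr_wpDl.
  exists (- hk (S i) 0 z t / (L + 1)); first by rewrite divr_gt0 ?oppr_gt0.
  move=> w; rewrite ltr_pdivlMr// => wz /(_ t tI); apply/negP; rewrite -ltNge.
  have := hL w z t t (lexx _) (lexx _); rewrite subrr normr0 addr0 => h1.
  have := ler_norm (hk (S i) 0 w t - hk (S i) 0 z t); have := normr_ge0 (w - z).
  by move: wz h1; clear; lra.
have bcov z : p < z < q -> unsigned T z -> exists i, A i z.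
  move=> zI _; have small (U : (R -> R) -> R) v : edist U -> epv U z v -> 0 < v ->
      exists k, forall t, 0 < t <= k.+1%:R^-1 -> 0 <= hk U 0 z t.
    move=> hU pvU v0; have [u u0 hu] := epv_hk hU pvU v0; exists (Num.bound u^-1) => t /andP[t0 tk].
    apply: hu; rewrite t0 (le_trans tk)// invf_ple ?posrE//.
    apply: le_trans (ltW (archi_boundP _)) _; first by rewrite invr_ge0 ltW.
    by rewrite ler_nat.
  have [h1|h1|h1] := ltgtP (h z) 0; last by have := h0 z zI; rewrite h1 eqxx.
    have [k hk'] := small (topp T) (- h z) hT' (pv' z zI) ltac:(by rewrite oppr_gt0).
    by exists k.*2.+1; rewrite /A /S /= odd_double uphalf_double.
  have [k hk'] := small T (h z) hT (pv z zI) h1.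
  by exists k.*2; rewrite /A /S /= odd_double doubleK.
have x0I : p < x0 < q by have [] := Nx0.
have [i [a' [b' [pa bq [n nI Nn] hA]]]] := baire_interval bNc bAc bcov x0I Nx0.
have sub z : a' < z < b' -> p < z < q.
  by move=> /andP[h1 h2]; rewrite (lt_trans pa)// (lt_trans h2).
have val (U : (R -> R) -> R) v z k : edist U -> epv U z v ->
    (forall t, 0 < t <= k.+1%:R^-1 -> 0 <= hk U 0 z t) -> 0 <= v.
  move=> hU pvU hk0; rewrite leNgt; apply/negP => v0.
  have v20 : 0 < - v / 2 by rewrite divr_gt0// oppr_gt0.
  have [d d0 hd] := epv_T0 hU pvU (@T0_ngam R) v20.
  pose t := Num.min d k.+1%:R^-1; have t0 : 0 < t by rewrite lt_min d0 invr_gt0 ltr0n.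
  have := hd t ltac:(by rewrite t0 ge_min lexx); rewrite affine_ngam// ler_norml => /andP[_].
  have := hk0 t ltac:(by rewrite t0 ge_min lexx orbT) => h1.
  have : 0 <= (Num.sqrt pi)^-1 * hk U 0 z t by rewrite mulr_ge0// invr_ge0 ltW// sqrt_pi_gt0.
  by move: v0; clear; lra.
case oi: (odd i) hA => hA.
  apply: (@no_unsigned_cluster (topp T) (fun y => - h y) a' b' n) => //.
    exact: unsigned_topp.
  move=> z zI Nz; apply: (val (topp T) _ z i./2) => //; first by apply: pv'; exact: sub.
  have := hA z zI; rewrite /A /S oi; apply; by rewrite -[T]toppK; exact: unsigned_topp.
apply: (@no_unsigned_cluster T h a' b' n) => //.
move=> z zI Nz; apply: (val T _ z i./2) => //; first by apply: pv; exact: sub.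
by have := hA z zI Nz; rewrite /A /S oi.
Qed.

End Sign.

End Darboux.

(** * Comparison with Lebesgue measure *)

Section MeanValue.
Context {R : realType}.
Implicit Types (f g h phi psi : R -> R) (n k m i j : nat) (x y z e c d p q v w B r s t M L K : R) (T S u : (R -> R) -> R).
Local Notation mu := (@lebesgue_measure R).

Lemma epv_lin c T S x v w : epv T x v -> epv S x w ->
  epv (fun f => c * T f + S f) x (c * v + w).
Proof.
move=> pT pS phi tphi e e0; have c1 : 0 < 2 * (`|c| + 1) by rewrite mulr_gt0// ltr_wpDl.
have [d1 d10 h1] := pT phi tphi (e / (2 * (`|c| + 1))) ltac:(by rewrite divr_gt0).
have [d2 d20 h2] := pS phi tphi (e / 2) ltac:(by rewrite divr_gt0).
exists (Num.min d1 d2); first by rewrite lt_min d10.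
move=> r /andP[r0]; rewrite le_min => /andP[r1 r2].
have k1 := h1 r ltac:(by rewrite r0 r1); have k2 := h2 r ltac:(by rewrite r0 r2).
move: (\int[mu]_y phi y) k1 k2 => I k1 k2.
have -> : r^-1 * (c * T (sc x r phi) + S (sc x r phi)) - (c * v + w) * I
  = c * (r^-1 * T (sc x r phi) - v * I) + (r^-1 * S (sc x r phi) - w * I) by ring.
apply: le_trans (ler_normD _ _) _; rewrite normrM.
have k3 : `|c| * `|r^-1 * T (sc x r phi) - v * I| <= e / 2.
  apply: le_trans (ler_wpM2l (normr_ge0 c) k1) _.
  rewrite mulrA ler_pdivrMr// (_ : e / 2 * _ = (`|c| + 1) * e); last by field.
  by rewrite ler_wpM2r ?(ltW e0)// lerDl.
by move: k2 k3; clear; lra.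
Qed.

Definition lebesgue_functional (a b : R) phi : R := \int[mu]_(y in `[a, b]) phi y.

Lemma lebesgue_functionalE (a b : R) phi (G : R -> R) : a < b -> sm phi ->
  (forall x, is_derive x 1 G (phi x)) -> lebesgue_functional a b phi = G b - G a.
Proof.
move=> ab sphi dG; rewrite /lebesgue_functional /Rintegral.
by rewrite (integral_antiderivative ab (smooth_continuous sphi) dG).
Qed.

Lemma edist_lebesgue (a b : R) : a < b -> edist (lebesgue_functional a b).
Proof.
move=> ab; split=> [c f g sf sg|].
  have [F _ dF] := antiderivative (smooth_continuous sf).
  have [G _ dG] := antiderivative (smooth_continuous sg).
  rewrite (lebesgue_functionalE ab sf dF) (lebesgue_functionalE ab sg dG).
  rewrite (@lebesgue_functionalE a b _ (fun y => c * F y + G y) ab); first by ring.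
  by apply: smooth_add => //; exact: smooth_scale.
exists (`|a| + `|b|), (b - a), 0%N; split; first by rewrite subr_ge0 ltW.
move=> f B sf /dboundP hB; have [F _ dF] := antiderivative (smooth_continuous sf).
rewrite (lebesgue_functionalE ab sf dF) mulrC -[X in _ * X]gtr0_norm ?subr_gt0//.
apply: (@mvt_bound R F f B a b dF) => z; rewrite (min_l (ltW ab)) (max_r (ltW ab)) => /andP[az zb].
apply: (hB 0%N z (leqnn 0)); rewrite /seg /=.
have := ler_norm b; have := ler_norm (- a); rewrite normrN.
have := normr_ge0 a; have := normr_ge0 b; move: az zb; clear => *; apply/andP; lra.
Qed.

Lemma epv_lebesgue (a b x : R) : a < x < b -> epv (lebesgue_functional a b) x 1.
Proof.
move=> /andP[ax xb] phi tphi e e0; have [A [sphi A0 pA]] := test_fun_sym tphi.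
have ab := lt_trans ax xb; have [_ _ z1 z2] := primitiveP sphi pA (ltW A0).
pose d := Num.min (x - a) (b - x) / A.
exists d; first by rewrite divr_gt0// lt_min !subr_gt0 ax.
move=> r /andP[r0]; rewrite ler_pdivlMr// le_min => /andP[r1 r2].
have [A' [ss A'0 pA']] := test_fun_sym (test_fun_sc x r0 tphi).
have [dQ _ _ _] := primitiveP ss pA' (ltW A'0).
rewrite (lebesgue_functionalE ab ss dQ) primitive_sc// /sc z1; last first.
  by rewrite ler_pdivlMr// mulrC.
rewrite z2; last by rewrite ler_pdivrMr//; move: r1; rewrite mulrC mulNr; clear; lra.
by rewrite mulr0 sub0r -mulrN opprK mulKf ?gt_eqF// mul1r subrr normr0 ltW.
Qed.

Lemma cut_smooth_product (a b s : R) (D : nat -> R -> R) :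
  (forall n x, a < x < b -> is_derive x 1 (D n) (D n.+1 x)) -> 0 < s ->
  sm (fun y => cut a b s y * D 0%N y).
Proof.
move=> dD s0; apply: (smooth_cut dD (a' := a + s) (b' := b - s)); rewrite ?ltrDl ?gtrBl//.
  exact: sm_cut.
exact: supp_in_cut.
Qed.

(* A nonnegative functional that is small on the cut-offs of [psi] is small on
   every test function they dominate. *)
Lemma squeeze_zero T (a b s x v : R) (D : nat -> R -> R) : edist T -> pos_on T a b ->
  (forall n x, a < x < b -> is_derive x 1 (D n) (D n.+1 x)) ->
  (forall y, a <= y <= b -> 0 <= D 0%N y) -> 0 < s ->
  (forall e, 0 < e -> exists k, forall m, (k <= m)%N ->
    `|T (fun y => cut a b (s * 2^-1 ^+ m) y * D 0%N y)| <= e) ->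
  a < x < b -> 0 < D 0%N x -> epv T x v -> v = 0.
Proof.
move=> hT pos dD D0 s0 hc xab Dx pv; have /andP[ax xb] := xab.
have d20 : 0 < 2^-1 :> R by clear; lra.
pose phi := plateau (- 2^-1) 2^-1 (2^-1 : R).
have sphi : sm phi by exact: smooth_plateau.
have pphi : supp_in (-1) 1 phi.
  by apply: supp_in_le (supp_plateau d20); clear; lra.
have [rho rho0 hrho] : exists2 rho, 0 < rho & forall y, `|y - x| < rho -> D 0%N x / 2 <= D 0%N y.
  have [/derivable1_diffP dif _] := dD 0%N x xab.
  have := differentiable_continuous dif.
  move=> /cvgrPdist_le /(_ (D 0%N x / 2) ltac:(by rewrite divr_gt0))[rho /= rho0 h].
  exists rho => // y yx; have := h y; rewrite /= distrC => /(_ yx).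
  by rewrite ler_norml => /andP[_]; clear; lra.
pose r0 := Num.min (rho / 2) (Num.min ((x - a) / 2) ((b - x) / 2)).
have r00 : 0 < r0 by rewrite !lt_min !divr_gt0 ?subr_gt0.
have [q1 q2 q3] : [/\ r0 <= rho / 2, r0 <= (x - a) / 2 & r0 <= (b - x) / 2].
  by split; rewrite !ge_min lexx ?orbT.
have Tz r : 0 < r <= r0 -> T (sc x r phi) = 0.
  move=> /andP[rp rr]; have ps := supp_sc (c := x) rp pphi.
  have ss : sm (sc x r phi) by exact: smooth_sc.
  have T0 : 0 <= T (sc x r phi).
    apply: (pos _ (x - r) (x + r) ss) => //; [by move=> y; exact: plateau_ge0|..].
      by move: q2 rr rp; clear; lra.
    by move: q3 rr rp; clear; lra.
  apply/eqP; rewrite eq_le T0 andbT; apply/ler_addgt0Pr => e e0; rewrite add0r.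
  (* Near x the function [D 0] is at least half its value at x, so C times the cut-off product
     dominates the bump. *)
  pose C := 2 / D 0%N x; have C0 : 0 < C by rewrite divr_gt0.
  have [k1 h1] := hc (e / C) ltac:(by rewrite divr_gt0).
  have [k2 h2] := half_small (mulr_ge0 (ler0n R 2) (ltW s0)) r00.
  pose m := maxn k1 k2; pose t := s * 2^-1 ^+ m; have t0 : 0 < t by exact: half_exp_gt0.
  have t2 : 2 * t <= r0 by rewrite mulrA; apply: h2; rewrite leq_maxr.
  have {}h1 := h1 m ltac:(by rewrite leq_maxl).
  have sc' := cut_smooth_product dD t0.
  have : 0 <= T (fun y => C * (cut a b t y * D 0%N y) + (- sc x r phi y)).
    apply: (pos _ (a + t) (b - t)).
    - by apply: smooth_add; [exact: smooth_scale|exact: smooth_opp].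
    - move=> y; have [yI|ny] := boolP (x - r <= y <= x + r); last first.
        rewrite (supp_in_eq0 ps) ?oppr0 ?addr0; last exact/negP.
        have [->|/(cut_supp t0) /andP[y1 y2]] := eqVneq (cut a b t y) 0.
          by rewrite mul0r mulr0.
        apply: mulr_ge0; first exact: ltW.
        apply: mulr_ge0; first exact: cut_ge0.
        by apply: D0; move: y1 y2 t0; clear => *; apply/andP; lra.
      have /andP[y1 y2] := yI.
      rewrite (cut1 t0); last by move: y1 y2 rr t2 q2 q3; clear => *; apply/andP; lra.
      rewrite mul1r subr_ge0; apply: le_trans (plateau_le1 _ _ _ _) _.
      rewrite /C mulrAC ler_pdivlMr// mul1r.
      have : `|y - x| < rho by rewrite ltr_norml; move: y1 y2 rr q1 rho0; clear => *; apply/andP; lra.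
      by move=> /hrho; clear; lra.
    - by rewrite ltrDl.
    - by rewrite gtrBl.
    - move=> y; have [cz|/(cut_supp t0) /andP[/ltW -> /ltW ->]//] := eqVneq (cut a b t y) 0.
      rewrite cz mul0r mulr0 add0r oppr_eq0 => /ps /andP[y1 y2].
      by apply/andP; move: y1 y2 rr t2 t0 q2 q3; clear; lra.
  rewrite (ed_lin hT)//; last exact: smooth_opp.
  rewrite (ed_opp hT)// subr_ge0 => /le_trans; apply.
  have := ler_wpM2l (ltW C0) (le_trans (ler_norm _) h1).
  by rewrite [X in _ <= X -> _]mulrC divfK// gt_eqF.
have I0 : 0 < \int[mu]_y phi y by apply: integral_plateau_gt0 => //; clear; lra.
suff : v * \int[mu]_y phi y = 0 by move/eqP; rewrite mulf_eq0 (gt_eqF I0) orbF => /eqP.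
apply/eqP; rewrite -normr_le0; apply/ler_addgt0Pr => e e0; rewrite add0r.
have [d d0 hd] := pv phi (test_fun_supp sphi pphi) e e0.
pose r := Num.min d r0; have rp : 0 < r by rewrite lt_min d0.
have := hd r ltac:(by rewrite rp ge_min lexx).
by rewrite Tz ?mulr0 ?sub0r ?normrN// rp ge_min lexx orbT.
Qed.

Lemma Rintegral_oo (a b : R) f : mu.-integrable `[a, b] (EFin \o f) ->
  \int[mu]_(x in `]a, b[) f x = \int[mu]_(x in `[a, b]) f x.
Proof.
move=> fi; rewrite -Rintegral_itv_obnd_cbnd.
  apply: Rintegral_itv_bndo_bndc; apply: integrableS fi => //.
  exact: subset_itv_oo_cc.
by apply: integrableS fi => //; exact: subset_itv_oc_cc.
Qed.

(** Dominated convergence on the open interval, where the cut-offs tend to 1; at a and b they are 0,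
    but these points have measure 0. *)
Lemma cut_integral_cvg (a b s e : R) psi : a < b -> {within `[a, b], continuous psi} ->
  (forall t, 0 < t -> sm (fun y => cut a b t y * psi y)) -> 0 < s -> 0 < e ->
  exists k, forall m, (k <= m)%N ->
    `|lebesgue_functional a b (fun y => cut a b (s * 2^-1 ^+ m) y * psi y)
      - \int[mu]_(y in `[a, b]) psi y| <= e.
Proof.
move=> ab cpsi scut s0 e0.
have ipsi : mu.-integrable `[a, b] (EFin \o psi).
  by apply: continuous_compact_integrable => //; exact: segment_compact.
pose F m y := cut a b (s * 2^-1 ^+ m) y * psi y.
have iF m : mu.-integrable `[a, b] (EFin \o F m).
  apply: integrable_segment; apply: smooth_continuous; exact: scut (half_exp_gt0 m s0).
have [M M0 hM] := within_bounded (ltW ab) cpsi.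
have sub : `]a, b[ `<=` `[a, b]%classic by exact: subset_itv_oo_cc.
have iFo m : mu.-integrable `]a, b[ (EFin \o F m) by exact: integrableS (iF m).
have ipo : mu.-integrable `]a, b[ (EFin \o psi) by exact: integrableS ipsi.
have cF x : `]a, b[%classic x -> (EFin \o F m) x @[m --> \oo] --> (EFin \o psi) x.
  rewrite /= in_itv /= => /andP[ax xb].
  have d0 : 0 < Num.min (x - a) (b - x) by rewrite lt_min !subr_gt0 ax.
  have [k hk] := half_small (mulr_ge0 (ler0n R 2) (ltW s0)) d0.
  apply: cvg_near_cst; exists k => // m /= /hk; rewrite -mulrA le_min => /andP[h1 h2].
  rewrite /F cut1 ?mul1r//; first exact: half_exp_gt0.
  by apply/andP; move: h1 h2; clear; lra.
have iM : mu.-integrable `]a, b[ (EFin \o (fun=> M)).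
  have iMc : mu.-integrable `[a, b] (EFin \o (fun=> M)).
    by apply: integrable_segment; exact: cst_continuous.
  exact: integrableS iMc.
have bF m x : `]a, b[%classic x -> (`|(EFin \o F m) x| <= (EFin \o (fun=> M)) x)%E.
  rewrite /= in_itv /= => /andP[ax xb]; rewrite lee_fin normrM.
  rewrite ger0_norm; last exact: cut_ge0.
  apply: le_trans (_ : 1 * M <= _); last by rewrite mul1r.
  apply: ler_pM; rewrite ?cut_ge0//; last by apply: hM; rewrite !ltW.
  by rewrite /cut mulr_ile1 ?step_ge0 ?step_le1.
have := @dominated_cvg _ _ R mu `]a, b[%classic (measurable_itv _) (fun m => EFin \o F m)
  (EFin \o psi) (EFin \o (fun=> M)) (fun m => measurable_int _ (iFo m)) cF (fun x _ => isT) iM bF.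
have -> : (\int[mu]_(x in `]a, b[) (EFin \o psi) x = (\int[mu]_(x in `]a, b[) psi x)%:E)%E.
  rewrite /Rintegral fineK//; exact: integrable_fin_num.
move=> /fine_cvgP[_] /cvgrPdist_le /(_ e e0) [k _ hk].
exists k => m km; rewrite distrC; have := hk m km.
by rewrite -(Rintegral_oo ipsi) /lebesgue_functional -(Rintegral_oo (iF m)).
Qed.

Theorem mean_value T (a b : R) (D : nat -> R -> R) f u : a < b -> edist T ->
  (forall n x, a < x < b -> is_derive x 1 (D n) (D n.+1 x)) ->
  {within `[a, b], continuous (D 0%N)} ->
  (forall y, a <= y <= b -> 0 <= D 0%N y) ->
  (forall x, a < x < b -> epv T x (f x)) -> cut_product T a b (D 0%N) u ->
  exists2 xi, a < xi < b & u (fun=> 1) = f xi * \int[mu]_(y in `[a, b]) D 0%N y.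
Proof.
move=> ab hT dD cD D0 pv cu; have [s s0 hs] := cut_product_cvg cu.
pose I := \int[mu]_(y in `[a, b]) D 0%N y; pose lam := lebesgue_functional a b.
pose c := u (fun=> 1); pose F m y := cut a b (s * 2^-1 ^+ m) y * D 0%N y.
have scut t : 0 < t -> sm (fun y => cut a b t y * D 0%N y) by exact: cut_smooth_product.
have sF m : sm (F m) by apply: scut; exact: half_exp_gt0.
have hlam := edist_lebesgue ab.
have cT e : 0 < e -> exists k, forall m, (k <= m)%N -> `|c - T (F m)| <= e.
  move=> e0; have [k hk] := hs (fun=> 1) e (smooth_cst 1) e0; exists k => m /hk.
  by congr (`| _ - T _| <= _); apply/funext => y; rewrite mulr1.
have cL e : 0 < e -> exists k, forall m, (k <= m)%N -> `|lam (F m) - I| <= e.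
  by move=> e0; exact: (cut_integral_cvg ab cD scut s0 e0).
have mid : a < (a + b) / 2 < b by move: ab; clear => *; apply/andP; lra.
(* If psi vanishes inside, both sides are 0 and any point serves. *)
have [[x0 x0I Dx0]|nex] := pselect (exists2 x, a < x < b & 0 < D 0%N x); last first.
  have F0 m : F m = fun=> 0.
    apply/funext => y; rewrite /F.
    have [->|/(cut_supp (half_exp_gt0 m s0)) /andP[y1 y2]] := eqVneq (cut a b (s * 2^-1 ^+ m) y) 0.
      by rewrite mul0r.
    have t0 := half_exp_gt0 m s0.
    have yI : a < y < b by move: y1 y2 t0; clear => *; apply/andP; lra.
    have /eqP -> : D 0%N y == 0.
      rewrite eq_le D0 ?andbT; last by have /andP[/ltW -> /ltW ->] := yI.
      by rewrite leNgt; apply/negP => Dy; apply: nex; exists y.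
    by rewrite mulr0.
  have c0 : c = 0.
    apply/eqP; rewrite -normr_le0; apply/ler_addgt0Pr => e e0; rewrite add0r.
    by have [k /(_ k (leqnn k))] := cT e e0; rewrite F0 ed0// subr0.
  have I0 : I = 0.
    apply/eqP; rewrite -normr_le0; apply/ler_addgt0Pr => e e0; rewrite add0r.
    by have [k /(_ k (leqnn k))] := cL e e0; rewrite F0 ed0// sub0r normrN.
  by exists ((a + b) / 2) => //; rewrite -/c -/I c0 I0 mulr0.
(* If I were 0, [squeeze_zero] for Lebesgue measure would make its point value 1 equal to 0. *)
have In0 : I != 0.
  apply/eqP => I0; have : 1 = 0 :> R; last by apply/eqP; exact: oner_neq0.
  apply: (squeeze_zero hlam _ dD D0 s0 _ x0I Dx0 (epv_lebesgue x0I)).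
    move=> g c' d' sg g0 _ _ _; rewrite /lebesgue_functional /Rintegral.
    by apply: fine_ge0; apply: integral_ge0 => y _; rewrite lee_fin.
  by move=> e /cL[k hk]; exists k => m /hk; rewrite I0 subr0.
(* With this constant S tends to 0 on the cut-offs of psi, and its point values are f x - ga. *)
pose ga := c / I; pose S g := (- ga) * lam g + T g.
have hS : edist S by exact: edist_lin.
have pS x : a < x < b -> epv S x ((- ga) * 1 + f x).
  by move=> xI; apply: epv_lin; [exact: epv_lebesgue|exact: pv].
have cS e : 0 < e -> exists k, forall m, (k <= m)%N -> `|S (F m)| <= e.
  move=> e0; have g1 : 0 < 2 * (`|ga| + 1) by rewrite mulr_gt0// ltr_wpDl.
  have [k1 h1] := cL (e / (2 * (`|ga| + 1))) ltac:(by rewrite divr_gt0).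
  have [k2 h2] := cT (e / 2) ltac:(by rewrite divr_gt0).
  exists (maxn k1 k2) => m; rewrite geq_max => /andP[/h1 q1 /h2 q2].
  have -> : S (F m) = - ga * (lam (F m) - I) - (c - T (F m)).
    by rewrite /S /ga; field.
  apply: le_trans (ler_normB _ _) _; rewrite normrM normrN.
  have q3 : `|ga| * `|lam (F m) - I| <= e / 2.
    apply: le_trans (ler_wpM2l (normr_ge0 ga) q1) _.
    rewrite mulrA ler_pdivrMr// (_ : e / 2 * _ = (`|ga| + 1) * e); last by field.
    by rewrite ler_wpM2r ?(ltW e0)// lerDl.
  by move: q2 q3; clear; lra.
apply: contrapT => none.
have fx x : a < x < b -> (- ga) * 1 + f x != 0.
  move=> xI; apply/eqP => E; apply: none; exists x => //.
  have -> : f x = ga by move: E; clear; lra.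
  by rewrite /ga divfK.
have z0 : (- ga) * 1 + f x0 = 0.
  have [pos|pos] := darboux_sign hS ab pS fx.
    exact: (squeeze_zero hS pos dD D0 s0 cS x0I Dx0 (pS x0 x0I)).
  have cS' e : 0 < e -> exists k, forall m, (k <= m)%N -> `|topp S (F m)| <= e.
    by move=> /cS[k hk]; exists k => m /hk; rewrite /topp normrN.
  have := squeeze_zero (edist_topp hS) pos dD D0 s0 cS' x0I Dx0 (epv_topp (pS x0 x0I)).
  by move/eqP; rewrite oppr_eq0 => /eqP.
by have := fx x0 x0I; rewrite z0 eqxx.
Qed.

End MeanValue.

(** * Integrability and the mean value of the product *)

Lemma epv_cutoff (R : realType) (g : distrib R) (a b x v : R) : a <= x <= b ->
  point_value g x v -> epv (fun f => g (fun y => plateau (a - 1) (b + 1) 1 y * f y)) x v.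
Proof.
move=> /andP[ax xb] pv phi tphi e e0; have [A [sphi A0 pA]] := test_fun_sym tphi.
have [d d0 hd] := pv_right pv tphi e0.
exists (Num.min d A^-1); first by rewrite lt_min d0 invr_gt0.
move=> r /andP[r0]; rewrite le_min => /andP[rd rA].
have {}rA : r * A <= 1 by rewrite -ler_pdivlMr// div1r.
have := hd r ltac:(by rewrite r0 rd); congr (`| _ * distrib_fun g _ - _| <= _).
apply/funext => y; have [->|] := eqVneq (sc x r phi y) 0; first by rewrite mulr0.
move=> /pA; rewrite ler_pdivlMr// ler_pdivrMr// => /andP[h1 h2].
rewrite plateau1 ?mul1r//; move: h1 h2 rA; rewrite mulNr (mulrC A r).
by move: ax xb; clear => *; apply/andP; lra.
Qed.

Theorem proposition11p1 (R : realType) (a b : R) (f psi : R -> R)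
  (ab : a < b)
  (Hf : Lojasiewicz_fun_on a b f)
  (Hpsi : smooth_on a b psi)
  (psi_ge0 : {in `[a, b], forall x, 0 <= psi x}) :
  dist_integrable a b (fun x => (f x * psi x)%:E) /\
  exists2 xi : R, xi \in `]a, b[ &
    dist_integral a b (fun x => (f x * psi x)%:E)
      = (f xi * \int[@lebesgue_measure R]_(x in `[a, b]) psi x)%:E.
Proof.
have [G [g _ gG] fG] := Hf; have [D [Dpsi dD cD]] := smooth_on_derivs Hpsi.
pose T h := g (fun y => plateau (a - 1) (b + 1) 1 y * h y).
have hT : edist T by apply: edist_distrib; exact: test_fun_plateau.
have pvT x : a <= x <= b -> epv T x (f x).
  move=> xI; rewrite fG ?in_itv//; exact: epv_cutoff.
have sub x : a < x < b -> a <= x <= b by move=> /andP[/ltW -> /ltW ->].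
(* The point values at a and b enter only through these two bounds, which make the cut-off products
   converge. *)
have Ta : scale_bounded T a 1 by apply: epv_scale_bounded (pvT a _); rewrite // lexx ltW.
have Tb : scale_bounded T b 1 by apply: epv_scale_bounded (pvT b _); rewrite // lexx ltW.
have bD n := within_bounded (ltW ab) (cD n).
have [u cu] := cut_product_exists ab hT Ta Tb dD bD.
have pvo x : a < x < b -> epv T x (f x) by move=> /sub; exact: pvT.
pose F x := f x * psi x.
have FE x : a < x < b -> F x = f x * D 0%N x.
  by move=> /sub xI; rewrite /F Dpsi ?in_itv.
have [v [U [maj min Ub]]] := product_pair ab hT dD pvo cu FE.
pose c := u (fun=> 1).
(* As c is both a minor and a major value, this comparison forces the supremum and the infimum to
   equal c. *)
have le_c d c' : minor_values a b (EFin \o F) d -> major_values a b (EFin \o F) c' -> d <= c'.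
  by move=> [v1 [V1 [m1 h1]]] [u1 [U1 [m2 h2]]]; exact: minor_le_major m2 m1 h2 h1.
have cmaj : major_values a b (EFin \o F) c by exists v, U.
have cmin : minor_values a b (EFin \o F) c by exists v, U.
have supE : ereal_sup (EFin @` minor_values a b (EFin \o F)) = c%:E.
  apply/eqP; rewrite eq_le; apply/andP; split.
    by apply: ge_ereal_sup => _ [d dm <-]; rewrite lee_fin; exact: le_c.
  by apply: ereal_sup_ubound; exists c.
have infE : ereal_inf (EFin @` major_values a b (EFin \o F)) = c%:E.
  apply/eqP; rewrite eq_le; apply/andP; split.
    by apply: ereal_inf_lbound; exists c.
  by apply: le_ereal_inf_tmp => _ [d dm <-]; rewrite lee_fin; exact: le_c.
split; first by split; [exists c|exists c|rewrite supE infE].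
have D0 y : a <= y <= b -> 0 <= D 0%N y by move=> yI; rewrite Dpsi ?psi_ge0 ?in_itv.
have [xi xiI cE] := mean_value ab hT dD (cD 0%N) D0 pvo cu.
exists xi; first by rewrite in_itv.
rewrite /dist_integral infE /c cE; congr ((_ * _)%:E).
by apply: eq_Rintegral => x; rewrite inE => /Dpsi ->.
Qed.
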